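(* Suppose that for all integers $r \geq 2$ and $n \geq 1$ such that smooth hypersurfaces of degree $r$ in $\mathbb{P}^{n+1}$ are Fano (i.e. have ample anticanonical bundle), the Shafarevich conjecture holds for smooth hypersurfaces of degree $r$ and dimension $n$. Then the Shafarevich conjecture holds for smooth hypersurfaces of degree $r$ and dimension $n$ for all integers $r \geq 2$ and $n \geq 1$.
   Context: For integers $r\ge 2$, $n\ge 1$, the Shafarevich conjecture for smooth hypersurfaces of degree $r$ and dimension $n$ is the statement: for every number field $K$ and every finite set $S$ of finite places of $K$, the set of $\mathcal{O}_{K,S}$-linear isomorphism classes of smooth hypersurfaces of degree $r$ in $\mathbb{P}^{n+1}_{\mathcal{O}_{K,S}}$ is finite. Here $\mathcal{O}_{K,S}$ is the ring of $S$-integers of $K$; a smooth hypersurface of degree $r$ in $\mathbb{P}^{n+1}_A$ is a closed subscheme smooth over $A$ all of whose fibres over points of $\operatorname{Spec} A$ are hypersurfaces of degree $r$; and an $A$-linear isomorphism is an isomorphism induced by an $A$-automorphism of the ambient $\mathbb{P}^{n+1}_A$. *)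

(* Defs.v *)
From HB Require Import structures.
From mathcomp Require Import all_boot all_order all_algebra all_field.
From mathcomp Require Import boolp classical_sets functions cardinality.
From mathcomp Require Import mpoly.

Set Implicit Arguments.
Unset Strict Implicit.
Unset Printing Implicit Defensive.

Import GRing.Theory.
Local Open Scope classical_set_scope.
Local Open Scope ring_scope.

Definition ring_of_integers (K : fieldExtType rat) : set K :=
  [set x | integralOver (intmul 1 : int -> K) x].

(* The finite places of K are the nonzero prime ideals of its ring of
   integers. *)
Definition finite_place (K : fieldExtType rat) (p : set K) : Prop :=
  [/\ p `<=` @ring_of_integers K,
      (exists2 x, p x & x != 0) /\ ~ p 1,
      forall x y, p x -> p y -> p (x + y),
      forall a x, ring_of_integers a -> p x -> p (a * x)
    & forall a b, ring_of_integers a -> ring_of_integers b ->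
        p (a * b) -> p a \/ p b].

(* The valuation of x at p is nonnegative: x lies in the localization at p. *)
Definition integral_at (K : fieldExtType rat) (p : set K) (x : K) : Prop :=
  exists a b, [/\ ring_of_integers a, ring_of_integers b, ~ p b & x * b = a].

Definition S_integral (K : fieldExtType rat) (S : set (set K)) : {pred K} :=
  fun x => `[< forall p, finite_place p -> ~ S p -> integral_at p x >].

Lemma S_integral_subring (K : fieldExtType rat) (S : set (set K)) :
  subring_closed (S_integral S).
Proof.
have intM (p : set K) b d : finite_place p ->
    ring_of_integers b -> ring_of_integers d -> ~ p b -> ~ p d -> ~ p (b * d).
  by case=> _ _ _ _ pr hb hd nb nd /(pr _ _ hb hd) [].
split.
- apply/asboolP => p [_ [_ p1] _ _ _] _; exists 1, 1.
  by split=> //; [exact: integral1|exact: integral1|rewrite mulr1].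
- move=> x y /asboolP hx /asboolP hy; apply/asboolP => p pp Sp.
  have [a [b [ha hb nb xE]]] := hx p pp Sp.
  have [c [d [hc hd nd yE]]] := hy p pp Sp.
  exists (a * d - c * b), (b * d); split.
  + by apply: integral_sub; apply: integral_mul.
  + exact: integral_mul.
  + exact: intM pp hb hd nb nd.
  + by rewrite mulrBl mulrA xE [b * d]mulrC mulrA yE.
- move=> x y /asboolP hx /asboolP hy; apply/asboolP => p pp Sp.
  have [a [b [ha hb nb xE]]] := hx p pp Sp.
  have [c [d [hc hd nd yE]]] := hy p pp Sp.
  exists (a * c), (b * d); split.
  + exact: integral_mul.
  + exact: integral_mul.
  + exact: intM pp hb hd nb nd.
  + by rewrite mulrACA xE yE.
Qed.

HB.instance Definition _ (K : fieldExtType rat) (S : set (set K)) :=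
  GRing.isSubringClosed.Build K (S_integral S) (@S_integral_subring K S).

Record S_integers (K : fieldExtType rat) (S : set (set K)) : Type := SInteger {
  S_integers_val :> K;
  _ : S_integers_val \in S_integral S }.

HB.instance Definition _ (K : fieldExtType rat) (S : set (set K)) :=
  [isSub for @S_integers_val K S].
HB.instance Definition _ (K : fieldExtType rat) (S : set (set K)) :=
  [Choice of S_integers S by <:].
HB.instance Definition _ (K : fieldExtType rat) (S : set (set K)) :=
  [SubChoice_isSubComNzRing of S_integers S by <:].

(* Schemes over A are handled through their functors of points on (nonzero)
   A-algebras.  An R-point of P^m_A is a direct summand L of R^(m+1) of
   constant rank one, i.e., the image of an idempotent matrix of rank one at
   every field-valued point of Spec R; L need not be free. *)
Definition proj_space (R : comNzRingType) (m : nat) :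
    set (set 'rV[R]_m.+1) :=
  [set L | exists P : 'M[R]_m.+1,
    [/\ P *m P = P,
        forall (k : fieldType) (f : {rmorphism R -> k}),
          \rank (map_mx f P) = 1%N
      & L = range (fun u : 'rV[R]_m.+1 => u *m P)]].

Definition eval_at (A : comNzRingType) (R : comAlgType A) (m : nat)
    (F : {mpoly A[m.+1]}) (v : 'rV[R]_m.+1) : R :=
  mmap (in_alg R) (v 0) F.

(* A closed subscheme of P^m_A is presented by a finite sequence of
   homogeneous equations.  Finitely many suffice for every closed subscheme
   when A is noetherian, and for every A when the subscheme is smooth. *)
Definition homogeneous_eqns (A : comNzRingType) (m : nat)
    (E : seq {mpoly A[m.+1]}) : Prop :=
  forall F, F \in E -> exists d, F \is d.-homog.

Definition zero_locus (A : comNzRingType) (m : nat) (E : seq {mpoly A[m.+1]})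
    (R : comAlgType A) : set (set 'rV[R]_m.+1) :=
  [set L | proj_space L /\
     forall F, F \in E -> forall v, L v -> eval_at F v = 0].
Arguments zero_locus {A m} E R _.

Definition same_subscheme (A : comNzRingType) (m : nat)
    (E E' : seq {mpoly A[m.+1]}) : Prop :=
  forall R : comAlgType A, zero_locus E R = zero_locus E' R.

(* The R'-submodule of R'^(m+1) generated by the image of L. *)
Definition base_change (A : comNzRingType) (R R' : comAlgType A)
    (f : {lrmorphism R -> R'}) (m : nat) (L : set 'rV[R]_m.+1) :
    set 'rV[R']_m.+1 :=
  [set w | exists (s : nat) (c : 'rV[R']_s) (V : 'M[R]_(s, m.+1)),
     (forall i, L (row i V)) /\ w = c *m map_mx f V].

(* An A-isomorphism between the closed subschemes E of P^m_A and E' of P^N_A: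
   a natural bijection between their points, by Yoneda. *)
Definition scheme_iso (A : comNzRingType) (m N : nat)
    (E : seq {mpoly A[m.+1]}) (E' : seq {mpoly A[N.+1]})
    (sigma : forall R : comAlgType A, set 'rV[R]_m.+1 -> set 'rV[R]_N.+1) :
    Prop :=
  (forall R : comAlgType A,
     set_bij (zero_locus E R) (zero_locus E' R) (sigma R)) /\
  (forall (R R' : comAlgType A) (f : {lrmorphism R -> R'}) L,
     zero_locus E R L ->
     sigma R' (base_change f L) = base_change f (sigma R L)).

(* [::] is the whole projective space, so sigma is an A-automorphism of
   P^m_A. *)
Definition linear_iso (A : comNzRingType) (m : nat)
    (E E' : seq {mpoly A[m.+1]}) : Prop :=
  exists sigma : forall R : comAlgType A, set 'rV[R]_m.+1 -> set 'rV[R]_m.+1,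
    scheme_iso [::] [::] sigma /\
    forall (R : comAlgType A) L, proj_space L ->
      (zero_locus E R L <-> zero_locus E' R (sigma R L)).

(* Each standard chart Spec A[x_0, ..., x_m]/(E, x_i - 1), which is finitely
   presented over A, is formally smooth: its points lift along square-zero
   extensions. *)
Definition smooth_over (A : comNzRingType) (m : nat)
    (E : seq {mpoly A[m.+1]}) : Prop :=
  forall (i : 'I_m.+1) (R R' : comAlgType A) (f : {lrmorphism R -> R'}),
    (forall y, exists x, f x = y) ->
    (forall x y, f x = 0 -> f y = 0 -> x * y = 0) ->
    forall v' : 'rV[R']_m.+1,
      v' 0 i = 1 -> (forall F, F \in E -> eval_at F v' = 0) ->
      exists v : 'rV[R]_m.+1,
        [/\ v 0 i = 1, forall F, F \in E -> eval_at F v = 0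
          & map_mx f v = v'].

(* phi exhibits k as the residue field of A at the prime ker phi. *)
Definition residue_field (A : comNzRingType) (k : fieldType)
    (phi : {rmorphism A -> k}) : Prop :=
  forall z : k, exists a b : A, phi b != 0 /\ z = phi a / phi b.

Definition hypersurface (k : fieldType) (r m : nat)
    (E : seq {mpoly k[m.+1]}) : Prop :=
  exists G : {mpoly k[m.+1]},
    [/\ G != 0, G \is r.-homog & same_subscheme E [:: G]].

Definition smooth_hypersurface (A : comNzRingType) (r n : nat)
    (E : seq {mpoly A[n.+2]}) : Prop :=
  [/\ homogeneous_eqns E,
      smooth_over E
    & forall (k : fieldType) (phi : {rmorphism A -> k}), residue_field phi ->
        hypersurface r [seq map_mpoly phi F | F <- E]].

Definition linear_iso_classes (A : comNzRingType) (r n : nat) :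
    set (set (seq {mpoly A[n.+2]})) :=
  [set C | exists2 E : seq {mpoly A[n.+2]}, smooth_hypersurface r E &
     C = [set E' | smooth_hypersurface r E' /\ linear_iso E E']].

Definition shafarevich (r n : nat) : Prop :=
  forall (K : fieldExtType rat) (S : set (set K)),
    finite_set S -> S `<=` @finite_place K ->
    finite_set (@linear_iso_classes (S_integers S) r n).

Definition line_through (R : comNzRingType) (m : nat) (v : 'rV[R]_m.+1) :
    set 'rV[R]_m.+1 :=
  range (fun a : R => a *: v).

(* [v + eps t] is an R[eps]-point of E, with eps^2 = 0.  Modulo R v, these t
   form the pullback of the tangent bundle to the point [v]. *)
Definition tangent_lift (A : comNzRingType) (R : comAlgType A) (m : nat)
    (E : seq {mpoly A[m.+1]}) (v t : 'rV[R]_m.+1) : Prop :=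
  forall F, F \in E -> \sum_(j < m.+1) eval_at (mderiv j F) v * t 0 j = 0.

(* Let T be the tangent bundle of E, smooth of relative dimension n, and let
   O(-1) be the tautological bundle of P^N, whose fibre at L is L itself.
   theta is a surjective, hence perfect, pairing
     (Lambda^n T)^(tensor q) * sigma^* O(-1) -> O,
   i.e., an isomorphism of the q-th power of the anticanonical bundle
   Lambda^n T with sigma^* O(1).  It is given on the points [v] of E with free
   underlying module, which determine it by Zariski descent, as a
   multilinear form in q blocks of n tangent vectors, alternating in each
   block and zero when one of them is v, and an element l of the fibre
   sigma [v].  Since [v + eps t] =
   [c v + eps c t] for a unit c, a tangent vector represented by t at v is
   represented by c t at c v. *)
Definition anticanonical_power_iso (A : comNzRingType) (m n N q : nat)
    (E : seq {mpoly A[m.+1]})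
    (sigma : forall R : comAlgType A, set 'rV[R]_m.+1 -> set 'rV[R]_N.+1)
    (theta : forall R : comAlgType A, 'rV[R]_m.+1 ->
       ('I_q -> 'I_n -> 'rV[R]_m.+1) -> 'rV[R]_N.+1 -> R) : Prop :=
  let dom (R : comAlgType A) v (t : 'I_q -> 'I_n -> 'rV[R]_m.+1) l :=
    [/\ zero_locus E R (line_through v),
        forall a b, tangent_lift E v (t a b)
      & sigma R (line_through v) l] in
  [/\ forall R v t l l' c, dom R v t l -> dom R v t l' ->
        theta R v t (c *: l + l') = c * theta R v t l + theta R v t l',
      forall R v t t' t'' l a b c,
        dom R v t l -> dom R v t' l -> dom R v t'' l ->
        t a b = c *: t' a b + t'' a b ->
        (forall i j, (i, j) != (a, b) -> t i j = t' i j /\ t i j = t'' i j) ->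
        theta R v t l = c * theta R v t' l + theta R v t'' l,
      forall R v t l a b, dom R v t l ->
        t a b = v \/ (exists2 b', b' != b & t a b = t a b') ->
        theta R v t l = 0,
      (forall (R : comAlgType A) v t l (c d : R), dom R v t l -> c * d = 1 ->
        theta R (c *: v) (fun a b => c *: t a b) l = theta R v t l) /\
      (forall (R R' : comAlgType A) (f : {lrmorphism R -> R'}) v t l,
        dom R v t l ->
        theta R' (map_mx f v) (fun a b => map_mx f (t a b)) (map_mx f l) =
        f (theta R v t l))
    & forall R v, zero_locus E R (line_through v) ->
        exists (s : nat) (c : 'I_s -> R)
          (t : 'I_s -> 'I_q -> 'I_n -> 'rV[R]_m.+1) (l : 'I_s -> 'rV[R]_N.+1),
          (forall i, dom R v (t i) (l i)) /\
          \sum_(i < s) c i * theta R v (t i) (l i) = 1].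

(* Some positive power of the anticanonical bundle is very ample, i.e., the
   pullback of O(1) along a closed immersion sigma into some P^N: an
   isomorphism onto a closed subscheme E' of P^N. *)
Definition ample_anticanonical (k : fieldType) (n m : nat)
    (E : seq {mpoly k[m.+1]}) : Prop :=
  exists (q N : nat) (E' : seq {mpoly k[N.+1]}) sigma theta,
    [/\ (0 < q)%N, homogeneous_eqns E', scheme_iso E E' sigma
      & @anticanonical_power_iso k m n N q E sigma theta].

Definition fano_hypersurfaces (r n : nat) : Prop :=
  forall (k : fieldType) (E : seq {mpoly k[n.+2]}),
    smooth_hypersurface r E -> ample_anticanonical n E.

(* Main.v *)
(* Smooth hypersurfaces of degree r <= n + 1 are Fano: the (n + 2 - r)-th tensor power of the
   tautological line embeds them, and the residue of the volume form identifies the anticanonical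
   bundle with O(n + 2 - r).  For r >= n + 2 (so r >= 3) one descends from dimension n + 1 to
   dimension n through the cyclic cover F + z^r of the hypersurface F = 0, which gets closer to the
   Fano range.

   Let E be a smooth hypersurface over the S-integers A.  After enlarging S to S', independently of
   E, by the places above r and above a bound for the ideal classes, E is defined by one form F that
   is primitive at all places outside S', and F + z^r is smooth over the S'-integers B.  So the
   Shafarevich conjecture in dimension n + 1 leaves finitely many classes of covers, and it remains
   to bound the number of classes of E with a given cover.

   Linear isomorphisms of covers are given by matrices over the number field K.  Each of them
   provides a direction p along which the form H of the cover varies as an r-th power of a linear
   form zeta.  Comparing the mixed derivatives of H, two such directions are either proportional or
   orthogonal for zeta, so that at most n + 3 of them occur; and two covers with proportional
   directions have bases F, F' that are equivalent under GL(K).  Finally, such an equivalence M is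
   c U with U in GL(O) at every place outside S, because smooth hypersurfaces of degree r >= 3 are
   stable: if the elementary divisors of M were not all equal, then one of the reductions would be
   singular along a coordinate subspace.  Thus the conjugation by M, and with it the isomorphism of
   projective spaces, is defined over A. *)

From HB Require Import structures.
From mathcomp Require Import all_boot all_order all_algebra all_field.
From mathcomp Require Import boolp classical_sets functions cardinality.
From mathcomp Require Import ring_quotient generic_quotient perm mpoly ring zify.
Require Import Defs.

Set Implicit Arguments.
Unset Strict Implicit.
Unset Printing Implicit Defensive.

Import GRing.Theory.
Local Open Scope classical_set_scope.
Local Open Scope ring_scope.
(** * Ideals and residue fields *)

(** Two devices get around this. A point of projective space over any ring is kept as a rank-one
    projector P, and a matrix M over K acts by P -> M^-1 P M, which involves only products of an
    entry of M^-1 with an entry of M; the scalar in M = c U cancels there. And an identity over an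
    A-algebra is proved by considering the ideal of those elements of A that kill its failure, and
    by showing place by place that this ideal is A; the local rings are valuation rings, where
    Gauss's lemma and Smith forms hold.

    The range r <= n + 1 contains r = 2 for every n >= 1, so the descent may assume r > 2; the
    exponent r - 2 must be positive both when mixed derivatives are compared and when elementary
    divisors are. Being Fano is a statement over every field, so the anticanonical bundle is
    computed without dividing by r. *)

Definition alg_of (A R : nzRingType) (phi : {rmorphism A -> R}) : Type := R.

Section AlgOf.
Variables (A R : comNzRingType) (phi : {rmorphism A -> R}).

HB.instance Definition _ := GRing.ComNzRing.on (alg_of phi).

Let scale (a : A) (x : alg_of phi) : alg_of phi := phi a * (x : R).

Let scaleA a b x : scale a (scale b x) = scale (a * b) x.
Proof. by rewrite /scale rmorphM mulrA. Qed.

Let scale1 : left_id 1 scale.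
Proof. by move=> x; rewrite /scale rmorph1 mul1r. Qed.

Let scaleDr : right_distributive scale +%R.
Proof. by move=> a x y; rewrite /scale mulrDr. Qed.

Let scaleDl x : {morph scale^~ x : a b / a + b}.
Proof. by move=> a b; rewrite /scale rmorphD mulrDl. Qed.

HB.instance Definition _ :=
  GRing.Zmodule_isLmodule.Build A (alg_of phi) scaleA scale1 scaleDr scaleDl.

Let scaleAl (a : A) (x y : alg_of phi) : a *: (x * y) = (a *: x) * y.
Proof. exact: mulrA. Qed.

HB.instance Definition _ := GRing.Lmodule_isLalgebra.Build A (alg_of phi) scaleAl.
HB.instance Definition _ := GRing.Lalgebra_isComAlgebra.Build A (alg_of phi).

Lemma in_alg_of a : in_alg (alg_of phi) a = phi a.
Proof. exact: mulr1. Qed.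

End AlgOf.

Section AlgOfMorphism.
Variables (A R R' : comNzRingType) (phi : {rmorphism A -> R}).
Variables (phi' : {rmorphism A -> R'}) (f : {rmorphism R -> R'}).
Hypothesis fphi : forall a, f (phi a) = phi' a.

Definition alg_of_map (x : alg_of phi) : alg_of phi' := f x.

Let map_zmod : zmod_morphism alg_of_map.
Proof. by move=> x y; apply: rmorphB. Qed.

Let map_monoid : monoid_morphism alg_of_map.
Proof. by split=> [|x y]; [exact: rmorph1 | exact: rmorphM]. Qed.

Let map_scalable : scalable alg_of_map.
Proof. by move=> a x; rewrite /alg_of_map rmorphM fphi. Qed.

HB.instance Definition _ := GRing.isZmodMorphism.Build _ _ alg_of_map map_zmod.
HB.instance Definition _ := GRing.isMonoidMorphism.Build _ _ alg_of_map map_monoid.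
HB.instance Definition _ := GRing.isScalable.Build _ _ _ _ alg_of_map map_scalable.

(** Through [alg_of], functors of points over A can be evaluated along any ring morphism from A, and
    one ring can carry several A-algebra structures; a commuting triangle becomes a morphism of
    algebras. *)
Lemma alg_of_lrmorphism :
  exists g : {lrmorphism alg_of phi -> alg_of phi'}, forall x, g x = f x.
Proof. by exists alg_of_map. Qed.

End AlgOfMorphism.

Definition is_ideal (R : comNzRingType) (I : set R) :=
  [/\ I 0, forall x y, I x -> I y -> I (x + y) & forall a x, I x -> I (a * x)].

Definition prime_ideal (R : comNzRingType) (I : set R) :=
  [/\ is_ideal I, ~ I 1 & forall x y, I (x * y) -> I x \/ I y].

Section Quotient.
Variables (R : comNzRingType) (I : set R).
Hypotheses (idI : is_ideal I) (I1 : ~ I 1).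

Definition ideal_pred (x : R) : bool := `[< I x >].

Let ideal_pred_closed : idealr_closed ideal_pred.
Proof.
case: idI => I0 ID IM; split; first exact/asboolP.
  by apply/negP => /asboolP.
by move=> a u v /asboolP Iu /asboolP Iv; apply/asboolP/ID => //; apply: IM.
Qed.

HB.instance Definition _ := isIdealr.Build R ideal_pred ideal_pred_closed.

Local Open Scope quotient_scope.

Lemma quotient_ring : exists (Q : comNzRingType) (pi : {rmorphism R -> Q}),
  (forall y, exists x, pi x = y) /\ (forall x, pi x = 0 <-> I x).
Proof.
pose J : idealr R := ideal_pred.
exists {ideal_quot J}, (\pi_{ideal_quot J} : {rmorphism R -> {ideal_quot J}}).
split=> [y|x]; first by exists (repr y); rewrite /= reprK.
have E : (\pi_{ideal_quot J} x == 0 :> {ideal_quot J}) = (x \in ideal_pred).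
  by rewrite piE /= /Quotient.equiv subr0.
split=> [h|Ix].
  by apply/asboolP; rewrite -[`[< _ >]]E; apply/eqP.
by apply/eqP; rewrite E; apply/asboolP.
Qed.

End Quotient.

Lemma rmorphism_factor (R Q Z : comNzRingType) (pi : {rmorphism R -> Q})
    (g : {rmorphism R -> Z}) :
  (forall y, exists x, pi x = y) -> (forall x, pi x = 0 -> g x = 0) ->
  exists h : {rmorphism Q -> Z}, forall x, h (pi x) = g x.
Proof.
move=> /boolp.choice [s sK] kerg.
have gE x y : pi x = pi y -> g x = g y.
  move=> e; apply/subr0_eq; rewrite -rmorphB; apply: kerg.
  by rewrite rmorphB e subrr.
pose h y := g (s y).
have hE x : h (pi x) = g x by apply: gE; rewrite sK.
have hZ : zmod_morphism h.
  by move=> x y; rewrite -rmorphB; apply: gE; rewrite rmorphB !sK.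
have hM : monoid_morphism h.
  split=> [|x y]; first by rewrite -(rmorph1 g); apply: gE; rewrite rmorph1 sK.
  by rewrite -rmorphM; apply: gE; rewrite rmorphM !sK.
pose hz := GRing.isZmodMorphism.Build _ _ h hZ.
pose hm := GRing.isMonoidMorphism.Build _ _ h hM.
pose H : {rmorphism Q -> Z} := HB.pack h hz hm.
by exists H.
Qed.
Local Notation "x %:F" := (@FracField.tofrac _ x).

Lemma fraction_div (R : idomainType) (z : {fraction R}) :
  exists a b : R, b != 0 /\ z = a%:F / b%:F.
Proof.
elim/quotW: z => x; exists (\n_x), (\d_x).
have dx : \d_x != 0 by exact: denom_ratioP.
split=> //; apply: (canRL (mulfK _)); first by rewrite tofrac_eq0.
unlock FracField.tofrac.
rewrite -[LHS](FracField.pi_mul) /FracField.mulf; apply/eqmodP.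
by rewrite /= FracField.equivfE !numden_Ratio ?oner_eq0 ?mulr1 ?mulf_neq0 // mulrC.
Qed.

Lemma prime_ideal_field (R : comNzRingType) (I : set R) : prime_ideal I ->
  exists (k : fieldType) (phi : {rmorphism R -> k}),
    residue_field phi /\ (forall x, phi x = 0 <-> I x).
Proof.
case=> idI I1 Ipr; have [Q [pi [pis pi0]]] := quotient_ring idI I1.
have dom x y : x * y = 0 :> Q -> x = 0 \/ y = 0.
  case: (pis x) (pis y) => [a <-] [b <-]; rewrite -rmorphM => /pi0 /Ipr.
  by case=> h; [left|right]; apply/pi0.
(* Units are recognized classically; elsewhere [inv] is the identity, the default that unit rings
   prescribe. *)
pose inv (x : Q) := if pselect (exists y, y * x = 1) is left h then projT1 (cid h) else x.
have mulVx : {in [pred x : Q | `[< exists y, y * x = 1 >]], left_inverse 1 inv *%R}.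
  move=> x /asboolP h; rewrite /inv; case: pselect => // h'.
  exact: (projT2 (cid h')).
have unitP (x y : Q) : y * x = 1 -> x \in [pred x : Q | `[< exists y, y * x = 1 >]].
  by move=> h; apply/asboolP; exists y.
have invout : {in [predC [pred x : Q | `[< exists y, y * x = 1 >]]], inv =1 id}.
  move=> x /negP h; rewrite /inv; case: pselect => // h'.
  by case: h; apply/asboolP.
pose m1 := GRing.ComNzRing_hasMulInverse.Build Q mulVx unitP invout.
pose QU : comUnitRingType := HB.pack Q m1.
have dom2 : GRing.integral_domain_axiom QU.
  by move=> x y /dom [] ->; rewrite eqxx ?orbT.
pose m2 := GRing.ComUnitRing_isIntegral.Build QU dom2.
pose D : idomainType := HB.pack QU m2.
pose emb : {rmorphism D -> {fraction D}} := @FracField.tofrac D.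
pose pi' : {rmorphism R -> D} := pi.
exists {fraction D}, (emb \o pi' : {rmorphism R -> {fraction D}}).
split=> [z|x].
  have [a [b [b0 ->]]] := fraction_div z.
  have [[u hu] [v hv]] := (pis a, pis b).
  by exists u, v; rewrite /= /emb /pi' /= hu hv tofrac_eq0; split.
rewrite -pi0 /=; split=> [/eqP|h]; first by rewrite /emb tofrac_eq0 => /eqP.
by rewrite /emb /pi' /= h rmorph0.
Qed.

(** An ideal J containing I and maximal among those that miss the powers of x is prime: if y and z
    lie outside, then powers of x lie in J + (y) and in J + (z), and their product lies in J + (yz).
    This produces the field-valued points at which ideals are tested below. *)
Lemma krull (R : comNzRingType) (I : set R) (x : R) : is_ideal I ->
  (forall n, ~ I (x ^+ n)) ->
  exists (k : fieldType) (phi : {rmorphism R -> k}),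
    [/\ residue_field phi, forall y, I y -> phi y = 0 & phi x != 0].
Proof.
move=> idI Ix.
pose P (J : set R) := (J = set0) \/
  [/\ is_ideal J, I `<=` J & forall n, ~ J (x ^+ n)].
have [F PF Ftot|J [PJ Jmax]] := @Zorn_bigcup R P.
  have [[J0 FJ0 nJ0]|allE] := pselect (exists2 J, F J & J <> set0); last first.
    left; apply/seteqP; split=> // y [J FJ Jy]; apply: allE.
    by exists J => // E; rewrite E in Jy.
  have nz J y : F J -> J y -> [/\ is_ideal J, I `<=` J & forall n, ~ J (x ^+ n)].
    by move=> FJ Jy; case: (PF _ FJ) => // E; rewrite E in Jy.
  have [y0 Jy0] : exists y, J0 y by apply/set0P/eqP.
  have [idJ0 IJ0 _] := nz _ _ FJ0 Jy0.
  right; split.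
  - split.
    + by exists J0 => //; case: idJ0.
    + move=> y z [J1 F1 J1y] [J2 F2 J2z].
      have [[_ D1 _] _ _] := nz _ _ F1 J1y; have [[_ D2 _] _ _] := nz _ _ F2 J2z.
      by case: (Ftot _ _ F1 F2) => s; [exists J2 => //; apply: D2 | exists J1 => //; apply: D1];
         rewrite //; apply: s.
    + move=> a y [J1 F1 J1y]; exists J1 => //.
      by have [[_ _ M1] _ _] := nz _ _ F1 J1y; apply: M1.
  - by move=> y /IJ0 h; exists J0.
  - by move=> n [J1 F1 J1y]; have [_ _ /(_ n)] := nz _ _ F1 J1y.
have [idJ IJ Jx] : [/\ is_ideal J, I `<=` J & forall n, ~ J (x ^+ n)].
  case: PJ => // J0; case: (Jmax I); last by right; split.
  rewrite J0; split=> //; move=> /(_ 0); apply; by case: idI.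
have [J0 JD JM] := idJ.
have adj y : ~ J y -> exists n a b, [/\ J a & x ^+ n = a + b * y].
  move=> Jy; apply: contrapT => h.
  apply: (Jmax [set z | exists a b, J a /\ z = a + b * y]).
    split=> [z Jz|]; first by exists z, 0; rewrite mul0r addr0.
    by move=> /(_ y) h'; apply/Jy/h'; exists 0, 1; rewrite mul1r add0r.
  right; split.
  - split.
    + by exists 0, 0; rewrite mul0r addr0.
    + move=> _ _ [a [b [Ja ->]]] [c [d [Jc ->]]]; exists (a + c), (b + d).
      by split; [exact: JD | rewrite mulrDl addrACA].
    + move=> c _ [a [b [Ja ->]]]; exists (c * a), (c * b).
      by split; [exact: JM | rewrite mulrDr mulrA].
  - by move=> z /IJ Jz; exists z, 0; rewrite mul0r addr0.
  - by move=> n [a [b [Ja E]]]; apply: h; exists n, a, b.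
have prJ : prime_ideal J.
  split=> //; first by have := Jx 0.
  move=> y z Jyz; apply: contrapT => /not_orP [Jy Jz].
  have [n [a [b [Ja En]]]] := adj _ Jy; have [m [c [d [Jc Em]]]] := adj _ Jz.
  apply: (Jx (n + m)%N); rewrite exprD En Em.
  have -> : (a + b * y) * (c + d * z) = (c + d * z) * a + ((b * y) * c + (b * d) * (y * z)).
    by ring.
  by apply: (JD); [|apply: JD]; apply: (JM).
have [k [phi [res phi0]]] := prime_ideal_field prJ.
exists k, phi; split=> // [y /IJ /phi0 //|].
by apply/eqP => /phi0; have := Jx 1; rewrite expr1.
Qed.

Lemma proper_ideal_field (R : comNzRingType) (I : set R) : is_ideal I -> ~ I 1 ->
  exists (k : fieldType) (phi : {rmorphism R -> k}),
    residue_field phi /\ (forall y, I y -> phi y = 0).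
Proof.
move=> idI I1; have [|k [phi [res h _]]] := @krull R I 1 idI.
  by move=> n; rewrite expr1n.
by exists k, phi.
Qed.

Lemma nilpotentP (R : comNzRingType) (x : R) :
  (forall (k : fieldType) (phi : {rmorphism R -> k}), phi x = 0) ->
  exists n, x ^+ n = 0.
Proof.
move=> h; apply: contrapT => nx.
have [||k [phi [_ _]]] := @krull R [set 0] x.
- by split=> [|_ _ -> ->|a _ ->] //=; rewrite ?addr0 ?mulr0.
- by move=> n /= e; apply: nx; exists n.
- by rewrite h eqxx.
Qed.

(** The gate to local arguments: if the multipliers that make a statement true form an ideal, the
    statement itself holds as soon as no field-valued point kills all of them. *)
Lemma unit_ideal (R : comNzRingType) (I : set R) : is_ideal I ->
  (forall (k : fieldType) (phi : {rmorphism R -> k}),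
     exists2 x, I x & phi x != 0) ->
  I 1.
Proof.
move=> idI h; apply: contrapT => /(proper_ideal_field idI) [k [phi [_ h0]]].
by have [x /h0 ->] := h k phi; rewrite eqxx.
Qed.

(** * Points of projective space and smooth forms *)

Section RankOne.
Variable R : comNzRingType.

(** Trace one and vanishing 2 x 2 minors: a description by equations, over any ring, of the
    projectors that [proj_space] describes through all field-valued points. Idempotence follows,
    since the minors turn an entry of P P into tr P times that entry of P. *)
Definition rk1 n (P : 'M[R]_n) : Prop :=
  \tr P = 1 /\ forall i j k l, P i j * P k l = P i l * P k j.

Definition span n (P : 'M[R]_n) : set 'rV[R]_n := range (fun u : 'rV[R]_n => u *m P).

Lemma rk1_idem n (P : 'M[R]_n) : rk1 P -> P *m P = P.
Proof.
move=> [t1 Pm]; apply/matrixP => i j; rewrite mxE.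
under eq_bigr do rewrite Pm.
by rewrite -mulr_sumr -[X in _ * X]/(\tr P) t1 mulr1.
Qed.

(** The diagonal entries add up to 1, so at each field-valued point one of them is nonzero, with all
    its powers: descent along the charts where P a a is invertible. *)
Lemma rk1_local n (P : 'M[R]_n) x : rk1 P ->
  (forall a, exists N, P a a ^+ N * x = 0) -> x = 0.
Proof.
move=> [t1 _] h; rewrite -[x]mul1r.
apply: (@unit_ideal R [set y | y * x = 0]) => [|k phi].
  split=> [|y z /= hy hz|a y /= hy]; rewrite /= ?mul0r //.
    by rewrite mulrDl hy hz addr0.
  by rewrite -mulrA hy mulr0.
have [a Pa] : exists a, phi (P a a) != 0.
  apply: contrapT => /forallNP h0; have /eqP := oner_neq0 k; apply.
  rewrite -(rmorph1 phi) -t1 rmorph_sum big1 // => a _.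
  by have /negP/negPn/eqP := h0 a.
have [N hN] := h a; exists (P a a ^+ N) => //.
by rewrite rmorphXn expf_neq0.
Qed.

(** For a column times a row, P = u v, both sides are u (v X u) v; the vanishing minors carry out
    this computation without factoring P. *)
Lemma rk1_sandwich n (P X : 'M[R]_n) : rk1 P -> P *m X *m P = \tr (P *m X) *: P.
Proof.
move=> [_ Pm]; apply/matrixP => i j; rewrite !mxE /mxtrace mulr_suml.
apply: eq_bigr => k _; rewrite !mxE !mulr_suml.
have -> : \sum_(l < n) P i l * X l k * P k j = \sum_(l < n) P k l * X l k * P i j.
  apply: eq_bigr => l _; transitivity (X l k * (P i l * P k j)); first by ring.
  by rewrite Pm; ring.
by [].
Qed.

Lemma spanP n (P : 'M[R]_n) v : rk1 P -> span P v <-> v *m P = v.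
Proof.
move=> hP; split=> [[u _ <-]|<-]; first by rewrite -mulmxA rk1_idem.
by exists v.
Qed.

Lemma rk1_span_eq n (P Q : 'M[R]_n) : rk1 P -> rk1 Q ->
  span P = span Q <-> P *m Q = P.
Proof.
move=> hP hQ; split=> [E|PQ].
  apply/row_matrixP => i; rewrite row_mul; apply/(spanP _ hQ).
  by rewrite -E; apply/(spanP _ hP); rewrite -row_mul rk1_idem.
(* One equation suffices: Q P Q = tr(Q P) Q, and tr(Q P) = tr(P Q) = tr P = 1. *)
have QP : Q *m P = Q.
  have := rk1_sandwich P hQ; rewrite mxtrace_mulC PQ (proj1 hP) scale1r.
  by rewrite -mulmxA PQ.
apply/seteqP; split=> v; rewrite !spanP // => <-.
  by rewrite -mulmxA PQ.
by rewrite -mulmxA QP.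
Qed.

Definition unimod n (v : 'rV[R]_n) : Prop := exists u : 'cV[R]_n, v *m u = 1%:M.

Lemma rk1_outer n (v : 'rV[R]_n) (u : 'cV[R]_n) : v *m u = 1%:M -> rk1 (u *m v).
Proof.
move=> vu; split; first by rewrite mxtrace_mulC vu mxtrace1.
move=> i j k l; rewrite !mxE !big_ord1; ring.
Qed.

Lemma span_outer m (v : 'rV[R]_m.+1) (u : 'cV[R]_m.+1) : v *m u = 1%:M ->
  span (u *m v) = line_through v.
Proof.
move=> vu; apply/seteqP; split=> w [z _ <-].
  by exists ((z *m u) 0 0) => //; rewrite mulmxA [X in _ = X *m v]mx11_scalar mul_scalar_mx.
by exists (z *: v) => //; rewrite mulmxA -scalemxAl vu -scalemxAl mul1mx.
Qed.

End RankOne.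

Lemma rk1_map (R S : comNzRingType) (f : {rmorphism R -> S}) n (P : 'M[R]_n) :
  rk1 P -> rk1 (map_mx f P).
Proof.
move=> [t1 Pm]; split; first by rewrite trace_map_mx t1 rmorph1.
by move=> i j k l; rewrite !mxE -!rmorphM Pm.
Qed.

Lemma rk1_field (k : fieldType) n (P : 'M[k]_n) :
  rk1 P <-> P *m P = P /\ \rank P = 1%N.
Proof.
split=> [hP|[PP rk]].
  split; first exact: rk1_idem.
  have [t1 Pm] := hP; have [a Pa] : exists a, P a a != 0.
    apply: contrapT => /forallNP h0; have /eqP := oner_neq0 k; apply.
    by rewrite -t1 /mxtrace big1 // => a _; have /negP/negPn/eqP := h0 a.
  have E : P = ((P a a)^-1 *: col a P) *m row a P.
    apply/matrixP => i j; rewrite !mxE big_ord1 !mxE.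
    by rewrite -mulrA Pm mulrC mulfK.
  apply/eqP; rewrite eqn_leq lt0n mxrank_eq0; apply/andP; split.
    by rewrite E (leq_trans (mxrankM_maxl _ _)) // rank_leq_col.
  by apply: contraNneq Pa => ->; rewrite mxE.
have [C [r E]] : exists (C : 'cV[k]_n) (r : 'rV[k]_n), P = C *m r.
  move: (col_base P) (row_base P) (mulmx_base P); rewrite rk => C r <-.
  by exists C, r.
split; last by move=> i j l m; rewrite E !mxE !big_ord1; ring.
have P0 : P != 0 by rewrite -mxrank_eq0 rk.
have : ((r *m C) 0 0) *: P = P.
  rewrite -[RHS]PP E mulmxA -[C *m r *m C]mulmxA.
  by rewrite [r *m C in RHS]mx11_scalar mul_mx_scalar -scalemxAl.
rewrite E mxtrace_mulC /mxtrace big_ord1 -E => /eqP.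
by rewrite -subr_eq0 -{2}[P]scale1r -scalerBl scaler_eq0 (negPf P0) orbF subr_eq0 => /eqP.
Qed.

(** That the minors vanish at all fields only makes them nilpotent; idempotence removes the
    nilpotents. Once P a a is inverted, the deviation [Q a] of P from the product of its column and
    row a is, up to scaling, an idempotent with nilpotent entries, hence zero. *)
Lemma idem_rk1 (R : comNzRingType) n (P : 'M[R]_n) : P *m P = P ->
  (forall (k : fieldType) (f : {rmorphism R -> k}), \rank (map_mx f P) = 1%N) ->
  rk1 P.
Proof.
move=> PP rkP.
have fP (k : fieldType) (f : {rmorphism R -> k}) : rk1 (map_mx f P).
  by apply/rk1_field; rewrite -map_mxM PP.
have field_nz (k : fieldType) (f : {rmorphism R -> k}) : exists a, f (P a a) != 0.
  apply: contrapT => /forallNP h0; have /eqP := oner_neq0 k; apply.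
  have [<- _] := fP k f; rewrite /mxtrace big1 // => a _; rewrite mxE.
  by have /negP/negPn/eqP := h0 a.
pose Q a : 'M[R]_n := P a a *: P - col a P *m row a P.
have QE a i j : Q a i j = P a a * P i j - P i a * P a j.
  by rewrite !mxE big_ord1 !mxE.
have nilQ a : exists N, forall i j, P a a ^+ N * Q a i j = 0.
  set g := col a P; set r := row a P.
  have Pg : P *m g = g by rewrite /g colE mulmxA PP.
  have rP : r *m P = r by rewrite /r -row_mul PP.
  have rg : r *m g = (P a a)%:M.
    rewrite [LHS]mx11_scalar; congr (_%:M); rewrite -[in RHS]PP !mxE.
    by apply: eq_bigr => i _; rewrite !mxE.
  have QQ : Q a *m Q a = P a a *: Q a.
    rewrite /Q -/g -/r mulmxBl !mulmxBr -!scalemxAl -!scalemxAr PP.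
    rewrite [P *m (g *m r)]mulmxA Pg -[g *m r *m P]mulmxA rP.
    rewrite -[g *m r *m (g *m r)]mulmxA [r *m (g *m r)]mulmxA rg mul_scalar_mx -scalemxAr.
    by rewrite subrr subr0 scalerBr.
  (* e kills [Q a], because [Q a] times P a a - [Q a] is zero; and e agrees with the n-th power of P
     a a up to a nilpotent, because [Q a] vanishes at every field. So a power of P a a kills
     [Q a]. *)
  pose e := \det ((P a a)%:M - Q a).
  have eQ i j : e * Q a i j = 0.
    have : Q a *m ((P a a)%:M - Q a) *m \adj ((P a a)%:M - Q a) = 0.
      by rewrite mulmxBr QQ mul_mx_scalar subrr mul0mx.
    by rewrite -mulmxA mul_mx_adj mul_mx_scalar => /matrixP /(_ i j); rewrite !mxE.
  have [k hk] : exists k, (P a a ^+ n - e) ^+ k = 0.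
    apply: nilpotentP => k f; rewrite rmorphB rmorphXn /= -det_map_mx map_mxB.
    have -> : map_mx f (Q a) = 0.
      apply/matrixP => i j; rewrite mxE QE !mxE rmorphB !rmorphM.
      have [_ /(_ a a i j)] := fP k f; rewrite !mxE => ->.
      by rewrite mulrC subrr.
    by rewrite subr0 map_scalar_mx det_scalar subrr.
  exists (n * k)%N => i j; rewrite exprM.
  have := subrXX (P a a ^+ n) (P a a ^+ n - e) k.
  by rewrite hk subr0 opprB addrC subrK => ->; rewrite mulrAC eQ mul0r.
have Pm i j k l : P i j * P k l = P i l * P k j.
  apply/subr0_eq; set d := _ - _; rewrite -[d]mul1r.
  apply: (@unit_ideal R [set y | y * d = 0]) => [|K phi].
    split=> [|y z /= hy hz|a y /= hy]; rewrite /= ?mul0r //.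
      by rewrite mulrDl hy hz addr0.
    by rewrite -mulrA hy mulr0.
  have [a ha] := field_nz _ phi; have [N hN] := nilQ a.
  exists (P a a ^+ N * (P a a * P a a)); last by rewrite rmorphM rmorphXn rmorphM !mulf_neq0 ?expf_neq0.
  have E i' j' k' l' : P a a ^+ N * (P a a * P i' j') * (P a a * P k' l') =
      P a a ^+ N * (P i' a * P a j') * (P k' a * P a l').
    have h1 : P a a ^+ N * (P a a * P i' j') = P a a ^+ N * (P i' a * P a j').
      by apply/subr0_eq; rewrite -mulrBr -QE hN.
    have h2 : P a a ^+ N * (P a a * P k' l') = P a a ^+ N * (P k' a * P a l').
      by apply/subr0_eq; rewrite -mulrBr -QE hN.
    rewrite h1; transitivity ((P i' a * P a j') * (P a a ^+ N * (P a a * P k' l'))); first by ring.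
    by rewrite h2; ring.
  rewrite /= /d mulrBr; apply/eqP; rewrite subr_eq0; apply/eqP.
  transitivity (P a a ^+ N * (P a a * P i j) * (P a a * P k l)); first by ring.
  rewrite E; transitivity (P a a ^+ N * (P a a * P i l) * (P a a * P k j)); last by ring.
  by rewrite E; ring.
(* The minors give tr P times P = P, so the trace is idempotent; being nonzero at every field it is
   a unit, hence 1. *)
have trM i j : \tr P * P i j = P i j.
  rewrite -[in RHS]PP mxE mulr_suml; apply: eq_bigr => k _.
  by rewrite Pm mulrC Pm mulrC.
have tr2 : \tr P * \tr P = \tr P.
  by rewrite {2 3}/mxtrace mulr_sumr; apply: eq_bigr => i _; rewrite trM.
split=> //.
have [x hx] : [set y | exists x, y = x * \tr P] 1.
  apply: unit_ideal => [|k phi]; first split=> [|_ _ [x ->] [y ->]|a _ [x ->]].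
  - by exists 0; rewrite mul0r.
  - by exists (x + y); rewrite mulrDl.
  - by exists (a * x); rewrite mulrA.
  exists (\tr P); first by exists 1; rewrite mul1r.
  by rewrite -trace_map_mx; have [-> _] := fP k phi; exact: oner_neq0.
by rewrite -[LHS]mul1r hx -mulrA tr2.
Qed.

Lemma proj_spaceP (R : comNzRingType) m (L : set 'rV[R]_m.+1) :
  proj_space L <-> exists P, rk1 P /\ L = span P.
Proof.
split=> [[P [PP rkP ->]]|[P [hP ->]]]; first by exists P; split=> //; apply: idem_rk1.
exists P; split=> //; first exact: rk1_idem.
by move=> k f; have /rk1_field[] := rk1_map f hP.
Qed.

Lemma line_proj (R : comNzRingType) m (v : 'rV[R]_m.+1) :
  proj_space (line_through v) <-> unimod v.
Proof.
split=> [/proj_spaceP [P [hP E]]|[u vu]]; last first.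
  by apply/proj_spaceP; exists (u *m v); split; [exact: rk1_outer | rewrite span_outer].
have Pv i : exists c, row i P = c *: v.
  have [c _ <-] : line_through v (row i P); last by exists c.
  by rewrite E; apply/(spanP _ hP); rewrite -row_mul rk1_idem.
have [c cP] := boolp.choice Pv; exists (\col_i c i).
rewrite [LHS]mx11_scalar; congr (_%:M); have [<- _] := hP; rewrite mxE.
by apply: eq_bigr => i _; have /rowP/(_ i) := cP i; rewrite !mxE mulrC.
Qed.

Lemma base_change_span (A : comNzRingType) (R R' : comAlgType A)
    (f : {lrmorphism R -> R'}) m (P : 'M[R]_m.+1) : rk1 P ->
  base_change f (span P) = span (map_mx f P).
Proof.
move=> hP; apply/seteqP; split=> w.
  move=> [s [c [V [hV ->]]]]; apply/spanP; first exact: rk1_map.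
  rewrite -mulmxA -map_mxM; congr (_ *m map_mx f _).
  by apply/row_matrixP => i; rewrite row_mul; apply/(spanP _ hP).
move=> [u _ <-]; exists m.+1, u, P; split=> // i.
by apply/(spanP _ hP); rewrite -row_mul rk1_idem.
Qed.

Lemma base_change_line (A : comNzRingType) (R R' : comAlgType A)
    (f : {lrmorphism R -> R'}) m (v : 'rV[R]_m.+1) : unimod v ->
  base_change f (line_through v) = line_through (map_mx f v).
Proof.
move=> [u vu]; rewrite -(span_outer vu) base_change_span; last exact: rk1_outer.
by rewrite map_mxM span_outer // -map_mxM vu map_mx1.
Qed.

Lemma unimod_map (R S : comNzRingType) (f : {rmorphism R -> S}) n (v : 'rV[R]_n) :
  unimod v -> unimod (map_mx f v).
Proof. by move=> [u vu]; exists (map_mx f u); rewrite -map_mxM vu map_mx1. Qed.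

Lemma unimod_coord (R : comNzRingType) n (v : 'rV[R]_n) i : v 0 i = 1 -> unimod v.
Proof.
move=> vi; exists (delta_mx i 0); rewrite -colE [LHS]mx11_scalar.
by rewrite mxE vi.
Qed.

Notation ev phi v := (mmap phi (fun_of_matrix v 0)).

Lemma eq_mmap (A R : nzRingType) n (f g : A -> R) (h h' : 'I_n -> R) :
  f =1 g -> h =1 h' -> mmap f h =1 mmap g h'.
Proof.
move=> fg hh F; rewrite /mmap; apply: eq_bigr => m _; rewrite fg; congr (_ * _).
by apply: eq_bigr => i _; rewrite hh.
Qed.

Lemma rmorph_mmap (A R S : comNzRingType) n (f : {rmorphism R -> S}) (phi : A -> R)
    (h : 'I_n -> R) F : f (mmap phi h F) = mmap (f \o phi) (f \o h) F.
Proof.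
rewrite /mmap rmorph_sum; apply: eq_bigr => m _; rewrite rmorphM; congr (_ * _).
by rewrite rmorph_prod; apply: eq_bigr => i _; rewrite rmorphXn.
Qed.

Lemma mmap_map_mpoly (A B R : comNzRingType) n (psi : {rmorphism A -> B})
    (phi : {rmorphism B -> R}) (h : 'I_n -> R) F :
  mmap phi h (map_mpoly psi F) = mmap (phi \o psi) h F.
Proof.
pose g := mmap phi h : {rmorphism {mpoly B[n]} -> R}.
rewrite -[LHS]/(g _) /map_mpoly rmorph_mmap; apply: eq_mmap => [a|i] /=.
  by rewrite mmapC.
by rewrite mmapX mmap1U.
Qed.

Lemma mmap_comp_mpoly (A R : comNzRingType) n k (phi : {rmorphism A -> R})
    (h : 'I_k -> R) (lq : n.-tuple {mpoly A[k]}) F :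
  mmap phi h (F \mPo lq) = mmap phi (fun i => mmap phi h (tnth lq i)) F.
Proof.
pose g := mmap phi h : {rmorphism {mpoly A[k]} -> R}.
rewrite -[LHS]/(g _) /comp_mpoly rmorph_mmap; apply: eq_mmap => [a|i] //=.
by rewrite mmapC.
Qed.

Lemma mmap_homogZ (A R : comNzRingType) n (phi : {rmorphism A -> R}) (h : 'I_n -> R)
    (c : R) d F : F \is d.-homog ->
  mmap phi (fun i => c * h i) F = c ^+ d * mmap phi h F.
Proof.
move=> hF; rewrite /mmap mulr_sumr; apply: eq_big_seq => m mF.
rewrite mulrCA; congr (_ * _); rewrite /mmap1 -(dhomogP _ _ _ hF m mF) /= mdegE.
rewrite -prodrXr -big_split /=; apply: eq_bigr => i _.
by rewrite exprMn.
Qed.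

Lemma ev_homogZ (A R : comNzRingType) n (phi : {rmorphism A -> R}) (v : 'rV[R]_n)
    (c : R) d F : F \is d.-homog -> ev phi (c *: v) F = c ^+ d * ev phi v F.
Proof.
by move=> hF; rewrite -(mmap_homogZ _ _ _ hF); apply: eq_mmap => // i; rewrite mxE.
Qed.

Lemma ev_map (A R S : comNzRingType) n (phi : {rmorphism A -> R}) (f : {rmorphism R -> S})
    (v : 'rV[R]_n) F : ev (f \o phi) (map_mx f v) F = f (ev phi v F).
Proof. by rewrite rmorph_mmap; apply: eq_mmap => // i; rewrite mxE. Qed.

Lemma eval_at_alg_of (A R : comNzRingType) (phi : {rmorphism A -> R}) m
    (F : {mpoly A[m.+1]}) (v : 'rV[R]_m.+1) :
  eval_at (R := alg_of phi) F v = ev phi v F.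
Proof. by apply: eq_mmap => // a; exact: in_alg_of. Qed.

(** For v in the span, P a a times v is v a times row a of P, so by homogeneity it suffices to test
    the rows; [rk1_local] permits powers of P a a in front. *)
Lemma rk1_homog_vanish (A R : comNzRingType) (phi : {rmorphism A -> R}) n (P : 'M[R]_n)
    d F : rk1 P -> F \is d.-homog ->
  (forall a, exists N, P a a ^+ N * ev phi (row a P) F = 0) ->
  forall v, span P v -> ev phi v F = 0.
Proof.
move=> hP hF h v /(spanP _ hP) vP; apply: (rk1_local hP) => a.
have [N hN] := h a; exists (d + N)%N.
rewrite exprD mulrAC -(ev_homogZ _ _ _ hF).
have -> : P a a *: v = v 0 a *: row a P.
  apply/rowP => j; rewrite -[in LHS]vP !mxE mulr_sumr -[in RHS]vP mxE mulr_suml.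
  apply: eq_bigr => i _; rewrite mulrCA -[in RHS]mulrA; congr (_ * _).
  by rewrite mulrC (proj2 hP).
by rewrite (ev_homogZ _ _ _ hF) -mulrA [X in _ * X]mulrC hN mulr0.
Qed.

Section ZeroLocus.
Variables (A : comNzRingType) (m : nat).
Implicit Types E : seq {mpoly A[m.+1]}.

Definition vanish (R : comNzRingType) (phi : {rmorphism A -> R}) E (v : 'rV[R]_m.+1) :=
  forall F, F \in E -> ev phi v F = 0.

Lemma zero_locus_line E (R : comAlgType A) (v : 'rV[R]_m.+1) : homogeneous_eqns E ->
  zero_locus E R (line_through v) <-> unimod v /\ vanish (in_alg R) E v.
Proof.
move=> hE; split=> [[/line_proj uv h]|[uv h]]; split=> //; first 1 last.
- exact/line_proj.
- move=> F FE w [c _ <-]; have [d Fd] := hE F FE.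
  by rewrite /eval_at (ev_homogZ _ _ _ Fd) h // mulr0.
by move=> F FE; apply: h => //; exists 1; rewrite ?scale1r.
Qed.

Lemma same_subscheme_vanish E E' : homogeneous_eqns E -> homogeneous_eqns E' ->
  same_subscheme E E' ->
  forall (R : comNzRingType) (phi : {rmorphism A -> R}) (v : 'rV[R]_m.+1), unimod v ->
  vanish phi E v <-> vanish phi E' v.
Proof.
move=> hE hE' EE R phi v uv.
have eqv E0 : vanish phi E0 v <-> vanish (in_alg (alg_of phi)) E0 v.
  split=> h F FE; last by rewrite -eval_at_alg_of; apply: h.
  by rewrite -[LHS]/(eval_at (R := alg_of phi) F v) eval_at_alg_of h.
rewrite !eqv; split=> h.
  have /(zero_locus_line _ hE') [] // : zero_locus E' (alg_of phi) (line_through v).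
  by rewrite -EE; apply/zero_locus_line.
have /(zero_locus_line _ hE) [] // : zero_locus E (alg_of phi) (line_through v).
by rewrite EE; apply/zero_locus_line.
Qed.

Lemma smooth_over_lift E : smooth_over E ->
  forall (i : 'I_m.+1) (R R' : comNzRingType) (phi : {rmorphism A -> R})
    (f : {rmorphism R -> R'}),
    (forall y, exists x, f x = y) ->
    (forall x y, f x = 0 -> f y = 0 -> x * y = 0) ->
    forall v' : 'rV[R']_m.+1, v' 0 i = 1 -> vanish (f \o phi) E v' ->
    exists v : 'rV[R]_m.+1, [/\ v 0 i = 1, vanish phi E v & map_mx f v = v'].
Proof.
move=> sE i R R' phi f fs f2 v' vi hv.
have [g gE] := @alg_of_lrmorphism A R R' phi (f \o phi) f (fun _ => erefl).
have gs (y : alg_of (f \o phi)) : exists x, g x = y.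
  by have [x <-] := fs y; exists x; rewrite gE.
have g2 x y : g x = 0 -> g y = 0 -> x * y = 0 by rewrite !gE; apply: f2.
have [F FE|v [v1 v2 v3]] := @sE i (alg_of phi) (alg_of (f \o phi)) g gs g2 v' vi.
  by rewrite eval_at_alg_of hv.
exists v; split=> // [F FE|]; first by rewrite -eval_at_alg_of v2.
by rewrite -v3; apply/rowP => j; rewrite !mxE gE.
Qed.

End ZeroLocus.

(** * Derivatives and the Jacobian criterion *)

Lemma mpoly_ring_ind (A : comNzRingType) n (P : {mpoly A[n]} -> Prop) :
  (forall c, P c%:MP) -> (forall i, P 'X_i) ->
  (forall p q, P p -> P q -> P (p + q)) -> (forall p q, P p -> P q -> P (p * q)) ->
  forall p, P p.
Proof.
move=> PC PX PD PM p; rewrite (mpolyE p).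
have P0 : P 0 by rewrite -mpolyC0.
have P1 : P 1 by rewrite -mpolyC1.
apply: (big_ind P) => // m _; rewrite -mul_mpolyC; apply: (PM) => //.
rewrite mpolyXE_id; apply: (big_ind P) => // i _.
by elim: (m i) => [|e IHe]; rewrite ?expr0 // exprS; apply: (PM).
Qed.

Lemma mderivXU (A : comNzRingType) n (i j : 'I_n) :
  mderiv i ('X_j : {mpoly A[n]}) = (i == j)%:R.
Proof.
rewrite mderivX mnm1E [j == i]eq_sym; have [->|_] := eqVneq i j; last by rewrite scale0r.
rewrite scale1r (_ : (U_(j) - U_(j))%MM = 0%MM) ?mpolyX0 //.
by apply/mnmP => k; rewrite mnmBE subnn mnm0E.
Qed.

Lemma mmap_taylor (A R : comNzRingType) n (phi : {rmorphism A -> R}) (h w : 'I_n -> R) F :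
  (forall i j, w i * w j = 0) ->
  mmap phi (fun i => h i + w i) F =
  mmap phi h F + \sum_j w j * mmap phi h (mderiv j F).
Proof.
move=> w2; elim/mpoly_ring_ind: F => [c|i|p q IHp IHq|p q IHp IHq].
- by rewrite !mmapC big1 ?addr0 // => j _; rewrite mderivC mmap0 mulr0.
- rewrite !mmapX !mmap1U (bigD1 i) //= big1 => [|j ji]; last first.
    by rewrite mderivXU (negPf ji) mmap0 mulr0.
  by rewrite mderivXU eqxx rmorph1 mulr1 addr0.
- rewrite !rmorphD /= IHp IHq addrACA -big_split /=; congr (_ + _).
  by apply: eq_bigr => j _; rewrite mderivD rmorphD mulrDr.
rewrite !rmorphM /= IHp IHq mulrDl !mulrDr -addrA; congr (_ + _).
set sp := \sum_j w j * mmap phi h (mderiv j p).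
set sq := \sum_j w j * mmap phi h (mderiv j q).
have -> : sp * sq = 0.
  rewrite mulr_suml big1 // => i _; rewrite mulr_sumr big1 // => j _.
  by rewrite mulrACA w2 mul0r.
rewrite addr0 mulr_sumr mulr_suml -big_split /=; apply: eq_bigr => j _.
by rewrite mderivM rmorphD !rmorphM /=; ring.
Qed.

Lemma mderiv_homog (A : comNzRingType) n d (F : {mpoly A[n]}) j :
  F \is d.-homog -> mderiv j F \is d.-1.-homog.
Proof.
move=> hF; apply/dhomogP => m; rewrite mcoeff_msupp mcoeff_deriv => nz.
have : F@_(m + U_(j)) != 0 by apply: contraNneq nz => ->; rewrite mul0rn.
by rewrite -mcoeff_msupp => /(dhomogP _ _ _ hF) /=; rewrite mdegD mdeg1 addn1 => <-.
Qed.

Lemma euler_homog (A : comNzRingType) n d (F : {mpoly A[n]}) : F \is d.-homog ->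
  \sum_j 'X_j * mderiv j F = d%:R * F.
Proof.
move=> hF; apply/mpolyP => m; rewrite -mpolyC_nat mcoeffCM raddf_sum /=.
transitivity (\sum_(j < n) F@_m *+ m j).
  apply: eq_bigr => j _; rewrite mulrC; case: (posnP (m j)) => mj.
    rewrite mj mulr0n memN_msupp_eq0 //; apply/negP => /msuppM_le /allpairsP [[m1 m2] /= [_]].
    rewrite msuppX inE => /eqP -> mE; move: mj; rewrite mE mnmDE mnm1E eqxx addn1 //.
  have mE : (U_(j) + (m - U_(j)))%MM = m by rewrite addmC submK // lep1mP -lt0n.
  rewrite -[in LHS]mE mcoeffMX mcoeff_deriv addmC mE; congr (_ *+ _).
  by rewrite mnmBE mnm1E eqxx subn1 prednK.
rewrite sumrMnr -mdegE; have [mF|/memN_msupp_eq0 ->] := boolP (m \in msupp F).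
  by rewrite (dhomogP _ _ _ hF m mF) mulr_natl.
by rewrite mul0rn mulr0.
Qed.

Section TruncatedPoly.
Variables (R : comNzRingType) (e : nat).

Definition trunc_ideal : set {poly R} := [set p | exists q, p = q * 'X^e].

Lemma trunc_is_ideal : is_ideal trunc_ideal.
Proof.
split=> [|_ _ [p ->] [q ->]|a _ [q ->]]; first by exists 0; rewrite mul0r.
  by exists (p + q); rewrite mulrDl.
by exists (a * q); rewrite mulrA.
Qed.

Lemma trunc_ideal1 : (0 < e)%N -> ~ trunc_ideal 1.
Proof.
move=> e0 [q /(congr1 (fun p : {poly R} => p`_0)) /eqP].
by rewrite coef1 coefMXn e0 oner_eq0.
Qed.

Lemma trunc_idealP p : trunc_ideal p <-> forall i, (i < e)%N -> p`_i = 0.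
Proof.
split=> [[q ->] i ie|h]; first by rewrite coefMXn ie.
exists (drop_poly e p); rewrite -[LHS](poly_take_drop e).
suff -> : take_poly e p = 0 by rewrite add0r.
by apply/polyP => i; rewrite coef_take_poly coef0; case: ltnP => // /h.
Qed.

End TruncatedPoly.

(** No singular point on the affine cone away from the origin, over any extension. The vanishing of
    G is listed along with that of its derivatives, since Euler's formula does not give it when the
    degree is zero in k. *)
Definition nonsing (k : fieldType) n (G : {mpoly k[n]}) : Prop :=
  forall (K : fieldType) (f : {rmorphism k -> K}) (c : 'rV[K]_n), c != 0 ->
    ev f c G = 0 -> (forall j, ev f c (mderiv j G) = 0) -> False.

Lemma mmap_at_class (A R : comNzRingType) n (pi : {rmorphism {mpoly A[n]} -> R}) p :
  ev (pi \o @mpolyC n A)%FUN (\row_j pi 'X_j) p = pi p.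
Proof.
elim/mpoly_ring_ind: p => [c|j|p q IHp IHq|p q IHp IHq].
- by rewrite mmapC.
- by rewrite mmapX mmap1U mxE.
- by rewrite !rmorphD /= IHp IHq.
- by rewrite !rmorphM /= IHp IHq.
Qed.

Section Jacobian.
Variables (k : fieldType) (n : nat) (G : {mpoly k[n]}).
Hypothesis nsG : nonsing G.

Lemma nonsing_gradient (R : comNzRingType) (f : {rmorphism k -> R}) (v : 'rV[R]_n) :
  unimod v -> ev f v G = 0 ->
  exists w : 'I_n -> R, \sum_j w j * ev f v (mderiv j G) = 1.
Proof.
move=> [u vu] Gv.
have [w ->] : [set y | exists w : 'I_n -> R, y = \sum_j w j * ev f v (mderiv j G)] 1;
  last by exists w.
apply: unit_ideal => [|K phi].
  split=> [|_ _ [a ->] [b ->]|a _ [b ->]].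
  - by exists (fun=> 0); rewrite big1 // => j _; rewrite mul0r.
  - exists (fun j => a j + b j); rewrite -big_split /=.
    by apply: eq_bigr => j _; rewrite mulrDl.
  - exists (fun j => a * b j); rewrite mulr_sumr.
    by apply: eq_bigr => j _; rewrite mulrA.
have [j hj] : exists j, phi (ev f v (mderiv j G)) != 0.
  apply: contrapT => /forallNP h0; apply: (nsG (f := phi \o f) (c := map_mx phi v)).
  - apply/negP => /eqP v0; have := congr1 (map_mx phi) vu.
    rewrite map_mxM v0 mul0mx map_mx1 => /matrixP /(_ 0 0) /eqP.
    by rewrite !mxE eqxx eq_sym oner_eq0.
  - by rewrite ev_map Gv rmorph0.
  - by move=> j; rewrite ev_map; have /negP/negPn/eqP := h0 j.
exists (ev f v (mderiv j G)) => //; exists (fun i => (i == j)%:R).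
rewrite (bigD1 j) //= eqxx mul1r big1 ?addr0 // => i /negPf ->.
by rewrite mul0r.
Qed.

(** A form of the Nullstellensatz: if the ideal of G and its derivatives missed all powers of a
    variable, [krull] would provide a field in which the classes of the variables form a singular
    point. *)
Lemma nonsing_ideal : exists N, forall i : 'I_n,
  exists (a : {mpoly k[n]}) (b : 'I_n -> {mpoly k[n]}),
    'X_i ^+ N = a * G + \sum_j b j * mderiv j G.
Proof.
pose I : set {mpoly k[n]} := [set p | exists a b, p = a * G + \sum_j b j * mderiv j G].
have idI : is_ideal I.
  split=> [|_ _ [a [b ->]] [a' [b' ->]]|p _ [a [b ->]]].
  - by exists 0, (fun=> 0); rewrite mul0r big1 ?addr0 // => j _; rewrite mul0r.
  - exists (a + a'), (fun j => b j + b' j); rewrite mulrDl addrACA -big_split /=.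
    by congr (_ + _); apply: eq_bigr => j _; rewrite mulrDl.
  - exists (p * a), (fun j => p * b j); rewrite mulrDr mulrA mulr_sumr.
    by congr (_ + _); apply: eq_bigr => j _; rewrite mulrA.
have h i : exists N, I ('X_i ^+ N).
  apply: contrapT => /forallNP h; have [K [phi [_ phiI phiX]]] := krull idI h.
  pose f : {rmorphism k -> K} := (phi \o @mpolyC n k)%FUN.
  have phiE p : phi p = ev f (\row_j phi 'X_j) p by rewrite -mmap_at_class.
  apply: (nsG (f := f) (c := \row_j phi 'X_j)).
  - by apply: contraNneq phiX => /rowP/(_ i); rewrite !mxE => ->.
  - rewrite -phiE phiI //; exists 1, (fun=> 0).
    by rewrite mul1r big1 ?addr0 // => j _; rewrite mul0r.
  - move=> j; rewrite -phiE phiI //; exists 0, (fun i => (i == j)%:R).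
    rewrite mul0r add0r (bigD1 j) //= eqxx mul1r big1 ?addr0 // => l /negPf ->.
    by rewrite mul0r.
have [N hN] := boolp.choice h; exists (\sum_i N i)%N => i.
rewrite (bigD1 i) //= exprD mulrC; case: idI => _ _ IM; exact: IM.
Qed.

End Jacobian.

Lemma map_mpoly_eq0 (k K : fieldType) n (f : {rmorphism k -> K}) (G : {mpoly k[n]}) :
  (map_mpoly f G == 0) = (G == 0).
Proof.
apply/eqP/eqP=> [h|->]; last by rewrite rmorph0.
apply/mpolyP => m; have /eqP := congr1 (mcoeff m) h.
by rewrite mcoeff_map_mpoly !mcoeff0 fmorph_eq0 => /eqP.
Qed.

(** A point with algebraically independent coordinates, in the fraction field of the polynomial
    ring. Polynomial identities are checked there, where one may divide by coordinates. *)
Lemma generic_point (K : fieldType) n :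
  exists (k1 : fieldType) (iota : {rmorphism K -> k1}) (x : 'I_n -> k1),
    forall p : {mpoly K[n]}, p != 0 -> mmap iota x p != 0.
Proof.
pose tf : {rmorphism {mpoly K[n]} -> {fraction {mpoly K[n]}}} := @FracField.tofrac _.
exists {fraction {mpoly K[n]}}, (tf \o @mpolyC n K)%FUN, (fun i => tf 'X_i) => p p0.
suff -> : mmap (tf \o @mpolyC n K)%FUN (fun i => tf 'X_i) p = tf p by rewrite tofrac_eq0.
elim/mpoly_ring_ind: {p0} p => [c|j|p q IHp IHq|p q IHp IHq].
- by rewrite mmapC.
- by rewrite mmapX mmap1U.
- by rewrite !rmorphD /= IHp IHq.
- by rewrite !rmorphM /= IHp IHq.
Qed.

(** Draw a line c + T y through a singular point c in a general direction, so that G has on it a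
    zero of exact order e at T = 0. Modulo T^e the line is a point of E, and smoothness lifts this
    point modulo T^(e+1). Passing to the lift changes G by T^e times a combination of derivatives of
    G on the line; these vanish at T = 0, so G would have order at least e + 1 on the line
    itself. *)
Lemma smooth_over_nonsing (A : comNzRingType) m (E : seq {mpoly A[m.+1]})
    (k : fieldType) (phi : {rmorphism A -> k}) (G : {mpoly k[m.+1]}) d :
  smooth_over E -> G != 0 -> G \is d.-homog ->
  (forall (R : comNzRingType) (psi : {rmorphism k -> R}) (v : 'rV[R]_m.+1), unimod v ->
     vanish (psi \o phi) E v <-> ev psi v G = 0) ->
  nonsing G.
Proof.
move=> sE G0 hG EG K f c0 c0nz Gc0 dGc0.
have [i ci0] : exists i, c0 0 i != 0.
  apply: contrapT => /forallNP h; case/eqP: c0nz; apply/rowP => i.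
  by rewrite mxE; have /negP/negPn/eqP := h i.
pose c := (c0 0 i)^-1 *: c0.
have ci : c 0 i = 1 by rewrite mxE mulVf.
have Gc : ev f c G = 0 by rewrite (ev_homogZ _ _ _ hG) Gc0 mulr0.
have dGc j : ev f c (mderiv j G) = 0.
  by rewrite (ev_homogZ _ _ _ (mderiv_homog j hG)) dGc0 mulr0.
have [k1 [iota [x xgen]]] := generic_point K m.+1.
have xi : x i != 0.
  have := xgen 'X_i; rewrite mmapX mmap1U; apply.
  by rewrite -msupp_eq0 msuppX.
(* The line joins c to the generic point, so G is nonzero at T = 1; coordinate i stays equal to
   1. *)
pose y j := x j / x i - iota (c 0 j).
have yi : y i = 0 by rewrite /y ci rmorph1 divff // subrr.
pose f1 : {rmorphism k -> k1} := (iota \o f)%FUN.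
pose psi : {rmorphism k -> {poly k1}} := (polyC \o f1)%FUN.
pose h j : {poly k1} := (iota (c 0 j))%:P.
pose w j : {poly k1} := (y j)%:P * 'X.
pose g := mmap psi (fun j => h j + w j) G.
have g0 : g != 0.
  apply/negP => /eqP /(congr1 (horner_eval (1 : k1))) /eqP.
  rewrite rmorph0 /g rmorph_mmap.
  rewrite (_ : mmap _ _ G = (x i)^-1 ^+ d * mmap iota x (map_mpoly f G)).
    by rewrite mulf_eq0 expf_eq0 invr_eq0 (negPf xi) andbF (negPf (xgen _ _)) ?map_mpoly_eq0.
  rewrite mmap_map_mpoly -(mmap_homogZ _ _ _ hG).
  apply: eq_mmap => [a|j] /=; first by rewrite /horner_eval hornerC.
  by rewrite /horner_eval /h /w /y hornerD hornerM !hornerC hornerX mulr1 addrC subrK mulrC.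
have [Q [pi [_ pi0]]] := quotient_ring (trunc_is_ideal k1 2) (@trunc_ideal1 k1 2 isT).
have hE j : mmap psi h (mderiv j G) = 0.
  by rewrite -[RHS](rmorph0 (polyC \o iota)%FUN) -(dGc j) rmorph_mmap.
have hG0 : mmap psi h G = 0.
  by rewrite -[RHS](rmorph0 (polyC \o iota)%FUN) -Gc rmorph_mmap.
have X2g : trunc_ideal 2 g.
  apply/pi0; rewrite /g rmorph_mmap /=.
  rewrite (@eq_mmap _ _ _ _ (pi \o psi)%FUN _ (fun j => pi (h j) + pi (w j))) //; last first.
    by move=> j /=; rewrite rmorphD.
  rewrite mmap_taylor => [|a b]; last first.
    by rewrite -rmorphM; apply/pi0; exists ((y a)%:P * (y b)%:P); rewrite /w; ring.
  rewrite -(rmorph_mmap pi psi) hG0 rmorph0 add0r big1 // => j _.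
  by rewrite -(rmorph_mmap pi psi) hE rmorph0 mulr0.
have [e [q [gE q0]]] : exists e q, g = q * 'X^e /\ ~~ root q 0.
  have [e [q]] := multiplicity_XsubC g 0; rewrite g0 implyTb subr0 => q0 gE.
  by exists e, q.
have e2 : (1 < e)%N.
  rewrite ltnNge; apply/negP => e1; case: X2g => q'; rewrite gE.
  have -> : q' * 'X^2 = q' * 'X^(2 - e) * 'X^e.
    by rewrite -mulrA -exprD subnK // (leq_trans e1).
  move=> /(mulIf (expf_neq0 _ (negbT (polyX_eq0 _)))) qE.
  by move: q0; rewrite qE /root !hornerE expr0n subn_eq0 leqNgt ltnS e1 mulr0 eqxx.
have e0 : (0 < e)%N by apply: ltn_trans e2.
have [R [p [ps p0]]] := quotient_ring (trunc_is_ideal k1 e.+1) (@trunc_ideal1 k1 e.+1 isT).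
have [R' [p' [ps' p0']]] := quotient_ring (trunc_is_ideal k1 e) (trunc_ideal1 e0).
have [u uE] : exists u : {rmorphism R -> R'}, forall z, u (p z) = p' z.
  apply: rmorphism_factor => // z /p0 [b ->]; apply/p0'; exists (b * 'X).
  by rewrite -mulrA -exprS.
have keru z : u z = 0 -> exists b, z = p (b * 'X^e).
  by have [a <-] := ps z; rewrite uE => /p0' [b ->]; exists b.
pose f2 : {rmorphism k -> R} := (p \o psi)%FUN.
have [|z1 z2|||v [vi /(@EG _ f2) Gv uv]] := @smooth_over_lift A m E sE i R R' (f2 \o phi)%FUN u _ _
  (\row_j p' (h j + w j)).
- by move=> z; have [a <-] := ps' z; exists (p a); rewrite uE.
- move=> /keru [a ->] /keru [b ->]; rewrite -rmorphM; apply/p0.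
  exists (a * b * 'X^(e - 1)); rewrite mulrACA -[RHS]mulrA -!exprD; congr (_ * 'X^_).
  by rewrite subn1 addnS -addSn prednK.
- by rewrite mxE /w yi mul0r addr0 /h ci !rmorph1.
- suff /EG : ev (p' \o psi)%FUN (\row_j p' (h j + w j)) G = 0.
    move=> hv F FE; rewrite -(hv _ F FE); last first.
      by apply: (unimod_coord (i := i)); rewrite mxE /w yi mul0r addr0 /h ci !rmorph1.
    by apply: eq_mmap => // a /=; rewrite uE.
  rewrite -[RHS](_ : p' g = 0); last by apply/p0'; exists q.
  by rewrite /g rmorph_mmap; apply: eq_mmap => // j; rewrite mxE.
have /boolp.choice [b bE] : forall j, exists b, v 0 j = p (h j + w j) + p (b * 'X^e).
  move=> j; have [|b bE] := keru (v 0 j - p (h j + w j)).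
    by rewrite rmorphB uE; have /rowP/(_ j) := uv; rewrite !mxE => ->; rewrite subrr.
  by exists b; rewrite -bE addrC subrK.
have /Gv : unimod v by exact: unimod_coord vi.
rewrite (@eq_mmap _ _ _ _ f2 _ (fun j => p (h j + w j) + p (b j * 'X^e))) //.
rewrite mmap_taylor => [|j l]; last first.
  rewrite -rmorphM; apply/p0; exists (b j * b l * 'X^(e - 1)).
  rewrite mulrACA -[RHS]mulrA -!exprD; congr (_ * 'X^_).
  by rewrite subn1 addnS -addSn prednK.
rewrite -(rmorph_mmap p psi) -/g big1 ?addr0 => [|j _]; last first.
  rewrite -(rmorph_mmap p psi) -rmorphM; apply/p0.
  have [r ->] : exists r, mmap psi (fun j => h j + w j) (mderiv j G) = r * 'X.
    have /factor_theorem [r] : root (mmap psi (fun j => h j + w j) (mderiv j G)) 0.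
      rewrite /root -[_.[_]]/(horner_eval 0 _) rmorph_mmap -[X in _ == X](rmorph0 iota) -[X in _ == iota X](dGc j).
      rewrite rmorph_mmap; apply/eqP/eq_mmap => [a|l] /=; first by rewrite /horner_eval hornerC.
      by rewrite /horner_eval /h /w hornerD hornerM !hornerC hornerX mulr0 addr0.
    by rewrite subr0 => ->; exists r.
  by exists (b j * r); rewrite exprS; ring.
move=> /p0 [r]; rewrite gE exprS mulrA => /(mulIf (expf_neq0 _ (negbT (polyX_eq0 _)))) qE.
by move: q0; rewrite qE /root !hornerE ?mulr0 eqxx.
Qed.

(** * The Fano range *)

Lemma comp_dhomog (A : comNzRingType) n l (F : {mpoly A[n]}) d e (t : n.-tuple {mpoly A[l]}) :
  F \is d.-homog -> (forall i, tnth t i \is e.-homog) -> F \mPo t \is (e * d)%N.-homog.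
Proof.
move=> hF ht; rewrite comp_mpolyEX big_seq rpred_sum // => m' mF; rewrite dhomogZ //.
rewrite comp_mpolyX -(dhomogP _ _ _ hF m' mF) /= mdegE.
elim/big_rec2: _ => [|i d' p _ hp]; first by rewrite muln0; exact: dhomog1.
by rewrite mulnDr dhomogM //; exact: dhomogMn.
Qed.

(** * Tensor powers of a line as an embedding *)

Section TensorPower.
Variables (m D : nat).
Local Notation W := {ffun 'I_D.+1 -> 'I_m.+1}.

(** Coordinates on the (D+1)-st tensor power are indexed by all words of D + 1 letters, not by
    monomials: symmetry becomes part of the equations of the image, and no multinomial coefficients
    occur, whatever the characteristic. *)
Definition tdim := #|{: W}|.-1.

Lemma tdimE : #|{: W}| = tdim.+1.
Proof. by rewrite prednK //; apply/card_gt0P; exists [ffun=> ord0]. Qed.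

Definition ix (w : W) : 'I_tdim.+1 := cast_ord tdimE (enum_rank w).
Definition wd (i : 'I_tdim.+1) : W := enum_val (cast_ord (esym tdimE) i).

Lemma ixK : cancel ix wd.
Proof. by move=> w; rewrite /wd /ix cast_ordK enum_rankK. Qed.

Lemma wdK : cancel wd ix.
Proof. by move=> i; rewrite /wd /ix enum_valK cast_ordKV. Qed.

Lemma sum_words (V : nmodType) (F : 'I_tdim.+1 -> V) : \sum_i F i = \sum_w F (ix w).
Proof. by apply: reindex; exists wd => ? _; [exact: ixK | exact: wdK]. Qed.

Definition upd (w : W) k a : W := [ffun j => if j == k then a else w j].

Lemma upd_id w k : upd w k (w k) = w.
Proof. by apply/ffunP => j; rewrite ffunE; case: eqP => [->|]. Qed.

Lemma updd w k a b : upd (upd w k a) k b = upd w k b.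
Proof. by apply/ffunP => j; rewrite !ffunE; case: eqP. Qed.

Lemma upd_at w k a : upd w k a k = a.
Proof. by rewrite ffunE eqxx. Qed.

Lemma prod_upd (R : comNzRingType) (f : 'I_D.+1 -> 'I_m.+1 -> R) w k a :
  \prod_j f j (upd w k a j) = f k a * \prod_(j | j != k) f j (w j).
Proof.
rewrite (bigD1 k) //= upd_at; congr (_ * _).
by apply: eq_bigr => j /negPf jk; rewrite ffunE jk.
Qed.

Section Matrices.
Variable R : comNzRingType.
Implicit Types P Q : 'M[R]_m.+1.

Definition tens P : 'M[R]_tdim.+1 := \matrix_(i, j) \prod_k P (wd i k) (wd j k).

Lemma tensE P w w' : tens P (ix w) (ix w') = \prod_k P (w k) (w' k).
Proof. by rewrite mxE !ixK. Qed.

Lemma tensM P Q : tens (P *m Q) = tens P *m tens Q.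
Proof.
apply/matrixP => i j; rewrite -[i]wdK -[j]wdK !mxE sum_words.
under [RHS]eq_bigr => w _ do rewrite !tensE -big_split /=.
rewrite -(bigA_distr_bigA (fun k a => P (wd i k) a * Q a (wd j k))) !wdK.
by apply: eq_bigr => k _; rewrite mxE.
Qed.

Lemma tens_rk1 P : rk1 P -> rk1 (tens P).
Proof.
move=> [t1 Pm]; split.
  rewrite /mxtrace sum_words; under eq_bigr do rewrite tensE.
  rewrite -(bigA_distr_bigA (fun k a => P a a)) big1 // => k _; exact: t1.
move=> i j k l; rewrite !mxE -!big_split /=; apply: eq_bigr => a _; exact: Pm.
Qed.

Lemma tens_ptrace P a b :
  \sum_(w : W | w ord0 == a) tens P (ix w) (ix (upd w ord0 b)) = P a b * \tr P ^+ D.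
Proof.
pose G (k : 'I_D.+1) c := if k == ord0 then (c == a)%:R * P c b else P c c.
transitivity (\sum_(w : W) \prod_k G k (w k)).
  rewrite big_mkcond; apply: eq_bigr => w _; rewrite tensE.
  rewrite [RHS](bigD1 ord0) //= {1}/G eqxx (prod_upd (fun k c => P (w k) c)).
  have -> : \prod_(j | j != ord0) G j (w j) = \prod_(j | j != ord0) P (w j) (w j).
    by apply: eq_bigr => j /negPf j0; rewrite /G j0.
  by case: eqP => _; rewrite ?mul1r ?mul0r.
rewrite -(bigA_distr_bigA G) big_ord_recl /G eqxx; congr (_ * _).
  rewrite (bigD1 a) //= eqxx mul1r big1 ?addr0 // => c /negPf ->; exact: mul0r.
rewrite (eq_bigr (fun=> \tr P)) => [|k _]; last by [].
by rewrite prodr_const card_ord.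
Qed.

Lemma tens_span_inj P Q : rk1 P -> rk1 Q -> span (tens P) = span (tens Q) ->
  span P = span Q.
Proof.
move=> hP hQ /(rk1_span_eq (tens_rk1 hP) (tens_rk1 hQ)) E.
apply/(rk1_span_eq hP hQ); rewrite -tensM in E.
have PE : P = \tr (P *m Q) ^+ D *: (P *m Q).
  apply/matrixP => a b; rewrite mxE mulrC -tens_ptrace E tens_ptrace.
  by rewrite (proj1 hP) expr1n mulr1.
by rewrite {1}PE -scalemxAl -mulmxA (rk1_idem hQ) -PE.
Qed.

Lemma tens_span_eq P Q : rk1 P -> rk1 Q -> span P = span Q ->
  span (tens P) = span (tens Q).
Proof.
move=> hP hQ /(rk1_span_eq hP hQ) E.
by apply/(rk1_span_eq (tens_rk1 hP) (tens_rk1 hQ)); rewrite -tensM E.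
Qed.

End Matrices.

Lemma tens_map (R S : comNzRingType) (f : {rmorphism R -> S}) (P : 'M[R]_m.+1) :
  map_mx f (tens P) = tens (map_mx f P).
Proof.
apply/matrixP => i j; rewrite !mxE rmorph_prod.
by apply: eq_bigr => k _; rewrite mxE.
Qed.

Section Equations.
Variable A : comNzRingType.
Variable E : seq {mpoly A[m.+1]}.
Hypothesis hE : homogeneous_eqns E.

Local Notation X w := ('X_(ix w) : {mpoly A[tdim.+1]}).

(** The exchange of the first letter of w with letter k of w', a relation satisfied by the tensor
    powers of a vector: k = 0 is a Segre relation, and the other k also force symmetry. *)
Definition swap_eqn (w w' : W) (k : 'I_D.+1) : {mpoly A[tdim.+1]} :=
  X w * X w' - X (upd w ord0 (w' k)) * X (upd w' k (w ord0)).

Definition contr_eqn (F : {mpoly A[m.+1]}) (w : W) : {mpoly A[tdim.+1]} :=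
  F \mPo [tuple X (upd w ord0 b) | b < m.+1].

Definition tens_eqns : seq {mpoly A[tdim.+1]} :=
  [seq swap_eqn x.1.1 x.1.2 x.2 | x <- enum {: W * W * 'I_D.+1}] ++
  [seq contr_eqn F w | F <- E, w <- enum {: W}].

Lemma homogX n (i : 'I_n) : ('X_i : {mpoly A[n]}) \is 1.-homog.
Proof. by rewrite dhomogX /= mdeg1. Qed.

Lemma swap_homog w w' k : swap_eqn w w' k \is 2.-homog.
Proof. by rewrite rpredB // -[2%N]/(1 + 1)%N dhomogM ?homogX. Qed.

Lemma tens_eqns_homog : homogeneous_eqns tens_eqns.
Proof.
move=> G; rewrite mem_cat => /orP[/mapP [x _ ->]|/allpairsP [[F w] /= [FE _ ->]]].
  by exists 2%N; apply: swap_homog.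
have [d hF] := hE FE; exists d; rewrite -[d]mul1n; apply: comp_dhomog => // i.
by rewrite tnth_mktuple homogX.
Qed.

Section Vanish.
Variables (R : comNzRingType) (phi : {rmorphism A -> R}) (z : 'rV[R]_tdim.+1).

Lemma tens_eqnsP : vanish phi tens_eqns z <->
  (forall w w' k, z 0 (ix w) * z 0 (ix w') =
     z 0 (ix (upd w ord0 (w' k))) * z 0 (ix (upd w' k (w ord0)))) /\
  (forall F, F \in E -> forall w, mmap phi (fun b => z 0 (ix (upd w ord0 b))) F = 0).
Proof.
have swE w w' k : ev phi z (swap_eqn w w' k) = z 0 (ix w) * z 0 (ix w') -
     z 0 (ix (upd w ord0 (w' k))) * z 0 (ix (upd w' k (w ord0))).
  by rewrite rmorphB !rmorphM /= !mmapX !mmap1U.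
have coE F w : ev phi z (contr_eqn F w) = mmap phi (fun b => z 0 (ix (upd w ord0 b))) F.
  rewrite mmap_comp_mpoly; apply: eq_mmap => // b.
  by rewrite tnth_mktuple mmapX mmap1U.
split=> [h|[h1 h2] G].
  split=> [w w' k|F FE w].
    apply/subr0_eq; rewrite -swE h // mem_cat; apply/orP; left.
    by apply/mapP; exists (w, w', k); rewrite ?mem_enum.
  rewrite -coE h // mem_cat; apply/orP; right.
  by apply/allpairsP; exists (F, w); rewrite mem_enum.
rewrite mem_cat => /orP[/mapP [x _ ->]|/allpairsP [[F w] /= [FE _ ->]]].
  by rewrite swE (h1 _ _ x.2) subrr.
by rewrite coE h2.
Qed.

End Vanish.

Section Locus.
Variables (R : comNzRingType) (phi : {rmorphism A -> R}).

Lemma tens_vanish (P : 'M[R]_m.+1) : rk1 P -> (forall v, span P v -> vanish phi E v) ->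
  forall z, span (tens P) z -> vanish phi tens_eqns z.
Proof.
move=> hP h z zP F FT; have [d hF] := tens_eqns_homog FT.
apply: (rk1_homog_vanish (tens_rk1 hP) hF) zP => i; exists 0%N; rewrite expr0 mul1r.
move: {d hF} F FT; apply/tens_eqnsP; rewrite -[i]wdK.
have rE w : row (ix (wd i)) (tens P) 0 (ix w) = \prod_k P (wd i k) (w k).
  by rewrite mxE tensE.
split=> [w w' k|F FE w].
  rewrite !rE !(prod_upd (fun j c => P (wd i j) c)).
  rewrite -{1}(upd_id w ord0) -{1}(upd_id w' k) !(prod_upd (fun j c => P (wd i j) c)).
  rewrite mulrACA (proj2 hP) mulrACA; congr (_ * _ * _).
rewrite (@eq_mmap _ _ _ phi phi _
  (fun b => (\prod_(j | j != ord0) P (wd i j) (w j)) * row (wd i ord0) P 0 b)) //; last first.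
  by move=> b; rewrite rE (prod_upd (fun j c => P (wd i j) c)) mulrC mxE.
have [d hF] := hE FE; rewrite (mmap_homogZ _ _ _ hF) h ?mulr0 //.
by apply/(spanP _ hP); rewrite -row_mul rk1_idem.
Qed.

Section Inverse.
Variable Q : 'M[R]_tdim.+1.
Hypotheses (hQ : rk1 Q) (QE : forall z, span Q z -> vanish phi tens_eqns z).

Let q w w' := Q (ix w) (ix w').

Definition ptrace : 'M[R]_m.+1 :=
  \matrix_(a, b) \sum_(w : W | w ord0 == a) Q (ix w) (ix (upd w ord0 b)).

Let rowQ u : vanish phi tens_eqns (row (ix u) Q).
Proof. by apply: QE; apply/(spanP _ hQ); rewrite -row_mul rk1_idem. Qed.

Let q_swap u w w' k :
  q u w * q u w' = q u (upd w ord0 (w' k)) * q u (upd w' k (w ord0)).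
Proof. by have /tens_eqnsP [/(_ w w' k) + _] := rowQ u; rewrite !mxE. Qed.

Let q_local x : (forall u, exists N, q u u ^+ N * x = 0) -> x = 0.
Proof. by move=> h; apply: (rk1_local hQ) => i; rewrite -[i]wdK; apply: h. Qed.

(** The quadrics hold on each row of Q. Since the rows are multiples of one of them wherever a
    diagonal entry is invertible, the quadrics also hold between two different rows. *)
Let q_polar u u' w w' k :
  q u w * q u' w' = q u (upd w ord0 (w' k)) * q u' (upd w' k (w ord0)).
Proof.
apply/subr0_eq/q_local => v; exists 2%N.
have E1 x x' : q v v ^+ 2 * (q u x * q u' x') = q u v * q u' v * (q v x * q v x').
  rewrite expr2; transitivity ((q u x * q v v) * (q u' x' * q v v)); first by ring.
  by rewrite /q (proj2 hQ) (proj2 hQ (ix u') _ _ _); ring.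
by rewrite mulrBr !E1 -mulrBr (q_swap v w w' k) subrr mulr0.
Qed.

(** Where q u u is invertible, the partial trace is a column times the row of entries at those words
    that differ from u in the first letter only. *)
Let ptraceE u a b :
  q u u * ptrace a b =
  (\sum_(w : W | w ord0 == a) q w (upd w ord0 (u ord0))) * q u (upd u ord0 b).
Proof.
rewrite mxE mulr_sumr mulr_suml; apply: eq_bigr => w _.
by rewrite -[LHS]/(q u u * q w (upd w ord0 b)) mulrC (q_polar w u _ u ord0) updd upd_at.
Qed.

Lemma ptrace_rk1 : rk1 ptrace.
Proof.
split.
  have [<- _] := hQ; rewrite /mxtrace sum_words.
  rewrite (partition_big (fun w : W => w ord0) predT) //=; apply: eq_bigr => a _.
  by rewrite mxE; apply: eq_bigr => w /eqP <-; rewrite upd_id.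
move=> a b c d; rewrite !mxE !mulr_suml; apply: eq_bigr => w _.
rewrite !mulr_sumr; apply: eq_bigr => w' _.
by rewrite -[LHS]/(q w _ * q w' _) (q_polar w w' (upd w ord0 b) (upd w' ord0 d) ord0) !updd !upd_at.
Qed.

Lemma ptrace_vanish v : span ptrace v -> vanish phi E v.
Proof.
move=> hv F FE; have [d hF] := hE FE.
apply: (rk1_homog_vanish ptrace_rk1 hF) hv => a; exists 0%N; rewrite expr0 mul1r.
apply: q_local => u; exists d; rewrite -(ev_homogZ _ _ _ hF).
rewrite (@eq_mmap _ _ _ phi phi _ (fun b =>
  (\sum_(w : W | w ord0 == a) q w (upd w ord0 (u ord0))) * q u (upd u ord0 b))) //.
  rewrite (mmap_homogZ _ _ _ hF).
  have /tens_eqnsP [_ /(_ _ FE u)] := rowQ u => E0.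
  rewrite (@eq_mmap _ _ _ phi phi _ (fun b => row (ix u) Q 0 (ix (upd u ord0 b)))) ?E0 ?mulr0 //.
  by move=> b; rewrite mxE.
by move=> b; rewrite -ptraceE !mxE.
Qed.

Let mix (u w : W) (s : seq 'I_D.+1) : W := [ffun k => if k \in s then w k else u k].

(** The letters of u are exchanged for those of w one at a time. This expresses the entry at w
    through entries at words that differ from u in the first letter only, so each row is a tensor
    power where q u u is invertible. *)
Let q_mix u (w : W) s : uniq s ->
  (\prod_(k <- s) q u (upd u ord0 (w k))) * q u u =
  (\prod_(k <- s) q u (upd u ord0 (u k))) * q u (mix u w s).
Proof.
elim: s => [_|k s IHs /= /andP [ks us]].
  by rewrite !big_nil !mul1r; congr (q _ _); apply/ffunP => k; rewrite ffunE.
rewrite !big_cons -!mulrA IHs // mulrCA [in RHS]mulrCA; congr (_ * _).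
rewrite (q_swap u _ (mix u w s) k) updd ffunE (negPf ks) upd_at; congr (_ * q _ _).
by apply/ffunP => j; rewrite !ffunE inE; case: eqP => [->|].
Qed.

Lemma tens_ptraceK : span (tens ptrace) = span Q.
Proof.
apply/(rk1_span_eq (tens_rk1 ptrace_rk1) hQ); apply/row_matrixP => i.
apply/rowP => j; apply/subr0_eq/q_local => u; exists (D.+1 + 1)%N.
have [C hC] : exists C, q u u ^+ (D.+1 + 1) *: row i (tens ptrace) = C *: row (ix u) Q.
  exists (\prod_k (\sum_(w : W | w ord0 == wd i k) q w (upd w ord0 (u ord0))) *
    \prod_(k <- enum 'I_D.+1) q u (upd u ord0 (u k))).
  apply/rowP => l; rewrite -[l]wdK !mxE exprD expr1 mulrAC.
  have -> : q u u ^+ D.+1 * \prod_k ptrace (wd i k) (wd (ix (wd l)) k) =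
      \prod_k (q u u * ptrace (wd i k) (wd l k)).
    by rewrite big_split /= prodr_const card_ord ixK.
  under eq_bigr do rewrite ptraceE.
  rewrite big_split /= -!mulrA; congr (_ * _).
  rewrite -[\prod_(k < D.+1) _]big_enum q_mix ?enum_uniq //=; congr (_ * q _ _).
  by apply/ffunP => k; rewrite ffunE mem_enum.
have -> : q u u ^+ (D.+1 + 1) * (row i (tens ptrace *m Q) 0 j - row i (tens ptrace) 0 j) =
    (q u u ^+ (D.+1 + 1) *: row i (tens ptrace) *m Q - q u u ^+ (D.+1 + 1) *: row i (tens ptrace)) 0 j.
  by rewrite -scalemxAl -row_mul -scalerBr !mxE.
by rewrite hC -scalemxAl -row_mul (rk1_idem hQ) subrr mxE.
Qed.

End Inverse.
End Locus.
End Equations.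
End TensorPower.

Lemma map_mpoly_idfun (A : comNzRingType) n (F : {mpoly A[n]}) : map_mpoly idfun F = F.
Proof. by apply/mpolyP => m; rewrite (mcoeff_map_mpoly _ m F). Qed.

Lemma hypersurface_fiber (A : comNzRingType) r n (E : seq {mpoly A[n.+2]})
    (k : fieldType) (phi : {rmorphism A -> k}) :
  smooth_hypersurface r E -> residue_field phi ->
  exists G : {mpoly k[n.+2]}, [/\ G != 0, G \is r.-homog, nonsing G &
    forall (R : comNzRingType) (psi : {rmorphism k -> R}) (v : 'rV[R]_n.+2), unimod v ->
      vanish (psi \o phi) E v <-> ev psi v G = 0].
Proof.
move=> [hE sE fE] res; have [G [G0 hG EG]] := fE k phi res.
have eqv (R : comNzRingType) (psi : {rmorphism k -> R}) (v : 'rV[R]_n.+2) : unimod v ->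
    vanish (psi \o phi) E v <-> ev psi v G = 0.
  move=> uv; have hphi : homogeneous_eqns [seq map_mpoly phi F | F <- E].
    move=> _ /mapP [F FE ->]; have [d /dhomogP hF] := hE F FE.
    exists d; apply/dhomogP => m'; rewrite mcoeff_msupp mcoeff_map_mpoly => h.
    by apply: hF; rewrite mcoeff_msupp; apply: contraNneq h => ->; apply/eqP/rmorph0.
  have hG' : homogeneous_eqns [:: G] by move=> F; rewrite inE => /eqP ->; exists r.
  have := same_subscheme_vanish hphi hG' EG psi uv.
  have -> : vanish psi [:: G] v <-> ev psi v G = 0.
    by split=> [h|h F]; [apply: h; rewrite inE | rewrite inE => /eqP ->].
  move=> <-; split=> h F.
    by move=> /mapP [F' FE ->]; rewrite mmap_map_mpoly h.
  by move=> FE; rewrite -mmap_map_mpoly h // map_f.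
exists G; split=> //; exact: smooth_over_nonsing sE G0 hG eqv.
Qed.

(** Over the dual numbers R[X]/(X^2), the vector v + X t is a point of E exactly if t is tangent; E
    and G have the same points over this ring as well. *)
Lemma tangent_liftP (A : comNzRingType) (R : comAlgType A) (m : nat)
    (E : seq {mpoly A[m.+1]}) (G : {mpoly A[m.+1]}) (v t : 'rV[R]_m.+1) :
  (forall (R : comNzRingType) (psi : {rmorphism A -> R}) (v : 'rV[R]_m.+1), unimod v ->
      vanish psi E v <-> ev psi v G = 0) ->
  unimod v -> vanish (in_alg R) E v ->
  tangent_lift E v t <-> \sum_j t 0 j * ev (in_alg R) v (mderiv j G) = 0.
Proof.
move=> EG [u vu] Ev.
have [Q [pi [_ pi0]]] := quotient_ring (trunc_is_ideal R 2) (@trunc_ideal1 R 2 isT).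
pose psi : {rmorphism A -> Q} := (pi \o (polyC \o in_alg R))%FUN.
pose w : 'rV[Q]_m.+1 := \row_j (pi (v 0 j)%:P + pi ((t 0 j)%:P * 'X)).
have wF F : ev psi w F = pi ((ev (in_alg R) v F)%:P +
    (\sum_j t 0 j * ev (in_alg R) v (mderiv j F))%:P * 'X).
  rewrite (@eq_mmap _ _ _ psi psi _ (fun j => pi (v 0 j)%:P + pi ((t 0 j)%:P * 'X))) //;
    last by move=> j; rewrite mxE.
  rewrite mmap_taylor => [|i j]; last first.
    by rewrite -rmorphM; apply/pi0; exists ((t 0 i)%:P * (t 0 j)%:P); ring.
  have E1 H : mmap psi (fun j => pi (v 0 j)%:P) H = pi (ev (in_alg R) v H)%:P.
    by rewrite (rmorph_mmap polyC) (rmorph_mmap pi).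
  rewrite rmorphD E1; congr (_ + _); rewrite rmorph_sum mulr_suml rmorph_sum.
  by apply: eq_bigr => j _; rewrite E1 -rmorphM; congr (pi _); rewrite /= polyCM mulrAC.
have w0 F : ev (in_alg R) v F = 0 ->
    ev psi w F = 0 <-> \sum_j t 0 j * ev (in_alg R) v (mderiv j F) = 0.
  move=> Fv; rewrite wF Fv polyC0 add0r pi0 trunc_idealP; split=> [/(_ 1%N isT)|->].
    by rewrite coefMX coefC.
  by move=> i _; rewrite polyC0 mul0r coef0.
have uw : unimod w.
  pose x := (t *m u) 0 0; exists (map_mx (pi \o (fun a => a%:P * (1 - x%:P * 'X))) u).
  rewrite [LHS]mx11_scalar; congr (_%:M); rewrite mxE.
  have sE : \sum_j ((v 0 j)%:P + (t 0 j)%:P * 'X) * (u j 0)%:P = 1 + x%:P * 'X.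
    have -> : 1 = ((v *m u) 0 0)%:P :> {poly R} by rewrite vu mxE eqxx.
    rewrite /x !mxE !raddf_sum mulr_suml -big_split /=.
    by apply: eq_bigr => j _; rewrite !polyCM; ring.
  transitivity (pi ((1 + x%:P * 'X) * (1 - x%:P * 'X))).
    rewrite -sE mulr_suml rmorph_sum; apply: eq_bigr => j _.
    by rewrite !mxE /= -rmorphD -rmorphM mulrA.
  apply/subr0_eq; rewrite -[X in _ - X](rmorph1 pi) -rmorphB; apply/pi0.
  by exists (- (x%:P * x%:P)); ring.
rewrite -w0; last by apply/EG => //; exists u.
rewrite -EG //; split=> h F FE; first by apply/w0; [exact: Ev|rewrite -[RHS](h F FE); apply: eq_bigr => j _; rewrite mulrC].
have /w0 := h F FE; move=> /(_ (Ev F FE)) E0; rewrite -[RHS]E0.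
by apply: eq_bigr => j _; rewrite mulrC.
Qed.

(** * Frames and the anticanonical bundle *)

Section Frame.
Variables (R : comNzRingType) (n : nat).
Implicit Types (v w : 'rV[R]_n.+2) (t : 'I_n -> 'rV[R]_n.+2).

(** Rows v, the n vectors t b, and w. With w dual to the gradient of G, the determinant is the
    residue of the volume form along G = 0. *)
Definition frame v t w : 'M[R]_n.+2 :=
  \matrix_i (if unlift ord0 i is Some i' then
               (if unlift ord_max i' is Some b then t b else w) else v).

Lemma row_frame0 v t w : row ord0 (frame v t w) = v.
Proof. by rewrite rowK unlift_none. Qed.

Lemma row_frame_max v t w : row (lift ord0 ord_max) (frame v t w) = w.
Proof. by rewrite rowK liftK unlift_none. Qed.

Lemma row_frame v t w b : row (lift ord0 (lift ord_max b)) (frame v t w) = t b.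
Proof. by rewrite rowK !liftK. Qed.

Lemma frame_ind (P : 'I_n.+2 -> Prop) : P ord0 -> P (lift ord0 ord_max) ->
  (forall b, P (lift ord0 (lift ord_max b))) -> forall i, P i.
Proof.
move=> h0 h1 hb i; have [i' ->|->//] := unliftP ord0 i.
by have [b ->|->] := unliftP ord_max i'.
Qed.

Lemma sum_frame (V : nmodType) (f : 'I_n.+2 -> V) :
  \sum_i f i = f ord0 + (\sum_b f (lift ord0 (lift ord_max b)) + f (lift ord0 ord_max)).
Proof.
rewrite big_ord_recl big_ord_recr /=; congr (_ + (_ + _)).
by apply: eq_bigr => b _; congr (f (lift ord0 _)); apply: val_inj; rewrite /= /bump [(n <= b)%N]leqNgt ltn_ord.
Qed.

Lemma frame_mulmx v t w (g : 'cV[R]_n.+2) :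
  v *m g = 0 -> (forall b, t b *m g = 0) -> w *m g = 0 -> frame v t w *m g = 0.
Proof.
move=> hv ht hw; apply/row_matrixP; elim/frame_ind => [||b];
  by rewrite row_mul ?row_frame0 ?row_frame_max ?row_frame row0.
Qed.

(** All rows are orthogonal to g, so multiplication by the adjugate shows that the determinant kills
    g; and w1 pairs with g to 1. *)
Lemma det_frame_kernel v t w (g : 'cV[R]_n.+2) w1 : w1 *m g = 1%:M ->
  v *m g = 0 -> (forall b, t b *m g = 0) -> w *m g = 0 -> \det (frame v t w) = 0.
Proof.
move=> w1g hv ht hw; have /(congr1 (mulmx (\adj (frame v t w)))) := frame_mulmx hv ht hw.
rewrite mulmxA mul_adj_mx mulmx0 mul_scalar_mx => /(congr1 (mulmx w1)).
rewrite -scalemxAr w1g mulmx0 => /matrixP /(_ 0 0).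
by rewrite !mxE mulr1.
Qed.

Lemma det_row_linear N (B C M : 'M[R]_N) i c :
  row i M = c *: row i B + row i C ->
  (forall i', i' != i -> row i' M = row i' B /\ row i' M = row i' C) ->
  \det M = c * \det B + \det C.
Proof.
move=> E h; rewrite -[\det C]mul1r.
have h' (M' : 'M[R]_N) : (forall i', i' != i -> row i' M = row i' M') -> row' i M' = row' i M.
  move=> e; apply/matrixP => a b; rewrite !mxE.
  have ne : lift i a != i by rewrite eq_sym neq_lift.
  by have /rowP/(_ b) := e _ ne; rewrite !mxE.
by apply: (determinant_multilinear (i0 := i)); rewrite ?scale1r //; apply: h' => i' /h [].
Qed.

Lemma det_frame_linear v t w w' c :
  \det (frame v t (c *: w + w')) = c * \det (frame v t w) + \det (frame v t w').
Proof.
apply: (det_row_linear (i := lift ord0 ord_max)); first by rewrite !row_frame_max.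
by elim/frame_ind => [||b]; rewrite ?eqxx // ?row_frame0 ?row_frame.
Qed.

Lemma det_frame_tlinear v t t' t'' w b c : t b = c *: t' b + t'' b ->
  (forall b', b' != b -> t b' = t' b' /\ t b' = t'' b') ->
  \det (frame v t w) = c * \det (frame v t' w) + \det (frame v t'' w).
Proof.
move=> tb h; apply: (det_row_linear (i := lift ord0 (lift ord_max b))).
  by rewrite !row_frame.
elim/frame_ind => [||b']; rewrite ?row_frame0 ?row_frame_max ?row_frame // => ne.
by apply: h; apply: contraNneq ne => ->.
Qed.

Lemma det_frame_alt v t w b : t b = v \/ (exists2 b', b' != b & t b = t b') ->
  \det (frame v t w) = 0.
Proof.
case=> [tb|[b' ne tb]].
  apply: (determinant_alternate (i1 := ord0) (i2 := lift ord0 (lift ord_max b))) => // j.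
  have /rowP/(_ j) := row_frame v t w b; have /rowP/(_ j) := row_frame0 v t w.
  by rewrite tb [in X in X -> _]mxE => -> ; rewrite mxE => ->.
apply: (determinant_alternate (i1 := lift ord0 (lift ord_max b))
  (i2 := lift ord0 (lift ord_max b'))) => [|j].
  by rewrite !(inj_eq lift_inj) eq_sym.
have /rowP/(_ j) := row_frame v t w b; have /rowP/(_ j) := row_frame v t w b'.
by rewrite tb [in X in X -> _]mxE => ->; rewrite mxE => ->.
Qed.

Lemma det_frameZ v t w c e :
  \det (frame (c *: v) (fun b => c *: t b) (e *: w)) = c ^+ n.+1 * e * \det (frame v t w).
Proof.
pose d : 'rV[R]_n.+2 := \row_i (if i == lift ord0 ord_max then e else c).
have -> : frame (c *: v) (fun b => c *: t b) (e *: w) = diag_mx d *m frame v t w.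
  apply/row_matrixP; elim/frame_ind => [||b]; rewrite row_mul row_diag_mx -scalemxAl -rowE mxE.
  - by rewrite !row_frame0.
  - by rewrite !row_frame_max eqxx.
  by rewrite !row_frame (inj_eq lift_inj) eq_sym (negPf (neq_lift _ _)).
rewrite det_mulmx det_diag big_ord_recl big_ord_recr !mxE /= eqxx; congr (_ * _).
rewrite (eq_bigr (fun=> c)) => [|b _]; last first.
  rewrite mxE; case: eqP => // /lift_inj /eqP.
  by rewrite -(inj_eq val_inj) /= ltn_eqF // ltn_ord.
by rewrite prodr_const card_ord mulrA -exprS.
Qed.

End Frame.

Lemma det_frame_map (R S : comNzRingType) (f : {rmorphism R -> S}) n
    (v w : 'rV[R]_n.+2) (t : 'I_n -> 'rV[R]_n.+2) :
  \det (frame (map_mx f v) (fun b => map_mx f (t b)) (map_mx f w)) =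
  f (\det (frame v t w)).
Proof.
rewrite -det_map_mx; congr (\det _); apply/row_matrixP.
by elim/frame_ind => [||b]; rewrite -map_row ?row_frame0 ?row_frame_max ?row_frame.
Qed.

Lemma frame_field_neq0 (K : fieldType) n (v w g : 'rV[K]_n.+2) :
  v != 0 -> v *m g^T = 0 -> w *m g^T = 1%:M ->
  exists J : 'I_n -> 'I_n.+2,
    \det (frame v (fun b => delta_mx 0 (J b) - g 0 (J b) *: w) w) != 0.
Proof.
move=> v0 vg wg; have [a va] : exists a, v 0 a != 0.
  by apply: contrapT => /forallNP h; case/eqP: v0; apply/rowP => a;
     rewrite mxE; have /negP/negPn/eqP := h a.
(* v and w are independent because g separates them. The two coordinates of a nonzero minor, a and
   [lift a b], are left out, and J runs over the other n. *)
have [b ab] : exists b, v 0 a * w 0 (lift a b) - v 0 (lift a b) * w 0 a != 0.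
  apply: contrapT => /forallNP h.
  have E : v 0 a *: w = w 0 a *: v.
    apply/rowP => j; rewrite !mxE; have [j' ->|->] := unliftP a j; last by rewrite mulrC.
    by have /negP/negPn := h j'; rewrite subr_eq0 => /eqP ->; rewrite mulrC.
  have := congr1 (fun x => (x *m g^T) 0 0) E.
  by rewrite -!scalemxAl wg vg !mxE mulr1 mulr0 => /eqP; rewrite (negPf va).
exists (fun k => lift a (lift b k)); rewrite -unitfE -unitmxE -row_free_unit.
apply/row_freeP; apply: contrapT => nf; set F := frame _ _ _ in nf.
have {nf} : ~~ row_free F by apply/negP => /row_freeP.
rewrite -kermx_eq0 => /rowV0Pn [x /sub_kermxP xF x0].
pose J k := lift a (lift b k); pose xt k := x 0 (lift ord0 (lift ord_max k)).
pose y := x 0 (lift ord0 ord_max) - \sum_k xt k * g 0 (J k).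
have xE : x 0 ord0 *: v + \sum_k xt k *: delta_mx 0 (J k) + y *: w = 0.
  rewrite -[RHS]xF mulmx_sum_row sum_frame row_frame0 row_frame_max -addrA; congr (_ + _).
  rewrite /y scalerBl addrA addrAC; congr (_ + _); rewrite scaler_suml -sumrB.
  by apply: eq_bigr => k _; rewrite row_frame scalerBr scalerA.
have xj j : (forall k, j != J k) -> x 0 ord0 * v 0 j + y * w 0 j = 0.
  move=> jJ; have /rowP/(_ j) := xE; rewrite !mxE summxE big1 ?addr0 // => k _.
  by rewrite !mxE (negPf (jJ k)) andbF mulr0.
have xa := xj a (fun k => neq_lift _ _).
have xb : x 0 ord0 * v 0 (lift a b) + y * w 0 (lift a b) = 0.
  by apply: xj => k; rewrite (inj_eq lift_inj) neq_lift.
have x00 : x 0 ord0 = 0.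
  apply: (mulIf ab); rewrite mul0r.
  transitivity ((x 0 ord0 * v 0 a + y * w 0 a) * w 0 (lift a b) -
    (x 0 ord0 * v 0 (lift a b) + y * w 0 (lift a b)) * w 0 a); first by ring.
  by rewrite xa xb !mul0r subrr.
have y0 : y = 0.
  apply: (mulIf ab); rewrite mul0r.
  transitivity ((x 0 ord0 * v 0 (lift a b) + y * w 0 (lift a b)) * v 0 a -
    (x 0 ord0 * v 0 a + y * w 0 a) * v 0 (lift a b)); first by ring.
  by rewrite xa xb !mul0r subrr.
have xt0 k : xt k = 0.
  have /rowP/(_ (J k)) := xE; rewrite x00 y0 !scale0r add0r addr0 summxE (bigD1 k) //=.
  rewrite !mxE !eqxx mulr1 big1 ?addr0 // => l lk.
  by rewrite !mxE !(inj_eq lift_inj) eq_sym (negPf lk) andbF mulr0.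
case/eqP: x0; apply/rowP; elim/frame_ind => [||k]; rewrite [RHS]mxE //; last exact: xt0.
by move: y0; rewrite /y big1 ?subr0 // => k _; rewrite xt0 mul0r.
Qed.

Section TensorVector.
Variables (m D : nat).
Local Notation W := {ffun 'I_D.+1 -> 'I_m.+1}.

Definition tvec (R : comNzRingType) (v : 'rV[R]_m.+1) : 'rV[R]_(tdim m D).+1 :=
  \row_j \prod_k v 0 (wd j k).

Lemma tvec_outer (R : comNzRingType) (v : 'rV[R]_m.+1) (u : 'cV[R]_m.+1) :
  tens D (u *m v) = (tvec u^T)^T *m tvec v.
Proof.
apply/matrixP => i j; rewrite !mxE big_ord1 !mxE -big_split /=.
by apply: eq_bigr => k _; rewrite !mxE big_ord1.
Qed.

Lemma tvec_unimod (R : comNzRingType) (v : 'rV[R]_m.+1) (u : 'cV[R]_m.+1) :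
  v *m u = 1%:M -> tvec v *m (tvec u^T)^T = 1%:M.
Proof.
move=> vu; rewrite [LHS]mx11_scalar; congr (_%:M); rewrite mxE sum_words.
transitivity (\sum_(w : W) \prod_k (v 0 (w k) * u (w k) 0)).
  apply: eq_bigr => w _; rewrite !mxE ixK -big_split /=.
  by apply: eq_bigr => k _; rewrite mxE.
rewrite -(bigA_distr_bigA (fun k a => v 0 a * u a 0)) big1 // => k _.
by have /matrixP/(_ 0 0) := vu; rewrite !mxE eqxx.
Qed.

Lemma tvecZ (R : comNzRingType) (c : R) v : tvec (c *: v) = c ^+ D.+1 *: tvec v.
Proof.
apply/rowP => j; rewrite !mxE.
under eq_bigr do rewrite mxE.
by rewrite big_split prodr_const card_ord.
Qed.

Lemma tvec_map (R S : comNzRingType) (f : {rmorphism R -> S}) v :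
  map_mx f (tvec v) = tvec (map_mx f v).
Proof.
apply/rowP => j; rewrite !mxE rmorph_prod.
by apply: eq_bigr => k _; rewrite mxE.
Qed.

End TensorVector.

Section Fano.
Variables (k : fieldType) (r n D : nat) (E : seq {mpoly k[n.+2]}).
Hypotheses (rD : (D + r = n.+1)%N) (r0 : (0 < r)%N) (smE : smooth_hypersurface r E).

Let hE : homogeneous_eqns E. Proof. by case: smE. Qed.

Definition tsigma (R : comAlgType k) (L : set 'rV[R]_n.+2) :
    set 'rV[R]_(tdim n.+1 D).+1 :=
  [set l | exists P, [/\ rk1 P, L = span P & span (tens D P) l]].

Lemma tsigma_span (R : comAlgType k) (P : 'M[R]_n.+2) : rk1 P ->
  tsigma (span P) = span (tens D P).
Proof.
move=> hP; apply/seteqP; split=> l; last by exists P.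
by move=> [Q [hQ PQ]]; rewrite (tens_span_eq D hQ hP).
Qed.

Lemma zero_locus_span (A : comNzRingType) m (F : seq {mpoly A[m.+1]}) (R : comAlgType A) (L : set 'rV[R]_m.+1) :
  zero_locus F R L <->
  exists P, [/\ rk1 P, L = span P & forall v, span P v -> vanish (in_alg R) F v].
Proof.
split=> [[/proj_spaceP [P [hP ->]] h]|[P [hP -> h]]].
  by exists P; split=> // v Pv G GF; apply: h.
split; first by apply/proj_spaceP; exists P.
by move=> G GF v Pv; apply: h.
Qed.

Lemma tsigma_iso : scheme_iso E (tens_eqns D E) tsigma.
Proof.
split=> [R|R R' f L /zero_locus_span [P [hP -> _]]]; last first.
  rewrite base_change_span // tsigma_span; last exact: rk1_map.
  by rewrite tsigma_span // base_change_span ?tens_map //; apply: tens_rk1.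
split.
- move=> L /zero_locus_span [P [hP -> PE]]; rewrite tsigma_span //.
  apply/zero_locus_span; exists (tens D P); split=> //; first exact: tens_rk1.
  exact: tens_vanish.
- move=> L L' /set_mem /zero_locus_span [P [hP -> _]] /set_mem /zero_locus_span [Q [hQ -> _]].
  by rewrite !tsigma_span //; apply: tens_span_inj.
move=> L' /zero_locus_span [Q [hQ -> QE]].
have hpt := ptrace_rk1 hQ QE.
exists (span (ptrace Q)); last by rewrite tsigma_span // (tens_ptraceK hQ QE).
apply/zero_locus_span; exists (ptrace Q); split=> //.
by apply: (ptrace_vanish hE hQ QE).
Qed.

Let idres : residue_field (idfun : {rmorphism k -> k}).
Proof. by move=> z; exists z, 1; rewrite oner_neq0 divr1. Qed.

Let G := projT1 (cid (hypersurface_fiber smE idres)).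

Let hG : G \is r.-homog. Proof. by rewrite /G; case: cid => ? []. Qed.
Let nsG : nonsing G. Proof. by rewrite /G; case: cid => ? []. Qed.
Let EG (R : comNzRingType) (psi : {rmorphism k -> R}) (v : 'rV[R]_n.+2) : unimod v ->
  vanish psi E v <-> ev psi v G = 0.
Proof.
by rewrite /G; case: cid => H [_ _ _ EH] /= uv; rewrite -EH.
Qed.

Definition grad (R : comAlgType k) (v : 'rV[R]_n.+2) : 'cV[R]_n.+2 :=
  \col_j ev (in_alg R) v (mderiv j G).

Let mul_grad (R : comAlgType k) (v w : 'rV[R]_n.+2) :
  w *m grad v = (\sum_j w 0 j * ev (in_alg R) v (mderiv j G))%:M.
Proof.
rewrite [LHS]mx11_scalar; congr (_%:M); rewrite mxE.
by apply: eq_bigr => j _; rewrite mxE.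
Qed.

Let gradZ (R : comAlgType k) (v : 'rV[R]_n.+2) c : grad (c *: v) = c ^+ r.-1 *: grad v.
Proof. by apply/colP => j; rewrite !mxE (ev_homogZ _ _ _ (mderiv_homog j hG)). Qed.

Let grad_map (R R' : comAlgType k) (f : {lrmorphism R -> R'}) (v : 'rV[R]_n.+2) :
  map_mx f (grad v) = grad (map_mx f v).
Proof.
apply/colP => j; rewrite !mxE rmorph_mmap; apply: eq_mmap => [a|i] /=.
  by rewrite linearZ rmorph1.
by rewrite mxE.
Qed.

(* The value does not depend on w: the difference of two choices lies, together with v and the t b,
   in the kernel of the gradient, so these n + 2 vectors are dependent. *)
Definition ttheta (R : comAlgType k) (v : 'rV[R]_n.+2)
    (t : 'I_1 -> 'I_n -> 'rV[R]_n.+2) (l : 'rV[R]_(tdim n.+1 D).+1) : R :=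
  xget 0 [set y | exists a w, [/\ l = a *: tvec D v, w *m grad v = 1%:M &
    y = a * \det (frame v (t ord0) w)]].

Section AtPoint.
Variables (R : comAlgType k) (v : 'rV[R]_n.+2).
Hypothesis uv : unimod v.

Lemma tthetaE (t : 'I_1 -> 'I_n -> 'rV[R]_n.+2) a w :
  v *m grad v = 0 -> (forall b, t ord0 b *m grad v = 0) -> w *m grad v = 1%:M ->
  ttheta v t (a *: tvec D v) = a * \det (frame v (t ord0) w).
Proof.
move=> hv ht hw; rewrite /ttheta; case: xgetP => [y _ [a' [w' [aE hw' ->]]]|/(_ (a * \det (frame v (t ord0) w)))]; last first.
  by case; exists a, w.
have [u vu] := uv; have tu := tvec_unimod D vu.
have -> : a' = a.
  have /(congr1 (mulmx^~ (tvec D u^T)^T)) := aE.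
  rewrite -!scalemxAl tu => /matrixP /(_ 0 0).
  by rewrite !mxE !mulr1.
congr (_ * _); have := det_frame_linear v (t ord0) w (w' - w) 1.
rewrite scale1r addrC subrK mul1r => ->.
by rewrite [X in _ + X](det_frame_kernel hw) ?addr0 // mulmxBl hw hw' subrr.
Qed.

Hypothesis Ev : vanish (in_alg R) E v.

Lemma grad_self : v *m grad v = 0.
Proof.
rewrite mul_grad; have /EG Gv := Ev; rewrite -scalemx1.
suff -> : \sum_j v 0 j * ev (in_alg R) v (mderiv j G) = 0 by rewrite scale0r.
have /(congr1 (mmap (in_alg R) (v 0))) := euler_homog hG.
rewrite rmorphM /= Gv // mulr0 rmorph_sum /= => E0; rewrite -[RHS]E0.
by apply: eq_bigr => j _; rewrite rmorphM /= mmapX mmap1U.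
Qed.

Lemma grad_tangent t : tangent_lift E v t <-> t *m grad v = 0.
Proof.
rewrite (tangent_liftP _ EG uv Ev) mul_grad; split=> [->|]; first by rewrite -scalemx1 scale0r.
by move=> /matrixP /(_ 0 0); rewrite !mxE mulr1n.
Qed.

Lemma grad_dual : exists w : 'rV[R]_n.+2, w *m grad v = 1%:M.
Proof.
have /EG Gv := Ev; have [w hw] := nonsing_gradient nsG uv (Gv uv).
exists (\row_j w j); rewrite mul_grad -[in RHS]hw; congr (_%:M).
by apply: eq_bigr => j _; rewrite mxE.
Qed.

Lemma tsigma_line l : tsigma (line_through v) l <-> exists a, l = a *: tvec D v.
Proof.
have [u vu] := uv; rewrite -(span_outer vu) tsigma_span; last exact: rk1_outer.
rewrite tvec_outer span_outer ?tvec_unimod //.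
by split=> [[a _ <-]|[a ->]]; exists a.
Qed.

(** Projection along w moves the standard basis into the tangent space. At each field-valued point
    some n of the projected vectors complete v and w to a basis, so the determinants generate the
    unit ideal. *)
Lemma ttheta_surj : exists (s : nat) (c : 'I_s -> R)
    (t : 'I_s -> 'I_1 -> 'I_n -> 'rV[R]_n.+2) (l : 'I_s -> 'rV[R]_(tdim n.+1 D).+1),
  (forall i, [/\ zero_locus E R (line_through v),
     forall a b, tangent_lift E v (t i a b) & tsigma (line_through v) (l i)]) /\
  \sum_(i < s) c i * ttheta v (t i) (l i) = 1.
Proof.
have [w hw] := grad_dual.
pose T := {ffun 'I_n -> 'I_n.+2}.
pose t (J : T) (a : 'I_1) b : 'rV[R]_n.+2 :=
  delta_mx 0 (J b) - ((delta_mx 0 (J b) : 'rV_n.+2) *m grad v) 0 0 *: w.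
have ht J a b : t J a b *m grad v = 0.
  rewrite mulmxBl -scalemxAl hw scalemx1 [X in X - _]mx11_scalar; exact: subrr.
have [c hc] : [set y | exists c : T -> R, y = \sum_J c J * \det (frame v (t J ord0) w)] 1.
  apply: unit_ideal => [|K phi].
    split=> [|_ _ [a ->] [b ->]|a _ [b ->]].
    - by exists (fun=> 0); rewrite big1 // => j _; rewrite mul0r.
    - exists (fun j => a j + b j); rewrite -big_split /=.
      by apply: eq_bigr => j _; rewrite mulrDl.
    - exists (fun j => a * b j); rewrite mulr_sumr.
      by apply: eq_bigr => j _; rewrite mulrA.
  have [||| J hJ] := @frame_field_neq0 K n (map_mx phi v) (map_mx phi w) (map_mx phi (grad v))^T.
  - have [u /(congr1 (map_mx phi))] := uv; rewrite map_mxM map_mx1.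
    move=> h; apply/negP => /eqP v0; move: h; rewrite v0 mul0mx => /matrixP /(_ 0 0) /eqP.
    by rewrite !mxE eqxx eq_sym oner_eq0.
  - by rewrite trmxK -map_mxM grad_self map_mx0.
  - by rewrite trmxK -map_mxM hw map_mx1.
  exists (\det (frame v (t [ffun b => J b] ord0) w)).
    exists (fun I => (I == [ffun b => J b])%:R).
    rewrite (bigD1 [ffun b => J b]) //= eqxx mul1r big1 ?addr0 // => I /negPf ->.
    by rewrite mul0r.
  rewrite -det_frame_map; apply: contraNneq hJ => <-; apply/eqP; congr (\det (frame _ _ _)).
  apply: funext => b; rewrite /t ffunE map_mxB map_mxZ map_delta_mx; congr (_ - _ *: _).
  by rewrite -rowE !mxE.
exists #|{: T}|, (fun i => c (enum_val i)), (fun i => t (enum_val i)), (fun=> 1 *: tvec D v).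
split=> [i|].
  split; first by apply/zero_locus_line.
    by move=> a b; apply/grad_tangent.
  by apply/tsigma_line; exists 1.
rewrite [RHS]hc [RHS](reindex (enum_val (A := {: T}))) /=; last first.
  by exists enum_rank => ? _; [exact: enum_valK | exact: enum_rankK].
by apply: eq_bigr => i _; rewrite (tthetaE _ grad_self (ht _ _) hw) mul1r.
Qed.

End AtPoint.

Lemma ttheta_iso : @anticanonical_power_iso k n.+1 n (tdim n.+1 D) 1 E tsigma ttheta.
Proof.
have domE (R : comAlgType k) (v : 'rV[R]_n.+2) (t : 'I_1 -> 'I_n -> 'rV[R]_n.+2) l :
    [/\ zero_locus E R (line_through v), forall a b, tangent_lift E v (t a b)
      & tsigma (line_through v) l] ->
    exists a w, [/\ unimod v, vanish (in_alg R) E v, v *m grad v = 0,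
      forall b, t ord0 b *m grad v = 0 & w *m grad v = 1%:M /\ l = a *: tvec D v].
  move=> [/(zero_locus_line _ hE) [uv Ev] tE /(tsigma_line uv) [a ->]].
  have [w hw] := grad_dual uv Ev; exists a, w; split=> //; first exact: grad_self.
  by move=> b; apply/(grad_tangent uv Ev).
split.
- move=> R v t l l' c /domE [a [w [uv Ev hv ht [hw ->]]]] /domE [a' [_ [_ _ _ _ [_ ->]]]].
  by rewrite scalerA -scalerDl !(tthetaE uv _ hv ht hw); ring.
- move=> R v t t' t'' l a b c /domE [e [w [uv Ev hv ht [hw ->]]]].
  move=> /domE [_ [_ [_ _ _ ht' _]]] /domE [_ [_ [_ _ _ ht'' _]]] tab h.
  rewrite !(tthetaE uv _ hv _ hw) //; rewrite (ord1 a) in tab h.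
  rewrite (det_frame_tlinear v w tab) ?mulrDr ?mulrA ?[e * c]mulrC ?mulrA //.
  by move=> b' b'b; apply: h; rewrite xpair_eqE negb_and b'b orbT.
- move=> R v t l a b /domE [e [w [uv Ev hv ht [hw ->]]]]; rewrite (ord1 a) => h.
  by rewrite (tthetaE uv _ hv ht hw) (det_frame_alt w h) mulr0.
- split.
    move=> R v t l c d /domE [e [w [uv Ev hv ht [hw ->]]]] cd.
    have ucv : unimod (c *: v).
      have [u vu] := uv; exists (d *: u).
      by rewrite -scalemxAl -scalemxAr scalerA vu cd scale1r.
    have dc j : c ^+ j * d ^+ j = 1 by rewrite -exprMn cd expr1n.
    have hcv : c *: v *m grad (c *: v) = 0.
      by rewrite gradZ -scalemxAl -scalemxAr hv !scaler0.
    have hct b : c *: t ord0 b *m grad (c *: v) = 0.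
      by rewrite gradZ -scalemxAl -scalemxAr ht !scaler0.
    have hdw : d ^+ r.-1 *: w *m grad (c *: v) = 1%:M.
      by rewrite gradZ -scalemxAl -scalemxAr hw scalerA mulrC dc scale1r.
    have lE : e *: tvec D v = (e * d ^+ D.+1) *: tvec D (c *: v).
      by rewrite tvecZ scalerA -mulrA [d ^+ _ * _]mulrC dc mulr1.
    rewrite [in LHS]lE (@tthetaE _ _ ucv (fun a b => c *: t a b) _ _ hcv hct hdw).
    rewrite (tthetaE uv _ hv ht hw) det_frameZ.
    (* The weights under scaling cancel: n + 1 from v and the tangent vectors against D + 1 from the
       tensor power and r - 1 from the vector dual to the gradient, where D + r = n + 1. *)
    have cdE : c ^+ n.+1 * (d ^+ D.+1 * d ^+ r.-1) = 1.
      by rewrite -exprD addSn -addnS prednK // rD dc.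
    set X := \det _; transitivity (c ^+ n.+1 * (d ^+ D.+1 * d ^+ r.-1) * (e * X)).
      by ring.
    by rewrite cdE mul1r.
  move=> R R' f v t l /domE [e [w [uv Ev hv ht [hw ->]]]].
  rewrite (tthetaE uv _ hv ht hw) map_mxZ tvec_map.
  rewrite (@tthetaE _ _ (unimod_map f uv) (fun a b => map_mx f (t a b)) (f e) (map_mx f w)).
  + by rewrite det_frame_map rmorphM.
  + by rewrite -grad_map -map_mxM hv map_mx0.
  + by move=> b; rewrite -grad_map -map_mxM ht map_mx0.
  + by rewrite -grad_map -map_mxM hw map_mx1.
move=> R v /(zero_locus_line _ hE) [uv Ev]; exact: ttheta_surj.
Qed.

End Fano.

Lemma fano_low_degree r n : (0 < r)%N -> (r <= n.+1)%N -> fano_hypersurfaces r n.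
Proof.
move=> r0 rn k E smE; have rD : (n.+1 - r + r = n.+1)%N by rewrite subnK.
pose D := (n.+1 - r)%N.
(* The exponent is 1, as O(D + 1) itself is very ample. *)
exists 1%N, (tdim n.+1 D), (tens_eqns D E), (@tsigma k n D), (@ttheta k r n D E smE); split=> //.
- by apply: tens_eqns_homog; case: smE.
- exact: tsigma_iso smE.
exact: ttheta_iso.
Qed.

(** * Automorphisms of projective space *)

Definition rdvd (R : comNzRingType) (s z : R) : Prop := exists c, z = s * c.

(** The f i have no common factor, in a form that mentions neither gcds nor prime elements and
    passes to polynomial rings. *)
Definition primitive_family (R : comNzRingType) (I : finType) (f : I -> R) : Prop :=
  forall s z, s != 0 -> (forall i, rdvd s (z * f i)) -> rdvd s z.

Definition has_content (R : comNzRingType) : Prop :=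
  forall (I : finType) (rho : I -> R), (exists i, rho i != 0) ->
    exists d f, (forall i, rho i = d * f i) /\ primitive_family f.

Lemma rdvdD (R : comNzRingType) (s x y : R) : rdvd s x -> rdvd s y -> rdvd s (x + y).
Proof. by move=> [a ->] [b ->]; exists (a + b); rewrite mulrDr. Qed.

Lemma rdvdB (R : comNzRingType) (s x y : R) : rdvd s x -> rdvd s y -> rdvd s (x - y).
Proof. by move=> [a ->] [b ->]; exists (a - b); rewrite mulrBr. Qed.

Lemma rdvdMl (R : comNzRingType) (s x y : R) : rdvd s x -> rdvd s (y * x).
Proof. by move=> [a ->]; exists (y * a); rewrite mulrCA. Qed.

Lemma rdvd0 (R : comNzRingType) (s : R) : rdvd s 0.
Proof. by exists 0; rewrite mulr0. Qed.

Lemma rdvd_sum (R : comNzRingType) (s : R) (I : Type) (r : seq I) (P : pred I) (F : I -> R) :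
  (forall i, P i -> rdvd s (F i)) -> rdvd s (\sum_(i <- r | P i) F i).
Proof. by move=> h; apply: big_ind => //; [exact: rdvd0 | exact: rdvdD]. Qed.

Lemma rdvd_polyC (R : idomainType) (s : R) (p : {poly R}) :
  rdvd s%:P p <-> forall i, rdvd s p`_i.
Proof.
split=> [[c ->] i|h]; first by exists c`_i; rewrite coefCM.
have [c hc] := boolp.choice h; exists (\poly_(i < size p) c i).
apply/polyP => i; rewrite coefCM coef_poly; case: ltnP => // hi.
by rewrite mulr0 nth_default.
Qed.

(** By descending induction on j, s divides the j-th coefficient of each f i times q. Indeed the
    coefficient of degree d + j of q f i isolates this j-th coefficient times the leading
    coefficient of q, and what remains is the same claim for a shorter q. Primitivity then applies
    to each coefficient of q. *)
Lemma gauss_family (R : idomainType) (I : finType) (f : I -> {poly R}) N (s : R) q :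
  primitive_family (fun x : I * 'I_N => (f x.1)`_x.2) -> s != 0 ->
  (forall i, (size (f i) <= N)%N) ->
  (forall i, rdvd s%:P (q * f i)) -> rdvd s%:P q.
Proof.
move=> fP s0 fN; have [M] := ubnP (size q); elim: M q => // M IH q qM qf.
have [->|q0] := eqVneq q 0; first exact: rdvd0.
pose d := (size q).-1; pose ql := take_poly d q.
have qE : q = ql + (lead_coef q)%:P * 'X^d.
  apply/polyP => i; rewrite coefD coefCM coefXn coef_take_poly lead_coefE -/d.
  case: (ltngtP i d) => [||->]; rewrite ?mulr0 ?mulr1 ?addr0 ?add0r //.
  by move=> di; rewrite nth_default // (leq_trans (leqSpred _)).
have qls : (size ql < M)%N.
  rewrite (leq_ltn_trans (size_take_poly _ _)) // -ltnS prednK //; last by rewrite lt0n size_poly_eq0.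
have coefq i j : rdvd s%:P (((f i)`_j)%:P * q).
  have [e] := ubnP (N - j)%N; elim: e j => // e IHe j je.
  have [Nj|jN] := leqP N j.
    by rewrite nth_default ?(leq_trans (fN i)) // polyC0 mul0r; apply: rdvd0.
  have fq a : (j < a)%N -> rdvd s%:P (((f i)`_a)%:P * q).
    move=> ja; apply: IHe; have [Na|aN] := leqP N a; first by rewrite (eqP Na); case: (e) je => //; rewrite ltnS leqn0 subn_eq0 leqNgt jN.
    by rewrite (leq_trans _ (_ : N - j <= e)%N) // ltn_sub2l.
  have lead : rdvd s ((f i)`_j * lead_coef q).
    have /rdvd_polyC /(_ (d + j)%N) := qf i.
    rewrite coefM (bigD1 (inord d)) //= inordK ?ltnS ?leq_addr // addKn mulrC.
    set T := \sum_(_ | _) _ => hs.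
    have hT : rdvd s T.
      apply: rdvd_sum => b bd; have [bd'|db] := ltnP b d.
        have /fq /rdvd_polyC /(_ b) : (j < d + j - b)%N.
          by rewrite ltn_subRL ltn_add2r.
        by rewrite coefCM mulrC.
      rewrite nth_default ?mul0r; first exact: rdvd0.
      have : (d < b)%N.
        rewrite ltn_neqAle db andbT; apply: contraNneq bd => bd; apply/eqP/val_inj.
        by rewrite /= inordK ?ltnS ?leq_addr.
      exact: leq_trans (leqSpred _).
    have := rdvdB hs hT; rewrite addrK lead_coefE; by [].
  have lead' : rdvd s%:P (((f i)`_j * lead_coef q)%:P).
    by apply/rdvd_polyC => l; rewrite coefC; case: eqP => _ //; apply: rdvd0.
  have hql : rdvd s%:P (((f i)`_j)%:P * ql).
    apply: IH => [|i'].
      by rewrite (leq_ltn_trans _ qls) // mul_polyC size_scale_leq.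
    have -> : ((f i)`_j)%:P * ql * f i' =
        ((f i)`_j)%:P * (q * f i') - ('X^d * f i') * (((f i)`_j * lead_coef q)%:P).
      have -> : ql = q - (lead_coef q)%:P * 'X^d by rewrite {1}qE addrK.
      by rewrite polyCM; ring.
    by apply: rdvdB; apply: rdvdMl.
  rewrite {1}qE mulrDr; apply: rdvdD => //; rewrite mulrA -polyCM mulrC; exact: rdvdMl.
apply/rdvd_polyC => b; apply: fP => // -[i j] /=.
by have /rdvd_polyC /(_ b) := coefq i j; rewrite coefCM mulrC.
Qed.

(** g is a nonzero combination of least size; division with remainder shows that it divides the
    whole family. *)
Lemma poly_field_gen (k : fieldType) (I : finType) (rho : I -> {poly k}) :
  (exists i, rho i != 0) ->
  exists g a f, [/\ g != 0, forall i, rho i = f i * g & \sum_i a i * f i = 1].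
Proof.
move=> [i0 ri0].
pose P n := `[< exists a : I -> {poly k}, \sum_i a i * rho i != 0 /\ size (\sum_i a i * rho i) = n >].
have exP : exists n, P n.
  exists (size (rho i0)); apply/asboolP; exists (fun i => (i == i0)%:R).
  rewrite (bigD1 i0) //= eqxx mul1r big1 ?addr0 // => i /negPf ->.
  by rewrite mul0r.
case: (ex_minnP exP) => n /asboolP [a [g0 gn]] nmin; set g := \sum_i _ in g0 gn.
have dv i : rho i %% g = 0.
  apply/eqP/negPn/negP => r0; have := ltn_modp (rho i) g; rewrite g0 gn ltnNge => /negP; apply.
  apply: nmin; apply/asboolP; exists (fun l => (l == i)%:R - (rho i %/ g) * a l).
  suff -> : \sum_l ((l == i)%:R - rho i %/ g * a l) * rho l = rho i %% g by [].
  under eq_bigr do rewrite mulrBl -mulrA.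
  rewrite sumrB -mulr_sumr -/g (bigD1 i) //= eqxx mul1r big1 ?addr0; last first.
    by move=> l /negPf ->; rewrite mul0r.
  by rewrite {1}(divp_eq (rho i) g) addrAC subrr add0r.
have rE i : rho i = (rho i %/ g) * g by rewrite {1}(divp_eq (rho i) g) dv addr0.
exists g, a, (fun i => rho i %/ g); split=> //.
apply: (mulIf g0); rewrite mul1r mulr_suml; apply: eq_bigr => i _.
by rewrite -mulrA -rE.
Qed.

Lemma common_denom (R : idomainType) (K : fieldType) (iota : {rmorphism R -> K})
    (I : finType) (z : I -> K) : injective iota ->
  (forall z, exists a b, b != 0 /\ z = iota a / iota b) ->
  exists b h, b != 0 /\ forall i, iota b * z i = iota (h i).
Proof.
move=> inj frac.
have : forall i, exists x : R * R, x.2 != 0 /\ z i = iota x.1 / iota x.2.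
  by move=> i; have [a [b h]] := frac (z i); exists (a, b).
move=> /boolp.choice [x hx].
have b0 i : iota (x i).2 != 0 by rewrite -(rmorph0 iota) (inj_eq inj); case: (hx i).
exists (\prod_i (x i).2), (fun i => (x i).1 * \prod_(j | j != i) (x j).2); split.
  by apply/prodf_neq0 => i _; case: (hx i).
move=> i; have [_ ->] := hx i; rewrite (bigD1 i) //= !rmorphM /=.
by rewrite mulrAC [iota (x i).2 * _]mulrC divfK.
Qed.

Lemma has_content_field (k : fieldType) : has_content k.
Proof.
move=> I rho _; exists 1, rho; split=> [i|s z s0 _]; first by rewrite mul1r.
by exists (s^-1 * z); rewrite mulrA divff // mul1r.
Qed.

(** Over the fraction field the polynomials form a principal ring, where the family is g times a
    family that generates 1. The latter is scaled so that its coefficients are a primitive family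
    over R; Gauss's lemma then brings the quotients back into R[X]. *)
Lemma has_content_poly (R : idomainType) : has_content R -> has_content {poly R}.
Proof.
move=> cR I rho [i0 ri0].
pose K : fieldType := {fraction R}.
have [K' [iota [inj frac]]] : exists (K : fieldType) (iota : {rmorphism R -> K}),
    injective iota /\ (forall z, exists a b, b != 0 /\ z = iota a / iota b).
  exists {fraction R}, (@FracField.tofrac R : {rmorphism R -> {fraction R}}).
  split=> [x y /eqP|z]; first by rewrite tofrac_eq => /eqP.
  exact: fraction_div.
have pinj : injective (map_poly iota).
  by move=> p q /polyP h; apply/polyP => i; apply: inj; rewrite -!coef_map h.
have p0 p : (map_poly iota p == 0) = (p == 0) by rewrite -(rmorph0 (map_poly iota)) (inj_eq pinj).
have iota0 a : (iota a == 0) = (a == 0) by rewrite -(rmorph0 iota) (inj_eq inj).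
have [|g [a [f0 [g0 rE af]]]] := @poly_field_gen K' I (fun i => map_poly iota (rho i)).
  by exists i0; rewrite p0.
pose N := (\max_i size (f0 i))%N.
have f0N i : (size (f0 i) <= N)%N by rewrite (leq_bigmax i).
have [b [h [b0 hE]]] := @common_denom R K' iota _ (fun x : I * 'I_N => (f0 x.1)`_x.2) inj frac.
have f0nz : exists x : I * 'I_N, h x != 0.
  apply: contrapT => /forallNP hz; have /eqP := oner_neq0 {poly K'}; apply; rewrite -af big1 // => i _.
  suff -> : f0 i = 0 by rewrite mulr0.
  apply/polyP => j; rewrite coef0; have [jN|Nj] := ltnP j N; last first.
    by rewrite nth_default // (leq_trans (f0N i)).
  have := hE (i, Ordinal jN); have /negP/negPn/eqP -> := hz (i, Ordinal jN).
  by rewrite rmorph0 /= => /eqP; rewrite mulf_eq0 iota0 (negPf b0) => /eqP.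
have [e [fc [heq fcP]]] := cR _ _ f0nz.
have e0 : e != 0 by have [x hx] := f0nz; apply: contraNneq hx => e0; rewrite heq e0 mul0r.
pose f i : {poly R} := \poly_(j < N) (if insub j is Some j' then fc (i, j') else 0).
have fcoef i (j : 'I_N) : (f i)`_j = fc (i, j).
  by rewrite coef_poly ltn_ord valK.
have fs i : (size (f i) <= N)%N by exact: size_poly.
have fE i : (iota b)%:P * f0 i = (iota e)%:P * map_poly iota (f i).
  apply/polyP => j; rewrite !coefCM coef_map /=; have [jN|Nj] := ltnP j N; last first.
    by rewrite !nth_default ?(leq_trans (f0N i)) ?(leq_trans (fs i)) // rmorph0 !mulr0.
  by rewrite -[j]/(val (Ordinal jN)) (hE (i, Ordinal jN)) fcoef heq rmorphM.
have fprim : primitive_family (fun x : I * 'I_N => (f x.1)`_x.2).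
  have -> : (fun x : I * 'I_N => (f x.1)`_x.2) = fc by apply: funext => -[i j]; exact: fcoef.
  exact: fcP.
have gauss q : (forall i, exists p, q * map_poly iota (f i) = map_poly iota p) ->
    exists p, q = map_poly iota p.
  move=> hq; have [s [u [s0 uE]]] := @common_denom R K' iota _ (fun j : 'I_(size q) => q`_j) inj frac.
  pose q' : {poly R} := \poly_(j < size q) (if insub j is Some j' then u j' else 0).
  have q'c (o : 'I_(size q)) : q'`_o = u o by rewrite coef_poly ltn_ord valK.
  have q'E : (iota s)%:P * q = map_poly iota q'.
    apply/polyP => j; rewrite coefCM coef_map /=; have [hj|hj] := ltnP j (size q).
      by rewrite -[j]/(val (Ordinal hj)) (uE (Ordinal hj)) q'c.
    by rewrite !nth_default ?(leq_trans (size_poly _ _)) // mulr0 rmorph0.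
  have [c cE] : rdvd s%:P q'.
    apply: (gauss_family fprim s0 fs) => i; have [p pE] := hq i; exists p.
    by apply: pinj; rewrite !rmorphM /= -q'E map_polyC /= -pE mulrA.
  exists c; apply: (@mulfI _ (iota s)%:P); first by rewrite polyC_eq0 iota0.
  by rewrite q'E cE rmorphM /= map_polyC.
have bP0 : (iota b)%:P != 0 :> {poly K'} by rewrite polyC_eq0 iota0.
have eP0 : (iota e)%:P != 0 :> {poly K'} by rewrite polyC_eq0 iota0.
have f0E i : f0 i = (iota e / iota b)%:P * map_poly iota (f i).
  by apply: (mulfI bP0); rewrite fE mulrA -polyCM mulrCA divff ?mulr1 // iota0.
have [|d dE] := gauss (g * (iota e / iota b)%:P).
  by move=> i; exists (rho i); rewrite rE f0E mulrC -mulrA mulrC mulrAC; ring.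
exists d, f; split=> [i|s z s0 hz].
  by apply: pinj; rewrite rmorphM /= -dE rE f0E; ring.
have [w wE] := boolp.choice hz.
have : map_poly iota z = map_poly iota s * \sum_i a i * ((iota e / iota b)%:P * map_poly iota (w i)).
  rewrite -[LHS]mulr1 -af !mulr_sumr; apply: eq_bigr => i _.
  have : map_poly iota z * map_poly iota (f i) = map_poly iota s * map_poly iota (w i).
    by rewrite -!rmorphM wE.
  rewrite f0E => E; transitivity (a i * (iota e / iota b)%:P * (map_poly iota z * map_poly iota (f i))); first by ring.
  by rewrite E; ring.
set q := \sum_i _ => zE; have [i|p pE] := gauss q.
  exists (w i); apply: (@mulfI _ (map_poly iota s)); first by rewrite p0.
  by rewrite mulrA -zE -!rmorphM wE.
by exists p; apply: pinj; rewrite rmorphM /= -pE.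
Qed.

Lemma has_content_iso (R S : idomainType) (f : {rmorphism R -> S}) (g : {rmorphism S -> R}) :
  cancel f g -> cancel g f -> has_content R -> has_content S.
Proof.
move=> fK gK cR I rho [i0 ri0].
have [|d [h [rE hP]]] := cR I (g \o rho).
  by exists i0; rewrite /= -(rmorph0 g) (inj_eq (can_inj gK)).
exists (f d), (f \o h); split=> [i|s z s0 hz].
  by rewrite -[LHS]gK -[g (rho i)]/((g \o rho) i) rE rmorphM.
have [||c cE] := hP (g s) (g z); last by exists (f c); rewrite -[z]gK cE rmorphM gK.
  by rewrite -(rmorph0 g) (inj_eq (can_inj gK)).
by move=> i; have [c cE] := hz i; exists (g c); rewrite -rmorphM -cE rmorphM /= fK.
Qed.

Lemma has_content_mpoly (k : fieldType) n : has_content {mpoly k[n]}.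
Proof.
elim: n => [|n IHn].
  pose f : {rmorphism k -> {mpoly k[0]}} := @mpolyC 0 k.
  pose g : {rmorphism {mpoly k[0]} -> k} := mmap idfun (fun=> 0).
  apply: (@has_content_iso k {mpoly k[0]} f g); last exact: has_content_field.
    by move=> c; rewrite /f /g /= mmapC.
  move=> p; rewrite /f /g /= [p]nvar0_mpolyC mmapC //.
have [w [wC wX]] : exists w : {rmorphism {mpoly k[n]} -> {mpoly k[n.+1]}},
    (forall c, w c%:MP = c%:MP) /\ forall i, w 'X_i = 'X_(widen_ord (leqnSn n) i).
  exists (@mwiden n k); split=> [c|i]; first exact: mwidenC.
  by rewrite /= mwidenX mnmwiden1.
have [g [gC gX]] : exists g : {rmorphism {poly {mpoly k[n]}} -> {mpoly k[n.+1]}},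
    (forall a, g a%:P = w a) /\ g 'X = 'X_ord_max.
  have cw : commr_rmorph w ('X_ord_max : {mpoly k[n.+1]}) by move=> b; apply: mulrC.
  by exists (horner_morph cw); split=> [a|]; [exact: horner_morphC | exact: horner_morphX].
have [f fE] : exists f : {rmorphism {mpoly k[n.+1]} -> {poly {mpoly k[n]}}},
    forall p, f p = muni p by exists (@muni n k).
have fX i : f 'X_i = if unlift ord_max i is Some j then ('X_j)%:P else 'X.
  rewrite fE muniE msuppX big_seq1 mcoeffX eqxx scale1r mnm1E.
  have [j ->|->] := unliftP ord_max i.
    rewrite eq_sym (negPf (neq_lift _ _)) expr0 alg_polyC; congr (_%:P); congr 'X_[_].
    apply/mnmP => l; rewrite mnmE !mnm1E -!val_eqE /=.
    by rewrite /bump leqNgt ltn_ord.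
  rewrite eqxx expr1 (_ : [multinom _ | _ < _] = 0%MM) ?mpolyX0 ?scale1r //.
  apply/mnmP => l; rewrite mnmE mnm1E mnm0E -val_eqE /=.
  by rewrite gtn_eqF.
have fC c : f c%:MP = (c%:MP)%:P by rewrite fE muniC.
have fK : cancel f g.
  elim/mpoly_ring_ind => [c|i|p q IHp IHq|p q IHp IHq].
  - by rewrite fC gC wC.
  - rewrite fX; have [j ->|->] := unliftP ord_max i; last by rewrite gX.
    rewrite gC wX; congr ('X_(_)); apply: val_inj => /=.
    by rewrite /bump leqNgt ltn_ord.
  - by rewrite !rmorphD /= IHp IHq.
  - by rewrite !rmorphM /= IHp IHq.
have fw a : f (w a) = a%:P.
  elim/mpoly_ring_ind: a => [c|i|p q IHp IHq|p q IHp IHq].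
  - by rewrite wC fC.
  - rewrite wX fX; have [j jE|jE] := unliftP ord_max (widen_ord (leqnSn n) i).
      congr (('X_(_))%:P); apply: val_inj; have := congr1 val jE.
      by rewrite /= /bump leqNgt ltn_ord.
    by have := congr1 val jE; rewrite /= => iE; have := ltn_ord i; rewrite iE ltnn.
  - by rewrite !rmorphD /= IHp IHq.
  - by rewrite !rmorphM /= IHp IHq.
have gK : cancel g f.
  elim/poly_ind => [|p c IHp]; first by rewrite !rmorph0.
  by rewrite !rmorphD !rmorphM /= IHp gX gC fw fX unlift_none.
apply: (@has_content_iso _ _ g f gK fK); exact: has_content_poly.
Qed.

Lemma poly_factor_monomial (R : idomainType) (P Q : {poly R}) c d : c != 0 ->
  P * Q = c%:P * 'X^d ->
  exists d1 d2 p q, [/\ P = p%:P * 'X^d1, Q = q%:P * 'X^d2 & (d1 + d2 = d)%N].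
Proof.
move=> c0 E.
have PQ0 : P * Q != 0 by rewrite E mulf_neq0 ?polyC_eq0 // expf_neq0 // polyX_eq0.
have [P0 Q0] : P != 0 /\ Q != 0 by apply/andP; rewrite -negb_or -mulf_eq0.
have split0 (s : {poly R}) : s != 0 -> exists e u, s = u * 'X^e /\ u.[0] != 0.
  move=> s0; have [e [u]] := multiplicity_XsubC s 0.
  by rewrite s0 //= subr0 => u0 ->; exists e, u.
have [a [u [pE u0]]] := split0 P P0; have [b [v [qE v0]]] := split0 Q Q0.
have E' : (u * v) * 'X^(a + b) = c%:P * 'X^d.
  by rewrite exprD mulrACA -pE -qE.
have uv0 : (u * v).[0] != 0 by rewrite hornerM mulf_neq0.
have X0 e : 'X^e != 0 :> {poly R} by rewrite expf_neq0 // polyX_eq0.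
have abd : (a + b = d)%N.
  apply/eqP; rewrite eqn_leq; apply/andP; split; rewrite leqNgt; apply/negP => lt.
    have : (u * v) * 'X^(a + b - d) = c%:P.
      by apply: (mulIf (X0 d)); rewrite -[LHS]mulrA -exprD subnK // ltnW.
    move=> /(congr1 (horner_eval 0)); rewrite /horner_eval hornerM hornerXn hornerC.
    by rewrite expr0n subn_eq0 leqNgt lt mulr0 => /eqP; rewrite eq_sym (negPf c0).
  have : u * v = c%:P * 'X^(d - (a + b)).
    by apply: (mulIf (X0 (a + b)%N)); rewrite E' -[RHS]mulrA -exprD subnK // ltnW.
  move=> /(congr1 (horner_eval 0)); rewrite /horner_eval [RHS]hornerM hornerXn.
  by rewrite expr0n subn_eq0 leqNgt lt mulr0 => /eqP; rewrite (negPf uv0).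
have uvE : u * v = c%:P by apply: (mulIf (X0 d)); rewrite -E' abd.
have [u0' v0'] : u != 0 /\ v != 0.
  by split; [apply: contraNneq u0|apply: contraNneq v0] => ->; rewrite horner0.
have suv : ((size u).-1 + (size v).-1 = 0)%N.
  have := congr1 (fun P : {poly R} => size P) uvE.
  rewrite size_mul // size_polyC c0 -(prednK (_ : 0 < size u)%N) ?lt0n ?size_poly_eq0 //.
  by rewrite -(prednK (_ : 0 < size v)%N) ?lt0n ?size_poly_eq0 // addnS /= addSn => -[].
have const (w : {poly R}) : (size w).-1 = 0%N -> w = (w`_0)%:P.
  by move=> sw; apply: size1_polyC; rewrite (leq_trans (leqSpred _)) // sw.
move/eqP: suv; rewrite addn_eq0 => /andP [/eqP /const uE /eqP /const vE].
by exists a, b, u`_0, v`_0; rewrite -uE -vE.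
Qed.

(** * Homogeneous polynomials *)

Section Homogeneous.
Variables (k : fieldType) (n : nat).
Implicit Types p q : {mpoly k[n]}.

(** The polynomial p(T x) in a new variable T. To be homogeneous means that it is a monomial in T,
    and factors of monomials are monomials. *)
Definition degmap : {mpoly k[n]} -> {poly {mpoly k[n]}} :=
  mmap (polyC \o @mpolyC n k) (fun i => ('X_i)%:P * 'X).

HB.instance Definition _ := GRing.RMorphism.on degmap.

Lemma degmapC c : degmap c%:MP = (c%:MP)%:P.
Proof. exact: mmapC. Qed.

Lemma degmapX i : degmap 'X_i = ('X_i)%:P * 'X.
Proof. by rewrite /degmap mmapX mmap1U. Qed.

Lemma degmapD p q : degmap (p + q) = degmap p + degmap q.
Proof. exact: rmorphD. Qed.

Lemma degmapM p q : degmap (p * q) = degmap p * degmap q.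
Proof. exact: rmorphM. Qed.

Lemma degmapK s : (degmap s).[1] = s.
Proof.
elim/mpoly_ring_ind: s => [c|i|a b IHa IHb|a b IHa IHb].
- by rewrite degmapC hornerC.
- by rewrite degmapX hornerM hornerC hornerX mulr1.
- by rewrite degmapD hornerD; congr (_ + _); [exact: IHa | exact: IHb].
- by rewrite degmapM hornerM; congr (_ * _); [exact: IHa | exact: IHb].
Qed.

Lemma degmapE p : degmap p = \sum_(m <- msupp p) (p@_m *: 'X_[m])%:P * 'X^(mdeg m).
Proof.
rewrite /degmap /mmap; apply: eq_bigr => m _ /=; rewrite -mul_mpolyC polyCM -mulrA; congr (_ * _).
rewrite /mmap1 mdegE -prodrXr mpolyXE_id rmorph_prod -big_split /=.
by apply: eq_bigr => i _; rewrite exprMn rmorphXn.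
Qed.

Lemma degmap_homog p d : p \is d.-homog <-> degmap p = p%:P * 'X^d.
Proof.
split=> [hp|E].
  rewrite degmapE [in RHS](mpolyE p) rmorph_sum mulr_suml; apply: eq_big_seq => m mp.
  by rewrite (dhomogP _ _ _ hp m mp).
apply/dhomogP => m mp; have := congr1 (fun P : {poly {mpoly k[n]}} => P`_(mdeg m)) E.
rewrite coefCM coefXn => /(congr1 (mcoeff m)).
have -> : (degmap p)`_(mdeg m)@_m = p@_m.
  rewrite degmapE coef_sum raddf_sum /= (bigD1_seq m) ?msupp_uniq //=.
  rewrite coefCM coefXn eqxx mulr1 mcoeffZ mcoeffX eqxx mulr1 big1 ?addr0 // => m' mm'.
  rewrite coefCM coefXn mulr_natr mcoeffMn mcoeffZ mcoeffX (negPf mm') mulr0.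
  by rewrite mul0rn.
case: eqP => [<- //|_]; rewrite mulr0 mcoeff0 => /eqP p0.
by move: mp; rewrite mcoeff_msupp p0.
Qed.

Lemma homog_factor p q d : p != 0 -> q != 0 -> p * q \is d.-homog ->
  exists d1 d2, [/\ p \is d1.-homog, q \is d2.-homog & (d1 + d2 = d)%N].
Proof.
move=> p0 q0 /degmap_homog; rewrite degmapM => E.
have c0 : p * q != 0 by rewrite mulf_neq0.
have [d1 [d2 [u [v [pE qE dE]]]]] := poly_factor_monomial c0 E.
have hom s e w : degmap s = w%:P * 'X^e -> s \is e.-homog.
  move=> sE; apply/degmap_homog; rewrite sE; congr (_%:P * _).
  apply: etrans (degmapK s); rewrite sE hornerM hornerC hornerXn expr1n; exact: esym (mulr1 w).
by exists d1, d2; split=> //; [exact: hom pE | exact: hom qE].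
Qed.

Lemma mpolyX_neq0 (i : 'I_n) : ('X_i : {mpoly k[n]}) != 0.
Proof. by rewrite -msupp_eq0 msuppX. Qed.

(** From the two divisions, with quotients c and d, one gets c X_j^b = d X_i^a. So X_i^a divides
    every monomial of c, and c / X_i^a is the quotient of z by s. *)
Lemma monom_coprime (i j : 'I_n) a b (s z : {mpoly k[n]}) : i != j ->
  rdvd s (z * 'X_i ^+ a) -> rdvd s (z * 'X_j ^+ b) -> rdvd s z.
Proof.
move=> ij [c cE] [d dE].
have [s0|s0] := eqVneq s 0.
  move: cE; rewrite s0 mul0r => /eqP; rewrite mulf_eq0 expf_eq0 (negPf (mpolyX_neq0 i)) andbF orbF.
  by move=> /eqP ->; exists 0; rewrite mul0r.
have E : c * 'X_j ^+ b = d * 'X_i ^+ a.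
  apply: (mulfI s0); rewrite !mulrA -cE -dE; ring.
have ca m : m \in msupp c -> (a <= m i)%N.
  move=> mc; have : (m + U_(j) *+ b)%MM \in msupp (c * 'X_j ^+ b).
    by rewrite mpolyXn mcoeff_msupp addmC mcoeffMX -mcoeff_msupp.
  rewrite E mpolyXn => /msuppM_le /allpairsP [[m1 m2] /= [_]].
  rewrite msuppX inE => /eqP -> /(congr1 (fun m : 'X_{1..n} => m i)).
  rewrite !mnmDE !mulmnE !mnm1E eqxx eq_sym (negPf ij) mul0n addn0 mul1n => ->.
  by rewrite leq_addl.
exists (\sum_(m <- msupp c) c@_m *: 'X_[m - U_(i) *+ a]).
have Xa : 'X_i ^+ a != 0 :> {mpoly k[n]} by rewrite expf_neq0 // mpolyX_neq0.
apply: (mulIf Xa); rewrite cE -mulrA; congr (_ * _).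
rewrite [LHS](mpolyE c) mulr_suml; apply: eq_big_seq => m mc.
rewrite -scalerAl mpolyXn -mpolyXD submK //; apply/mnm_lepP => l.
rewrite mulmnE mnm1E; case: eqP => [<-|_]; rewrite ?mul1n ?ca //.
Qed.

End Homogeneous.

(** The property is stated by values, as it is used on charts: y holds homogeneous coordinates and
    y' their quotients by y i. *)
Lemma homogenize (A : comNzRingType) n (p : {mpoly A[n]}) i N : (msize p <= N)%N ->
  exists ph : {mpoly A[n]}, ph \is N.-homog /\
    forall (R : comNzRingType) (psi : {rmorphism A -> R}) (y y' : 'I_n -> R),
      (forall j, y j = y i * y' j) -> mmap psi y ph = y i ^+ N * mmap psi y' p.
Proof.
move=> pN; exists (\sum_(m <- msupp p) p@_m *: ('X_i ^+ (N - mdeg m) * 'X_[m])).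
have mN m : m \in msupp p -> (mdeg m <= N)%N.
  by move=> mp; rewrite (leq_trans _ pN) // ltnW // msize_mdeg_lt.
split=> [|R psi y y' yE].
  rewrite big_seq rpred_sum // => m /mN mp; rewrite dhomogZ // mpolyXn -mpolyXD dhomogX /=.
  by rewrite mdegD mdegMn mdeg1 mul1n subnK.
rewrite rmorph_sum /= [mmap psi y' p]/mmap mulr_sumr; apply: eq_big_seq => m /mN mp.
rewrite mmapZ rmorphM rmorphXn /= !mmapX mmap1U [RHS]mulrCA; congr (_ * _).
rewrite -[in RHS](subnK mp) exprD -mulrA; congr (_ * _).
rewrite /mmap1 mdegE -prodrXr -big_split /=; apply: eq_bigr => j _.
by rewrite yE exprMn.
Qed.

Lemma rk1_rows (R : comNzRingType) n (P Q : 'M[R]_n) a a' b c : rk1 P -> rk1 Q ->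
  span Q = span P -> P a b * Q a' c = P a c * Q a' b.
Proof.
move=> hP hQ /(rk1_span_eq hQ hP) <-; rewrite !mxE !mulr_sumr; apply: eq_bigr => l _.
rewrite mulrCA [RHS]mulrCA; congr (_ * _); exact: (proj2 hP).
Qed.

(** * Automorphisms become linear over a field *)

Section ProjectiveAutomorphism.
Variables (B : comNzRingType) (m : nat).
Implicit Type sigma : forall R : comAlgType B, set 'rV[R]_m.+1 -> set 'rV[R]_m.+1.
Local Notation auto := (@scheme_iso B m m [::] [::]).

Lemma zero_locus_nil (R : comAlgType B) (L : set 'rV[R]_m.+1) :
  zero_locus ([::] : seq {mpoly B[m.+1]}) R L <-> proj_space L.
Proof. by split=> [[]|hL] //; split=> //. Qed.

Lemma auto_inverse sigma : auto sigma ->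
  exists tau, auto tau /\ forall (R : comAlgType B) L, proj_space L -> tau R (sigma R L) = L.
Proof.
move=> [bij nat].
pose tau (R : comAlgType B) (L' : set 'rV[R]_m.+1) :=
  xget set0 [set L | proj_space L /\ sigma R L = L'].
have tauK (R : comAlgType B) L : proj_space L -> tau R (sigma R L) = L.
  move=> hL; rewrite /tau; case: xgetP => [L' _ [hL' E]|/(_ L)]; last by case.
  have [_ inj _] := bij R; apply: inj => //; rewrite inE; exact/zero_locus_nil.
have tauP (R : comAlgType B) L' : proj_space L' -> proj_space (tau R L') /\ sigma R (tau R L') = L'.
  move=> /zero_locus_nil hL'; have [_ _ surj] := bij R; have [L /zero_locus_nil hL <-] := surj _ hL'.
  by rewrite tauK.
exists tau; split=> //; split=> [R|R R' f L /zero_locus_nil /tauP [hL <-]]; last first.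
  rewrite -nat; last exact/zero_locus_nil.
  rewrite !tauK //; have /proj_spaceP [P [hP ->]] := hL.
  by rewrite base_change_span //; apply/proj_spaceP; exists (map_mx f P); split=> //; apply: rk1_map.
split=> [L /zero_locus_nil /tauP [hL _]|L L'|L /zero_locus_nil hL]; first exact/zero_locus_nil.
  move=> /set_mem /zero_locus_nil /tauP [_ E] /set_mem /zero_locus_nil /tauP [_ E'] E2.
  by rewrite -E -E' E2.
exists (sigma R L); last exact: tauK.
by have [fn _ _] := bij R; apply: fn; apply/zero_locus_nil.
Qed.

Variable sigma : forall R : comAlgType B, set 'rV[R]_m.+1 -> set 'rV[R]_m.+1.
Hypothesis aut : auto sigma.

Lemma auto_line (R : comNzRingType) (phi : {rmorphism B -> R}) (v : 'rV[R]_m.+1) :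
  unimod v -> exists Q, rk1 Q /\ sigma (R := alg_of phi) (line_through v) = span Q.
Proof.
move=> uv; have [bij _] := aut; have [fn _ _] := bij (alg_of phi).
have /fn : zero_locus ([::] : seq {mpoly B[m.+1]}) (alg_of phi) (line_through v).
  by apply/zero_locus_nil/line_proj.
by move=> /zero_locus_nil /proj_spaceP.
Qed.

Lemma auto_natural (R R' : comNzRingType) (phi : {rmorphism B -> R})
    (phi' : {rmorphism B -> R'}) (f : {rmorphism R -> R'}) (v : 'rV[R]_m.+1) (Q : 'M[R]_m.+1) :
  (forall b, f (phi b) = phi' b) -> unimod v -> rk1 Q ->
  sigma (R := alg_of phi) (line_through v) = span Q ->
  sigma (R := alg_of phi') (line_through (map_mx f v)) = span (map_mx f Q).
Proof.
move=> fphi uv hQ E; have [g gE] := alg_of_lrmorphism fphi.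
have gm n (X : 'M[R]_(n, m.+1)) : map_mx f X = map_mx g X.
  by apply/matrixP => i j; rewrite !mxE gE.
have [_ nat] := aut; have := nat (alg_of phi) (alg_of phi') g (line_through v).
rewrite E base_change_span // base_change_line // -!gm; apply.
by apply/zero_locus_nil/line_proj.
Qed.

Variables (K : fieldType) (j : {rmorphism B -> K}).

(** Applied to the universal points of the charts, sigma gives rank-one matrices with polynomial
    entries. They have the same span at the generic point, so after homogenization all their rows
    are proportional. One nonzero row divided by its content gives the forms f, and every row is a
    multiple of f; trace one then puts powers of the variables into the ideal of the f b. *)
Lemma auto_forms : exists e (f : 'I_m.+1 -> {mpoly K[m.+1]}) N,
  [/\ forall b, f b \is e.-homog,
      forall i, exists a, 'X_i ^+ N = \sum_b a b * f b &
      forall (R : comNzRingType) (psi : {rmorphism K -> R}) (v : 'rV[R]_m.+1) i, v 0 i = 1 ->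
        unimod (\row_b ev psi v (f b)) /\
        sigma (R := alg_of (psi \o j)) (line_through v) = line_through (\row_b ev psi v (f b))].
Proof.
pose S := {mpoly K[m.+1]}.
pose jS : {rmorphism B -> S} := (@mpolyC m.+1 K \o j)%FUN.
(* The universal point of chart i over the polynomial ring in all variables: 'X_i is replaced by 1
   in the point but stays in the ring. *)
pose vi (i : 'I_m.+1) : 'rV[S]_m.+1 := \row_l (if l == i then 1 else 'X_l).
have uvi i : unimod (vi i) by apply: (unimod_coord (i := i)); rewrite mxE eqxx.
have /boolp.choice [P hP] : forall i, exists Q, rk1 Q /\
    sigma (R := alg_of jS) (line_through (vi i)) = span Q.
  by move=> i; apply: auto_line.
pose N := (\max_(x : 'I_m.+1 * 'I_m.+1 * 'I_m.+1) msize (P x.1.1 x.1.2 x.2))%N.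
have /boolp.choice [p hp] : forall x : 'I_m.+1 * 'I_m.+1 * 'I_m.+1, exists ph : S, ph \is N.-homog /\
    forall (R : comNzRingType) (psi : {rmorphism K -> R}) (y y' : 'I_m.+1 -> R),
    (forall j, y j = y x.1.1 * y' j) ->
    mmap psi y ph = y x.1.1 ^+ N * mmap psi y' (P x.1.1 x.1.2 x.2).
  by move=> x; apply: homogenize; rewrite (leq_bigmax x).
have [k [iota [x xgen]]] := generic_point K m.+1.
pose tf : {rmorphism S -> k} := mmap iota x.
have tf_inj : injective tf.
  move=> s t /eqP; rewrite -subr_eq0 -rmorphB => h; apply/eqP; rewrite -subr_eq0.
  by apply: contraTT h => /xgen.
have tfX i : tf 'X_i = x i by rewrite /tf /= mmapX mmap1U.
have xi i : x i != 0.
  by rewrite -tfX -(rmorph0 tf) (inj_eq tf_inj) mpolyX_neq0.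
pose psi i : {rmorphism S -> k} := mmap iota (fun l => x l / x i).
have psiE i b : psi i (jS b) = (iota \o j) b by rewrite /psi /jS /= mmapC.
have spanx i : sigma (R := alg_of (iota \o j)) (line_through (\row_l x l)) =
    span (map_mx (psi i) (P i)).
  have [h1 h2] := hP i; rewrite -(auto_natural (psiE i) (uvi i) h1 h2); congr (sigma _).
  have -> : map_mx (psi i) (vi i) = (x i)^-1 *: \row_l x l.
    apply/rowP => l; rewrite !mxE mulrC; case: eqP => [->|_]; first by rewrite rmorph1 divff.
    by rewrite /psi /= mmapX mmap1U.
  apply/seteqP; split=> _ [c _ <-].
    by exists (c * x i) => //; rewrite scalerA mulfK.
  by exists (c / x i) => //; rewrite scalerA.
have tfp i a b : tf (p (i, a, b)) = x i ^+ N * psi i (P i a b).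
  have [_ E] := hp (i, a, b); apply: (E k iota x (fun l => x l / x i)) => l /=.
  by rewrite mulrC divfK.
have prel i a b i' a' c : p (i, a, b) * p (i', a', c) = p (i, a, c) * p (i', a', b).
  apply: tf_inj; rewrite !rmorphM /= !tfp mulrACA [RHS]mulrACA; congr (_ * _).
  have h1 := rk1_map (psi i) (proj1 (hP i)); have h2 := rk1_map (psi i') (proj1 (hP i')).
  have := @rk1_rows _ _ _ _ a a' b c h1 h2; rewrite !mxE; apply.
  by rewrite -!spanx.
have ptr i : \sum_a p (i, a, a) = 'X_i ^+ N.
  apply: tf_inj; rewrite rmorph_sum rmorphXn /= tfX.
  under eq_bigr do rewrite tfp.
  rewrite -mulr_sumr -rmorph_sum -[X in psi i X]/(\tr (P i)).
  by have [[-> _] _] := hP i; rewrite rmorph1 mulr1.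
have [a0 pa0] : exists a, p (ord0, a, a) != 0.
  apply: contrapT => /forallNP h; have : 'X_(ord0 : 'I_m.+1) ^+ N != 0 :> S.
    by rewrite expf_neq0 // mpolyX_neq0.
  by rewrite -ptr big1 ?eqxx // => a _; have /negP/negPn/eqP := h a.
have [|d [f [fE fP]]] := @has_content_mpoly K m.+1 _ (fun b => p (ord0, a0, b)).
  by exists a0.
have d0 : d != 0 by apply: contraNneq pa0 => d0; rewrite fE d0 mul0r.
have fa0 : f a0 != 0 by apply: contraNneq pa0 => f0; rewrite fE f0 mulr0.
have pf i a b c : p (i, a, b) * f c = p (i, a, c) * f b.
  by apply: (mulfI d0); rewrite mulrCA -fE [RHS]mulrCA -fE.
have /boolp.choice [q hq] : forall x : 'I_m.+1 * 'I_m.+1, exists e, forall b, p (x, b) = e * f b.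
  move=> [i a]; have [|e eE] := fP (f a0) (p (i, a, a0)) fa0.
    by move=> b; exists (p (i, a, b)); rewrite -pf mulrC.
  exists e => b; apply: (mulIf fa0); rewrite pf eE; ring.
have dfh : d * f a0 \is N.-homog by rewrite -fE; case: (hp (ord0, a0, a0)).
have [d1 [d2 [hd1 hd2 dN]]] := homog_factor d0 fa0 dfh.
exists d2, f, N; split.
- move=> b; have [->|fb0] := eqVneq (f b) 0; first exact: rpred0.
  have := proj1 (hp (ord0, a0, b)); rewrite fE => /(homog_factor d0 fb0) [d1' [d2' [h1 h2 E]]].
  suff -> : d2 = d2' by [].
  have E1 : d1 = d1' by apply: dhomog_uniq hd1 h1.
  by apply/(@addnI d1); rewrite dN E1 E.
- move=> i; exists (fun b => q (i, b)); rewrite -ptr.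
  by apply: eq_bigr => a _; rewrite -hq.
move=> R psi' v i vi1; set F := \row_b _.
pose chi : {rmorphism S -> R} := mmap psi' (v 0).
have chiE b : chi (jS b) = (psi' \o j) b by rewrite /chi /jS /= mmapC.
have vE : map_mx chi (vi i) = v.
  apply/rowP => l; rewrite !mxE; case: eqP => [->|_]; first by rewrite rmorph1 vi1.
  by rewrite /chi /= mmapX mmap1U.
have [h1 h2] := hP i; have := auto_natural chiE (uvi i) h1 h2; rewrite vE => ->.
pose u : 'cV[R]_m.+1 := \col_a chi (q (i, a)).
have PE : map_mx chi (P i) = u *m F.
  apply/matrixP => a b; rewrite !mxE big_ord1 !mxE -rmorphM -hq.
  have [_ E] := hp (i, a, b); have := E R psi' (v 0) (v 0).
  by rewrite /= vi1 expr1n mul1r => <- // l; rewrite mul1r.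
have Fu : F *m u = 1%:M.
  have [t1 _] := rk1_map chi h1; rewrite [LHS]mx11_scalar; congr (_%:M).
  by rewrite -t1 PE mxtrace_mulC /mxtrace big_ord1.
by rewrite PE span_outer //; split=> //; exists u.
Qed.

End ProjectiveAutomorphism.

Lemma line_through_prop (k : fieldType) m (v w : 'rV[k]_m.+1) :
  line_through v = line_through w -> forall b c, v 0 b * w 0 c = v 0 c * w 0 b.
Proof.
move=> E b c; have [t _ <-] : line_through v w by rewrite E; exists 1; rewrite ?scale1r.
by rewrite !mxE; ring.
Qed.

Lemma line_throughZ (k : fieldType) m (v : 'rV[k]_m.+1) c : c != 0 ->
  line_through (c *: v) = line_through v.
Proof.
move=> c0; apply/seteqP; split=> _ [t _ <-].
  by exists (t * c) => //; rewrite scalerA.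
by exists (t / c) => //; rewrite scalerA divfK.
Qed.

(** Substituting the forms of sigma into those of its inverse gives q times the variables. At a zero
    of q the forms of sigma vanish, and then all variables do. Hence q divides powers of two
    variables, so it is constant, and the product of the two degrees is 1. *)
Lemma auto_matrix (B : comNzRingType) (K : fieldType) (j : {rmorphism B -> K}) n
    (sigma : forall R : comAlgType B, set 'rV[R]_n.+2 -> set 'rV[R]_n.+2) :
  @scheme_iso B n.+1 n.+1 [::] [::] sigma ->
  exists2 M : 'M[K]_n.+2, M \in unitmx &
    forall (R : comNzRingType) (psi : {rmorphism K -> R}) (v : 'rV[R]_n.+2) i, v 0 i = 1 ->
      sigma (alg_of (psi \o j)) (line_through v) = line_through (v *m map_mx psi M).
Proof.
move=> aut; have [tau [aut' tauK]] := auto_inverse aut.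
have [e [f [N [fh fX fE]]]] := auto_forms aut j.
have [e' [h [N' [hh hX hE]]]] := auto_forms aut' j.
pose S := {mpoly K[n.+2]}.
have [k [iota [x xgen]]] := generic_point K n.+2.
pose tf : {rmorphism S -> k} := mmap iota x.
have tf_inj : injective tf.
  move=> s t /eqP; rewrite -subr_eq0 -rmorphB => H; apply/eqP; rewrite -subr_eq0.
  by apply: contraTT H => /xgen.
have tfX i : tf 'X_i = x i by rewrite /tf /= mmapX mmap1U.
have xi i : x i != 0.
  by rewrite -tfX -(rmorph0 tf) (inj_eq tf_inj) mpolyX_neq0.
pose t := [tuple f b | b < n.+2].
pose H b : S := h b \mPo t.
have HX b c : H b * 'X_c = H c * 'X_b.
  pose vx : 'rV[k]_n.+2 := (x ord0)^-1 *: \row_l x l.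
  have vx0 : vx 0 ord0 = 1 by rewrite !mxE mulVf.
  have [[u uf] sE] := fE k iota vx ord0 vx0.
  pose y : 'rV[k]_n.+2 := \row_b tf (f b).
  have fy : \row_b ev iota vx (f b) = (x ord0)^-1 ^+ e *: y.
    apply/rowP => l; rewrite !mxE (ev_homogZ _ _ _ (fh l)); congr (_ * _).
    by apply: eq_mmap => // a; rewrite mxE.
  have xe0 : (x ord0)^-1 ^+ e != 0 by rewrite expf_neq0 // invr_eq0.
  have [i yi] : exists i, y 0 i != 0.
    apply: contrapT => /forallNP y0; have /matrixP /(_ 0 0) := uf.
    have -> : \row_b ev iota vx (f b) = 0.
      by rewrite fy; apply/rowP => l; have /negP/negPn/eqP := y0 l; rewrite !mxE => ->; rewrite mulr0.
    by rewrite mul0mx !mxE eqxx => /eqP; rewrite eq_sym oner_eq0.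
  have wi : ((y 0 i)^-1 *: y) 0 i = 1 by rewrite mxE mulVf.
  have [_ tE] := hE k iota _ _ wi.
  have := tauK (alg_of (iota \o j)) (line_through vx).
  have sE' : sigma (alg_of (iota \o j)) (line_through vx) = line_through ((y 0 i)^-1 *: y).
    by rewrite sE fy !line_throughZ ?invr_eq0.
  rewrite sE' tE.
  move=> E; have {E} := E (proj2 (line_proj vx) (unimod_coord vx0)).
  move=> /line_through_prop /(_ b c); rewrite !mxE.
  rewrite !(ev_homogZ _ _ _ (hh _)).
  have tfH l : ev iota y (h l) = tf (H l).
    by rewrite /tf /= mmap_comp_mpoly; apply: eq_mmap => // a; rewrite mxE tnth_mktuple.
  rewrite !tfH => E; apply: tf_inj; rewrite !rmorphM /= !tfX.
  have c0 : ((y 0 i)^-1 ^+ e') * (x ord0)^-1 != 0 by rewrite mulf_neq0 ?expf_neq0 ?invr_eq0.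
  apply: (mulfI c0); rewrite mulrACA [RHS]mulrACA.
  have -> : y 0 i = tf (f i) by rewrite mxE.
  exact: E.
pose i1 : 'I_n.+2 := lift ord0 ord0.
have i01 : ord0 != i1 by exact: neq_lift.
have [q qE] : rdvd 'X_ord0 (H ord0).
  apply: (@monom_coprime K n.+2 ord0 i1 1 1) => //; first by exists (H ord0); rewrite expr1 mulrC.
  by rewrite expr1 HX; exists (H i1); rewrite mulrC.
have Hq b : H b = q * 'X_b.
  apply: (mulIf (mpolyX_neq0 K ord0)); rewrite HX qE; ring.
have qX i : exists M, rdvd q ('X_i ^+ M).
  apply: contrapT => /forallNP nq; have idq : is_ideal [set p | rdvd q p].
    by split=> [|a b|a b]; [exact: rdvd0 | exact: rdvdD | exact: rdvdMl].
  have [F [phi [_ phiq phiX]]] := krull idq nq.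
  have phif b : phi (f b) = 0.
    apply/eqP; rewrite -(negbK (_ == 0)); apply/negP => fb.
    have := expf_neq0 N' fb; rewrite -rmorphXn phiq ?eqxx //.
    have [a aE] := hX b; have := congr1 (fun s => s \mPo t) aE.
    rewrite rmorphXn /= comp_mpolyXU -tnth_nth tnth_mktuple => ->; rewrite raddf_sum.
    apply: rdvd_sum => l _; rewrite [X in rdvd q X](_ : _ = (a l \mPo t) * H l); last exact: rmorphM.
    by rewrite Hq; exists ((a l \mPo t) * 'X_l); rewrite mulrCA.
  have [a aE] := fX i; have := expf_neq0 N phiX; rewrite -rmorphXn aE rmorph_sum big1 ?eqxx //.
  by move=> b _; rewrite rmorphM /= phif mulr0.
have [M0 q0] := qX ord0; have [M1 q1] := qX i1.
have [c cE] : rdvd q 1 by apply: (@monom_coprime K n.+2 ord0 i1 M0 M1) => //; rewrite mul1r.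
have [qn0 cn0] : q != 0 /\ c != 0 by apply/andP; rewrite -negb_or -mulf_eq0 -cE oner_eq0.
have e1 : e = 1%N.
  have qc : q * c \is 0%N.-homog by rewrite -cE; exact: dhomog1.
  have [d1 [d2 [hq _ /eqP]]] := homog_factor qn0 cn0 qc.
  rewrite addn_eq0 => /andP [/eqP d10 _]; rewrite {}d10 in hq.
  have H1 : H ord0 \is 1.-homog.
    by rewrite Hq -[1%N]/(0 + 1)%N dhomogM // dhomogX /= mdeg1.
  have H2 : H ord0 \is (e * e')%N.-homog.
    by apply: comp_dhomog => // i; rewrite tnth_mktuple.
  have H0 : H ord0 != 0 by rewrite Hq mulf_neq0 // mpolyX_neq0.
  by have /eqP := dhomog_uniq H0 H1 H2; rewrite eq_sym muln_eq1 => /andP [/eqP].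
pose M : 'M[K]_n.+2 := \matrix_(a, b) (f b)@_U_(a).
have fM b : f b = \sum_a M a b *: 'X_a.
  apply/mpolyP => m; rewrite raddf_sum /=.
  have [/mdeg1P [i /eqP ->]|m1] := boolP (mdeg m == 1%N).
    rewrite (bigD1 i) //= mcoeffZ mcoeffX eqxx mulr1 mxE big1 ?addr0 // => l li.
    by rewrite mcoeffZ mcoeffX eq_mnm1 (negPf li) mulr0.
  rewrite (dhomog_nemf_coeff (fh b)) ?e1 // big1 // => l _.
  by rewrite mcoeffZ mcoeffX; case: eqP => [lm|]; [move: m1; rewrite -lm mdeg1 | rewrite mulr0].
have fev (R : comNzRingType) (psi : {rmorphism K -> R}) (v : 'rV[R]_n.+2) :
    \row_b ev psi v (f b) = v *m map_mx psi M.
  apply/rowP => b; rewrite !mxE fM rmorph_sum; apply: eq_bigr => a _ /=.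
  by rewrite mmapZ mmapX mmap1U !mxE mulrC.
exists M; last by move=> R psi v i vi; rewrite -fev; apply: (proj2 (fE R psi v i vi)).
(* A kernel vector of M is a common zero of the f b, whose ideal contains powers of all
   variables. *)
rewrite -row_free_unit -kermx_eq0; apply/rowV0P => z /sub_kermxP zM.
apply/rowP => i; rewrite mxE; have [a aE] := fX i.
have := congr1 (mmap idfun (z 0)) aE; rewrite rmorphXn /= mmapX mmap1U rmorph_sum big1.
  by move=> /eqP; rewrite expf_eq0 => /andP [_ /eqP].
move=> b _; rewrite rmorphM /=.
have /rowP/(_ b) := fev K idfun z.
have -> : map_mx idfun M = M by apply/matrixP => ? ?; rewrite mxE.
by rewrite zM !mxE => ->; rewrite mulr0.
Qed.

(** * Number fields and their finite places *)

Import Num.Theory Order.TTheory.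
Import VectorInternalTheory.

Section NumberField.
Variable K : fieldExtType rat.
Local Notation OK := (@ring_of_integers K).
Local Notation d := (dim K).
Local Notation intK := (intmul 1 : int -> K).

Lemma OK_int (n : int) : OK n%:~R. Proof. exact: integral_id. Qed.
Lemma OKD x y : OK x -> OK y -> OK (x + y). Proof. exact: integral_add. Qed.
Lemma OKB x y : OK x -> OK y -> OK (x - y). Proof. exact: integral_sub. Qed.
Lemma OKM x y : OK x -> OK y -> OK (x * y). Proof. exact: integral_mul. Qed.
Lemma OK0 : OK 0. Proof. exact: integral0. Qed.
Lemma OK1 : OK 1. Proof. exact: integral1. Qed.

Lemma OK_sum (I : Type) (r : seq I) (P : pred I) (F : I -> K) :
  (forall i, P i -> OK (F i)) -> OK (\sum_(i <- r | P i) F i).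
Proof. by move=> h; apply: (big_ind OK) => //; [exact: OK0 | exact: OKD]. Qed.

Lemma OK_exp x n : OK x -> OK (x ^+ n).
Proof.
by move=> hx; elim: n => [|n IHn]; rewrite ?expr0 ?exprS; [exact: OK1 | exact: OKM].
Qed.

Lemma intrK_inj : injective (fun n : int => n%:~R : K).
Proof.
move=> a b /eqP; rewrite -subr_eq0 -rmorphB /= -(rmorph_int (in_alg K)).
by rewrite fmorph_eq0 intr_eq0 subr_eq0 => /eqP.
Qed.

Lemma intrK_eq0 (n : int) : (n%:~R == 0 :> K) = (n == 0).
Proof. by rewrite -(inj_eq intrK_inj). Qed.

(** The regular representation, on row vectors; [nrm] is the norm of K over the rationals. *)
Definition mulmat (x : K) : 'M[rat]_d := \matrix_i v2r (r2v (delta_mx 0 i) * x).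

Lemma mulmatE u x : u *m mulmat x = v2r (r2v u * x).
Proof.
rewrite [in RHS](row_sum_delta u) mulmx_sum_row linear_sum mulr_suml linear_sum.
by apply: eq_bigr => i _; rewrite rowK linearZ -scalerAl linearZ.
Qed.

Lemma mulmatP (A : 'M[rat]_d) x : (forall u, u *m A = v2r (r2v u * x)) -> A = mulmat x.
Proof. by move=> h; apply/row_matrixP => i; rewrite !rowE h mulmatE. Qed.

Lemma mulmatM x y : mulmat (x * y) = mulmat x *m mulmat y.
Proof. by apply/esym/mulmatP => u; rewrite mulmxA !mulmatE v2rK mulrA. Qed.

Lemma mulmatD x y : mulmat (x + y) = mulmat x + mulmat y.
Proof. by apply/esym/mulmatP => u; rewrite mulmxDr !mulmatE mulrDr linearD. Qed.

Lemma mulmatZ c x : mulmat (c *: x) = c *: mulmat x.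
Proof. by apply/esym/mulmatP => u; rewrite -scalemxAr !mulmatE -scalerAr linearZ. Qed.

Lemma mulmat1 : mulmat 1 = 1%:M.
Proof. by apply/esym/mulmatP => u; rewrite mulmx1 mulr1 r2vK. Qed.

Definition nrm x := \det (mulmat x).

Lemma nrmM x y : nrm (x * y) = nrm x * nrm y.
Proof. by rewrite /nrm mulmatM det_mulmx. Qed.

Lemma nrm_eq0 x : nrm x = 0 -> x = 0.
Proof.
move=> n0; apply/eqP; apply: contraT => x0; have := nrmM x x^-1.
by rewrite divff // /nrm mulmat1 det1 -/(nrm x) n0 mul0r => /eqP; rewrite oner_eq0.
Qed.

(* The order of the elements that are integral matrices in the chosen basis of K. *)
Definition order (x : K) : Prop := exists A : 'M[int]_d, mulmat x = map_mx intr A.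

Lemma dimK_gt0 : (0 < d)%N.
Proof.
have : v2r (1 : K) != 0.
  by apply/negP => /eqP; rewrite -[0](raddf0 v2r) => /v2r_inj /eqP; rewrite oner_eq0.
by case: d (v2r (1 : K)) => // u; rewrite thinmx0 eqxx.
Qed.

(** The chosen basis of K, as a vector over K, is an eigenvector of the transposed integral matrix
    with eigenvalue x. *)
Lemma order_integral x : order x -> OK x.
Proof.
move=> [A xA]; exists (char_poly A^T); first exact: char_poly_monic.
have -> : map_poly intK (char_poly A^T) = char_poly (map_mx intK A^T).
  by rewrite map_char_poly.
rewrite -eigenvalue_root_char; apply/eigenvalueP.
exists (\row_j r2v (delta_mx 0 j)).
  apply/rowP => i; rewrite !mxE -[RHS]mulrC -[RHS]v2rK -[r2v _ in RHS]mul1r.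
  rewrite mul1r -mulmatE xA.
  rewrite [X in r2v X](row_sum_delta) linear_sum; apply: eq_bigr => j _.
  rewrite !mxE linearZ (bigD1 i) //= !mxE !eqxx mul1r big1 => [|l li]; last first.
    by rewrite !mxE (negPf li) mul0r.
  rewrite addr0 mulrC -(rmorph_int (in_alg K)) /= -scalerAl mul1r.
  by [].
apply/negP => /eqP/rowP h; have d0 := dimK_gt0.
have := h (Ordinal d0); rewrite !mxE => /(congr1 v2r); rewrite r2vK linear0 => /rowP/(_ (Ordinal d0)).
by rewrite !mxE !eqxx.
Qed.

Lemma orderM x y : order x -> order y -> order (x * y).
Proof. by move=> [A xA] [B yB]; exists (A *m B); rewrite mulmatM xA yB map_mxM. Qed.

Lemma orderD x y : order x -> order y -> order (x + y).
Proof. by move=> [A xA] [B yB]; exists (A + B); rewrite mulmatD xA yB map_mxD. Qed.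

Lemma order_int (n : int) : order n%:~R.
Proof.
exists n%:M; rewrite -(rmorph_int (in_alg K)) /= mulmatZ mulmat1 map_scalar_mx.
by rewrite scalemx1.
Qed.

Lemma order_sum (I : Type) (r : seq I) (P : pred I) (F : I -> K) :
  (forall i, P i -> order (F i)) -> order (\sum_(i <- r | P i) F i).
Proof. by move=> h; apply: (big_ind order) => //; [exact: (order_int 0) | exact: orderD]. Qed.

Lemma nrm_order x : order x -> exists z : int, nrm x = z%:~R.
Proof. by move=> [A xA]; exists (\det A); rewrite /nrm xA det_map_mx. Qed.

Lemma rat_frac (z : rat) : exists a b : int, b != 0 /\ z = a%:~R / b%:~R.
Proof. by exists (numq z), (denq z); rewrite denq_neq0 divq_num_den. Qed.

Lemma rat_common_denom (I : finType) (z : I -> rat) :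
  exists (b : int) (h : I -> int), b != 0 /\ forall i, b%:~R * z i = (h i)%:~R.
Proof.
by apply: (@common_denom int rat intr I z) => //; [exact: intr_inj | exact: rat_frac].
Qed.

(** D is a common denominator of the structure constants of the multiplication. *)
Lemma lattice_ex : exists D : int, D != 0 /\
  forall u : 'rV[int]_d, order (r2v (D%:~R *: map_mx intr u)).
Proof.
have [D [h [D0 hE]]] := rat_common_denom
  (fun x : 'I_d * 'I_d * 'I_d => v2r (r2v (delta_mx 0 x.1.1) * r2v (delta_mx 0 x.1.2) : K) 0 x.2).
exists D; split=> // u; exists (\matrix_(i, j) \sum_k u 0 k * h (i, k, j)).
apply/matrixP => i j; rewrite !mxE (row_sum_delta (map_mx _ _)) scaler_sumr linear_sum mulr_sumr.
rewrite linear_sum summxE rmorph_sum; apply: eq_bigr => k _.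
rewrite rmorphM /= -hE /= !linearZ /= -scalerAr linearZ -scalerAr linearZ !mxE.
by rewrite mulrCA.
Qed.

Lemma order_frac (I : finType) (z : I -> K) :
  exists c : int, c != 0 /\ forall i, order (c%:~R * z i).
Proof.
have [D [D0 hD]] := lattice_ex.
have [b [h [b0 hE]]] := rat_common_denom (fun x : I * 'I_d => v2r (z x.1) 0 x.2).
exists (D * b); split=> [|i]; first by rewrite mulf_neq0.
have := hD (\row_j h (i, j)); congr order; rewrite rmorphM /= -mulrA.
rewrite -!(rmorph_int (in_alg K)) /= !mulr_algl linearZ; congr (_ *: _).
rewrite -[z i in RHS]v2rK -linearZ; congr (r2v _); apply/rowP => j.
by rewrite !mxE -hE.
Qed.

Lemma det_bound n (A : 'M[rat]_n) B : (forall i j, `|A i j| <= B) ->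
  `|\det A| <= (n`!)%:R * B ^+ n.
Proof.
move=> hA; apply: (le_trans (ler_norm_sum _ _ _)).
apply: (@le_trans _ _ (\sum_(s : 'S_n) B ^+ n)); last first.
  by rewrite sumr_const card_Sn mulr_natl.
apply: ler_sum => s _; rewrite normrM normrX normrN1 expr1n mul1r normr_prod.
rewrite -[X in B ^+ X]card_ord -prodr_const; apply: ler_prod => i _.
by rewrite normr_ge0 hA.
Qed.

(* Pigeonhole on the multiples of a modulo the order: this is the finiteness of the class number. *)
Lemma nrm_approx : exists M : nat, (0 < M)%N /\ forall a : K, exists t b,
  [/\ (0 < t <= M)%N, order b & `|nrm (t%:R * a - b)| < 1].
Proof.
have [D [D0 hD]] := lattice_ex.
have D0' : D%:~R != 0 :> rat by rewrite intr_eq0.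
pose H k := mulmat (r2v (D%:~R *: delta_mx 0 k)).
pose B : rat := \sum_(x : 'I_d * 'I_d * 'I_d) `|H x.1.1 x.1.2 x.2|.
have B0 : 0 <= B by apply: sumr_ge0.
(* With coordinates of absolute value at most 1/m the norm is below 1, by the Leibniz bound for
   determinants. *)
pose m := (Num.bound ((d`!)%:R * B ^+ d)).+1.
have mB : (d`!)%:R * B ^+ d < m%:R.
  apply: lt_trans (archi_boundP _) _; first by rewrite mulr_ge0 ?exprn_ge0 ?ler0n.
  by rewrite ltr_nat.
have m0 : 0 < m%:R :> rat by rewrite ltr0n.
have small (y : 'rV[rat]_d) : (forall k, `|y 0 k| <= m%:R^-1) ->
    `|nrm (r2v (D%:~R *: y))| < 1.
  move=> hy; have E : mulmat (r2v (D%:~R *: y)) = \sum_k y 0 k *: H k.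
    apply/esym/mulmatP => u; rewrite mulmx_sumr [in RHS](row_sum_delta y) scaler_sumr.
    rewrite linear_sum mulr_sumr linear_sum; apply: eq_bigr => k _; rewrite -scalemxAr /H mulmatE.
    by rewrite !linearZ /= -!scalerAr !linearZ /= !scalerA mulrC.
  have hE i j : `|mulmat (r2v (D%:~R *: y)) i j| <= m%:R^-1 * B.
    rewrite E summxE; apply: (le_trans (ler_norm_sum _ _ _)).
    apply: (@le_trans _ _ (\sum_k m%:R^-1 * `|H k i j|)).
      by apply: ler_sum => k _; rewrite mxE normrM ler_wpM2r.
    rewrite -mulr_sumr ler_wpM2l ?invr_ge0 ?ler0n //.
    rewrite /B -(pair_big xpredT xpredT (fun x c => `|H x.1 x.2 c|)) /=.
    rewrite -(pair_big xpredT xpredT (fun a b => \sum_c `|H a b c|)) /=.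
    apply: ler_sum => k _; rewrite (bigD1 i) //= (bigD1 j) //= -addrA lerDl.
    by rewrite addr_ge0 // !sumr_ge0 // => *; rewrite sumr_ge0.
  apply: (le_lt_trans (det_bound hE)); rewrite exprMn mulrCA.
  apply: (@le_lt_trans _ _ (m%:R^-1 * ((d`!)%:R * B ^+ d))); last first.
    by rewrite ltr_pdivrMl // mulr1.
  rewrite ler_wpM2r ?mulr_ge0 ?exprn_ge0 ?ler0n // exprVn lef_pV2 ?posrE ?exprn_gt0 //.
  by rewrite -[X in X <= _]expr1 ler_weXn2l ?dimK_gt0 // ler1n.
(* The fractional parts of m^d + 1 multiples of the coordinates fall into m^d boxes. Two share a
   box, and t is the difference of their indices. *)
exists (m ^ d)%N; split; first by rewrite expn_gt0.
move=> a; have [g aE] : exists g : 'rV[rat]_d, a = r2v (D%:~R *: g).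
  by exists (D%:~R^-1 *: v2r a); rewrite scalerA divff // scale1r v2rK.
pose fr (t : nat) k : rat := t%:R * g 0 k - (Num.floor (t%:R * g 0 k))%:~R.
have fr01 t k : 0 <= fr t k < 1.
  have /andP [h1 h2] := floor_itv (t%:R * g 0 k).
  by rewrite subr_ge0 h1 /= ltrBlDl -[X in _ < _ + X]/(1%:~R) -intrD.
have bx_lt t k : (`|Num.floor (m%:R * fr t k)|%N < m)%N.
  have /andP [f0 f1] := fr01 t k.
  have fl0 : 0 <= Num.floor (m%:R * fr t k) by rewrite floor_ge0 mulr_ge0 // ltW.
  rewrite -ltz_nat gez0_abs // floor_lt_int -[X in _ < X]mulr1 -[X in _ < X * _]/(m%:R).
  by rewrite ltr_pM2l.
pose bx (t : 'I_(m ^ d).+1) : {ffun 'I_d -> 'I_m} := [ffun k => Ordinal (bx_lt t k)].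
have [t1 [t2 [t12 bE]]] : exists t1 t2 : 'I_(m ^ d).+1, (t1 < t2)%N /\ bx t1 = bx t2.
  have : ~~ injectiveb bx.
    apply/injectiveP => /leq_card; rewrite card_ffun !card_ord leqNgt; by rewrite ltnSn.
  move=> /injectivePn [x [y xy bxy]]; have [lt|lt|/val_inj E] := ltngtP x y.
  - by exists x, y.
  - by exists y, x.
  - by rewrite E eqxx in xy.
pose u : 'rV[int]_d := \row_k (Num.floor (t2%:R * g 0 k) - Num.floor (t1%:R * g 0 k)).
exists (t2 - t1)%N, (r2v (D%:~R *: map_mx intr u)); split=> //.
  by rewrite subn_gt0 t12 (leq_trans (leq_subr _ _)) // -ltnS.
rewrite {1}aE -(rmorph_nat (in_alg K)) /= mulr_algl -linearZ -linearB scalerA mulrC -scalerA -scalerBr.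
apply: small => k; have /ffunP/(_ k) := bE; rewrite !ffunE => /(congr1 val) /= fE.
have -> : ((t2 - t1)%:R *: g - map_mx intr u) 0 k = fr t2 k - fr t1 k.
  rewrite !mxE natrB 1?ltnW // rmorphB /= /fr; ring.
have fge t : 0 <= Num.floor (m%:R * fr t k).
  by have /andP [h _] := fr01 t k; rewrite floor_ge0 mulr_ge0 // ltW.
have {}fE : Num.floor (m%:R * fr t1 k) = Num.floor (m%:R * fr t2 k).
  by rewrite -[LHS]gez0_abs // -[RHS]gez0_abs // fE.
rewrite -(ler_pM2l m0) divff ?gt_eqF // -[X in X * _]gtr0_norm // -normrM mulrBr.
have /andP [a1 a2] := floor_itv (m%:R * fr t1 k); have /andP [b1 b2] := floor_itv (m%:R * fr t2 k).
rewrite fE in a1 a2; rewrite intrD in a2 b2.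
rewrite ler_norml; apply/andP; split.
  rewrite lerBrDl -lerBrDr opprK; apply: ltW; apply: (lt_le_trans a2); by rewrite lerD2r.
rewrite lerBlDl; apply: ltW; apply: (lt_le_trans b2); by rewrite lerD2r.
Qed.

End NumberField.

(** * Finite places as valuations *)

Section Places.
Variable K : fieldExtType rat.
Local Notation OK := (@ring_of_integers K).
Implicit Types (p q : set K) (x y : K).

(** Multiplied by the n-th power of c 0, the equation becomes monic in c 0 x. *)
Lemma deflate_lead (c : nat -> K) n x : (forall i, OK (c i)) ->
  \sum_(i < n.+2) c i * x ^+ (n.+1 - i) = 0 -> OK (c 0%N * x).
Proof.
move=> hc E; pose r : {poly K} := \poly_(j < n.+1) (c (n.+1 - j)%N * c 0%N ^+ (n - j)).
pose q : {poly K} := 'X^(n.+1) + r.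
have qlt : (size r < size ('X^(n.+1) : {poly K}))%N by rewrite size_polyXn ltnS size_poly.
have qm : q \is monic by rewrite monicE lead_coefDl // lead_coefXn.
apply: (integral_root_monic qm); last first.
  apply/integral_poly => i; rewrite coefD coefXn coef_poly; apply: integral_add.
    exact: integral_nat.
  by case: ifP => _; [apply: OKM => //; exact: OK_exp | exact: OK0].
rewrite /root /q hornerD hornerXn horner_poly; apply/eqP.
rewrite -[RHS](mulr0 (c 0%N ^+ n)) -[X in _ = _ * X]E mulr_sumr [RHS]big_ord_recl /= subn0; congr (_ + _).
  by rewrite exprMn [c 0%N ^+ n.+1]exprSr mulrA.
rewrite (reindex_inj rev_ord_inj) /=; apply: eq_bigr => i _; rewrite /bump leq0n add1n.
have iN : (i <= n)%N by rewrite -ltnS.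
rewrite subSS subSn ?leq_subr // subKn // exprMn [in RHS]mulrCA -!mulrA; congr (_ * _).
by rewrite mulrA -exprD subnKC // subSS.
Qed.

(** The Horner partial sums of an equation of x are integral: c 0 x is, and c 0 x + c 1 is then the
    leading coefficient of an equation of lower degree. *)
Lemma deflate (c : nat -> K) n x : (forall i, OK (c i)) ->
  \sum_(i < n.+1) c i * x ^+ (n - i) = 0 ->
  forall k, (k <= n)%N -> OK (\sum_(i < k.+1) c i * x ^+ (k - i)).
Proof.
elim: n c => [|n IHn] c hc E k kn.
  by move: kn; rewrite leqn0 => /eqP ->; rewrite E; exact: OK0.
have hc0 := deflate_lead hc E.
case: k kn => [|k] kn; first by rewrite big_ord1 subnn expr0 mulr1.
pose c' i := if i is i'.+1 then c i'.+2 else c 0%N * x + c 1%N.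
have sE l : \sum_(i < l.+2) c i * x ^+ (l.+1 - i) = \sum_(i < l.+1) c' i * x ^+ (l - i).
  rewrite big_ord_recl [X in _ + X]big_ord_recl addrA [in RHS]big_ord_recl.
  by congr (_ + _); rewrite /= /bump /= !subn0 subSS subn0 mulrDl exprS mulrA.
rewrite sE; apply: IHn => //; last by rewrite -sE.
by case=> [|i] //=; exact: OKD.
Qed.

Lemma poly_int_bezout (s : seq int) : exists (u : seq int) (g : int),
  \sum_(i < size s) u`_i * s`_i = g /\ forall i, exists c, s`_i = c * g.
Proof.
elim: s => [|a s [u [g [gE gd]]]].
  by exists [::], 0; rewrite big_ord0; split=> // i; exists 0; rewrite nth_nil mul0r.
have [y [z yz]] := Bezoutz a g.
exists (y :: [seq z * t | t <- take (size s) u]), (gcdz a g); split=> [|[|i]] /=.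
- rewrite big_ord_recl /= -[in RHS]yz; congr (_ + _); rewrite -[in RHS]gE mulr_sumr.
  apply: eq_bigr => i _; rewrite /= mulrA; congr (_ * _).
  have [iu|ui] := ltnP i (size (take (size s) u)).
    by rewrite (nth_map 0) // nth_take ?ltn_ord.
  rewrite nth_default ?size_map //; rewrite size_take_min geq_min in ui.
  by rewrite leqNgt ltn_ord /= in ui; rewrite nth_default ?mulr0.
- by have /dvdzP [c cE] := dvdz_gcdl a g; exists c.
- have [c ->] := gd i; have /dvdzP [e gE'] := dvdz_gcdr a g.
  by exists (c * e); rewrite [in LHS]gE' mulrA.
Qed.

Lemma algebraic_int x : exists p : {poly int}, p != 0 /\ (map_poly intr p).[x] = 0.
Proof.
have [c [c0 /(_ tt) cx]] := @order_frac K unit (fun=> x).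
have [p pm p0] := order_integral cx.
exists (p \Po (c *: 'X)); split.
  have sc : size (c *: 'X : {poly int}) = 2%N by rewrite size_scale ?size_polyX.
  by rewrite comp_poly2_eq0 ?monic_neq0.
rewrite map_comp_poly horner_comp map_polyZ /= map_polyX hornerZ hornerX.
by apply/eqP.
Qed.

(** b and b' lie in the inverse of the fractional ideal (1, x) and show that it is invertible. They
    come from an integral equation of x whose coefficients have been divided by their gcd: a Bezout
    relation for these coefficients is rewritten by expressing each one as a Horner partial sum
    minus x times the preceding one. *)
Lemma integral_denominators x : exists b b', [/\ OK b, OK b', OK (b * x), OK (b' * x)
  & b + b' * x = 1].
Proof.
have [p [p0 px]] := algebraic_int x.
have [u [g [gE gd]]] := poly_int_bezout p.
have g0 : g != 0.
  apply: contraNneq p0 => g0; apply/eqP/polyP => i; have [c ->] := gd i.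
  by rewrite g0 mulr0 coef0.
have [e eE] := boolp.choice gd.
have ue : \sum_(i < size p) u`_i * e i = 1.
  apply: (mulIf g0); rewrite mul1r -[in RHS]gE mulr_suml; apply: eq_bigr => i _.
  by rewrite -mulrA -eE.
pose n := (size p).-1; have sp : size p = n.+1 by rewrite /n prednK // lt0n size_poly_eq0.
pose c i : K := (e (n - i)%N)%:~R.
have hc i : OK (c i) by exact: OK_int.
have E : \sum_(i < n.+1) c i * x ^+ (n - i) = 0.
  apply: (@mulIf _ (g%:~R : K)); first by rewrite intrK_eq0.
  rewrite mul0r -[RHS]px horner_coef size_map_poly_id0 ?sp; last first.
    by rewrite intrK_eq0 lead_coef_eq0.
  rewrite mulr_suml [RHS](reindex_inj rev_ord_inj); apply: eq_bigr => i _ /=.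
  by rewrite coef_map /= eE rmorphM /= subSS mulrAC.
pose b k := \sum_(i < k.+1) c i * x ^+ (k - i).
have hb k : (k <= n)%N -> OK (b k) by exact: (deflate hc E).
have bS k : b k.+1 = b k * x + c k.+1.
  rewrite /b big_ord_recr /= subnn expr0 mulr1; congr (_ + _); rewrite mulr_suml.
  by apply: eq_bigr => i _; rewrite -mulrA -exprSr subSn // -ltnS.
have hbx k : (k <= n)%N -> OK (b k * x).
  rewrite leq_eqVlt => /orP [/eqP ->|kn]; first by rewrite /b E mul0r; exact: OK0.
  by rewrite -[b k * x](addrK (c k.+1)) -bS; apply: OKB => //; exact: hb.
pose U i : K := (u`_(n - i))%:~R; have hU i : OK (U i) by exact: OK_int.
exists (\sum_(i < n.+1) U i * b i), (- \sum_(i < n) U i.+1 * b i).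
have h1 : OK (\sum_(i < n.+1) U i * b i).
  by apply: OK_sum => i _; apply: OKM => //; apply: hb; rewrite -ltnS.
have OKN y : OK y -> OK (- y) by rewrite -[- y]add0r; apply: OKB; exact: OK0.
have h2 : OK (- \sum_(i < n) U i.+1 * b i).
  by apply/OKN/OK_sum => i _; apply: OKM => //; apply/hb/ltnW.
split=> //.
- rewrite mulr_suml; apply: OK_sum => i _; rewrite -mulrA; apply: OKM => //.
  by apply: hbx; rewrite -ltnS.
- rewrite mulNr; apply: OKN; rewrite mulr_suml; apply: OK_sum => i _; rewrite -mulrA.
  by apply: OKM => //; apply/hbx/ltnW.
transitivity (\sum_(i < n.+1) U i * c i); last first.
  rewrite -[RHS](rmorph1 (intmul 1 : int -> K)) /= -ue sp rmorph_sum.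
  rewrite [RHS](reindex_inj rev_ord_inj); apply: eq_bigr => i _ /=.
  by rewrite subSS rmorphM.
rewrite big_ord_recl [RHS]big_ord_recl mulNr -addrA; congr (_ + _).
  by rewrite /b big_ord1 subnn expr0 mulr1.
rewrite mulr_suml -sumrB; apply: eq_bigr => i _.
by rewrite -mulrA -mulrBr bS addrAC subrr add0r.
Qed.

(** In b + b' x = 1 either b is not in p and x = (b x) / b, or b' x is not in p and the inverse of x
    is b' / (b' x). *)
Lemma place_integral p x : finite_place p -> x != 0 ->
  integral_at p x \/ integral_at p x^-1.
Proof.
move=> [_ [_ p1] pD _ _] x0; have [b [b' [hb hb' hbx hb'x E]]] := integral_denominators x.
have [pb|pb] := pselect (p b); last by left; exists (b * x), b; split=> //; rewrite mulrC.
right; exists b', (b' * x); split=> //; last by rewrite mulrCA mulVf // mulr1.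
by move=> pb'; apply: p1; rewrite -E; apply: pD.
Qed.

(** The integer is the constant coefficient of an equation of a nonzero element of p, divided by the
    variable until this coefficient is nonzero. *)
Lemma place_has_int p : finite_place p -> exists z : int, z != 0 /\ p z%:~R.
Proof.
move=> [pO [[a pa a0] p1] pD pM ppr]; have [f fm fx] := pO _ pa.
have fx0 : (map_poly intr f).[a] = 0 by apply/eqP.
move: fm fx0 => /monic_neq0; clear fx; have [n] := ubnP (size f).
elim: n f => // n IHn f fn f0 fx.
pose g := drop_poly 1 f.
have fE : f = g * 'X + (f`_0)%:P.
  rewrite -{1}(poly_take_drop 1 f) addrC expr1; congr (_ + _).
  by apply/polyP => -[|i]; rewrite coef_take_poly coefC.
have gx : OK (map_poly intr g).[a].
  apply: integral_horner (pO _ pa); apply/integral_poly => i.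
  by rewrite coef_map; exact: OK_int.
move: fx; rewrite {1}fE rmorphD rmorphM /= map_polyX map_polyC hornerD hornerMX hornerC /= => fx.
have [z0|z0] := eqVneq f`_0 0; last first.
  exists f`_0; split=> //; rewrite -[_%:~R]add0r -(subrr ((map_poly intr g).[a] * a)) addrAC fx sub0r.
  rewrite -mulNr; apply: pM => //; rewrite -[- _]add0r; apply: OKB gx; exact: OK0.
have sf : (0 < size f)%N by rewrite lt0n size_poly_eq0.
apply: (IHn g).
- by rewrite size_drop_poly subn1 -ltnS prednK.
- by apply: contraNneq f0 => g0; rewrite fE g0 z0 mul0r polyC0 addr0.
- by move: fx; rewrite z0 addr0 => /eqP; rewrite mulf_eq0 (negPf a0) orbF => /eqP.
Qed.

Lemma place_prime p : finite_place p ->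
  exists2 l : nat, prime l & forall z : int, p z%:~R <-> (l%:Z %| z)%Z.
Proof.
move=> hp; have [z [z0 pz]] := place_has_int hp; have [pO [_ p1] pD pM ppr] := hp.
have pN y : p y -> p (- y) by move=> py; rewrite -mulN1r; apply: pM => //; exact: (OK_int _ (-1)).
have [l lpr pl] : exists2 l : nat, prime l & p (l%:Z)%:~R.
  have : p (`|z|%N%:Z)%:~R.
    by rewrite abszE; case: (ger0P z) => // _; rewrite rmorphN; apply: pN.
  have : (0 < `|z|)%N by rewrite lt0n absz_eq0.
  move: `|z|%N => t; have [n] := ubnP t; elim: n t => // n IHn t tn t0 pt.
  have [t1|t1] := leqP t 1.
    by case: p1; have -> : 1 = (t%:Z)%:~R :> K by rewrite (_ : t = 1%N) //; apply/eqP; rewrite eqn_leq t1.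
  have E : t = (pdiv t * (t %/ pdiv t))%N by rewrite mulnC divnK // pdiv_dvd.
  move: pt; rewrite {1}E PoszM rmorphM /= => /ppr [||h|h]; try exact: OK_int.
    by exists (pdiv t); rewrite ?pdiv_prime.
  apply: (IHn (t %/ pdiv t)%N) => //.
    exact: leq_trans (ltn_Pdiv (prime_gt1 (pdiv_prime t1)) t0) _.
  by rewrite divn_gt0 ?pdiv_gt0 // dvdn_leq // pdiv_dvd.
exists l => // y; split=> [py|/dvdzP [c ->]]; last by rewrite rmorphM; apply: pM => //; exact: OK_int.
apply: contrapT => /negP ny; have : coprimez l y.
  by rewrite coprimezE prime_coprime // -[_ %| _]/(l%:Z %| y)%Z.
move=> /coprimezP [[u v] /= uv]; apply: p1.
have -> : 1 = u%:~R * (l%:Z)%:~R + v%:~R * y%:~R :> K by rewrite -!rmorphM -rmorphD uv.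
by apply: pD; apply: pM => //; exact: OK_int.
Qed.

(* Distinct maximal ideals are incomparable; integrality reduces this to Z. *)
Lemma place_incomparable p q : finite_place p -> finite_place q -> p `<=` q -> p = q.
Proof.
move=> hp hq pq; apply/seteqP; split=> // x qx.
have [pO [[a pa a0] p1] pD pM ppr] := hp; have [qO [_ q1] qD qM qpr] := hq.
apply: contrapT => px; have [f fm fx] := qO _ qx.
have {fx} : p (map_poly intr f).[x].
  by move/eqP: fx => ->; rewrite -(subrr a) -mulN1r; apply: pD => //; apply: pM => //; exact: (OK_int _ (-1)).
have [n] := ubnP (size f); elim: n f fm => // n IHn f fm fn.
have f0 : (0 < size f)%N by rewrite lt0n size_poly_eq0 monic_neq0.
have [f1|f1] := leqP (size f) 1.
  have -> : f = 1 by have fc := size1_polyC f1; move/eqP: fm; rewrite fc lead_coefC => ->.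
  by rewrite rmorph1 hornerC => /p1.
pose g := drop_poly 1 f.
have fE : f = g * 'X + (f`_0)%:P.
  rewrite -{1}(poly_take_drop 1 f) addrC expr1; congr (_ + _).
  by apply/polyP => -[|i]; rewrite coef_take_poly coefC.
have sg : size g = (size f).-1 by rewrite size_drop_poly subn1.
have gm : g \is monic.
  rewrite monicE lead_coefE sg coef_drop_poly; move/eqP: fm.
  by rewrite lead_coefE => fm; apply/eqP; rewrite -[RHS]fm; by rewrite addn1 prednK // -subn1 subn_gt0.
have gx : OK (map_poly intr g).[x].
  apply: integral_horner (qO _ qx); apply/integral_poly => i.
  by rewrite coef_map; exact: OK_int.
rewrite {1}fE rmorphD rmorphM /= map_polyX map_polyC hornerD hornerMX hornerC /= => pfx.
have qf0 : q (f`_0)%:~R.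
  have -> : (f`_0)%:~R = (map_poly intr g).[x] * x + (f`_0)%:~R + (- (map_poly intr g).[x]) * x :> K.
    by ring.
  apply: qD; first exact: pq.
  apply: qM => //; rewrite -[- _]add0r; apply: OKB gx; exact: OK0.
have pf0 : p (f`_0)%:~R.
  have [l lpr pl] := place_prime hp; have [l' l'pr ql] := place_prime hq.
  have : q (l%:Z)%:~R by apply/pq/pl.
  move=> /ql; rewrite dvdzE /= dvdn_prime2 // => /eqP E; apply/pl; rewrite -E; exact/ql.
have : p ((map_poly intr g).[x] * x).
  have -> : (map_poly intr g).[x] * x = (map_poly intr g).[x] * x + (f`_0)%:~R + (-1) * (f`_0)%:~R by ring.
  by apply: pD => //; apply: pM => //; exact: (OK_int _ (-1)).
case/ppr => //; first exact: qO.
apply: IHn => //; rewrite sg -ltnS prednK //.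
Qed.
End Places.

(** * Localization and the local-global principle *)

Section Localization.
Variable K : fieldExtType rat.
Local Notation OK := (@ring_of_integers K).
Implicit Types (p q : set K) (x y : K) (S : set (set K)).

(** The local ring at p is a ring of S-integers, for S everything but p; so its ring structure is
    already at hand. *)
Lemma integral_atE p x : finite_place p ->
  integral_at p x <-> x \in S_integral (~` [set p]).
Proof.
move=> hp; split=> [h|/asboolP h]; last by apply: h => // -[].
by apply/asboolP => q _ /contrapT ->.
Qed.

Lemma OK_integral_at p x : finite_place p -> OK x -> integral_at p x.
Proof. by move=> [_ [_ p1] _ _ _] hx; exists x, 1; split; rewrite ?mulr1 //; exact: OK1. Qed.

Lemma OK_S_integral S x : OK x -> x \in S_integral S.
Proof. by move=> hx; apply/asboolP => p hp _; exact: OK_integral_at. Qed.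

Lemma S_integers_incl S S' : S `<=` S' ->
  exists incl : {rmorphism S_integers S -> S_integers S'}, forall a, val (incl a) = val a.
Proof.
move=> SS'; have S_at x : x \in S_integral S -> x \in S_integral S'.
  by move=> /asboolP h; apply/asboolP => p hp nS; apply: h => // /SS'.
pose incl0 (a : S_integers S) := SInteger (S_at _ (valP a)).
have i0z : zmod_morphism incl0 by move=> a b; apply: val_inj.
have i0m : monoid_morphism incl0 by split=> [|a b]; apply: val_inj.
pose hz := GRing.isZmodMorphism.Build _ _ incl0 i0z.
pose hm := GRing.isMonoidMorphism.Build _ _ incl0 i0m.
by exists (HB.pack_for {rmorphism S_integers S -> S_integers S'} incl0 hz hm).
Qed.

Lemma place_ring S p : finite_place p -> ~ S p ->
  exists (O : comNzRingType) (iota : {rmorphism O -> K})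
    (incl : {rmorphism S_integers S -> O}),
  [/\ injective iota, forall a, iota (incl a) = val a &
      forall x, integral_at p x <-> exists a, iota a = x].
Proof.
move=> hp nSp; have [|incl inclE] := @S_integers_incl S (~` [set p]).
  by move=> q Sq /= qp; rewrite qp in Sq.
exists (S_integers (~` [set p])), (val : S_integers (~` [set p]) -> K), incl.
split=> [|//|x]; first exact: val_inj.
rewrite integral_atE //; split=> [hx|[a <-]]; last exact: valP.
by exists (SInteger hx).
Qed.

Lemma place_localization S p : finite_place p -> ~ S p ->
  exists (O : comNzRingType) (iota : {rmorphism O -> K})
    (incl : {rmorphism S_integers S -> O}) (k : fieldType) (phi : {rmorphism O -> k}),
  [/\ injective iota, forall a, iota (incl a) = val a,
      forall x, integral_at p x <-> exists a, iota a = x,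
      residue_field (phi \o incl) &
      (forall a, phi a != 0 <-> iota a != 0 /\ integral_at p (iota a)^-1) /\
      (forall a, exists s c, phi (incl s) != 0 /\ incl s * a = incl c)].
Proof.
move=> hp nSp; have [pO [_ p1] pD pM ppr] := hp.
have [O [iota [incl [iota_inj inclE iotaP]]]] := place_ring hp nSp.
pose m : set O := [set x : O | exists a b, [/\ p a, OK b, ~ p b & iota x * b = a]].
have pN b d : OK b -> OK d -> ~ p b -> ~ p d -> ~ p (b * d).
  by move=> hb hd nb nd /(ppr _ _ hb hd) [].
have repr (x : O) : exists a b, [/\ OK a, OK b, ~ p b & iota x * b = a].
  by have [a [b h]] := (iotaP (iota x)).2 (ex_intro _ x erefl); exists a, b.
have b0 b : ~ p b -> (exists y, p y) -> b != 0.
  by move=> nb [y py]; apply/negP => /eqP b0; apply: nb; rewrite b0 -(mul0r y); apply: pM => //; exact: OK0.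
have [y0 py0] : exists y, p y by have [_ [[y py _] _] _ _ _] := hp; exists y.
have p0 : p 0 by rewrite -(mul0r y0); apply: pM => //; exact: OK0.
have nz b : ~ p b -> b != 0 by move=> nb; apply: b0 => //; exists y0.
have idm : is_ideal m.
  split=> [|x y [a [b [pa hb nb xE]]] [c [d [pc hd nd yE]]]|x y [c [d [pc hd nd yE]]]].
  - by exists 0, 1; rewrite rmorph0 mul0r; split=> //; exact: OK1.
  - exists (a * d + c * b), (b * d); split.
    + by apply: pD; rewrite mulrC; apply: pM.
    + exact: OKM.
    + exact: pN.
    + by rewrite rmorphD /= -xE -yE; ring.
  - have [a [b [ha hb nb xE]]] := repr x; exists (a * c), (b * d); split.
    + exact: pM.
    + exact: OKM.
    + exact: pN.
    + by rewrite rmorphM /= -xE -yE; ring.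
have mP (x : O) a b : OK a -> OK b -> ~ p b -> iota x * b = a -> m x -> p a.
  move=> ha hb nb xE [c [d [pc hd nd xE']]].
  have : p (a * d) by rewrite -xE mulrAC xE' mulrC; apply: pM.
  by case/ppr.
have prm : prime_ideal m.
  split=> // [m1|x y].
    by apply: (p1); apply: (mP 1 1 1) => //; rewrite ?rmorph1 ?mulr1 //; exact: OK1.
  have [a [b [ha hb nb xE]]] := repr x; have [c [d [hc hd nd yE]]] := repr y.
  move=> /(mP _ (a * c) (b * d)) h; have /ppr [] : p (a * c).
    apply: h; [exact: OKM | exact: OKM | exact: pN |].
    by rewrite rmorphM /= -xE -yE; ring.
  - exact: ha.
  - exact: hc.
  - by move=> pa; left; exists a, b.
  - by move=> pc; right; exists c, d.
have [k [phi [res phi0]]] := prime_ideal_field prm.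
have phiU (x : O) a b : OK a -> OK b -> ~ p a -> ~ p b -> iota x * b = a -> phi x != 0.
  by move=> ha hb na nb xE; apply/eqP => /phi0 /(mP _ _ _ ha hb nb xE).
have den (x : O) : exists s c, [/\ phi (incl s) != 0, incl s * x = incl c & True].
  have [a [b [ha hb nb xE]]] := repr x.
  exists (SInteger (OK_S_integral S hb)), (SInteger (OK_S_integral S ha)); split=> //.
    by apply: (phiU _ b 1) => //; [exact: OK1 | rewrite mulr1].
  by apply: iota_inj; rewrite rmorphM !inclE /= mulrC.
exists O, iota, incl, k, phi; split=> //.
  move=> z; have [u [v [v0 ->]]] := res z.
  have [s [c [s0 sc _]]] := den u; have [t [e [t0 te _]]] := den v.
  have e0 : phi (incl e) != 0 by rewrite -te rmorphM mulf_neq0.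
  exists (c * t), (e * s); split; first by rewrite /= !rmorphM mulf_neq0.
  by rewrite /= !rmorphM /= -sc -te !rmorphM /=; field; rewrite s0 t0 v0.
split=> a; last by have [s [c [h1 h2 _]]] := den a; exists s, c.
split=> [a0|[a0 /iotaP [b bE]]].
  have a0' : iota a != 0.
    by apply: contraNneq a0; rewrite -(rmorph0 iota) => /iota_inj ->; rewrite rmorph0.
  split=> //; have [c [d [hc hd nd aE]]] := repr a.
  exists d, c; split=> //; last by rewrite -aE mulrA mulVf // mul1r.
  by move=> pc; move/eqP: a0; apply; apply/phi0; exists c, d.
have : a * b = 1 by apply: iota_inj; rewrite rmorphM rmorph1 /= bE divff.
move=> /(congr1 phi); rewrite rmorphM rmorph1 /= => h.
by apply: contraTneq (oner_neq0 k) => a00; rewrite -h a00 mul0r eqxx.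
Qed.

Lemma residue_field_val S : residue_field (val : S_integers S -> K).
Proof.
move=> z; have [c [c0 /(_ tt) cz]] := @order_frac K unit (fun=> z).
have ho := order_integral cz.
exists (SInteger (OK_S_integral S ho)), (SInteger (OK_S_integral S (@OK_int K c))) => /=.
rewrite intrK_eq0 c0; split=> //.
by rewrite [_ * z]mulrC mulfK // intrK_eq0.
Qed.

(** P j is not contained in P i, so it has an element outside P i; the product over j stays outside
    because P i is prime. *)
Lemma place_separation (m : nat) (P : 'I_m -> set K) :
  (forall i, finite_place (P i)) -> injective P ->
  exists x : 'I_m -> K, forall i, [/\ OK (x i), ~ P i (x i) & forall j, j != i -> P j (x i)].
Proof.
move=> fP P_inj; suff /boolp.choice [x hx] : forall i, exists y,
  [/\ OK y, ~ P i y & forall j, j != i -> P j y] by exists x.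
move=> i.
have : forall j, exists y, j != i -> P j y /\ ~ P i y.
  move=> j; have [->|ji] := eqVneq j i; first by exists 0.
  apply: contrapT => /forallNP h; have PjPi : P j `<=` P i.
    by move=> y Py; apply: contrapT => nPy; apply: (h y).
  by have /P_inj E := place_incomparable (fP j) (fP i) PjPi; rewrite E eqxx in ji.
move=> /boolp.choice [y hy]; exists (\prod_(j | j != i) y j).
have [PiO [_ Pi1] _ _ Pipr] := fP i.
have yO j : j != i -> OK (y j).
  by move=> /hy [Py _]; have [PO _ _ _ _] := fP j; apply: PO.
have [h1 h2] : OK (\prod_(j | j != i) y j) /\ ~ P i (\prod_(j | j != i) y j).
  apply: (big_ind (fun z => OK z /\ ~ P i z)).
  - by split=> //; exact: OK1.
  - by move=> a c [ha na] [hc nc]; split; [exact: OKM | case/Pipr].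
  - by move=> j ji; split; [exact: yO | case: (hy j ji)].
split=> // j ji; rewrite (bigD1 j) //= mulrC.
have [_ _ _ PM _] := fP j; apply: PM; last by case: (hy j ji).
by apply: (big_ind OK) => [|a c|j' /andP [/yO]] //; [exact: OK1 | exact: OKM].
Qed.

(** More than dim K places over l would give elements x i outside P i and inside all other P j, with
    a nontrivial relation over the integers. At P i this relation shows that l divides the i-th
    coefficient; after division by l the argument repeats, so all powers of l divide the
    coefficients. *)
Lemma places_over_prime (l : nat) : prime l ->
  finite_set [set p : set K | finite_place p /\ p l%:R].
Proof.
move=> lpr; apply: contrapT => /infiniteP /card_leP [f].
pose P (i : nat) : set K := val (f (to_setT i)).
have hP (i : nat) : finite_place (P i) /\ (P i) l%:R by have := valP (f (to_setT i)); rewrite inE.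
have P_inj i j : P i = P j -> i = j.
  by move=> /val_inj/(@inj _ _ _ f) h; have := h (mem_set I) (mem_set I); move/(congr1 val).
pose d := dim K.
have [||x hx] := @place_separation d.+1 (fun i => P i).
- by move=> i; case: (hP i).
- by move=> i j /P_inj /val_inj.
have rel (z : 'I_d.+1 -> int) : \sum_i (z i)%:~R * x i = 0 -> forall i, exists c, z i = l%:Z * c.
  move=> E i; have [[_ _ PD PM Ppr] Pl] := hP i; have [xO nx xP] := hx i.
  have : P i ((z i)%:~R * x i).
    have -> : (z i)%:~R * x i = \sum_(j | j != i) (- z j)%:~R * x j.
      move: E; rewrite (bigD1 i) //= => /eqP; rewrite addr_eq0 => /eqP ->.
      by rewrite -sumrN; apply: eq_bigr => j _; rewrite rmorphN mulNr.
    have P0 : P i 0 by rewrite -(mul0r l%:R); apply: PM => //; exact: OK0.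
    apply: (big_ind (P i)) => // j ji; apply: PM; first exact: OK_int.
    by have [_ _] := hx j; apply; rewrite eq_sym.
  case/Ppr => //; first exact: OK_int.
  have [l' l'pr hl'] := place_prime (proj1 (hP i)).
  have := Pl; rewrite -[l%:R]/((l%:Z)%:~R) => /hl'; rewrite dvdzE /= dvdn_prime2 // => /eqP E'.
  by move=> /hl' /dvdzP [c ->]; exists c; rewrite E' mulrC.
have [z [i0 zi0] zx] : exists2 z : 'I_d.+1 -> int, exists i, z i != 0 & \sum_i (z i)%:~R * x i = 0.
  pose X := \matrix_(i < d.+1) v2r (x i).
  have : kermx X != 0.
    rewrite kermx_eq0 /row_free; apply/negP => /eqP rX.
    by have := rank_leq_col X; rewrite rX ltnn.
  case/rowV0Pn => u /sub_kermxP uX u0.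
  have [b [h [b0 hE]]] := rat_common_denom (fun i => u 0 i).
  exists h.
    apply: contrapT => /forallNP h0; case/eqP: u0; apply/rowP => i; rewrite mxE.
    have /eqP := hE i; have /negP/negPn/eqP -> := h0 i.
    by rewrite mulf_eq0 intr_eq0 (negPf b0) => /eqP.
  apply: (@v2r_inj _ K); rewrite raddf0 -[RHS](scaler0 _ b%:~R) -uX mulmx_sum_row linear_sum scaler_sumr.
  apply: eq_bigr => i _; rewrite rowK scalerA hE -linearZ; congr (v2r _).
  by rewrite -(rmorph_int (in_alg K)) /= mulr_algl.
have div N : forall z : 'I_d.+1 -> int, \sum_i (z i)%:~R * x i = 0 ->
    forall i, (l ^ N %| `|z i|)%N.
  elim: N => [|N IHN] {i0 zi0 zx}z zx i; first exact: dvd1n.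
  have /boolp.choice [c cE] := rel z zx.
  rewrite cE abszM expnS dvdn_mul //; apply: IHN.
  have l0 : l%:R != 0 :> K by rewrite -[l%:R]/((l%:Z)%:~R) intrK_eq0 -lt0n prime_gt0.
  apply: (mulfI l0); rewrite mulr0 -[RHS]zx mulr_sumr; apply: eq_bigr => j _.
  by rewrite cE rmorphM mulrA.
have := div `|z i0|%N z zx i0; apply/negP; rewrite gtnNdvd ?absz_gt0 //.
by rewrite ltn_expl // prime_gt1.
Qed.

Lemma places_over_finite (t : nat) : (0 < t)%N ->
  finite_set [set p : set K | finite_place p /\ p t%:R].
Proof.
have [n] := ubnP t; elim: n t => // n IHn t tn t0.
have [t1|t1] := leqP t 1.
  apply: (sub_finite_set _ (finite_set0 _)) => p [[_ [_ p1] _ _ _]].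
  by rewrite (_ : t = 1%N) //; apply/eqP; rewrite eqn_leq t1.
have tE : t = (pdiv t * (t %/ pdiv t))%N by rewrite mulnC divnK // pdiv_dvd.
have h1 := places_over_prime (pdiv_prime t1).
have h2 : finite_set [set p : set K | finite_place p /\ p (t %/ pdiv t)%:R].
  apply: IHn; last by rewrite divn_gt0 ?pdiv_gt0 // dvdn_leq // pdiv_dvd.
  exact: leq_trans (ltn_Pdiv (prime_gt1 (pdiv_prime t1)) t0) _.
have : finite_set ([set p | finite_place p /\ p (pdiv t)%:R] `|`
  [set p : set K | finite_place p /\ p (t %/ pdiv t)%:R]) by rewrite finite_setU.
apply: sub_finite_set => p [hp]; rewrite {1}tE natrM; have [_ _ _ _ ppr] := hp.
by case/ppr => [||h|h]; [exact: (OK_int _ (Posz _)) | exact: (OK_int _ (Posz _)) | left | right].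
Qed.

Lemma nonunit_finite x : x != 0 ->
  finite_set [set p : set K | finite_place p /\ ~ (integral_at p x /\ integral_at p x^-1)].
Proof.
move=> x0; have [c [c0 cx]] := @order_frac K bool (fun b => if b then x else x^-1).
have c0' : (0 < `|c|)%N by rewrite absz_gt0.
apply: (sub_finite_set _ (places_over_finite c0')) => p [hp nu]; split=> //.
have [_ _ _ pM _] := hp; apply: contrapT => pc; apply: nu.
have {}pc : ~ p c%:~R.
  move=> h; apply: pc; rewrite -[_%:R]/((`|c|%N%:Z)%:~R) abszE; case: (ger0P c) => // _.
  by rewrite rmorphN -mulN1r; apply: pM => //; exact: (OK_int _ (-1)).
split; [exists (c%:~R * x), c%:~R | exists (c%:~R * x^-1), c%:~R]; split=> //;
  rewrite 1?[RHS]mulrC //; try exact: OK_int; apply: order_integral.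
  exact: (cx true).
exact: (cx false).
Qed.

(** A nonzero b in I fails to be a unit at finitely many places only. An element c of I that is a
    unit at those outside S is assembled, and [integral_denominators] for c / b writes 1 in terms of
    b and c. The coefficients are integral at the good places because b is a unit there, and at the
    bad ones because c is. *)
Lemma local_global S (I : set (S_integers S)) : is_ideal I ->
  (exists2 b, I b & b != 0) ->
  (forall p, finite_place p -> ~ S p ->
     exists s, [/\ I s, val s != 0 & integral_at p (val s)^-1]) ->
  I 1.
Proof.
move=> [I0 ID IM] [b Ib b0] hI.
have vb0 : val b != 0 by rewrite -(rmorph0 (val : S_integers S -> K)) (inj_eq val_inj).
pose bad := [set p | finite_place p /\ ~ (integral_at p (val b) /\ integral_at p (val b)^-1)] `&` ~` S.
have /finite_seqP [ps psE] : finite_set bad by apply: finite_setIl; exact: nonunit_finite.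
have psP p : p \in ps <-> bad p by rewrite psE.
pose ps' := undup ps; pose n := size ps'; pose P (i : 'I_n) : set K := nth set0 ps' i.
have hP i : bad (P i) by apply/psP; rewrite -mem_undup mem_nth.
have P_inj i j : P i = P j -> i = j.
  by move=> /eqP; rewrite nth_uniq ?undup_uniq // => /eqP /val_inj.
have fpP i : finite_place (P i) by have [[]] := hP i.
have [e he] := place_separation fpP P_inj.
have /boolp.choice [s hs] : forall i, exists s, [/\ I s, val s != 0 & integral_at (P i) (val s)^-1].
  by move=> i; apply: hI => //; have [] := hP i.
have eO i : OK (e i) by case: (he i).
(* The multiplier [e i] is a unit at [P i] and lies in the other [P j], so at [P i] only the unit
   [e i] times [s i] survives modulo the maximal ideal. *)
pose c : S_integers S := \sum_i SInteger (OK_S_integral S (eO i)) * s i.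
have Ic : I c by apply: (big_ind I) => // i _; apply: IM; case: (hs i).
have cU i : val c != 0 /\ integral_at (P i) (val c)^-1.
  have nS : ~ S (P i) by have [] := hP i.
  have [O [iota [incl [k [phi [inj inclE iP _ [phiU _]]]]]]] := place_localization (fpP i) nS.
  rewrite -inclE; apply/phiU; rewrite rmorph_sum rmorph_sum (bigD1 i) //= big1 ?addr0.
    rewrite !rmorphM mulf_neq0 //; apply/phiU; rewrite inclE /=; last by case: (hs i).
    have [hO nP _] := he i; have [PO [[y Py _] P1] _ PM _] := fpP i.
    have e0 : e i != 0.
      by apply/negP => /eqP ei0; apply: nP; rewrite ei0 -(mul0r y); apply: PM => //; exact: OK0.
    split=> //; exists 1, (e i); split=> //; [exact: OK1 | by rewrite mulVf].
  move=> j ji; rewrite !rmorphM /=; apply/eqP; rewrite mulf_eq0; apply/orP; left.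
  apply: contrapT => /negP/phiU; rewrite inclE /= => -[ej0 [a [d [ha hd nd E]]]].
  have [_ _ /(_ i)] := he j; rewrite eq_sym => /(_ ji) Pej.
  have [_ _ _ PM _] := fpP i; apply: nd; have -> : d = a * e j by rewrite -E mulrAC mulVf // mul1r.
  exact: PM.
have [be [be' [h1 h2 h3 h4 E]]] := integral_denominators (val c / val b).
have cint : be / val b \in S_integral S /\ be' / val b \in S_integral S.
  suff h p : finite_place p -> ~ S p -> integral_at p (be / val b) /\ integral_at p (be' / val b).
    by split; apply/asboolP => p hp nS; case: (h p hp nS).
  move=> hp nS; have mul x y : integral_at p x -> integral_at p y -> integral_at p (x * y).
    by rewrite !integral_atE //; exact: rpredM.
  have [[ub1 ub2]|ub] := pselect (integral_at p (val b) /\ integral_at p (val b)^-1).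
    by split; apply: mul => //; exact: OK_integral_at.
  have /psP : bad p by [].
  rewrite -mem_undup => pps; pose i : 'I_n := Ordinal (etrans (index_mem p ps') pps).
  have Pi : P i = p by rewrite /P /= nth_index.
  have [c0 cinv] := cU i; rewrite Pi in cinv.
  have aux x : x / val b = (x * (val c / val b)) * (val c)^-1 by field; rewrite c0.
  by split; rewrite aux; apply: mul => //; exact: OK_integral_at.
have -> : 1 = SInteger cint.1 * b + SInteger cint.2 * c.
  apply: val_inj; rewrite rmorph1 rmorphD !rmorphM /= -[LHS]E divfK //.
  by rewrite mulrA mulrAC.
by apply: ID; apply: IM.
Qed.

(* b is an element of minimal norm in the ideal generated by the g i; by [nrm_approx] the ideal is then
   principal away from M. *)
Lemma scale_primitive : exists M : nat, (0 < M)%N /\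
  forall (I : finType) (g : I -> K), (exists i, g i != 0) ->
  exists2 b : K, b != 0 & forall p, finite_place p -> ~ p M%:R ->
    (forall i, integral_at p (g i / b)) /\
    exists i, g i / b != 0 /\ integral_at p (g i / b)^-1.
Proof.
(* Every t up to the bound divides the factorial, hence is a unit at the places that do not contain
   it. *)
have [M [M0 hM]] := nrm_approx K; exists M`!; split=> [|I g [i0 gi0]]; first exact: fact_gt0.
have [c [c0 cg]] := order_frac g.
pose J : set K := [set y | exists a : I -> K, (forall i, order (a i)) /\ y = \sum_i a i * (c%:~R * g i)].
have JO y : J y -> order y.
  by move=> [a [ha ->]]; apply: order_sum => i _; exact: orderM.
have gJ i : J (c%:~R * g i).
  exists (fun j => (i == j)%:R); split=> [j|]; first exact: (order_int _ (Posz _)).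
  rewrite (bigD1 i) //= eqxx mul1r big1 ?addr0 // => j ji.
  by rewrite eq_sym (negPf ji) mul0r.
have JM a y : order a -> J y -> J (a * y).
  move=> ha [b [hb ->]]; exists (fun i => a * b i); split=> [i|]; first exact: orderM.
  by rewrite mulr_sumr; apply: eq_bigr => i _; rewrite mulrA.
have JD x y : J x -> J y -> J (x + y).
  move=> [a [ha ->]] [b [hb ->]]; exists (fun i => a i + b i); split=> [i|]; first exact: orderD.
  by rewrite -big_split; apply: eq_bigr => i _; rewrite mulrDl.
have cK : c%:~R != 0 :> K by rewrite intrK_eq0.
pose Q (n : nat) := `[< exists y, [/\ J y, y != 0 & `|nrm y| = n%:R] >].
have nat_nrm y : J y -> exists n : nat, `|nrm y| = n%:R.
  by move=> /JO /nrm_order [z ->]; exists `|z|%N; rewrite -intr_norm -abszE.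
have exQ : exists n, Q n.
  have [n nE] := nat_nrm _ (gJ i0); exists n; apply/asboolP; exists (c%:~R * g i0).
  by split=> //; rewrite mulf_neq0.
case: (ex_minnP exQ) => n /asboolP [b [Jb b0 bn]] nmin.
have dvd i : exists t be, [/\ (0 < t <= M)%N, order be & t%:R * (c%:~R * g i / b) = be].
  have [t [be [tM hbe lt1]]] := hM (c%:~R * g i / b); exists t, be; split=> //.
  apply/subr0_eq/eqP; apply: contraT => ne0; set w := _ - be in lt1 ne0 *.
  have Jw : J (w * b).
    have -> : w * b = t%:R * (c%:~R * g i) + (- be) * b.
      by rewrite /w mulrBl mulNr -[_ * _ * b]mulrA divfK.
    apply: JD; first by apply: JM => //; exact: (order_int _ (Posz _)).
    by apply: JM => //; rewrite -mulN1r; apply: orderM => //; exact: (order_int _ (-1)).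
  have [n' n'E] := nat_nrm _ Jw.
  have : (n <= n')%N by apply: nmin; apply/asboolP; exists (w * b); split=> //; rewrite mulf_neq0.
  have bn0 : 0 < `|nrm b| by rewrite normr_gt0; apply: contraNneq b0 => /nrm_eq0 ->.
  rewrite leqNgt => /negP; case; rewrite -(ltr_nat rat) -n'E -bn nrmM normrM.
  by rewrite gtr_pMl.
exists (b / c%:~R); first by rewrite mulf_neq0 // invr_eq0.
move=> p hp npM; have [_ [_ p1] _ pM _] := hp.
have gE i : g i / (b / c%:~R) = c%:~R * g i / b by rewrite invf_div mulrA [g i * _]mulrC.
have integ i : integral_at p (g i / (b / c%:~R)).
  have [t [be [tM hbe E]]] := dvd i; rewrite gE; exists be, t%:R; split.
  - exact: order_integral.
  - exact: (OK_int _ (Posz _)).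
  - move=> pt; apply: npM; have /dvdnP [e ->] : (t %| M`!)%N by rewrite dvdn_fact.
    by rewrite natrM; apply: pM => //; exact: (OK_int _ (Posz _)).
  - by rewrite mulrC.
split=> //; apply: contrapT => /forallNP nU.
have nS : ~ (set0 : set (set K)) p by [].
have [O [iota [incl [k [phi [inj inclE iP _ [phiU _]]]]]]] := place_localization hp nS.
have [a [ha bE]] := Jb.
have /boolp.choice [u uE] : forall i, exists u, iota u = g i / (b / c%:~R) by move=> i; apply/iP.
have /boolp.choice [v vE] : forall i, exists v, iota v = a i.
  by move=> i; apply/iP/OK_integral_at => //; exact: order_integral.
have : \sum_i v i * u i = 1.
  apply: inj; rewrite rmorph_sum rmorph1 /=; apply: (mulIf b0); rewrite mul1r [RHS]bE mulr_suml.
  by apply: eq_bigr => i _; rewrite rmorphM /= uE vE gE -[_ * _ * b]mulrA divfK.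
move=> /(congr1 phi); rewrite rmorph_sum rmorph1 big1 => [/eqP|i _]; first by rewrite eq_sym oner_eq0.
rewrite rmorphM /=; apply/eqP; rewrite mulf_eq0; apply/orP; right.
by apply: contrapT => /negP /phiU; rewrite uE => /(nU i).
Qed.

End Localization.

(** * Hypersurfaces over valuation rings *)

Definition gen_ideal (R : comNzRingType) (I : finType) (h : I -> R) : set R :=
  [set p | exists a, p = \sum_i a i * h i].

Lemma gen_is_ideal (R : comNzRingType) (I : finType) (h : I -> R) : is_ideal (gen_ideal h).
Proof.
split=> [|_ _ [a ->] [b ->]|p _ [a ->]].
- by exists (fun=> 0); rewrite big1 // => i _; rewrite mul0r.
- by exists (fun i => a i + b i); rewrite -big_split; apply: eq_bigr => i _; rewrite mulrDl.
- by exists (fun i => p * a i); rewrite mulr_sumr; apply: eq_bigr => i _; rewrite mulrA.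
Qed.

Lemma gen_ideal_gen (R : comNzRingType) (I : finType) (h : I -> R) i : gen_ideal h (h i).
Proof.
exists (fun j => (j == i)%:R); rewrite (bigD1 i) //= eqxx mul1r big1 ?addr0 // => j /negPf ->.
by rewrite mul0r.
Qed.

Lemma is_ideal_sum (R : comNzRingType) (J : set R) (I : Type) (r : seq I) (P : pred I) (F : I -> R) :
  is_ideal J -> (forall i, P i -> J (F i)) -> J (\sum_(i <- r | P i) F i).
Proof. by move=> [J0 JD _] h; apply: big_ind. Qed.

Lemma gen_ideal_map (R S : comNzRingType) (f : {rmorphism R -> S}) (I : finType) (h : I -> R) p :
  gen_ideal h p -> gen_ideal (f \o h) (f p).
Proof.
move=> [a ->]; exists (f \o a); rewrite rmorph_sum; apply: eq_bigr => i _.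
by rewrite /= rmorphM.
Qed.

(** The second clause, that no new monomials appear, makes it possible to lift a reduction without
    the terms that reduce to 0. *)
Lemma mpoly_lift (R S : nzRingType) (f : {rmorphism R -> S}) n (p : {mpoly S[n]}) :
  (forall m, m \in msupp p -> exists a, f a = p@_m) ->
  exists q, map_mpoly f q = p /\ forall m, p@_m = 0 -> q@_m = 0.
Proof.
move=> h; have /boolp.choice [a aE] : forall m, exists a, m \in msupp p -> f a = p@_m.
  by move=> m; have [/h [a]|_] := boolP (m \in msupp p); [exists a | exists 0].
exists (\sum_(m <- msupp p) a m *: 'X_[m]); split=> [|m pm].
  rewrite [RHS]mpolyE raddf_sum; apply: eq_big_seq => m mp /=.
  by rewrite map_mpolyZ map_mpolyX aE.
rewrite raddf_sum big_seq big1 // => m' m'p; rewrite /= mcoeffZ mcoeffX.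
by case: eqP m'p => [->|_ _]; rewrite ?mulr0 // mcoeff_msupp pm eqxx.
Qed.

Lemma pihomogM (R : comNzRingType) n D d (a h : {mpoly R[n]}) : h \is d.-homog ->
  pihomog mdeg D (a * h) = (if (d <= D)%N then pihomog mdeg (D - d) a else 0) * h.
Proof.
move=> hd; rewrite {1}[a]mpolyE mulr_suml raddf_sum /=.
under eq_bigr => m _ do rewrite -scalerAl linearZ /=.
have mh m : 'X_[m] * h \is (mdeg m + d)%N.-homog by rewrite dhomogM // dhomogX.
case: leqP => dD.
  rewrite pihomogE mulr_suml [RHS]big_mkcond; apply: eq_bigr => m _.
  case: ifPn => [/eqP mD|mD]; last 
    by rewrite (pihomog_ne0 _ (mh m)) ?scaler0 //; apply: contraNneq mD => <-; rewrite addnK.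
  by rewrite pihomog_dE ?scalerAl // -[D](subnK dD) -mD mh.
rewrite mul0r big1 // => m _; rewrite (pihomog_ne0 _ (mh m)) ?scaler0 //.
by rewrite gtn_eqF // (leq_trans dD) // leq_addl.
Qed.

Lemma pihomog_map (R S : comNzRingType) (f : {rmorphism R -> S}) n D (p : {mpoly R[n]}) :
  map_mpoly f (pihomog mdeg D p) = pihomog mdeg D (map_mpoly f p).
Proof.
transitivity (\sum_(m <- msupp p) (if mdeg m == D then f p@_m *: 'X_[m] else 0)).
  rewrite pihomogE big_mkcond raddf_sum; apply: eq_bigr => m _ /=.
  by case: ifP => _; rewrite ?rmorph0 // map_mpolyZ map_mpolyX.
have -> : map_mpoly f p = \sum_(m <- msupp p) f p@_m *: 'X_[m].
  rewrite {1}[p]mpolyE raddf_sum; apply: eq_bigr => m _ /=.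
  by rewrite map_mpolyZ map_mpolyX.
rewrite linear_sum; apply: eq_bigr => m _ /=.
by rewrite linearZ /= pihomogX; case: ifP; rewrite ?scaler0.
Qed.

Lemma large_mdeg n (m : 'X_{1..n}) N : (n * N < mdeg m)%N -> exists i, (N <= m i)%N.
Proof.
move=> h; apply: contrapT => /forallNP hN; move: h; apply/negP; rewrite -leqNgt mdegE.
apply: leq_trans (_ : \sum_(i < n) N <= _)%N; last by rewrite sum_nat_const card_ord.
by apply: leq_sum => i _; rewrite leqNgt; apply/negP => /ltnW /hN.
Qed.

(** Nakayama's lemma in a single degree. As D > n N, every monomial of degree D contains the N-th
    power of a variable, so it lies in the reduced ideal. Lifting these memberships gives a linear
    system for the monomials modulo the ideal, whose matrix reduces to the identity and hence is
    invertible. *)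
Lemma homog_nakayama (R : comNzRingType) (k : fieldType) (phi : {rmorphism R -> k})
    n s (h : 'I_s -> {mpoly R[n]}) (d : 'I_s -> nat) N :
  (forall z, exists a, phi a = z) -> (forall a, phi a != 0 -> exists b, a * b = 1) ->
  (forall j, h j \is (d j).-homog) ->
  (forall i : 'I_n, gen_ideal (fun j => map_mpoly phi (h j)) ('X_i ^+ N)) ->
  exists D, forall i : 'I_n, gen_ideal h ('X_i ^+ D).
Proof.
move=> surj unit hd hX; pose D := (n * N).+1; exists D => i0.
have [J0 JD JM] := gen_is_ideal h; have [J0' JD' JM'] := gen_is_ideal (fun j => map_mpoly phi (h j)).
(* [z w] is the monomial w if its degree is D and 0 otherwise, so that all monomials of degree at
   most D can serve as indices. *)
pose T := 'X_{1..n < D.+1}; pose z (w : T) : {mpoly R[n]} := pihomog mdeg D 'X_[bmnm w].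
have /boolp.choice [C hC] : forall w : T, exists c : T -> R,
    (forall w', phi (c w') = 0) /\ gen_ideal h (z w - \sum_w' c w' *: z w').
  move=> w; have [wD|wD] := eqVneq (mdeg w) D; last first.
    exists (fun=> 0); split=> [w'|]; first by rewrite rmorph0.
    by rewrite big1 => [|w' _]; rewrite ?scale0r // subr0 /z pihomogX (negPf wD).
  have [i iN] : exists i, (N <= bmnm w i)%N by apply: large_mdeg; rewrite wD.
  have [a aE] : gen_ideal (fun j => map_mpoly phi (h j)) 'X_[bmnm w].
    suff -> : 'X_[bmnm w] = 'X_[bmnm w - U_(i) *+ N] * 'X_i ^+ N :> {mpoly k[n]} by apply: JM'.
    rewrite mpolyXn -mpolyXD submK //; apply/mnm_lepP => j; rewrite mulmnE mnm1E.
    by case: eqP => [<-|_]; rewrite ?mul1n ?mul0n.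
  have /boolp.choice [b bE] : forall j, exists b, map_mpoly phi b = a j.
    by move=> j; have [b [bE _]] := mpoly_lift (fun m _ => surj (a j)@_m); exists b.
  pose q := pihomog mdeg D (\sum_j b j * h j).
  have Jq : gen_ideal h q.
    exists (fun j => if (d j <= D)%N then pihomog mdeg (D - d j) (b j) else 0).
    by rewrite /q raddf_sum; apply: eq_bigr => j _; exact: pihomogM.
  have qX : map_mpoly phi q = 'X_[bmnm w].
    rewrite pihomog_map rmorph_sum /=; under eq_bigr => j _ do rewrite rmorphM /= bE.
    by rewrite -aE pihomog_dE // dhomogX; apply/eqP.
  exists (fun w' => (w' == w)%:R - q@_(bmnm w')); split=> [w'|].
    rewrite rmorphB rmorph_nat -mcoeff_map_mpoly qX mcoeffX -val_eqE eq_sym.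
    by rewrite [X in X - _](_ : _ = (bmnm w == bmnm w')%:R) ?subrr.
  suff -> : z w - \sum_w' ((w' == w)%:R - q@_(bmnm w')) *: z w' = q by [].
  under eq_bigr => w' _ do rewrite scalerBl.
  rewrite sumrB (bigD1 w) //= eqxx scale1r big1 ?addr0 => [|w' /negPf ->]; last by rewrite scale0r.
  rewrite opprB addrC subrK.
  have qh : q \is D.-homog by exact: pihomogP.
  have qs : (msize q <= D.+1)%N.
    rewrite msizeE; apply/bigmax_leqP_seq => m mq _; move/dhomogP: qh => /(_ m mq) mD.
    by rewrite ltnS mD.
  rewrite -[RHS](pihomog_dE qh) [in RHS](mpolywE qs) raddf_sum /=.
  by apply: eq_bigr => w' _; rewrite linearZ.
pose M : 'M[R]_#|{: T}| := 1%:M - \matrix_(i, j) C (enum_val i) (enum_val j).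
have [b bM] : exists b, \det M * b = 1.
  apply: unit; rewrite -det_map_mx map_mxB map_mx1.
  rewrite [X in _ - X](_ : _ = 0) ?subr0 ?det1 ?oner_neq0 //.
  by apply/matrixP => i j; rewrite !mxE; have [H1 _] := hC (enum_val i); exact: H1.
pose Mz : 'cV[{mpoly R[n]}]_#|{: T}| := map_mx (@mpolyC n R) M *m \col_i z (enum_val i).
have JMz i : gen_ideal h (Mz i 0).
  have [_] := hC (enum_val i); congr (gen_ideal h _).
  rewrite [RHS]mxE; symmetry.
  under eq_bigr => j _ do rewrite !mxE mpolyCB mulrBl.
  rewrite sumrB (bigD1 i) //= eqxx mul1r big1 ?addr0 => [|j]; last first.
    by rewrite eq_sym => /negPf ->; rewrite mpolyC0 mul0r.
  congr (_ - _); rewrite [RHS](reindex_onto enum_val enum_rank) => [|w _]; last exact: enum_rankK.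
  by apply: eq_big => [j|j _]; rewrite ?enum_valK ?eqxx // mul_mpolyC.
have Jz w : gen_ideal h (z w).
  have : gen_ideal h (b%:MP * (map_mx (@mpolyC n R) (\adj M) *m Mz) (enum_rank w) 0).
    apply: (JM); rewrite mxE; apply: is_ideal_sum; first exact: gen_is_ideal.
    by move=> j _; apply: (JM); exact: JMz.
  rewrite mulmxA -map_mxM mul_adj_mx map_scalar_mx mul_scalar_mx !mxE enum_rankK mulrA -mpolyCM.
  by rewrite [b * _]mulrC bM mpolyC1 mul1r.
have wD : (mdeg (U_(i0) *+ D) < D.+1)%N by rewrite mdegMn mdeg1 mul1n.
have := Jz (BMultinom wD); rewrite /z pihomogX /= mdegMn mdeg1 mul1n eqxx.
by rewrite mpolyXn.
Qed.

(** On chart i, g lies in the ideal of the e j and 'X_i - 1, as the universal point in the quotient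
    shows. Homogenizing the coefficients costs a power of 'X_i, and the resulting identity is
    checked at the generic point. *)
Lemma subscheme_ideal (k : fieldType) n s (e : 'I_s -> {mpoly k[n]}) (d : 'I_s -> nat) g D i :
  (forall j, e j \is (d j).-homog) -> g \is D.-homog ->
  (forall (R : comNzRingType) (psi : {rmorphism k -> R}) (v : 'rV[R]_n), v 0 i = 1 ->
     (forall j, ev psi v (e j) = 0) -> ev psi v g = 0) ->
  exists N, gen_ideal e ('X_i ^+ N * g).
Proof.
move=> ed gD h.
pose J : set {mpoly k[n]} := [set p | exists a b, p = \sum_j a j * e j + b * ('X_i - 1)].
have idJ : is_ideal J.
  split=> [|_ _ [a [b ->]] [a' [b' ->]]|p _ [a [b ->]]].
  - by exists (fun=> 0), 0; rewrite mul0r big1 ?addr0 // => j _; rewrite mul0r.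
  - exists (fun j => a j + a' j), (b + b'); rewrite mulrDl addrACA -big_split /=.
    by congr (_ + _); apply: eq_bigr => j _; rewrite mulrDl.
  - exists (fun j => p * a j), (p * b); rewrite mulrDr mulrA mulr_sumr.
    by congr (_ + _); apply: eq_bigr => j _; rewrite mulrA.
have [a [b gE]] : J g.
  have [J1|J1] := pselect (J 1); first by rewrite -[g]mulr1; case: idJ => _ _; apply.
  have [Q [pi [_ piJ]]] := quotient_ring idJ J1.
  apply/piJ; rewrite -mmap_at_class; apply: h => [|j].
    rewrite mxE; apply/subr0_eq; rewrite -(rmorph1 pi) -rmorphB; apply/piJ.
    by exists (fun=> 0), 1; rewrite mul1r big1 ?add0r // => j _; rewrite mul0r.
  rewrite mmap_at_class; apply/piJ; exists (fun l => (l == j)%:R), 0.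
  rewrite mul0r addr0 (bigD1 j) //= eqxx mul1r big1 ?addr0 // => l /negPf ->.
  by rewrite mul0r.
have /boolp.choice [ah ahE] := fun j => homogenize i (leqnn (msize (a j))).
have [k1 [iota [x x_inj]]] := generic_point k n.
pose y j := x j / x i.
have xi0 : x i != 0 by have := x_inj 'X_i (mpolyX_neq0 _ i); rewrite mmapX mmap1U.
have xE j : x j = x i * y j by rewrite /y mulrC divfK.
pose M j := (msize (a j) + d j)%N; pose T := (D + \sum_j M j)%N.
have MT j : (M j <= T)%N by rewrite /T (bigD1 j) //= addnCA leq_addr.
exists (T - D)%N; exists (fun j => 'X_i ^+ (T - M j) * ah j).
apply/eqP; rewrite -subr_eq0; apply: contraT => /x_inj /eqP; case.
rewrite rmorphB rmorph_sum /= rmorphM rmorphXn /= mmapX mmap1U.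
have xh d0 p : p \is d0.-homog -> mmap iota x p = x i ^+ d0 * mmap iota y p.
  by move=> pd; rewrite -(mmap_homogZ iota y (x i) pd); apply: eq_mmap => // j.
rewrite (xh _ _ gD) mulrA -exprD subnK ?leq_addr // {1}gE rmorphD rmorph_sum rmorphM rmorphB rmorph1 /=.
have yi : y i = 1 by rewrite /y divff.
rewrite mmapX mmap1U yi subrr mulr0 addr0 mulr_sumr -sumrB big1 // => j _.
rewrite !rmorphM rmorphXn /= mmapX mmap1U (xh _ _ (ed j)).
have [_ /(_ _ iota _ _ xE) ->] := ahE j.
have -> : x i ^+ T = x i ^+ (T - M j) * (x i ^+ msize (a j) * x i ^+ d j).
  by rewrite -!exprD subnK.
move: (x i ^+ (T - M j)) (x i ^+ msize (a j)) (x i ^+ d j) (mmap iota y (a j)) (mmap iota y (e j)).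
by move=> c1 c2 c3 c4 c5; ring.
Qed.

(** Two charts suffice, because powers of two different variables are coprime. *)
Lemma subscheme_divides (k : fieldType) n (g e : {mpoly k[n.+2]}) D d :
  g \is D.-homog -> e \is d.-homog ->
  (forall (R : comNzRingType) (psi : {rmorphism k -> R}) (v : 'rV[R]_n.+2) i, v 0 i = 1 ->
     ev psi v g = 0 -> ev psi v e = 0) ->
  rdvd g e.
Proof.
move=> gD ed h.
have hX i : exists N, rdvd g (e * 'X_i ^+ N).
  have [N [a aE]] := @subscheme_ideal k n.+2 1 (fun=> g) (fun=> D) e d i (fun=> gD) ed
    (fun R psi v vi hv => h R psi v i vi (hv ord0)).
  by exists N; exists (a ord0); rewrite mulrC aE big_ord1 mulrC.
have [a ha] := hX ord0; have [b hb] := hX ord_max.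
by apply: monom_coprime ha hb.
Qed.

Lemma map_homog (R S : nzRingType) (f : {rmorphism R -> S}) n d (p : {mpoly R[n]}) :
  p \is d.-homog -> map_mpoly f p \is d.-homog.
Proof.
move=> /dhomogP pd; apply/dhomogP => m; rewrite mcoeff_msupp mcoeff_map_mpoly => fm.
apply: pd; rewrite mcoeff_msupp; apply: contraNneq fm => ->.
by rewrite raddf0.
Qed.

(** * Valuation rings and primitive forms *)

Section Valuation.
Variables (O : comNzRingType) (K k : fieldType).
Variables (iota : {rmorphism O -> K}) (phi : {rmorphism O -> k}).

(** No value group appears: any x in K or its inverse comes from O, and the elements with nonzero
    residue are units. The trivial case O = K is included. *)
Definition valuation_ring : Prop :=
  [/\ injective iota, forall x, exists a, x = iota a \/ x * iota a = 1,
      forall a, phi a != 0 -> exists b, a * b = 1 & forall z, exists a, phi a = z].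

Hypothesis V : valuation_ring.

Lemma val_min (I : eqType) (s : seq I) (g : I -> K) : (exists2 i, i \in s & g i != 0) ->
  exists i0, [/\ i0 \in s, g i0 != 0 & forall i, i \in s -> exists a, g i = iota a * g i0].
Proof.
elim: s => [[]|i s IHs h] //; have [_ Vt _ _] := V.
have [[i1 i1s gi1]|s0] := pselect (exists2 i, i \in s & g i != 0).
  have [|i0 [i0s gi0 hi0]] := IHs; first by exists i1.
  have [a [aE|aE]] := Vt (g i / g i0).
    exists i0; split=> //; first by rewrite inE i0s orbT.
    move=> i2; rewrite inE => /predU1P [->|/hi0 //].
    by exists a; rewrite -aE divfK.
  have gi : g i != 0 by apply: contra_eq_neq aE => ->; rewrite !mul0r eq_sym oner_neq0.
  exists i; split=> //; first exact: mem_head.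
  move=> i2; rewrite inE => /predU1P [->|/hi0 [b ->]]; first by exists 1; rewrite rmorph1 mul1r.
  exists (b * a); rewrite rmorphM -mulrA; congr (_ * _).
  by apply: (mulIf (invr_neq0 gi0)); rewrite divff // -aE; ring.
have [i1 i1s gi1] := h; have i1E : i1 = i.
  by move: i1s; rewrite inE => /predU1P [//|i1s]; case: s0; exists i1.
rewrite i1E in gi1; exists i; split=> //; first exact: mem_head.
move=> i2; rewrite inE => /predU1P [->|i2s]; first by exists 1; rewrite rmorph1 mul1r.
exists 0; rewrite rmorph0 mul0r; apply/eqP/negPn/negP => gi2.
by case: s0; exists i2.
Qed.

Lemma map_mpoly_inj n : injective (map_mpoly (n := n) iota).
Proof.
have [inj _ _ _] := V; move=> p q /mpolyP pq; apply/mpolyP => m; apply: inj.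
by have := pq m; rewrite !mcoeff_map_mpoly.
Qed.

Lemma map_mpoly_homog n d (p : {mpoly O[n]}) :
  map_mpoly iota p \is d.-homog -> p \is d.-homog.
Proof.
have [inj _ _ _] := V; move=> /dhomogP h; apply/dhomogP => m; rewrite mcoeff_msupp => pm.
by apply: h; rewrite mcoeff_msupp mcoeff_map_mpoly -(rmorph0 iota) (inj_eq inj).
Qed.

Lemma primitive_scale n (G : {mpoly K[n]}) : G != 0 ->
  exists c Gp, [/\ c != 0, map_mpoly iota Gp = c *: G & map_mpoly phi Gp != 0].
Proof.
move=> G0; have [inj _ _ _] := V.
have [|m0 [m0s Gm0 hm0]] := @val_min _ (msupp G) (fun m => G@_m).
  by exists (mlead G); [exact: mlead_supp | rewrite mleadc_eq0].
have c0 : (G@_m0)^-1 != 0 by rewrite invr_eq0.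
have [m|Gp [GpE _]] := @mpoly_lift _ _ iota n ((G@_m0)^-1 *: G).
  rewrite mcoeff_msupp mcoeffZ mulf_eq0 negb_or -mcoeff_msupp => /andP [_ /hm0 [a ->]].
  by exists a; rewrite mulrCA mulVf ?mulr1.
exists (G@_m0)^-1, Gp; split=> //.
apply/negP => /eqP /mpolyP /(_ m0); rewrite mcoeff_map_mpoly mcoeff0.
have -> : Gp@_m0 = 1.
  by apply: inj; rewrite -mcoeff_map_mpoly GpE mcoeffZ mulVf // rmorph1.
by move=> /eqP; apply/negP; exact: (eq_ind_r (fun z => z != 0) (oner_neq0 k) (rmorph1 phi)).
Qed.

(** Scale h to a primitive form hp. The product Gp hp has a unit coefficient, and comparison with e
    at that monomial shows that the scalar lies in O. *)
Lemma gauss_lift n (Gp e : {mpoly O[n]}) h : map_mpoly phi Gp != 0 ->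
  map_mpoly iota e = map_mpoly iota Gp * h ->
  exists h', e = Gp * h' /\ map_mpoly iota h' = h.
Proof.
move=> Gp0 eE; have [inj _ unit _] := V; have inj' := @map_mpoly_inj n.
suff [h' h'E] : exists h', map_mpoly iota h' = h.
  by exists h'; split=> //; apply: inj'; rewrite rmorphM /= h'E.
have [->|h0] := eqVneq h 0; first by exists 0; rewrite rmorph0.
have [c [hp [c0 hpE hp0]]] := primitive_scale h0.
have : map_mpoly phi (Gp * hp) != 0 by rewrite rmorphM mulf_neq0.
rewrite -mleadc_eq0; set m := mlead _; rewrite mcoeff_map_mpoly => /unit [b bE].
exists ((e@_m * b)%:MP * hp); rewrite rmorphM /= map_mpolyC hpE mul_mpolyC scalerA.
suff -> : iota (e@_m * b) * c = 1 by rewrite scale1r.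
rewrite -[RHS](rmorph1 iota) -bE !rmorphM mulrAC; congr (_ * _).
by rewrite -!mcoeff_map_mpoly rmorphM /= hpE eE -scalerAr mcoeffZ mulrC.
Qed.

End Valuation.

(** O is a local ring of A inside K: the last condition provides denominators in A that are units at
    the place. The residue field has to be one of A, since the fibres of a hypersurface are
    prescribed at those. *)
Definition is_place (A : comNzRingType) (K : fieldType) (j : {rmorphism A -> K})
    (O : comNzRingType) (iota : {rmorphism O -> K}) (incl : {rmorphism A -> O})
    (k : fieldType) (phi : {rmorphism O -> k}) : Prop :=
  [/\ valuation_ring iota phi, forall a, iota (incl a) = j a, residue_field (phi \o incl) &
      forall a, exists s c, phi (incl s) != 0 /\ incl s * a = incl c].

(** The trivial place stands for the generic point; it is what supplies a nonzero element of an
    ideal that is tested place by place. *)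
Lemma generic_place (A : comNzRingType) (K : fieldType) (j : {rmorphism A -> K}) :
  residue_field j -> is_place j (O := K) idfun j (k := K) idfun.
Proof.
move=> res; split=> //.
- split=> // [x|a a0|z]; [by exists x; left | by exists a^-1; rewrite divff | by exists z].
by move=> z; have [c [s [s0 ->]]] := res z; exists s, c; rewrite mulrC divfK.
Qed.

Lemma homog0_const (k : fieldType) n (u : {mpoly k[n]}) : u \is 0.-homog -> u = (u@_0%MM)%:MP.
Proof.
move=> /dhomogP u0; apply/mpolyP => m; rewrite mcoeffC eq_sym.
have [->|m0] := eqVneq m 0%MM; first by rewrite mulr1.
by rewrite mulr0; apply: memN_msupp_eq0; apply: contra m0 => /u0 /eqP; rewrite mdeg_eq0.
Qed.

Lemma homog_unit_factor (k : fieldType) n (f g : {mpoly k[n]}) d : g != 0 ->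
  f \is d.-homog -> g \is d.-homog -> rdvd f g -> exists2 c, c != 0 & g = c *: f.
Proof.
move=> g0 fd gd [u gE].
have f0 : f != 0 by apply: contraNneq g0 => f0; rewrite gE f0 mul0r.
have u0 : u != 0 by apply: contraNneq g0 => u0; rewrite gE u0 mulr0.
have fud : f * u \is d.-homog by rewrite -gE.
have [d1 [d2 [f1 u2 dE]]] := homog_factor f0 u0 fud.
have d2E : d2 = 0%N by apply/eqP; rewrite -(eqn_add2l d1) dE addn0 (dhomog_uniq f0 f1 fd).
rewrite d2E in u2; have uE := homog0_const u2.
exists u@_0%MM; last by rewrite gE {1}uE mulrC mul_mpolyC.
by apply: contraNneq u0 => c0; rewrite uE c0 mpolyC0.
Qed.

Lemma nonsingZ (k : fieldType) n (G : {mpoly k[n]}) c : c != 0 -> nonsing (c *: G) -> nonsing G.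
Proof.
move=> c0 h K f x x0 G0 dG; apply: (h K f x x0) => [|i].
  by rewrite mmapZ G0 mulr0.
by rewrite mderivZ mmapZ dG mulr0.
Qed.

Section PlaceHypersurface.
Variables (A : comNzRingType) (K : fieldType) (j : {rmorphism A -> K}).
Variables (O : comNzRingType) (iota : {rmorphism O -> K}) (incl : {rmorphism A -> O}).
Variables (k : fieldType) (phi : {rmorphism O -> k}).
Hypothesis pl : is_place j iota incl phi.
Variables (r n : nat) (E : seq {mpoly A[n.+2]}) (G : {mpoly K[n.+2]}).
Hypothesis smE : smooth_hypersurface r E.
Hypotheses (G0 : G != 0) (Gr : G \is r.-homog).
Hypothesis GE : forall (R : comNzRingType) (psi : {rmorphism K -> R}) (v : 'rV[R]_n.+2),
  unimod v -> vanish (psi \o j) E v <-> ev psi v G = 0.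
Variables (c : K) (Gp : {mpoly O[n.+2]}).
Hypotheses (c0 : c != 0) (GpE : map_mpoly iota Gp = c *: G) (Gp0 : map_mpoly phi Gp != 0).

(* The equations of E are multiples of the primitive form Gp, by the Gauss lemma; the cofactors have no
   common zero modulo the maximal ideal, hence none at all by Nakayama's lemma. *)
Lemma place_hypersurface :
  [/\ Gp \is r.-homog, nonsing (map_mpoly phi Gp),
      forall l : 'I_(size E), exists h, map_mpoly incl E`_l = Gp * h &
      exists N, forall i, gen_ideal (fun l : 'I_(size E) => map_mpoly incl E`_l) ('X_i ^+ N * Gp)].
Proof.
have [V inclE res den] := pl; have [hE smo fib] := smE.
have Gpr : Gp \is r.-homog by apply: (map_mpoly_homog V); rewrite GpE dhomogZ.
have /boolp.choice [d ed] : forall l : 'I_(size E), exists d, E`_l \is d.-homog.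
  by move=> l; apply/hE/mem_nth.
have mapE_homog (S : comNzRingType) (f : {rmorphism A -> S}) l : map_mpoly f E`_(val l) \is (d l).-homog.
  by apply: map_homog; exact: ed.
have /boolp.choice [h hP] : forall l : 'I_(size E), exists h,
    map_mpoly incl E`_l = Gp * h /\ exists d', h \is d'.-homog.
  move=> l; have [h0 h0E] : rdvd G (map_mpoly j E`_l).
    apply: (subscheme_divides Gr (mapE_homog _ _ l)) => R psi v i vi.
    rewrite mmap_map_mpoly => /(GE psi (unimod_coord vi)); apply.
    by apply: mem_nth; exact: ltn_ord.
  have eE : map_mpoly iota (map_mpoly incl E`_l) = map_mpoly iota Gp * (c^-1 *: h0).
    rewrite GpE -scalerAl -scalerAr scalerA divff // scale1r -h0E.
    by apply/mpolyP => m; rewrite !mcoeff_map_mpoly; exact: inclE.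
  have [h [hh hiota]] := gauss_lift V Gp0 eE; exists h; split=> //.
  have [h00|h00] := eqVneq h0 0.
    exists 0%N; apply: (map_mpoly_homog V); rewrite hiota h00 scaler0; exact: dhomog0.
  have [|d1 [d2 [_ h0d _]]] := @homog_factor _ _ G h0 (d l) G0 h00.
    by rewrite -h0E; exact: mapE_homog.
  by exists d2; apply: (map_mpoly_homog V); rewrite hiota dhomogZ.
have hGp (l : 'I_(size E)) : map_mpoly incl E`_l = Gp * h l by case: (hP l).
have /boolp.choice [dh hd] : forall l, exists d', h l \is d'.-homog by move=> l; have [] := hP l.
have phigpr : map_mpoly phi Gp \is r.-homog by exact: map_homog Gpr.
have [G' [G'0 G'r nsG' G'E]] := hypersurface_fiber smE res.
have evE (R : comNzRingType) (psi : {rmorphism k -> R}) (v : 'rV[R]_n.+2) (l : 'I_(size E)) :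
    ev (psi \o (phi \o incl)) v E`_l = ev psi v (map_mpoly phi Gp) * ev psi v (map_mpoly phi (h l)).
  rewrite -rmorphM /= -rmorphM /= -hGp !mmap_map_mpoly; exact: eq_mmap.
have vanE (R : comNzRingType) (psi : {rmorphism k -> R}) (v : 'rV[R]_n.+2) :
    vanish (psi \o (phi \o incl)) E v <-> forall l : 'I_(size E), ev (psi \o (phi \o incl)) v E`_l = 0.
  split=> [hv l|hv e /(nthP 0) [l ls <-]]; first exact/hv/mem_nth.
  exact: (hv (Ordinal ls)).
have [u u0 G'u] : exists2 u, u != 0 & G' = u *: map_mpoly phi Gp.
  apply: (homog_unit_factor G'0 phigpr G'r).
  apply: (subscheme_divides phigpr G'r) => R psi v i vi hv.
  apply/(G'E R psi v (unimod_coord vi))/vanE => l.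
  by rewrite evE hv mul0r.
split=> //.
- by apply: (nonsingZ u0); rewrite -G'u.
- by move=> l; exists (h l).
have : forall i : 'I_n.+2, exists N, gen_ideal (fun l => map_mpoly phi (h l)) ('X_i ^+ N).
  move=> i; have [|N [a aE]] := @subscheme_ideal k n.+2 (size E)
    (fun l => map_mpoly (phi \o incl) E`_l) d (map_mpoly phi Gp) r i (mapE_homog _ _) phigpr.
    move=> R psi v vi hv; have : vanish (psi \o (phi \o incl)) E v.
      by apply/vanE => l; have := hv l; rewrite mmap_map_mpoly.
    move=> /(G'E R psi v (unimod_coord vi)); rewrite G'u mmapZ => hu.
    have : psi (u^-1 * u) * ev psi v (map_mpoly phi Gp) = 0 by rewrite rmorphM -mulrA hu mulr0.
    by rewrite mulVf // rmorph1 mul1r.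
  exists N, a; apply: (mulIf Gp0); rewrite aE mulr_suml; apply: eq_bigr => l _.
  rewrite -mulrA; congr (_ * _); rewrite mulrC -rmorphM /= -hGp.
  by apply/mpolyP => m; rewrite !mcoeff_map_mpoly.
move=> /boolp.choice [N hN].
have {}hN i : gen_ideal (fun l => map_mpoly phi (h l)) ('X_i ^+ (\sum_i N i)).
  rewrite (bigD1 i) //= exprD mulrC.
  by have [_ _] := gen_is_ideal (fun l => map_mpoly phi (h l)); apply.
have [_ _ unit surj] := V; have [D hD] := homog_nakayama surj unit hd hN.
exists D => i; have [a ->] := hD i; exists a; rewrite mulr_suml; apply: eq_bigr => l _.
by rewrite hGp -mulrA [h l * _]mulrC.
Qed.

End PlaceHypersurface.

(** * Stability of smooth forms *)

Section TooFewForms.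
Variables (K : fieldType) (s e D : nat) (f : 'I_s.+1 -> {mpoly K[s.+2]}).
Hypotheses (e0 : (0 < e)%N) (fe : forall l, f l \is e.-homog).
Hypothesis fD : forall i, gen_ideal f ('X_i ^+ D).

Local Notation T0 := (s.+2 * D).+1.
Local Notation sub := (mmap (@mpolyC s.+2 K) f).

Let spanned T (p : {mpoly K[s.+2]}) : Prop :=
  exists q : 'X_{1..s.+2 < T0} -> {mpoly K[s.+1]},
    (forall m al, al \in msupp (q m) -> (e * mdeg al + mdeg m = T)%N) /\
    p = \sum_m sub (q m) * 'X_[m].

Let spannedD T p p' : spanned T p -> spanned T p' -> spanned T (p + p').
Proof.
move=> [q [qT ->]] [q' [qT' ->]]; exists (fun m => q m + q' m); split=> [m al|].
  by move=> /msuppD_le; rewrite mem_cat => /orP [/qT|/qT'].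
by rewrite -big_split; apply: eq_bigr => m _; rewrite rmorphD mulrDl.
Qed.

Let spanned0 T : spanned T 0.
Proof.
exists (fun=> 0); split=> [m al|]; first by rewrite msupp0.
by rewrite big1 // => m _; rewrite rmorph0 mul0r.
Qed.

Let spannedM T p l : spanned T p -> spanned (e + T) (p * f l).
Proof.
move=> [q [qT ->]]; exists (fun m => q m * 'X_l); split=> [m al|].
  rewrite (perm_mem (msuppMX _ _)) => /mapP [al' /qT <- ->].
  by rewrite mdegD mdeg1 mulnDr muln1 addnA.
rewrite mulr_suml; apply: eq_bigr => m _.
by rewrite rmorphM /= mmapX mmap1U mulrAC.
Qed.

(* So K[x] is a finite module over K[f]; its part of degree T would have dimension O(T^s), but it
   has dimension about T^(s+1). *)
Lemma homog_spanned T p : p \is T.-homog -> spanned T p.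
Proof.
have [M] := ubnP T; elim: M T p => // M IHM T p TM pT.
have [TT0|TT0] := ltnP T T0.
  exists (fun m => (p@_m)%:MP); split=> [m al|].
    rewrite msuppC; case: eqP => [//|/eqP pm]; rewrite inE => /eqP ->.
    move/dhomogP: pT => /(_ m); rewrite mcoeff_msupp => /(_ pm) <-.
    by rewrite mdeg0 muln0.
  rewrite [LHS](@mpolywE _ _ T0); first by apply: eq_bigr => m _; rewrite mmapC mul_mpolyC.
  rewrite msizeE; apply/bigmax_leqP_seq => m mp _.
  by move/dhomogP: pT => ->.
have [a aE] : gen_ideal f p.
  rewrite [p]mpolyE big_seq; apply: is_ideal_sum; first exact: gen_is_ideal.
  move=> m mp; have mT : mdeg m = T by move/dhomogP: pT => ->.
  have [i iD] : exists i, (D <= m i)%N by apply: large_mdeg; rewrite mT.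
  have [_ _ JM] := gen_is_ideal f; rewrite -mul_mpolyC; apply: (JM).
  suff -> : 'X_[m] = 'X_[m - U_(i) *+ D] * 'X_i ^+ D :> {mpoly K[s.+2]} by apply: JM.
  rewrite mpolyXn -mpolyXD submK //; apply/mnm_lepP => j; rewrite mulmnE mnm1E.
  by case: eqP => [<-|_]; rewrite ?mul1n ?mul0n.
rewrite -(pihomog_dE pT) aE raddf_sum /=.
apply: (big_ind (spanned T)) => [||l _]; [exact: spanned0 | exact: spannedD |].
rewrite (pihomogM _ _ (fe l)); case: leqP => eT; last by rewrite mul0r; exact: spanned0.
rewrite -{1}(subnKC eT); apply/spannedM/IHM; last exact: pihomogP.
by rewrite ltnS in TM; apply: leq_trans TM; rewrite ltn_subrL e0 (leq_trans e0 eT).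
Qed.

Lemma too_few_forms_aux : False.
Proof.
(* The spanning products of degree T number at most c0 (T + 1)^s, which is at most t (t + 1)^s since
   T + 1 <= (s + 1)(t + 1). On the other side stand the (t + 1)^(s + 1) monomials whose first s + 1
   exponents are at most t. *)
pose c0 := #|{: 'X_{1..s.+2 < T0}}|; pose t := (c0 * s.+1 ^ s)%N; pose T := (s.+1 * t)%N.
pose BT := {ffun 'I_s.+1 -> 'I_t.+1}.
pose mono (b : BT) : 'X_{1..s.+2} :=
  [multinom (if unlift ord_max i is Some i' then b i' : nat else T - \sum_l b l)%N | i < s.+2].
have monoT b : mdeg (mono b) = T.
  rewrite mdegE big_ord_recr /= mnmE unlift_none.
  rewrite (eq_bigr (fun i => b i : nat)) => [|i _]; last first.
    have -> : widen_ord (leqnSn s.+1) i = lift ord_max i.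
      by apply: val_inj; rewrite /= /bump leqNgt ltn_ord.
    by rewrite mnmE liftK.
  rewrite subnKC //; apply: leq_trans (_ : \sum_(i < s.+1) t <= _)%N.
    by apply: leq_sum => i _; exact: leq_ord.
  by rewrite sum_nat_const card_ord.
have mono_inj : injective mono.
  move=> b b' /mnmP h; apply/ffunP => i; apply: val_inj.
  by have := h (lift ord_max i); rewrite !mnmE liftK.
have /boolp.choice [q hq] : forall b, exists q : 'X_{1..s.+2 < T0} -> {mpoly K[s.+1]},
    (forall m al, al \in msupp (q m) -> (e * mdeg al + mdeg m = T)%N) /\
    'X_[mono b] = \sum_m sub (q m) * 'X_[m].
  by move=> b; apply: homog_spanned; rewrite dhomogX; exact/eqP/monoT.
pose J : {set 'X_{1..s.+2 < T0} * 'X_{1..s.+1 < T.+1}} :=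
  finset (fun x : 'X_{1..s.+2 < T0} * 'X_{1..s.+1 < T.+1} => e * mdeg x.2 + mdeg x.1 == T)%N.
have XE b : 'X_[mono b] = \sum_(x in J) (q b x.1)@_x.2 *: (sub 'X_[x.2] * 'X_[x.1]).
  have [qT ->] := hq b; transitivity (\sum_(x : 'X_{1..s.+2 < T0} * 'X_{1..s.+1 < T.+1})
      (q b x.1)@_x.2 *: (sub 'X_[x.2] * 'X_[x.1])).
    rewrite -(pair_bigA _ (fun m al : bmultinom _ _ => (q b m)@_al *: (sub 'X_[al] * 'X_[m]))) /=.
    apply: eq_bigr => m _; rewrite {1}[q b m](@mpolywE _ _ T.+1); last first.
      rewrite msizeE; apply/bigmax_leqP_seq => al /qT <- _.
      by rewrite ltnS (leq_trans _ (leq_addr _ _)) // leq_pmull.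
    rewrite raddf_sum mulr_suml; apply: eq_bigr => al _ /=.
    by rewrite mmapZ -mulrA mul_mpolyC.
  rewrite [RHS]big_mkcond; apply: eq_bigr => x _; rewrite inE.
  case: ifPn => // /eqP xT; rewrite memN_msupp_eq0 ?scale0r //.
  by apply/negP => /qT.
pose eJ (x : 'I_#|J|) : 'X_{1..s.+2 < T0} * 'X_{1..s.+1 < T.+1} := enum_val x.
pose eB (b : 'I_#|{: BT}|) : BT := enum_val b.
pose A : 'M[K]_(#|{: BT}|, #|J|) := \matrix_(b, x) (q (eB b) (eJ x).1)@_(eJ x).2.
pose B : 'M[K]_(#|J|, #|{: BT}|) :=
  \matrix_(x, b) (sub 'X_[(eJ x).2] * 'X_[(eJ x).1])@_(mono (eB b)).
have AB : A *m B = 1%:M.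
  apply/matrixP => b b'; rewrite !mxE.
  have := congr1 (mcoeff (mono (eB b'))) (XE (eB b)).
  rewrite mcoeffX (inj_eq mono_inj) (inj_eq enum_val_inj) => ->.
  rewrite raddf_sum [RHS]big_enum_val; apply: eq_bigr => x _ /=.
  by rewrite mcoeffZ !mxE.
have : (#|{: BT}| <= #|J|)%N.
  by rewrite -(mxrank1 K #|{: BT}|) -AB (leq_trans (mxrankM_maxl _ _)) // rank_leq_col.
rewrite card_ffun !card_ord leqNgt => /negP; apply.
(* The exponents in the f l have a total fixed by m, so the first is determined by the others;
   without this saving the count would not be strict. *)
pose g (x : 'X_{1..s.+2 < T0} * 'X_{1..s.+1 < T.+1}) : 'X_{1..s.+2 < T0} * {ffun 'I_s -> 'I_T.+1} :=
  (x.1, [ffun i => inord (bmnm x.2 (lift ord0 i))]).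
have g_inj : {in J &, injective g}.
  move=> [m al] [m' al']; rewrite !inE /= => /eqP h /eqP h' [mE /ffunP alE].
  congr pair => //; apply/val_inj/mnmP => i.
  have comp i' : al (lift ord0 i') = al' (lift ord0 i') :> nat.
    have bd (be : 'X_{1..s.+1 < T.+1}) : (be (lift ord0 i') < T.+1)%N.
      by apply: leq_ltn_trans (bmdeg be); rewrite mdegE (bigD1 (lift ord0 i')) // leq_addr.
    by have := congr1 val (alE i'); rewrite !ffunE /= !inordK.
  case: (unliftP ord0 i) => [i'|] -> /=; first exact: comp.
  have : (e * mdeg al = e * mdeg al')%N.
    by apply/eqP; rewrite -(eqn_add2r (mdeg m)) h mE h'.
  move/eqP; rewrite eqn_pmul2l // !mdegE !big_ord_recl => /eqP.
  under eq_bigr => i' _ do rewrite comp.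
  by move/addIn.
rewrite -(card_in_imset g_inj); apply: leq_ltn_trans (max_card _) _.
rewrite card_prod card_ffun !card_ord -/c0.
apply: leq_ltn_trans (_ : c0 * (s.+1 * t.+1) ^ s < _)%N.
  have TE : (T.+1 <= s.+1 * t.+1)%N by rewrite mulnS /T addnC -addn1 leq_add2l.
  rewrite leq_mul2l; apply/orP; right; have [s0|s0] := posnP s.
    by rewrite s0 !expn0.
  by rewrite leq_exp2r.
by rewrite expnMn mulnA -/t expnS ltn_mul2r expn_gt0 /= ltnS leqnn.
Qed.

End TooFewForms.

(** A case of the projective dimension theorem, by counting monomials; for s = 0 the ideal is
    zero. *)
Lemma too_few_forms (K : fieldType) s (f : 'I_s -> {mpoly K[s.+1]}) e D :
  (0 < e)%N -> (forall l, f l \is e.-homog) -> (forall i, gen_ideal f ('X_i ^+ D)) -> False.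
Proof.
case: s f => [|s] f e0 fe fD; last exact: too_few_forms_aux e0 fe fD.
have [a /eqP] := fD ord0; rewrite big_ord0.
by rewrite (negPf (expf_neq0 _ (mpolyX_neq0 _ _))).
Qed.

(** * Elementary divisors over a valuation ring *)

Section Smith.
Variable O : comNzRingType.

Definition inv_pair m (U U' : 'M[O]_m) := U *m U' = 1%:M.

Lemma inv_pairM m (U U' W W' : 'M[O]_m) :
  inv_pair U U' -> inv_pair W W' -> inv_pair (U *m W) (W' *m U').
Proof. by move=> UU WW; rewrite /inv_pair mulmxA -(mulmxA U) WW mulmx1. Qed.

Lemma tperm_inv_pair m (i j : 'I_m) : inv_pair (tperm_mx i j) (tperm_mx i j).
Proof. by rewrite /inv_pair /tperm_mx -perm_mxM tperm2 perm_mx1. Qed.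

Hypothesis total : forall (I : finType) (g : I -> O), (exists i, g i != 0) ->
  exists i0, g i0 != 0 /\ forall i, rdvd (g i0) (g i).

Lemma val_smith m (M : 'M[O]_m) : exists (U U' W W' : 'M[O]_m) (d : 'rV[O]_m),
  [/\ inv_pair U U', inv_pair W W', M = U *m diag_mx d *m W &
      forall i j : 'I_m, (i <= j)%N -> rdvd (d 0 i) (d 0 j)].
Proof.
elim: m M => [|m IHm] M.
  exists 1%:M, 1%:M, 1%:M, 1%:M, 0; rewrite /inv_pair mulmx1; split=> //; last by case.
  by apply/matrixP; case.
have [M0|M0] := pselect (exists ij, M ij.1 ij.2 != 0); last first.
  exists 1%:M, 1%:M, 1%:M, 1%:M, 0; rewrite /inv_pair !mulmx1 mul1mx; split=> // [|i j _].
    apply/matrixP => i j; rewrite linear0 mxE; apply/eqP/negPn/negP => Mij.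
    by apply: M0; exists (i, j).
  by rewrite !mxE; exists 0; rewrite mulr0.
have [[i0 j0] [/= c0 hM]] := total M0.
set c := M i0 j0 in c0 hM.
have /boolp.choice [a aE] : forall i, exists a : 'I_m.+1 -> O, forall j, M i j = c * a j.
  by move=> i; have /boolp.choice [a0 h] := fun j => hM (i, j); exists a0.
(* The pivot is set to 1 by hand, which avoids cancelling c. *)
pose b : 'M[O]_(m.+1) := \matrix_(i, j) (if (i == i0) && (j == j0) then 1 else a i j).
have ME : M = c *: b.
  apply/matrixP => i j; rewrite !mxE; case: ifP => [/andP [/eqP -> /eqP ->]|_]; last exact: aE.
  by rewrite mulr1.
pose b' : 'M[O]_(1 + m) := tperm_mx i0 0 *m b *m tperm_mx j0 0.
have b'0 : ulsubmx b' = 1%:M.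
  rewrite /b' -xrowE -xcolE; apply/matrixP => i j; rewrite !mxE !ord1 /=.
  by rewrite lshift0 !tpermR !eqxx.
have bE : b = tperm_mx i0 0 *m b' *m tperm_mx j0 0.
  rewrite /b' -!mulmxA tperm_inv_pair mulmx1 !mulmxA.
  by rewrite [tperm_mx i0 0 *m _]tperm_inv_pair mul1mx.
have [U [U' [W [W' [d [UU WW BE sd]]]]]] := IHm (drsubmx b' - dlsubmx b' *m ursubmx b').
pose L : 'M[O]_(1 + m) := block_mx 1%:M 0 (dlsubmx b') 1%:M.
pose Ri : 'M[O]_(1 + m) := block_mx 1%:M (ursubmx b') 0 1%:M.
have LL : inv_pair L (block_mx 1%:M 0 (- dlsubmx b') 1%:M : 'M_(1 + m)).
  rewrite /inv_pair mulmx_block !mulmx1 !mul1mx !mul0mx !mulmx0 !addr0 add0r subrr.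
  by rewrite -scalar_mx_block.
have RR : inv_pair Ri (block_mx 1%:M (- ursubmx b') 0 1%:M : 'M_(1 + m)).
  rewrite /inv_pair mulmx_block !mulmx1 !mul1mx !mul0mx !mulmx0 !addr0 add0r addNr.
  by rewrite -scalar_mx_block.
have blk (X X' : 'M[O]_m) : inv_pair X X' ->
    inv_pair (block_mx 1%:M 0 0 X : 'M_(1 + m)) (block_mx 1%:M 0 0 X' : 'M_(1 + m)).
  move=> XX; rewrite /inv_pair mulmx_block !mulmx1 !mul0mx !mulmx0 !addr0 add0r XX.
  by rewrite -scalar_mx_block.
have b'E : b' = L *m (block_mx 1%:M 0 0 U *m diag_mx (row_mx 1 d) *m block_mx 1%:M 0 0 W) *m Ri.
  rewrite diag_mx_row (_ : diag_mx 1 = 1%:M); last first.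
    by apply/matrixP => i j; rewrite !ord1 !mxE !eqxx.
  rewrite !mulmx_block !mulmx1 !mul1mx !mul0mx !mulmx0 !addr0 !add0r ?mulmx1 ?mul0mx ?mulmx0 ?addr0 ?add0r.
  by rewrite -BE addrC subrK mul1mx -b'0 submxK.
exists (tperm_mx i0 0 *m (L *m block_mx 1%:M 0 0 U)), ((block_mx 1%:M 0 0 U' *m block_mx 1%:M 0 (- dlsubmx b') 1%:M) *m tperm_mx i0 0).
exists (block_mx 1%:M 0 0 W *m Ri *m tperm_mx j0 0), (tperm_mx j0 0 *m (block_mx 1%:M (- ursubmx b') 0 1%:M *m block_mx 1%:M 0 0 W')).
pose dd : 'rV[O]_(1 + m) := c *: row_mx 1 d.
have ddE (l : 'I_(1 + m)) : dd 0 l = c * (row_mx 1 d : 'rV[O]_(1 + m)) 0 l by rewrite mxE.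
exists dd; split.
- by apply: inv_pairM; [exact: tperm_inv_pair | apply: inv_pairM => //; exact: blk].
- by apply: inv_pairM; [apply: inv_pairM => //; exact: blk | exact: tperm_inv_pair].
- rewrite ME bE b'E /dd linearZ /= -scalemxAr -scalemxAl; congr (_ *: _).
  by rewrite !mulmxA.
move=> i j; rewrite !ddE {ddE}.
have e1 : (1 : 'rV[O]_1) 0 0 = 1 by rewrite mxE eqxx.
case: (@fintype.splitP 1 m i) => i1 i1E; case: (@fintype.splitP 1 m j) => j1 j1E ij.
- have -> : i = lshift m i1 by apply: val_inj.
  have -> : j = lshift m j1 by apply: val_inj.
  by rewrite !row_mxEl !ord1; exists 1; rewrite mulr1.
- have -> : i = lshift m i1 by apply: val_inj.
  have -> : j = rshift 1 j1 by apply: val_inj.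
  by rewrite row_mxEl row_mxEr !ord1 e1 mulr1; exists (d 0 j1).
- by move: ij; rewrite i1E j1E !ord1.
have -> : i = rshift 1 i1 by apply: val_inj.
have -> : j = rshift 1 j1 by apply: val_inj.
rewrite !row_mxEr; have [|e eE] := sd i1 j1; first by rewrite -(leq_add2l 1) -i1E -j1E.
by exists e; rewrite eE mulrA.
Qed.

End Smith.

Lemma val_total (O : comNzRingType) (K k : fieldType) (iota : {rmorphism O -> K})
    (phi : {rmorphism O -> k}) : valuation_ring iota phi ->
  forall (I : finType) (g : I -> O), (exists i, g i != 0) ->
  exists i0, g i0 != 0 /\ forall i, rdvd (g i0) (g i).
Proof.
move=> V I g [i1 gi1]; have [inj _ _ _] := V.
have inj0 x : iota x != 0 <-> x != 0 by rewrite -(rmorph0 iota) (inj_eq inj).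
have [|i0 [_ /inj0 gi0 h]] := val_min V (s := enum I) (g := iota \o g).
  by exists i1; [rewrite mem_enum | apply/inj0].
exists i0; split=> // i; have [|a aE] := h i; first by rewrite mem_enum.
by exists a; apply: inj; rewrite rmorphM mulrC.
Qed.

(** * Linear substitutions *)

Section LinearSubstitution.
Variable R : comNzRingType.

(** The value of [lin M p] at a row v is that of p at v M; with this convention [lin] respects the
    order of matrix products. *)
Definition lin m (M : 'M[R]_m) : {mpoly R[m]} -> {mpoly R[m]} :=
  mmap (@mpolyC m R) (fun i => \sum_j M j i *: 'X_j).

Lemma linX m (M : 'M[R]_m) i : lin M 'X_i = \sum_j M j i *: 'X_j.
Proof. by rewrite /lin mmapX mmap1U. Qed.

Lemma linD m (M : 'M[R]_m) p q : lin M (p + q) = lin M p + lin M q.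
Proof. exact: rmorphD. Qed.

Lemma lin_M m (M : 'M[R]_m) p q : lin M (p * q) = lin M p * lin M q.
Proof. exact: rmorphM. Qed.

Lemma linC m (M : 'M[R]_m) c : lin M c%:MP = c%:MP.
Proof. by rewrite /lin mmapC. Qed.

Lemma linZ m (M : 'M[R]_m) c p : lin M (c *: p) = c *: lin M p.
Proof. by rewrite -!mul_mpolyC lin_M linC. Qed.

Lemma lin_sum m (M : 'M[R]_m) (I : Type) (s : seq I) (P : pred I) F :
  lin M (\sum_(i <- s | P i) F i) = \sum_(i <- s | P i) lin M (F i).
Proof. exact: raddf_sum. Qed.

Lemma lin_mulmx m (A B : 'M[R]_m) p : lin (A *m B) p = lin A (lin B p).
Proof.
elim/mpoly_ring_ind: p => [c|i|p q IHp IHq|p q IHp IHq].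
- by rewrite !linC.
- rewrite !linX lin_sum; under [RHS]eq_bigr => j _ do rewrite linZ linX scaler_sumr.
  rewrite exchange_big; apply: eq_bigr => j _; rewrite mxE scaler_suml.
  by apply: eq_bigr => l _; rewrite scalerA mulrC.
- by rewrite !linD IHp IHq.
- by rewrite !lin_M IHp IHq.
Qed.

Lemma lin1 m p : lin (1%:M : 'M[R]_m) p = p.
Proof.
elim/mpoly_ring_ind: p => [c|i|p q IHp IHq|p q IHp IHq].
- by rewrite linC.
- rewrite linX (bigD1 i) //= mxE eqxx scale1r big1 ?addr0 // => j /negPf ji.
  by rewrite mxE ji scale0r.
- by rewrite linD IHp IHq.
- by rewrite lin_M IHp IHq.
Qed.

Lemma lin_homog m (M : 'M[R]_m) d p : p \is d.-homog -> lin M p \is d.-homog.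
Proof.
move=> pd; pose lq := [tuple (\sum_j M j i *: 'X_j : {mpoly R[m]}) | i < m].
rewrite -(mul1n d); suff -> : lin M p = p \mPo lq.
  apply: comp_dhomog => // i; rewrite tnth_mktuple rpred_sum // => j _.
  by rewrite dhomogZ // dhomogX /= mdeg1.
by apply: eq_mmap => // i; rewrite tnth_mktuple.
Qed.

Lemma ev_lin (S : comNzRingType) (psi : {rmorphism R -> S}) m (M : 'M[R]_m) (v : 'rV[S]_m) p :
  ev psi v (lin M p) = ev psi (v *m map_mx psi M) p.
Proof.
elim/mpoly_ring_ind: p => [c|i|p q IHp IHq|p q IHp IHq].
- by rewrite linC !mmapC.
- rewrite linX raddf_sum [RHS]mmapX mmap1U mxE; apply: eq_bigr => j _ /=.
  by rewrite mmapZ mmapX mmap1U mxE mulrC.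
- by rewrite linD !mmapD IHp IHq.
- by rewrite lin_M !rmorphM /= IHp IHq.
Qed.

Lemma mderiv_lin m (M : 'M[R]_m) j p :
  mderiv j (lin M p) = \sum_i M j i *: lin M (mderiv i p).
Proof.
elim/mpoly_ring_ind: p => [c|i|p q IHp IHq|p q IHp IHq].
- by rewrite linC mderivC big1 // => i _; rewrite mderivC -mpolyC0 linC mpolyC0 scaler0.
- rewrite linX raddf_sum (bigD1 j) //= big1 ?addr0; last first.
    by move=> l /negPf lj; rewrite mderivZ mderivXU eq_sym lj scaler0.
  rewrite mderivZ mderivXU eqxx (bigD1 i) //= mderivXU eqxx big1 ?addr0.
    by rewrite -mpolyC1 linC.
  by move=> l /negPf li; rewrite mderivXU li -mpolyC0 linC mpolyC0 scaler0.
- rewrite linD !mderivD IHp IHq -big_split; apply: eq_bigr => i _ /=.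
  by rewrite mderivD linD scalerDr.
- rewrite lin_M !mderivM IHp IHq mulr_suml mulr_sumr -big_split; apply: eq_bigr => i _ /=.
  by rewrite mderivM linD !lin_M scalerDr scalerAl -scalerAr.
Qed.

Lemma lin_diagE m (d : 'rV[R]_m) p w : (lin (diag_mx d) p)@_w = p@_w * \prod_i d 0 i ^+ w i.
Proof.
suff E i : lin (diag_mx d) 'X_i = d 0 i *: 'X_i.
  have EX v : lin (diag_mx d) 'X_[v] = (\prod_i d 0 i ^+ v i) *: 'X_[v].
    rewrite -[in RHS]mmap1_id /lin mmapX /mmap1 -scaler_prod; apply: eq_bigr => i _.
    by rewrite -linX E exprZn.
  rewrite [p]mpolyE lin_sum !raddf_sum mulr_suml; apply: eq_bigr => v _ /=.
  rewrite linZ EX !mcoeffZ mcoeffX -mulrA; congr (_ * _).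
  by case: eqP => [->|_]; rewrite ?mulr0 ?mul0r // mulrC.
rewrite linX (bigD1 i) //= mxE eqxx mulr1n big1 ?addr0 // => j /negPf ji.
by rewrite mxE ji mulr0n scale0r.
Qed.

End LinearSubstitution.

Lemma map_lin (R S : comNzRingType) (f : {rmorphism R -> S}) m (M : 'M[R]_m) p :
  map_mpoly f (lin M p) = lin (map_mx f M) (map_mpoly f p).
Proof.
elim/mpoly_ring_ind: p => [c|i|p q IHp IHq|p q IHp IHq].
- by rewrite linC map_mpolyC linC.
- rewrite linX map_mpolyX linX raddf_sum; apply: eq_bigr => j _ /=.
  by rewrite map_mpolyZ map_mpolyX mxE.
- by rewrite linD !rmorphD /= linD IHp IHq.
- by rewrite lin_M !rmorphM /= lin_M IHp IHq.
Qed.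

Lemma map_mderiv (R S : comNzRingType) (f : {rmorphism R -> S}) m j (p : {mpoly R[m]}) :
  map_mpoly f (mderiv j p) = mderiv j (map_mpoly f p).
Proof.
by apply/mpolyP => w; rewrite mcoeff_map_mpoly !mcoeff_mderiv mcoeff_map_mpoly raddfMn.
Qed.

Lemma nonsing_lin (k : fieldType) m (G : {mpoly k[m]}) (M M' : 'M[k]_m) :
  M *m M' = 1%:M -> nonsing G -> nonsing (lin M G).
Proof.
move=> MM h F f c c0 cG cdG; have MF : map_mx f M *m map_mx f M' = 1%:M.
  by rewrite -map_mxM MM map_mx1.
apply: (h F f (c *m map_mx f M)).
- by apply: contraNneq c0 => cM; rewrite -[c]mulmx1 -MF mulmxA cM mul0mx.
- by rewrite -ev_lin.
have M'M : map_mx f M' *m map_mx f M = 1%:M by apply: mulmx1C.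
pose g : 'cV[F]_m := \col_i ev f (c *m map_mx f M) (mderiv i G).
suff g0 : g = 0 by move=> i; have /matrixP/(_ i 0) := g0; rewrite !mxE.
rewrite -[g]mul1mx -M'M -mulmxA (_ : map_mx f M *m g = 0) ?mulmx0 //.
apply/matrixP => j l; rewrite mxE [RHS]mxE -[RHS](cdG j) mderiv_lin raddf_sum.
by apply: eq_bigr => i _ /=; rewrite mmapZ ev_lin !mxE.
Qed.

Section Stability.
Variables (O : comNzRingType) (K k : fieldType).
Variables (iota : {rmorphism O -> K}) (phi : {rmorphism O -> k}).
Hypothesis V : valuation_ring iota phi.

Lemma weight_divides m (d : 'rV[K]_m) (w : 'X_{1..m}) x :
  (forall i, w i != 0%N -> exists a, x = iota a * d 0 i) ->
  exists a, x ^+ mdeg w = iota a * \prod_i d 0 i ^+ w i.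
Proof.
move=> h; have /boolp.choice [a aE] : forall i, exists a, w i != 0%N -> x = iota a * d 0 i.
  by move=> i; have [/h [a]|_] := boolP (w i != 0%N); [exists a | exists 0].
exists (\prod_i a i ^+ w i); rewrite mdegE -prodrXr rmorph_prod -big_split.
apply: eq_bigr => i _ /=; rewrite rmorphXn -exprMn.
by have [->|wi] := eqVneq (w i) 0%N; rewrite ?expr0 // -aE.
Qed.

(* Otherwise replace H by a lift of its reduction without terms that reduce to 0.  On the coordinate
   subspace x_i = 0 (i > l), all its partial derivatives but l of them vanish, so by [too_few_forms]
   all of them have a common zero.  This is done over K, where r is invertible and Euler's formula
   applies. *)
Lemma unstable_weight N r (H : {mpoly O[N.+1]}) (H' : {mpoly O[N.+1]}) (d : 'rV[K]_N.+1) u :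
  (1 < r)%N -> r%:R != 0 :> K -> H \is r.-homog -> nonsing (map_mpoly phi H) ->
  (forall i, d 0 i != 0) -> (forall i j : 'I_N.+1, (i <= j)%N -> exists a, d 0 j = iota a * d 0 i) ->
  u != 0 -> lin (diag_mx d) (map_mpoly iota H) = u *: map_mpoly iota H' ->
  forall l : 'I_N.+1, exists a, d 0 l ^+ r.-1 * d 0 (rev_ord l) = iota a * u.
Proof.
move=> r1 r0 Hr ns d0 sd u0 HH l; have [inj tot unit surj] := V.
apply: contrapT => /forallNP nex; set e := _ * _ in nex.
have e0 : e != 0 by rewrite mulf_neq0 ?expf_neq0.
(* If the conclusion fails, u has larger valuation than e, that is, u / e lies in the maximal
   ideal. *)
have [a0 uE phia0] : exists2 a0, u = iota a0 * e & phi a0 = 0.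
  have [a0 [aE|aE]] := tot (u / e); last first.
    by case: (nex a0); apply: (mulIf (invr_neq0 e0)); rewrite divff // -aE [LHS]mulrC mulrA.
  exists a0; first by rewrite -aE divfK.
  apply/eqP/negPn/negP => /unit [b ab1]; case: (nex b).
  by rewrite -[u](divfK e0) aE mulrA -rmorphM mulrC [b * _]mulrC ab1 rmorph1 mulr1.
(* The weight of this monomial divides e, so its coefficient in H is a0 times an element of O. *)
have phiH0 (w : 'X_{1..N.+1}) (j : 'I_N.+1) : mdeg w = r.-1 -> (j <= rev_ord l)%N ->
    (forall i : 'I_N.+1, (l < i)%N -> w i = 0%N) -> phi H@_(w + U_(j))%MM = 0.
  move=> wr jl wl; have [a1 a1E] := sd _ _ jl.
  have [|a2 a2E] := @weight_divides _ d w (d 0 l).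
    by move=> i wi; apply: sd; rewrite leqNgt; apply: contra_neqN wi => /wl.
  pose v := (w + U_(j))%MM; pose wt := \prod_i d 0 i ^+ v i.
  have wt0 : wt != 0 by apply/prodf_neq0 => i _; rewrite expf_neq0.
  have wtE : e = iota (a2 * a1) * wt.
    rewrite /e -wr a2E a1E rmorphM /wt.
    under [in RHS]eq_bigr => i _ do rewrite mnmDE exprD.
    have U1 : \prod_i d 0 i ^+ U_(j)%MM i = d 0 j.
      rewrite (bigD1 j) //= mnm1E eqxx expr1 big1 ?mulr1 // => i /negPf ij.
      by rewrite mnm1E eq_sym ij expr0.
    by rewrite big_split /= U1 mulrACA.
  have := congr1 (mcoeff v) HH.
  rewrite lin_diagE -/wt mcoeffZ !mcoeff_map_mpoly uE wtE => h.
  have : H@_v = a0 * (a2 * a1) * H'@_v.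
    apply: inj; apply: (mulIf wt0); rewrite !rmorphM; rewrite h !rmorphM; ring.
  by move=> ->; rewrite !rmorphM phia0 !mul0r.
have [Hh [HhE Hh0]] := @mpoly_lift _ _ phi N.+1 (map_mpoly phi H) (fun m _ => surj _).
have Hhr : Hh \is r.-homog.
  apply/dhomogP => m; rewrite mcoeff_msupp => m0.
  have /dhomogP := map_homog phi Hr; apply; rewrite mcoeff_msupp.
  by apply: contraNneq m0 => /Hh0 ->.
pose hf (i : 'I_N.+2) := if unlift ord0 i is Some j then mderiv j Hh else Hh.
have [N0 hN0] := nonsing_ideal ns.
have [||D hD] := @homog_nakayama _ _ phi _ _ hf (fun i => if unlift ord0 i is Some j then r.-1 else r) N0 surj unit.
- move=> i; rewrite /hf; case: unlift => [j|] //; exact: mderiv_homog.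
- move=> i; have [a [b ->]] := hN0 i; exists (fun i => if unlift ord0 i is Some j then b j else a).
  rewrite [RHS]big_ord_recl /hf unlift_none HhE; congr (_ + _); apply: eq_bigr => j _.
  by rewrite liftK map_mderiv HhE.
pose HK := map_mpoly iota Hh.
have HKr : HK \is r.-homog by exact: map_homog.
have hK i : gen_ideal (fun j => mderiv j HK) ('X_i ^+ D).
  have [a aE] := gen_ideal_map (map_mpoly iota) (hD i).
  rewrite rmorphXn /= map_mpolyX in aE; rewrite aE.
  have idK := gen_is_ideal (fun j => mderiv j HK); have [_ _ KM] := idK.
  apply: is_ideal_sum => // i' _; apply: (KM); rewrite /= /hf; case: unlift => [j|].
    by rewrite map_mderiv; exact: (gen_ideal_gen (fun j => mderiv j HK)).
  have HKE : (r%:R^-1)%:MP * \sum_j 'X_j * mderiv j HK = HK.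
    rewrite (euler_homog HKr) mulrA -(rmorph_nat (@mpolyC N.+1 K) r) -mpolyCM.
    by rewrite mulVf // mpolyC1 mul1r.
  suff : gen_ideal (fun j => mderiv j HK) ((r%:R^-1)%:MP * \sum_j 'X_j * mderiv j HK) by rewrite HKE.
  apply: (KM); apply: is_ideal_sum => // j _; apply: (KM).
  exact: (gen_ideal_gen (fun j => mderiv j HK)).
(* Restriction to l + 1 variables. The derivatives of index at most N - l vanish there, and l are
   left. *)
pose lq := [tuple (if (i <= l)%N then 'X_(inord i) else 0 : {mpoly K[l.+1]}) | i < N.+1].
have rhoX i : 'X_i \mPo lq = (if (i <= l)%N then 'X_(inord i) else 0 : {mpoly K[l.+1]}).
  by rewrite comp_mpolyXU -tnth_nth tnth_mktuple.
have rho0 (j : 'I_N.+1) : (j <= rev_ord l)%N -> mderiv j HK \mPo lq = 0.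
  move=> jl; rewrite comp_mpolyE big_seq big1 // => w; rewrite mcoeff_msupp => w0.
  have [[i il wi]|nw] := pselect (exists2 i : 'I_N.+1, (l < i)%N & w i != 0%N).
    by rewrite (bigD1 i) //= tnth_mktuple leqNgt il expr0n (negPf wi) mul0r scaler0.
  have Hw : HK@_(w + U_(j)) = 0.
    rewrite mcoeff_map_mpoly (Hh0 _) ?raddf0 // mcoeff_map_mpoly; apply: phiH0 => //.
      have /dhomogP := mderiv_homog j HKr; apply; by rewrite mcoeff_msupp.
    by move=> i il; apply/eqP/negPn/negP => wi; apply: nw; exists i.
  by rewrite mcoeff_mderiv Hw mul0rn eqxx in w0.
have jP (i : 'I_l) : (N - l + i.+1 < N.+1)%N by have := ltn_ord i; have := ltn_ord l; lia.
pose g (i : 'I_l) := mderiv (Ordinal (jP i)) HK \mPo lq.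
apply: (@too_few_forms K l g r.-1 D).
- by case: (r) r1 => // -[].
- move=> i; rewrite -[r.-1]mul1n; apply: comp_dhomog; first exact: mderiv_homog.
  move=> i'; rewrite tnth_mktuple; case: ifP => _; last exact: dhomog0.
  by rewrite dhomogX /= mdeg1.
move=> i; have il : (i < N.+1)%N by apply: leq_trans (ltn_ord l); exact: ltn_ord.
have [a aE] := gen_ideal_map (comp_mpoly lq) (hK (Ordinal il)).
have -> : 'X_i = 'X_(Ordinal il) \mPo lq.
  by rewrite rhoX /= -ltnS ltn_ord; congr 'X_ _; apply: val_inj; rewrite /= inordK.
rewrite -rmorphXn /= aE; apply: is_ideal_sum; first exact: gen_is_ideal.
move=> j _; have [_ _ GM] := gen_is_ideal g; apply: GM => /=.
have [jl|jl] := leqP j (rev_ord l); first by rewrite rho0 //; case: (gen_is_ideal g).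
have j'l : (j - (N - l).+1 < l)%N by move: jl; have := ltn_ord j; have := ltn_ord l; rewrite /=; lia.
have -> : j = Ordinal (jP (Ordinal j'l)).
  by apply: val_inj; move: jl; have := ltn_ord l; rewrite /=; lia.
exact: (gen_ideal_gen g (Ordinal j'l)).
Qed.

End Stability.

Section StableMatrix.
Local Opaque lin.
Variables (O : comNzRingType) (K k : fieldType).
Variables (iota : {rmorphism O -> K}) (phi : {rmorphism O -> k}).
Hypothesis V : valuation_ring iota phi.

Definition vunit (x : K) : Prop := exists a b, [/\ x = iota a, x^-1 = iota b & x != 0].

Lemma vunitP (a b : O) : a * b = 1 -> vunit (iota a).
Proof.
move=> ab; have iab : iota a * iota b = 1 by rewrite -rmorphM ab rmorph1.
have a0 : iota a != 0 by apply: contra_eq_neq iab => ->; rewrite mul0r eq_sym oner_neq0.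
by exists a, b; split=> //; apply: (mulfI a0); rewrite divff.
Qed.

Lemma vunitM x y : vunit x -> vunit y -> vunit (x * y).
Proof.
move=> [a [b [aE bE x0]]] [c [d [cE dE y0]]]; exists (a * c), (b * d).
by rewrite invfM !rmorphM -aE -bE -cE -dE mulf_neq0.
Qed.

Lemma vunitV x : vunit x -> vunit x^-1.
Proof. by move=> [a [b [aE bE x0]]]; exists b, a; rewrite invrK invr_eq0. Qed.

Lemma vunit_root x n : (0 < n)%N -> x != 0 -> vunit (x ^+ n) -> vunit x.
Proof.
have [inj tot unit _] := V.
have h y a : y != 0 -> y = iota a -> (0 < n)%N -> vunit (y ^+ n) -> vunit y.
  move=> y0 yE n0 [_ [b [_ bE _]]].
  have ab : a ^+ n * b = 1.
    by apply: inj; rewrite rmorphM rmorphXn rmorph1 /= -yE -bE divff // expf_neq0.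
  have [|c ac] := unit a; last by rewrite yE; exact: vunitP ac.
  apply: contra_eq_neq (congr1 phi ab) => a0.
  by rewrite rmorphM rmorphXn a0 expr0n eqn0Ngt n0 mul0r rmorph1 eq_sym oner_neq0.
move=> n0 x0; have [a [aE|aE]] := tot x; first exact: h aE n0.
have xV : x^-1 = iota a by apply: (mulfI x0); rewrite divff.
move=> /vunitV; rewrite -exprVn => /(h _ a (invr_neq0 x0) xV n0) /vunitV.
by rewrite invrK.
Qed.

(** The invertible factors of the Smith form of M are absorbed into the two forms. Then
    [unstable_weight], for the diagonal substitution and for its inverse with the variables
    reversed, shows that d_l^(r-1) d_(N-l) / u is a unit for every l. Comparing l with N - l, the
    (r-2)-nd power of d_l / d_(N-l) is a unit, and r > 2 allows a root to be taken. So all d_l^r / u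
    are units, and all d_l / d_0 as well. *)
Lemma stable_matrix N r (G1 G2 : {mpoly O[N.+1]}) (M : 'M[K]_N.+1) u :
  (2 < r)%N -> r%:R != 0 :> K -> G1 \is r.-homog -> G2 \is r.-homog ->
  nonsing (map_mpoly phi G1) -> nonsing (map_mpoly phi G2) ->
  M \in unitmx -> u != 0 -> lin M (map_mpoly iota G2) = u *: map_mpoly iota G1 ->
  exists c (U U' : 'M[O]_N.+1), [/\ c != 0, U *m U' = 1%:M & M = c *: map_mx iota U].
Proof.
move=> r2 r0 G1r G2r ns1 ns2 Mu u0 MG; have [inj tot unit surj] := V.
have [c0 [a [c0n aE]]] : exists c0 (a : 'M[O]_N.+1), c0 != 0 /\ M = c0 *: map_mx iota a.
  have [|ij [_ c0 hM]] := val_min V (s := enum {: 'I_N.+1 * 'I_N.+1}) (g := fun ij => M ij.1 ij.2).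
    apply: contrapT => nM; have M0 : M = 0.
      apply/matrixP => i j; rewrite mxE; apply/eqP/negPn/negP => Mij.
      by apply: nM; exists (i, j); rewrite // mem_enum.
    by move: Mu; rewrite M0 unitmxE det0 unitr0.
  have /boolp.choice [a aE] : forall i, exists a : 'I_N.+1 -> O, forall j, M i j = iota (a j) * M ij.1 ij.2.
    move=> i; have /boolp.choice [a0 h] := fun j => hM (i, j) (mem_enum _ _); by exists a0.
  exists (M ij.1 ij.2), (\matrix_(i, j) a i j); split=> //.
  by apply/matrixP => i j; rewrite !mxE aE mulrC.
have [U [U' [W [W' [d0 [UU WW aUW sd0]]]]]] := val_smith (val_total V) a.
have [d [ME sd]] : exists d, M = map_mx iota U *m diag_mx d *m map_mx iota W /\
    forall i j : 'I_N.+1, (i <= j)%N -> exists e, d 0 j = iota e * d 0 i.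
  exists (c0 *: map_mx iota d0); split.
    by rewrite aE aUW !map_mxM map_diag_mx linearZ /= -scalemxAr -scalemxAl.
  by move=> i j /sd0 [e eE]; exists e; rewrite !mxE eE rmorphM; ring.
have dn0 i : d 0 i != 0.
  have : \det (diag_mx d) != 0.
    apply/negP => /eqP dd; move: Mu; rewrite unitmxE ME !det_mulmx dd mulr0 mul0r.
    by rewrite unitr0.
  by rewrite det_diag; apply: contraNneq => di; rewrite (bigD1 i) //= di mul0r.
have U'U : U' *m U = 1%:M by exact: mulmx1C.
have phi_inv (X Y : 'M[O]_N.+1) : X *m Y = 1%:M -> map_mx phi X *m map_mx phi Y = 1%:M.
  by move=> XY; rewrite -map_mxM XY map_mx1.
have [H1 [H2 [H1r H2r nsH1 nsH2 HH]]] : exists H1 H2, [/\ H1 \is r.-homog, H2 \is r.-homog,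
    nonsing (map_mpoly phi H1), nonsing (map_mpoly phi H2) &
    lin (diag_mx d) (map_mpoly iota H2) = u *: map_mpoly iota H1].
  exists (lin U' G1), (lin W G2); split; try exact: lin_homog.
  - by rewrite map_lin; exact: nonsing_lin (phi_inv _ _ U'U) ns1.
  - by rewrite map_lin; exact: nonsing_lin (phi_inv _ _ WW) ns2.
  rewrite (map_lin iota U') (map_lin iota W) -linZ -MG ME.
  move: (map_mpoly iota G2) => B; rewrite !lin_mulmx -[RHS]lin_mulmx.
  by rewrite -map_mxM U'U map_mx1 lin1.
(* The antidiagonal permutation, which puts the inverses of the d l back into the order of
   divisibility. *)
pose Jm (R : comNzRingType) : 'M[R]_N.+1 := \matrix_(i, j) (j == rev_ord i)%:R.
have Jmul (R : comNzRingType) p (X : 'M[R]_(N.+1, p)) i j : (Jm R *m X) i j = X (rev_ord i) j.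
  rewrite mxE (bigD1 (rev_ord i)) //= mxE eqxx mul1r big1 ?addr0 // => l /negPf li.
  by rewrite mxE li mul0r.
have JJ (R : comNzRingType) : Jm R *m Jm R = 1%:M.
  by apply/matrixP => i j; rewrite Jmul !mxE rev_ordK eq_sym.
have mapJ (R S : comNzRingType) (f : {rmorphism R -> S}) : map_mx f (Jm R) = Jm S.
  by apply/matrixP => i j; rewrite !mxE rmorph_nat.
pose d' : 'rV[K]_N.+1 := \row_i (d 0 (rev_ord i))^-1.
have dd' : diag_mx d' *m (Jm K *m diag_mx d) = Jm K.
  apply/matrixP => i j; rewrite mul_diag_mx mxE Jmul !mxE.
  rewrite [rev_ord i == j]eq_sym; case: eqP => _; last by rewrite mulr0n mulr0.
  by rewrite mulr1n mulVf.
have sd' (i j : 'I_N.+1) : (i <= j)%N -> exists e, d' 0 j = iota e * d' 0 i.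
  move=> ij; have [|e eE] := sd (rev_ord j) (rev_ord i).
    by rewrite /= leq_sub2l.
  exists e; rewrite !mxE eE invfM.
  have e0 : iota e != 0 by apply: contraNneq (dn0 (rev_ord i)) => e0; rewrite eE e0 mul0r.
  by rewrite mulrA divff ?mul1r.
have HH' : lin (diag_mx d') (map_mpoly iota (lin (Jm O) H1)) = u^-1 *: map_mpoly iota (lin (Jm O) H2).
  rewrite (map_lin iota (Jm O) H1) (map_lin iota (Jm O) H2) mapJ.
  move: (map_mpoly iota H1) (map_mpoly iota H2) HH => A B AB.
  have uinj (p q : {mpoly K[N.+1]}) : u *: p = q -> p = u^-1 *: q.
    by move=> <-; rewrite scalerA mulVf // scale1r.
  apply: uinj; rewrite -[u *: lin _ _]linZ -[u *: lin _ _]linZ -AB.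
  by rewrite -[lin (Jm K) (lin _ _)]lin_mulmx -[LHS]lin_mulmx dd'.
have r1 : (1 < r)%N by exact: ltnW.
have s2 := unstable_weight V r1 r0 H2r nsH2 dn0 sd u0 HH.
have s1 l : exists b, u = iota b * (d 0 (rev_ord l) ^+ r.-1 * d 0 l).
  have [|||b bE] := unstable_weight V r1 r0 (lin_homog (Jm O) H1r) _ _ sd' _ HH' l.
  - rewrite map_lin mapJ; exact: nonsing_lin (JJ _) nsH1.
  - by move=> i; rewrite mxE invr_eq0.
  - by rewrite invr_eq0.
  exists b; rewrite !mxE rev_ordK exprVn -invfM in bE.
  have : (d 0 (rev_ord l) ^+ r.-1 * d 0 l) != 0 by rewrite mulf_neq0 ?expf_neq0.
  move: bE; set e := _ * d 0 l => bE e0; apply: (mulIf (invr_neq0 u0)); rewrite divff //.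
  by rewrite mulrAC -bE mulVf.
pose e l := d 0 l ^+ r.-1 * d 0 (rev_ord l).
have e0 l : e l != 0 by rewrite mulf_neq0 ?expf_neq0.
have eU l : vunit (e l / u).
  have [a1 a1E] := s2 l; have [b bE] := s1 (rev_ord l); rewrite rev_ordK -/(e l) in bE.
  exists a1, b; split; first by rewrite /e a1E mulfK.
    by rewrite invf_div bE mulfK.
  by rewrite mulf_neq0 ?invr_neq0.
have dU l : vunit (d 0 l / d 0 (rev_ord l)).
  have r2' : (0 < r - 2)%N by rewrite subn_gt0.
  apply: (vunit_root r2'); first by rewrite mulf_neq0 ?invr_neq0.
  suff -> : (d 0 l / d 0 (rev_ord l)) ^+ (r - 2) = (e l / u) * (e (rev_ord l) / u)^-1.
    by apply/vunitM => //; exact/vunitV.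
  have rE : r.-1 = (r - 2).+1 by rewrite -subn1 -subSn.
  rewrite /e rev_ordK rE !exprS expr_div_n.
  have p1 : d 0 (rev_ord l) ^+ (r - 2) != 0 by exact: expf_neq0.
  by field; rewrite u0 p1 !dn0.
have dr l : vunit (d 0 l ^+ r / u).
  have -> : d 0 l ^+ r / u = (e l / u) * (d 0 l / d 0 (rev_ord l)).
    have rE : r = r.-1.+1 by rewrite prednK // ltnW.
    by rewrite /e {1}rE exprSr; field; rewrite u0 dn0.
  exact: vunitM.
have dd l : vunit (d 0 l / d 0 0).
  apply: (@vunit_root _ r); [exact: ltnW | by rewrite mulf_neq0 ?invr_neq0 |].
  have -> : (d 0 l / d 0 0) ^+ r = (d 0 l ^+ r / u) * (d 0 0 ^+ r / u)^-1.
    rewrite expr_div_n; have p1 : d 0 0 ^+ r != 0 by exact: expf_neq0.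
    by field; rewrite u0 p1.
  by apply/vunitM => //; exact/vunitV.
have /boolp.choice [x xP] : forall l, exists x, d 0 l / d 0 0 = iota x.1 /\ x.1 * x.2 = 1.
  move=> l; have [x [y [xE yE dn]]] := dd l; exists (x, y); split=> //=.
  by apply: inj; rewrite rmorphM rmorph1 -xE -yE divff.
pose X := diag_mx (\row_l (x l).1); pose X' := diag_mx (\row_l (x l).2).
have XX : X *m X' = 1%:M.
  apply/matrixP => i j; rewrite mul_diag_mx !mxE; have [_] := xP i.
  by case: eqP => _; rewrite ?mulr1n ?mulr0n ?mulr0.
exists (d 0 0), (U *m X *m W), (W' *m (X' *m U')); split=> //.
  exact: (inv_pairM (inv_pairM UU XX) WW).
rewrite ME !map_mxM scalemxAl scalemxAr; congr (_ *m _ *m _).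
rewrite map_diag_mx -linearZ; congr diag_mx; apply/rowP => l; rewrite !mxE.
by have [<- _] := xP l; rewrite mulrC divfK.
Qed.

End StableMatrix.

(** * Linear isomorphisms over S-integers *)

(** This interface separates arithmetic from geometry: the arguments on hypersurfaces only see
    valuation rings and these two gluing principles. *)
Definition local_global_ring (A : comNzRingType) (K : fieldType) (j : {rmorphism A -> K}) : Prop :=
  [/\ injective j,
      forall I, is_ideal I ->
        (forall (O : comNzRingType) (iota : {rmorphism O -> K}) (incl : {rmorphism A -> O})
           (k : fieldType) (phi : {rmorphism O -> k}),
           is_place j iota incl phi -> exists s, I s /\ phi (incl s) != 0) -> I 1 &
      forall x,
        (forall (O : comNzRingType) (iota : {rmorphism O -> K}) (incl : {rmorphism A -> O})
           (k : fieldType) (phi : {rmorphism O -> k}),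
           is_place j iota incl phi -> exists a, iota a = x) -> exists a, j a = x].

Lemma place_is_place (K : fieldExtType rat) (S : set (set K)) p : finite_place p -> ~ S p ->
  exists (O : comNzRingType) (iota : {rmorphism O -> K})
    (incl : {rmorphism S_integers S -> O}) (k : fieldType) (phi : {rmorphism O -> k}),
  [/\ is_place (val : S_integers S -> K) iota incl phi,
      forall x, integral_at p x <-> exists a, iota a = x &
      forall a, phi a != 0 <-> iota a != 0 /\ integral_at p (iota a)^-1].
Proof.
move=> hp nS; have [O [iota [incl [k [phi [inj inclE iP res [phiU den]]]]]]] := place_localization hp nS.
exists O, iota, incl, k, phi; split=> //; split=> //.
have unit a : phi a != 0 -> exists b, a * b = 1.
  move=> /phiU [a0 /iP [b bE]]; exists b; apply: inj.
  by rewrite rmorphM rmorph1 /= bE divff.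
split=> // [x|z].
  have [->|x0] := eqVneq x 0; first by exists 0; left; rewrite rmorph0.
  have [/iP [a aE]|/iP [a aE]] := place_integral hp x0; exists a; [by left | right].
  by rewrite aE divff.
have [c [s [s0 ->]]] := res z; have [b bE] := unit _ s0.
exists (incl c * b); rewrite rmorphM /=; congr (_ * _).
have := congr1 phi bE; rewrite rmorphM rmorph1 => h.
by apply: (mulfI s0); rewrite divff //; exact: h.
Qed.

Lemma S_integers_local_global (K : fieldExtType rat) (S : set (set K)) :
  local_global_ring (val : S_integers S -> K).
Proof.
split=> [|I idI h|x h]; first exact: val_inj.
  apply: local_global => // [|p hp nS].
    have [s [Is s0]] := h _ _ _ _ _ (generic_place (@residue_field_val K S)).
    by exists s => //; apply: contraNneq s0 => ->; rewrite /= rmorph0.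
  have [O [iota [incl [k [phi [pl iP phiU]]]]]] := place_is_place hp nS.
  have [s [Is /phiU s0]] := h _ _ _ _ _ pl; exists s; split=> //; have [_ inclE _ _] := pl.
    by rewrite -inclE; case: s0.
  by rewrite -inclE; case: s0.
suff hx : x \in S_integral S by exists (SInteger hx).
apply/asboolP => p hp nS; have [O [iota [incl [k [phi [pl iP _]]]]]] := place_is_place hp nS.
exact/iP/(h _ _ _ _ _ pl).
Qed.

(** It trades the powers of homogeneous coordinates left by Nakayama's lemma for a power of one
    combination of them: 1, or a diagonal entry of a projector up to a factor from A. *)
Lemma ideal_radical_sum (R : comNzRingType) (J : set R) m (z w : 'I_m -> R) N :
  is_ideal J -> (forall i, J (z i ^+ N)) -> exists N', J ((\sum_i z i * w i) ^+ N').
Proof.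
move=> idJ hz; apply: contrapT => /forallNP h.
have [k [phi [_ phiJ]]] := krull idJ h; rewrite rmorph_sum big1 ?eqxx // => i _.
have : phi (z i) ^+ N = 0 by rewrite -rmorphXn phiJ.
by move=> /eqP; rewrite expf_eq0 rmorphM => /andP [_ /eqP ->]; rewrite mul0r.
Qed.

Section PlaceDenominators.
Variables (A : comNzRingType) (K : fieldType) (j : {rmorphism A -> K}).
Variables (O : comNzRingType) (iota : {rmorphism O -> K}) (incl : {rmorphism A -> O}).
Variables (k : fieldType) (phi : {rmorphism O -> k}).
Hypothesis pl : is_place j iota incl phi.
Hypothesis j_inj : injective j.

Lemma incl_inj : injective incl.
Proof. by have [_ inclE _ _] := pl; move=> a b ab; apply: j_inj; rewrite -!inclE ab. Qed.

Lemma clear_denominators (I : finType) (a : I -> O) :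
  exists s c, phi (incl s) != 0 /\ forall i, incl s * a i = incl (c i).
Proof.
have [_ _ _ den] := pl.
have /boolp.choice [x xP] : forall i, exists x, phi (incl x.1) != 0 /\ incl x.1 * a i = incl x.2.
  by move=> i; have [s [c h]] := den (a i); exists (s, c).
exists (\prod_i (x i).1), (fun i => (\prod_(l | l != i) (x l).1) * (x i).2); split.
  by rewrite !rmorph_prod; apply/prodf_neq0 => i _; case: (xP i).
move=> i; have [_ xE] := xP i; rewrite (bigD1 i) //= !rmorphM /= -xE.
by rewrite mulrAC mulrC.
Qed.

Lemma clear_ideal n (I : finType) (e : I -> {mpoly A[n]}) p :
  gen_ideal (fun l => map_mpoly incl (e l)) (map_mpoly incl p) ->
  exists s, phi (incl s) != 0 /\ gen_ideal e (s *: p).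
Proof.
move=> [a aE].
have [s [c [s0 cE]]] := clear_denominators (fun x : {l : I & 'I_(size (msupp (a l)))} =>
  (a (tag x))@_(nth 0%MM (msupp (a (tag x))) (tagged x))).
have h l m : exists b, incl s * (a l)@_m = incl b.
  have [ms|ms] := boolP (m \in msupp (a l)); last first.
    by exists 0; rewrite memN_msupp_eq0 // mulr0 rmorph0.
  have := cE (Tagged (fun l => 'I_(size (msupp (a l)))) (Ordinal (etrans (index_mem m _) ms))).
  by rewrite /= nth_index // => ->; exists (c (Tagged (fun l => 'I_(size (msupp (a l)))) (Ordinal (etrans (index_mem m _) ms)))).
have /boolp.choice [b bE] : forall l, exists b, map_mpoly incl b = incl s *: a l.
  move=> l; have [m _|b [bE _]] := @mpoly_lift _ _ incl n (incl s *: a l); last by exists b.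
  by have [b bE] := h l m; exists b; rewrite mcoeffZ bE.
exists s; split=> //; exists b; apply/mpolyP => m; apply: incl_inj.
rewrite -!mcoeff_map_mpoly map_mpolyZ aE rmorph_sum scaler_sumr; congr mcoeff.
by apply: eq_bigr => l _; rewrite rmorphM /= bE scalerAl.
Qed.

End PlaceDenominators.

(* [conj_mx t psi P] is M^-1 P M when only the products t = (M^-1)_ai M_lb of entries of M^-1 and M
   lie in A. *)
Section Conjugation.
Variables (A : comNzRingType) (K : fieldType) (j : {rmorphism A -> K}) (n : nat).
Hypothesis j_inj : injective j.
Implicit Types (t : 'I_n -> 'I_n -> 'I_n -> 'I_n -> A) (M : 'M[K]_n).

Definition conj_coef t (M M' : 'M[K]_n) : Prop :=
  M *m M' = 1%:M /\ forall a i l b, j (t a i l b) = M' a i * M l b.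

Definition conj_mx t (R : comNzRingType) (psi : {rmorphism A -> R}) (P : 'M[R]_n) : 'M[R]_n :=
  \matrix_(a, b) \sum_i \sum_l psi (t a i l b) * P i l.

Variables (t : 'I_n -> 'I_n -> 'I_n -> 'I_n -> A) (M M' : 'M[K]_n).
Hypothesis tM : conj_coef t M M'.

Section Algebra.
Variables (R : comNzRingType) (psi : {rmorphism A -> R}).
Implicit Types P Q : 'M[R]_n.
Local Notation cj := (conj_mx t psi).

Let entry_prod P Q a b c d : cj P a b * cj Q c d =
  \sum_i \sum_l \sum_k \sum_m psi (t a i l b * t c k m d) * (P i l * Q k m).
Proof.
rewrite !mxE mulr_suml; apply: eq_bigr => i _; rewrite mulr_suml; apply: eq_bigr => l _.
rewrite mulr_sumr; apply: eq_bigr => k _; rewrite mulr_sumr; apply: eq_bigr => m _.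
by rewrite mulrACA rmorphM.
Qed.

Lemma conj_mulmx P Q : cj P *m cj Q = cj (P *m Q).
Proof.
have [MM tE] := tM; apply/matrixP => a c; rewrite [LHS]mxE.
under eq_bigr => b _ do rewrite entry_prod.
rewrite exchange_big mxE; apply: eq_bigr => i _ /=.
under [RHS]eq_bigr => m _ do rewrite mxE mulr_sumr.
rewrite exchange_big [RHS]exchange_big; apply: eq_bigr => l _ /=.
rewrite exchange_big /= (bigD1 l) //= [X in _ + X]big1 ?addr0 => [|k kl].
  rewrite exchange_big; apply: eq_bigr => m _ /=; rewrite -mulr_suml -rmorph_sum; congr (psi _ * _).
  apply: j_inj; rewrite rmorph_sum tE; under eq_bigr => b _ do rewrite rmorphM !tE mulrACA mulrC.
  under eq_bigr => b _ do rewrite mulrAC -mulrA.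
  have -> : M' a i * M m c = (M *m M') l l * (M' a i * M m c) by rewrite MM mxE eqxx mul1r.
  by rewrite mxE mulr_suml; apply: eq_bigr => b _; ring.
rewrite exchange_big big1 // => m _ /=; rewrite -mulr_suml -rmorph_sum.
suff -> : \sum_b t a i l b * t b k m c = 0 by rewrite rmorph0 mul0r.
apply: j_inj; rewrite rmorph0 rmorph_sum; transitivity ((M *m M') l k * (M' a i * M m c)).
  by rewrite mxE mulr_suml; apply: eq_bigr => b _; rewrite rmorphM !tE; ring.
by rewrite MM mxE eq_sym (negPf kl) mul0r.
Qed.

Lemma conj_rk1 P : rk1 P -> rk1 (cj P).
Proof.
have [MM tE] := tM; move=> [trP mP]; split.
  rewrite /mxtrace; under eq_bigr => a _ do rewrite mxE.
  rewrite exchange_big -[RHS]trP; apply: eq_bigr => i _ /=; rewrite exchange_big (bigD1 i) //=.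
  have E l : \sum_a t a i l a = (l == i)%:R.
    apply: j_inj; rewrite rmorph_sum rmorph_nat; transitivity ((M *m M') l i); last by rewrite MM mxE.
    by rewrite mxE; apply: eq_bigr => a _; rewrite tE mulrC.
  rewrite -mulr_suml -rmorph_sum E eqxx rmorph1 mul1r big1 ?addr0 // => l /negPf li.
  by rewrite -mulr_suml -rmorph_sum E li rmorph0 mul0r.
move=> a b c d; rewrite !entry_prod; apply: eq_bigr => i _.
under [LHS]eq_bigr => l _ do rewrite exchange_big.
rewrite [LHS]exchange_big /=; apply: eq_bigr => l _; rewrite exchange_big; apply: eq_bigr => k _ /=.
apply: eq_bigr => m _; rewrite mP; congr (psi _ * _).
by apply: j_inj; rewrite !rmorphM !tE; ring.
Qed.

Lemma conj_mxK t' P : conj_coef t' M' M -> conj_mx t' psi (cj P) = P.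
Proof.
have [MM tE] := tM; move=> [M'M tE']; apply/matrixP => x y; rewrite mxE.
have E i l : \sum_a \sum_b t' x a b y * t a i l b = (x == i)%:R * (l == y)%:R.
  apply: j_inj; rewrite rmorph_sum rmorphM !rmorph_nat.
  transitivity ((M *m M') x i * (M *m M') l y); last by rewrite MM !mxE.
  rewrite !mxE mulr_suml; apply: eq_bigr => a _; rewrite rmorph_sum mulr_sumr.
  by apply: eq_bigr => b _; rewrite rmorphM tE tE'; ring.
transitivity (\sum_i \sum_l psi (\sum_a \sum_b t' x a b y * t a i l b) * P i l).
  under [RHS]eq_bigr => i _ do under eq_bigr => l _ do rewrite rmorph_sum mulr_suml.
  under [RHS]eq_bigr => i _ do rewrite exchange_big.
  rewrite [RHS]exchange_big; apply: eq_bigr => a _ /=.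
  under [RHS]eq_bigr => i _ do under eq_bigr => l _ do rewrite rmorph_sum mulr_suml.
  under [RHS]eq_bigr => i _ do rewrite exchange_big.
  rewrite [RHS]exchange_big; apply: eq_bigr => b _ /=.
  rewrite mxE mulr_sumr; apply: eq_bigr => i _; rewrite mulr_sumr; apply: eq_bigr => l _.
  by rewrite rmorphM mulrA.
rewrite (bigD1 x) //= (bigD1 y) //= E !eqxx mulr1 rmorph1 mul1r !big1 ?addr0 //.
  move=> i; rewrite eq_sym => /negPf xi; rewrite big1 // => l _.
  by rewrite E xi mul0r rmorph0 mul0r.
by move=> l /negPf ly; rewrite E ly mulr0 rmorph0 mul0r.
Qed.

End Algebra.

Lemma conj_map (R S : comNzRingType) (psi : {rmorphism A -> R}) (psi' : {rmorphism A -> S})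
    (f : {rmorphism R -> S}) P : (forall a, f (psi a) = psi' a) ->
  map_mx f (conj_mx t psi P) = conj_mx t psi' (map_mx f P).
Proof.
move=> h; apply/matrixP => a b; rewrite !mxE rmorph_sum; apply: eq_bigr => i _.
by rewrite rmorph_sum; apply: eq_bigr => l _; rewrite rmorphM h mxE.
Qed.

End Conjugation.

Definition generic_form (A : comNzRingType) (K : fieldType) (j : {rmorphism A -> K}) r n
    (E : seq {mpoly A[n.+2]}) (G : {mpoly K[n.+2]}) : Prop :=
  [/\ G != 0, G \is r.-homog &
    forall (R : comNzRingType) (psi : {rmorphism K -> R}) (v : 'rV[R]_n.+2),
      unimod v -> vanish (psi \o j) E v <-> ev psi v G = 0].

Lemma lin_scalar (R : comNzRingType) n d (c : R) (p : {mpoly R[n]}) : p \is d.-homog ->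
  lin c%:M p = c ^+ d *: p.
Proof.
move=> /dhomogP hp; rewrite -diag_const_mx; apply/mpolyP => m; rewrite lin_diagE mcoeffZ.
have [mp|mp] := boolP (m \in msupp p); last by rewrite memN_msupp_eq0 // mul0r mulr0.
have <- : mdeg m = d by exact: hp.
rewrite mulrC mdegE -prodrXr; congr (_ * _); apply: eq_bigr => i _.
by rewrite mxE.
Qed.

Section LinearIso.
Variables (A : comNzRingType) (K : fieldType) (j : {rmorphism A -> K}) (r n : nat).
Hypothesis lg : local_global_ring j.
Hypotheses (r2 : (2 < r)%N) (r0 : r%:R != 0 :> K).
Local Opaque lin.

(** Over O the equations of E2 are multiples of a primitive form, and those of E1 generate theirs up
    to powers of the variables. [stable_matrix] compares the two forms, and the comparison is
    carried back to the equations. *)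
Lemma unit_substitution (E1 E2 : seq {mpoly A[n.+2]}) G1 G2 (M : 'M[K]_n.+2) u
    (O : comNzRingType) (iota : {rmorphism O -> K}) (incl : {rmorphism A -> O})
    (k : fieldType) (phi : {rmorphism O -> k}) :
  is_place j iota incl phi ->
  smooth_hypersurface r E1 -> smooth_hypersurface r E2 ->
  generic_form j r E1 G1 -> generic_form j r E2 G2 ->
  M \in unitmx -> u != 0 -> lin M G2 = u *: G1 ->
  exists c (U U' : 'M[O]_n.+2), [/\ c != 0, U *m U' = 1%:M, M = c *: map_mx iota U &
    forall e, e \in E2 -> exists N, forall i,
      gen_ideal (fun l : 'I_(size E1) => map_mpoly incl E1`_l) ('X_i ^+ N * lin U (map_mpoly incl e))].
Proof.
move=> pl sm1 sm2 [G10 G1r G1E] [G20 G2r G2E] Mu u0 MG; have [V _ _ _] := pl.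
have [c1 [G1p [c10 G1pE G1p0]]] := primitive_scale V G10.
have [c2 [G2p [c20 G2pE G2p0]]] := primitive_scale V G20.
have [G1pr ns1 _ [N hN]] := place_hypersurface pl sm1 G10 G1r G1E c10 G1pE G1p0.
have [G2pr ns2 fac _] := place_hypersurface pl sm2 G20 G2r G2E c20 G2pE G2p0.
have MGp : lin M (map_mpoly iota G2p) = (c2 * u / c1) *: map_mpoly iota G1p.
  by rewrite G2pE linZ MG G1pE !scalerA; congr (_ *: _); field.
have u'0 : c2 * u / c1 != 0 by rewrite !mulf_neq0 ?invr_neq0.
have [c [U [U' [c0 UU ME]]]] := stable_matrix V r2 r0 G1pr G2pr ns1 ns2 Mu u'0 MGp.
exists c, U, U'; split=> // e e2; exists N => i.
have [l lE] : exists l : 'I_(size E2), E2`_l = e.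
  by move: e2 => /(nthP 0) [l ls <-]; exists (Ordinal ls).
have [h hE] := fac l; rewrite -lE hE lin_M.
have [q [qE _]] : exists q, lin U G2p = G1p * q /\ map_mpoly iota q = (c ^- r * (c2 * u / c1))%:MP.
  apply: (gauss_lift V G1p0); rewrite mulrC mul_mpolyC -scalerA -MGp ME map_lin.
  have G2iota : map_mpoly iota G2p \is r.-homog by exact: map_homog.
  move: (map_mpoly iota G2p) (map_mx iota U) G2iota => B X Br.
  rewrite -[c *: X]mul_scalar_mx lin_mulmx.
  rewrite (lin_scalar c (lin_homog X Br)).
  by rewrite scalerA mulVf ?scale1r // expf_neq0.
have [a aE] := hN i; rewrite qE !mulrA aE; exists (fun l => a l * (q * lin U h)).
by rewrite -mulrA mulr_suml; apply: eq_bigr => l' _; rewrite mulrAC.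
Qed.

(** Fix a row b of the new projector Q and an equation e. The elements of A that kill the value of e
    after multiplication by a power of Q b b form an ideal, which is tested at the places. There M =
    c U; with denominators cleared, row b of Q is up to s0^2 a vector z, on which E1 vanishes, times
    the matrix W of U, and [unit_substitution] applies to z. *)
Lemma conj_vanish (E1 E2 : seq {mpoly A[n.+2]}) G1 G2 (M M' : 'M[K]_n.+2) u t
    (R : comNzRingType) (psi : {rmorphism A -> R}) (P : 'M[R]_n.+2) :
  smooth_hypersurface r E1 -> smooth_hypersurface r E2 ->
  generic_form j r E1 G1 -> generic_form j r E2 G2 ->
  u != 0 -> lin M G2 = u *: G1 -> conj_coef j t M M' -> rk1 P ->
  (forall v, span P v -> vanish psi E1 v) ->
  forall v, span (conj_mx t psi P) v -> vanish psi E2 v.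
Proof.
move=> sm1 sm2 g1 g2 u0 MG [MM tE] rP vP v hv e e2.
have [j_inj LG _] := lg; have [hE2 _ _] := sm2; have [d ed] := hE2 e e2.
have tM : conj_coef j t M M' by split.
have rQ := conj_rk1 j_inj tM psi rP.
apply: (rk1_homog_vanish rQ ed _ hv) => b {v hv}.
set Q := conj_mx t psi P in rQ *; set Y := ev psi (row b Q) e.
pose I : set A := [set s | exists N, psi s * (Q b b ^+ N * Y) = 0].
suff [N] : I 1 by rewrite rmorph1 mul1r; exists N.
apply: LG => [|O iota incl k phi pl].
  split=> [|x y [N xN] [N' yN']|x y [N yN]].
  - by exists 0%N; rewrite rmorph0 mul0r.
  - exists (N + N')%N; rewrite rmorphD mulrDl {1}addnC !exprD.
    have -> : psi x * (Q b b ^+ N' * Q b b ^+ N * Y) = Q b b ^+ N' * (psi x * (Q b b ^+ N * Y)) by ring.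
    have -> : psi y * (Q b b ^+ N * Q b b ^+ N' * Y) = Q b b ^+ N * (psi y * (Q b b ^+ N' * Y)) by ring.
    by rewrite xN yN' !mulr0 addr0.
  - by exists N; rewrite rmorphM -mulrA yN mulr0.
have Mu : M \in unitmx by have [] := mulmx1_unit MM.
have [c [U [U' [c0 UU ME UE]]]] := unit_substitution pl sm1 sm2 g1 g2 Mu u0 MG.
have [V inclE _ _] := pl; have [inj _ _ _] := V; have i_inj := incl_inj pl j_inj.
have [s0 [cf [s00 cfE]]] := clear_denominators pl
  (fun x : bool * ('I_n.+2 * 'I_n.+2) => if x.1 then U x.2.1 x.2.2 else U' x.2.1 x.2.2).
pose W : 'M[A]_n.+2 := \matrix_(i, l) cf (true, (i, l)).
pose X : 'M[A]_n.+2 := \matrix_(i, l) cf (false, (i, l)).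
have WE : map_mx incl W = incl s0 *: map_mx idfun U.
  by apply/matrixP => i l; rewrite !mxE -(cfE (true, (i, l))).
have {}WE : map_mx incl W = incl s0 *: U by rewrite WE; congr (_ *: _); apply/matrixP => i l; rewrite mxE.
have XE : map_mx incl X = incl s0 *: U'.
  by apply/matrixP => i l; rewrite !mxE -(cfE (false, (i, l))).
have M'E : M' = c^-1 *: map_mx iota U'.
  have UU' : map_mx iota U *m map_mx iota U' = 1%:M by rewrite -map_mxM UU map_mx1.
  rewrite -[M']mul1mx -(mulmx1C UU') -mulmxA -[X in _ *m X](scalerK c0) scalemxAl -ME MM.
  by rewrite -scalemxAr mulmx1.
(* The scalar c cancels between M and its inverse. *)
have sE i l b' : s0 ^+ 2 * t b i l b' = X b i * W l b'.
  have hW : j (W l b') = iota (incl s0) * iota (U l b').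
    by rewrite -inclE -rmorphM; have /matrixP/(_ l b') := WE; rewrite [LHS]mxE [RHS]mxE => ->.
  have hX : j (X b i) = iota (incl s0) * iota (U' b i).
    by rewrite -inclE -rmorphM; have /matrixP/(_ b i) := XE; rewrite [LHS]mxE [RHS]mxE => ->.
  apply: j_inj; rewrite [RHS]rmorphM hX hW rmorphM rmorphXn tE ME M'E -inclE.
  rewrite [(_ *: map_mx iota U') _ _]mxE [(_ *: map_mx iota U) _ _]mxE.
  rewrite [map_mx iota U' _ _]mxE [map_mx iota U _ _]mxE.
  by move: (iota (incl s0)) (iota (U' b i)) (iota (U l b')) => y1 y2 y3; field.
pose z := row b (map_mx psi X) *m P.
have zE : z *m map_mx psi W = psi s0 ^+ 2 *: row b Q.
  apply/rowP => b'; rewrite [LHS]mxE [RHS]mxE [row b Q 0 b']mxE /Q [conj_mx _ _ _ _ _]mxE.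
  transitivity (\sum_i \sum_l psi (X b i * W l b') * P i l).
    rewrite exchange_big; apply: eq_bigr => l _ /=; rewrite [z 0 l]mxE mulr_suml.
    apply: eq_bigr => i _; rewrite rmorphM [row _ _ _ _]mxE [map_mx psi X _ _]mxE [map_mx psi W _ _]mxE.
    by rewrite mulrAC.
  rewrite mulr_sumr; apply: eq_bigr => i _; rewrite mulr_sumr; apply: eq_bigr => l _.
  by rewrite -sE rmorphM rmorphXn mulrA.
have hz : vanish psi E1 z by apply: vP; exists (row b (map_mx psi X)).
have [N hN] := UE e e2.
have /boolp.choice [s1 s1P] : forall i, exists s1, phi (incl s1) != 0 /\
    gen_ideal (fun l : 'I_(size E1) => E1`_l) (s1 *: ('X_i ^+ N * lin W e)).
  move=> i; apply: (clear_ideal pl j_inj); rewrite rmorphM rmorphXn /= map_mpolyX map_lin WE.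
  have eh : map_mpoly incl e \is d.-homog by exact: map_homog.
  rewrite -mul_mx_scalar lin_mulmx (lin_scalar _ eh) linZ -scalerAr -mul_mpolyC.
  by have [_ _ GM] := gen_is_ideal (fun l : 'I_(size E1) => map_mpoly incl E1`_l); apply: GM.
have Yz : ev psi z (lin W e) = (psi s0 ^+ 2) ^+ d * Y by rewrite ev_lin zE (ev_homogZ _ _ _ ed).
have hzN i : psi (s1 i) * (z 0 i ^+ N * ((psi s0 ^+ 2) ^+ d * Y)) = 0.
  have [_ [a aE]] := s1P i; have := congr1 (fun p => ev psi z p) aE.
  rewrite /= mmapZ rmorphM rmorphXn /= mmapX mmap1U Yz rmorph_sum big1 // => l _.
  by rewrite rmorphM /= [X in _ * X](hz _ (mem_nth 0 (ltn_ord l))) mulr0.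
pose J : set R := [set y | psi (\prod_i s1 i) * (y * ((psi s0 ^+ 2) ^+ d * Y)) = 0].
have [|i|N' JN'] := @ideal_radical_sum R J n.+2 (z 0) (fun i => psi (W i b)) N.
- split=> [|x y hx hy|x y hy]; rewrite /J /= ?mul0r ?mulr0 //.
    by rewrite mulrDl mulrDr hx hy addr0.
  by rewrite -mulrA mulrCA hy mulr0.
- rewrite /J /= (bigD1 i) //= [s1 i * _]mulrC rmorphM -mulrA hzN mulr0.
  by [].
have zb : \sum_i z 0 i * psi (W i b) = psi s0 ^+ 2 * Q b b.
  have /rowP/(_ b) := zE; rewrite [LHS]mxE [RHS]mxE [row b Q 0 b]mxE => <-.
  by apply: eq_bigr => i _; rewrite [map_mx psi W _ _]mxE.
rewrite zb /J /= in JN'.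
exists (\prod_i s1 i * (s0 ^+ 2) ^+ d * (s0 ^+ 2) ^+ N'); split.
  exists N'; rewrite 2!rmorphM [psi ((s0 ^+ 2) ^+ d)]rmorphXn [psi ((s0 ^+ 2) ^+ N')]rmorphXn.
  rewrite [psi (s0 ^+ 2)]rmorphXn -[RHS]JN' [(_ * Q b b) ^+ N']exprMn.
  move: (psi (\prod_i s1 i)) ((psi s0 ^+ 2) ^+ d) ((psi s0 ^+ 2) ^+ N') (Q b b ^+ N') => y1 y2 y3 y4.
  ring.
rewrite !rmorphM !mulf_neq0 ?rmorphXn ?expf_neq0 //.
by rewrite !rmorph_prod; apply/prodf_neq0 => i _; case: (s1P i).
Qed.

End LinearIso.

Section LinearIsoOfMatrix.
Variables (A : comNzRingType) (K : fieldType) (j : {rmorphism A -> K}) (r n : nat).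
Hypothesis lg : local_global_ring j.
Hypotheses (r2 : (2 < r)%N) (r0 : r%:R != 0 :> K).
Local Opaque lin.

Lemma conj_coef_exists (E1 E2 : seq {mpoly A[n.+2]}) G1 G2 (M : 'M[K]_n.+2) u :
  smooth_hypersurface r E1 -> smooth_hypersurface r E2 ->
  generic_form j r E1 G1 -> generic_form j r E2 G2 ->
  M \in unitmx -> u != 0 -> lin M G2 = u *: G1 ->
  exists t, conj_coef j t M (invmx M).
Proof.
move=> sm1 sm2 g1 g2 Mu u0 MG; have [j_inj LG INT] := lg.
have h (x : 'I_n.+2 * 'I_n.+2 * 'I_n.+2 * 'I_n.+2) :
    exists y, j y = invmx M x.1.1.1 x.1.1.2 * M x.1.2 x.2.
  apply: INT => O iota incl k phi pl.
  have [c [U [U' [c0 UU ME _]]]] := unit_substitution r2 r0 pl sm1 sm2 g1 g2 Mu u0 MG.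
  have M'E : invmx M = c^-1 *: map_mx iota U'.
    have UU' : map_mx iota U *m map_mx iota U' = 1%:M by rewrite -map_mxM UU map_mx1.
    rewrite -[invmx M]mul1mx -(mulmx1C UU') -mulmxA -[X in _ *m X](scalerK c0) scalemxAl -ME mulmxV //.
    by rewrite -scalemxAr mulmx1.
  exists (U' x.1.1.1 x.1.1.2 * U x.1.2 x.2).
  rewrite M'E ME rmorphM !mxE; move: (iota _) (iota _) => y1 y2; by field.
have [t tE] := boolp.choice h; exists (fun a i l b => t (a, i, l, b)); split; first exact: mulmxV.
by move=> a i l b; rewrite tE.
Qed.

Lemma linear_iso_of_matrix (E1 E2 : seq {mpoly A[n.+2]}) G1 G2 (M : 'M[K]_n.+2) u :
  smooth_hypersurface r E1 -> smooth_hypersurface r E2 ->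
  generic_form j r E1 G1 -> generic_form j r E2 G2 ->
  M \in unitmx -> u != 0 -> lin M G2 = u *: G1 -> linear_iso E1 E2.
Proof.
move=> sm1 sm2 g1 g2 Mu u0 MG; have [j_inj _ _] := lg.
have M'u : invmx M \in unitmx by rewrite unitmx_inv.
have MG' : lin (invmx M) G1 = u^-1 *: G2.
  by rewrite -[G1](scalerK u0) -MG linZ -lin_mulmx mulVmx // lin1.
have [t tM] := conj_coef_exists sm1 sm2 g1 g2 Mu u0 MG.
have [t'] := conj_coef_exists sm2 sm1 g2 g1 M'u (invr_neq0 u0) MG'; rewrite invmxK => tM'.
pose cj (R : comAlgType A) (P : 'M[R]_n.+2) := conj_mx t (in_alg R) P.
pose cj' (R : comAlgType A) (P : 'M[R]_n.+2) := conj_mx t' (in_alg R) P.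
have cjr (R : comAlgType A) (P : 'M[R]_n.+2) : rk1 P -> rk1 (cj R P) by exact: (conj_rk1 j_inj tM).
have cjr' (R : comAlgType A) (P : 'M[R]_n.+2) : rk1 P -> rk1 (cj' R P) by exact: (conj_rk1 j_inj tM').
have cjK (R : comAlgType A) (P : 'M[R]_n.+2) : cj' R (cj R P) = P by exact: (conj_mxK j_inj tM).
have cjK' (R : comAlgType A) (P : 'M[R]_n.+2) : cj R (cj' R P) = P by exact: (conj_mxK j_inj tM').
have cjM (R : comAlgType A) (P Q : 'M[R]_n.+2) : cj R P *m cj R Q = cj R (P *m Q).
  exact: (conj_mulmx j_inj tM).
have cj_inj (R : comAlgType A) (P Q : 'M[R]_n.+2) : rk1 P -> rk1 Q ->
    span (cj R P) = span (cj R Q) <-> span P = span Q.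
  move=> rP rQ; rewrite (rk1_span_eq (cjr _ _ rP) (cjr _ _ rQ)) (rk1_span_eq rP rQ) cjM.
  by split=> [/(congr1 (cj' R))|->] //; rewrite !cjK.
(* A line has many projectors; by [cj_inj] the image depends on the line alone. *)
pose sigma (R : comAlgType A) (L : set 'rV[R]_n.+2) : set 'rV[R]_n.+2 :=
  [set w | exists P, [/\ rk1 P, L = span P & span (cj R P) w]].
have sigmaE (R : comAlgType A) (P : 'M[R]_n.+2) : rk1 P -> sigma R (span P) = span (cj R P).
  move=> rP; apply/seteqP; split=> w /=; last by exists P.
  by move=> [Q [rQ /(cj_inj R P Q rP rQ) ->]].
exists sigma; split; last first.
  move=> R L /proj_spaceP [P [rP ->]]; rewrite sigmaE //.
  have van (E : seq {mpoly A[n.+2]}) (Q : 'M[R]_n.+2) : rk1 Q ->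
      zero_locus E R (span Q) <-> forall v, span Q v -> vanish (in_alg R) E v.
    move=> rQ; split=> [[_ h] v Qv F FE|h]; first exact: h.
    by split=> [|F FE v Qv]; [apply/proj_spaceP; exists Q | exact: h].
  rewrite (van E1 P rP) (van E2 _ (cjr _ _ rP)); split=> h.
    exact: (conj_vanish lg r2 r0 sm1 sm2 g1 g2 u0 MG tM rP h).
  have := conj_vanish lg r2 r0 sm2 sm1 g2 g1 (invr_neq0 u0) MG' tM' (cjr _ _ rP) h.
  by rewrite -/(cj' R _) cjK.
split=> [R|R R' f L].
  split.
  - move=> L /zero_locus_nil /proj_spaceP [P [rP ->]]; rewrite sigmaE //.
    by apply/zero_locus_nil/proj_spaceP; exists (cj R P); split=> //; exact: cjr.
  - move=> L L'; rewrite !inE => /zero_locus_nil /proj_spaceP [P [rP ->]].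
    move=> /zero_locus_nil /proj_spaceP [P' [rP' ->]].
    by rewrite !sigmaE // => /(cj_inj R P P' rP rP').
  - move=> L /zero_locus_nil /proj_spaceP [P [rP ->]]; exists (span (cj' R P)).
      by apply/zero_locus_nil/proj_spaceP; exists (cj' R P); split=> //; exact: cjr'.
    by rewrite sigmaE ?cjK' //; exact: cjr'.
move=> /zero_locus_nil /proj_spaceP [P [rP ->]].
rewrite (base_change_span f rP) sigmaE; last exact: rk1_map.
rewrite sigmaE // (base_change_span f (cjr _ _ rP)); congr span.
by rewrite /cj (conj_map _ (psi' := in_alg R')) // => a /=; rewrite rmorph_alg.
Qed.

End LinearIsoOfMatrix.

(** * Cyclic covers *)

Section CyclicCover.
Variables (R : comNzRingType) (r m : nat).

Definition emb (F : {mpoly R[m]}) : {mpoly R[m.+1]} :=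
  mmap (@mpolyC m.+1 R) (fun i => 'X_(lift ord0 i)) F.

Definition cyclic_cover (F : {mpoly R[m]}) : {mpoly R[m.+1]} := emb F + 'X_ord0 ^+ r.

Definition tl (S : nzRingType) (v : 'rV[S]_m.+1) : 'rV[S]_m := \row_i v 0 (lift ord0 i).

Lemma ev_emb (S : comNzRingType) (psi : {rmorphism R -> S}) (v : 'rV[S]_m.+1) F :
  ev psi v (emb F) = ev psi (tl v) F.
Proof.
rewrite /emb rmorph_mmap; apply: eq_mmap => [c|i] /=; first by rewrite mmapC.
by rewrite mmapX mmap1U mxE.
Qed.

Lemma ev_cyclic_cover (S : comNzRingType) (psi : {rmorphism R -> S}) (v : 'rV[S]_m.+1) F :
  ev psi v (cyclic_cover F) = ev psi (tl v) F + v 0 0 ^+ r.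
Proof. by rewrite /cyclic_cover rmorphD rmorphXn /= ev_emb mmapX mmap1U. Qed.

Lemma cyclic_cover_homog F : F \is r.-homog -> cyclic_cover F \is r.-homog.
Proof.
move=> Fr; rewrite /cyclic_cover rpredD //; last by rewrite mpolyXn dhomogX /= mdegMn mdeg1 mul1n.
pose lq := [tuple ('X_(lift ord0 i) : {mpoly R[m.+1]}) | i < m].
rewrite -[r]mul1n; suff -> : emb F = F \mPo lq.
  by apply: comp_dhomog => // i; rewrite tnth_mktuple dhomogX /= mdeg1.
by apply: eq_mmap => // i; rewrite tnth_mktuple.
Qed.

Lemma mderiv_emb0 F : mderiv ord0 (emb F) = 0.
Proof.
rewrite /emb; elim/mpoly_ring_ind: F => [c|i|p q IHp IHq|p q IHp IHq].
- by rewrite mmapC mderivC.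
- by rewrite mmapX mmap1U mderivXU.
- by rewrite mmapD mderivD IHp IHq addr0.
- by rewrite rmorphM /= mderivM IHp IHq mul0r mulr0 addr0.
Qed.

Lemma mderiv_emb F i : mderiv (lift ord0 i) (emb F) = emb (mderiv i F).
Proof.
rewrite /emb; elim/mpoly_ring_ind: F => [c|l|p q IHp IHq|p q IHp IHq].
- by rewrite mmapC !mderivC mmap0.
- by rewrite mmapX mmap1U !mderivXU (inj_eq lift_inj) rmorph_nat.
- by rewrite mmapD !mderivD mmapD IHp IHq.
- by rewrite rmorphM /= !mderivM mmapD !rmorphM /= IHp IHq.
Qed.

Lemma mderivXn (i : 'I_m.+1) e : mderiv i ('X_i ^+ e : {mpoly R[m.+1]}) = e%:R *: 'X_i ^+ e.-1.
Proof.
rewrite !mpolyXn mderivX mulmnE mnm1E eqxx mul1n; case: e => [|e]; first by rewrite !scale0r.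
by rewrite mulmS addmC addmK.
Qed.

Lemma mderiv_cyclic_cover0 F : mderiv ord0 (cyclic_cover F) = r%:R *: 'X_ord0 ^+ r.-1.
Proof. by rewrite /cyclic_cover mderivD mderiv_emb0 add0r mderivXn. Qed.

Lemma mderiv_cyclic_cover F i : mderiv (lift ord0 i) (cyclic_cover F) = emb (mderiv i F).
Proof.
rewrite /cyclic_cover mderivD mderiv_emb mpolyXn mderivX mulmnE mnm1E.
by rewrite (_ : _ == _ = false) // mul0n scale0r addr0.
Qed.

End CyclicCover.

Lemma map_cyclic_cover (R S : comNzRingType) (psi : {rmorphism R -> S}) r m (F : {mpoly R[m]}) :
  map_mpoly psi (cyclic_cover r F) = cyclic_cover r (map_mpoly psi F).
Proof.
rewrite /cyclic_cover rmorphD rmorphXn /= map_mpolyX; congr (_ + _).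
rewrite /emb; elim/mpoly_ring_ind: F => [c|l|p q IHp IHq|p q IHp IHq].
- by rewrite mmapC !map_mpolyC mmapC.
- by rewrite mmapX mmap1U !map_mpolyX mmapX mmap1U.
- by rewrite mmapD !rmorphD /= IHp IHq.
- by rewrite !rmorphM /= IHp IHq.
Qed.

Lemma cyclic_cover_nonsing (k : fieldType) r m (F : {mpoly k[m]}) : (1 < r)%N -> r%:R != 0 :> k ->
  nonsing F -> nonsing (cyclic_cover r F).
Proof.
move=> r1 r0 ns K f c c0 H0 dH.
have z0 : c 0 0 = 0.
  have := dH ord0; rewrite mderiv_cyclic_cover0 mmapZ rmorphXn /= mmapX mmap1U rmorph_nat => /eqP.
  rewrite mulf_eq0 -(rmorph_nat f) fmorph_eq0 (negPf r0) /= expf_eq0 => /andP [_ /eqP] //.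
apply: (ns K f (tl c)).
- apply: contraNneq c0 => tl0; apply/eqP/rowP => i; rewrite [RHS]mxE.
  case: (unliftP ord0 i) => [i'|] -> //.
  by have /rowP/(_ i') := tl0; rewrite !mxE.
- by move: H0; rewrite ev_cyclic_cover z0 expr0n eqn0Ngt (ltnW r1) addr0.
- by move=> i; rewrite -ev_emb -(mderiv_cyclic_cover r); exact: dH.
Qed.

(** Newton's method: any lift v1 of the point has an error h with h^2 = 0, and the derivatives at v1
    generate the unit ideal, because h vanishes at every field and the form is nonsingular there. *)
Lemma smooth_over_form (B : comNzRingType) m r (H : {mpoly B[m.+1]}) : H \is r.-homog ->
  (forall (k : fieldType) (psi : {rmorphism B -> k}), nonsing (map_mpoly psi H)) ->
  smooth_over [:: H].
Proof.
move=> Hr ns i R R' f surj sq v' v'i hv'.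
have /boolp.choice [g gE] := surj.
pose v1 : 'rV[R]_m.+1 := \row_l (if l == i then 1 else g (v' 0 l)).
have v1i : v1 0 i = 1 by rewrite mxE eqxx.
have fv1 : map_mx f v1 = v'.
  by apply/rowP => l; rewrite !mxE; case: eqP => [->|_]; rewrite ?rmorph1 ?v'i.
pose psi : {rmorphism B -> R} := in_alg R.
have psi' b : f (psi b) = in_alg R' b by rewrite /= rmorph_alg.
pose h := ev psi v1 H.
have fh : f h = 0.
  rewrite /h rmorph_mmap -[RHS](hv' H (mem_head _ _)); apply: eq_mmap => [b|l] /=; first exact: psi'.
  by have /rowP/(_ l) := fv1; rewrite [LHS]mxE.
have hh : h * h = 0 by exact: sq.
have [w wE] : exists w : 'I_m.+1 -> R, \sum_l w l * ev psi v1 (mderiv l H) = 1.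
  have [w ->] : gen_ideal (fun l => ev psi v1 (mderiv l H)) 1; last by exists w.
  apply: unit_ideal => [|k chi]; first exact: gen_is_ideal.
  apply: contrapT => nx; have chi0 l : chi (ev psi v1 (mderiv l H)) = 0.
    apply/eqP/negPn/negP => hl; apply: nx; exists (ev psi v1 (mderiv l H)) => //.
    exact: (gen_ideal_gen (fun l => ev psi v1 (mderiv l H))).
  have chih : chi h = 0.
    have /eqP := congr1 chi hh; rewrite rmorphM rmorph0 mulf_eq0 orbb.
    by move/eqP.
  have evE p : ev idfun (map_mx chi v1) (map_mpoly (chi \o psi) p) = chi (ev psi v1 p).
    by rewrite mmap_map_mpoly rmorph_mmap; apply: eq_mmap => // l /=; rewrite mxE.
  apply: (ns k (chi \o psi) k idfun (map_mx chi v1)).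
  - apply/eqP => /rowP/(_ i); rewrite !mxE eqxx rmorph1 => /eqP; rewrite oner_eq0.
    by [].
  - by rewrite evE.
  - by move=> l; rewrite -map_mderiv evE chi0.
(* The correction -h w alone would move coordinate i away from 1. Subtracting w i times v1 from w
   prevents this, and by Euler's formula it changes the value by a multiple of h^2 only. *)
pose dl l := - h * (w l - w i * v1 0 l).
exists (\row_l (v1 0 l + dl l)); split.
- by rewrite mxE v1i /dl v1i mulr1 subrr mulr0 addr0.
- move=> _ /[!inE] /eqP ->; rewrite /eval_at.
  transitivity (mmap psi (fun l => v1 0 l + dl l) H).
    by apply: eq_mmap => // l; rewrite mxE.
  rewrite mmap_taylor => [|l l']; last first.
    by rewrite /dl mulrACA mulrNN hh mul0r.
  under eq_bigr => l _ do rewrite /dl -mulrA mulrBl -(mulrA (w i)).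
  rewrite -mulr_sumr sumrB wE -mulr_sumr.
  have -> : \sum_l v1 0 l * ev psi v1 (mderiv l H) = r%:R * h.
    have := congr1 (fun p => ev psi v1 p) (euler_homog Hr).
    rewrite rmorphM rmorph_nat rmorph_sum /= => <-; apply: eq_bigr => l _.
    by rewrite rmorphM /= mmapX mmap1U.
  rewrite -/h mulrBr mulr1 addrA subrr add0r !mulNr opprK.
  by rewrite mulrCA [h * (_ * h)]mulrCA hh !mulr0.
- pose fr : {rmorphism R -> R'} := f; have frh : fr h = 0 by exact: fh.
  have fdl l : fr (dl l) = 0 by rewrite /dl rmorphM rmorphN frh oppr0 mul0r.
  rewrite -fv1; apply/rowP => l; rewrite [LHS]mxE [X in f X]mxE [RHS]mxE.
  by have := rmorphD fr (v1 0 l) (dl l); rewrite fdl addr0 => E; exact: E.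
Qed.

(** * Cyclic covers over the enlarged ring *)

Section PlaceCover.
Variables (A : comNzRingType) (K : fieldType) (j : {rmorphism A -> K}).
Variables (O : comNzRingType) (iota : {rmorphism O -> K}) (incl : {rmorphism A -> O}).
Variables (k : fieldType) (phi : {rmorphism O -> k}).
Hypothesis pl : is_place j iota incl phi.
Hypothesis j_inj : injective j.

Lemma clear_mpoly n (p : {mpoly O[n]}) :
  exists s q, phi (incl s) != 0 /\ map_mpoly incl q = incl s *: p.
Proof.
have [s [c [s0 cE]]] := clear_denominators pl (fun i : 'I_(size (msupp p)) => p@_(nth 0%MM (msupp p) i)).
have [m|q [qE _]] := @mpoly_lift _ _ incl n (incl s *: p); last by exists s, q.
rewrite mcoeffZ => _; have [mp|mp] := boolP (m \in msupp p); last first.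
  by exists 0; rewrite memN_msupp_eq0 // mulr0 rmorph0.
exists (c (Ordinal (etrans (index_mem m _) mp))).
by rewrite -cE /= nth_index.
Qed.

Variables (r n : nat) (E : seq {mpoly A[n.+2]}) (G : {mpoly K[n.+2]}).
Hypothesis smE : smooth_hypersurface r E.
Hypothesis gE : generic_form j r E G.
Variables (c : K) (Gp : {mpoly O[n.+2]}).
Hypotheses (c0 : c != 0) (GpE : map_mpoly iota Gp = c *: G) (Gp0 : map_mpoly phi Gp != 0).

(** Up to multipliers from A that are units at the place, E is cut out by the single form F2 over
    A. *)
Lemma place_cover : exists s2 F2, [/\ phi (incl s2) != 0, map_mpoly incl F2 = incl s2 *: Gp,
  exists s N, phi (incl s) != 0 /\
    forall i, gen_ideal (fun l : 'I_(size E) => E`_l) (s *: ('X_i ^+ N * F2)) &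
  forall l : 'I_(size E), exists s h, phi (incl s) != 0 /\ s *: E`_l = F2 * h].
Proof.
have [G0 Gr GE] := gE.
have [_ _ fac [N hN]] := place_hypersurface pl smE G0 Gr GE c0 GpE Gp0.
have [s2 [F2 [s20 F2E]]] := clear_mpoly Gp; exists s2, F2; split=> // [|l].
  have /boolp.choice [s sP] : forall i, exists s, phi (incl s) != 0 /\
      gen_ideal (fun l : 'I_(size E) => E`_l) (s *: ('X_i ^+ N * F2)).
    move=> i; apply: (clear_ideal pl j_inj); rewrite rmorphM rmorphXn /= map_mpolyX F2E.
    rewrite -scalerAr -mul_mpolyC.
    by have [_ _ GM] := gen_is_ideal (fun l : 'I_(size E) => map_mpoly incl E`_l); apply: GM.
  exists (\prod_i s i), N; split.
    by rewrite !rmorph_prod; apply/prodf_neq0 => i _; case: (sP i).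
  move=> i; rewrite (bigD1 i) //= mulrC -scalerA -mul_mpolyC.
  have [_ _ GM] := gen_is_ideal (fun l : 'I_(size E) => E`_l); apply: GM.
  by case: (sP i).
have [h hE] := fac l; have [s3 [h3 [s30 h3E]]] := clear_mpoly h.
exists (s2 * s3), h3; split; first by rewrite !rmorphM mulf_neq0.
apply/mpolyP => m; apply: (incl_inj pl j_inj); rewrite -!mcoeff_map_mpoly; congr mcoeff.
rewrite rmorphM /= F2E h3E map_mpolyZ hE rmorphM -scalerAl -scalerAr scalerA.
by [].
Qed.

End PlaceCover.

Section Cover.
Variables (K : fieldExtType rat) (S S' : set (set K)) (r n : nat).
Hypothesis SS' : S `<=` S'.
Local Notation A := (S_integers S).
Local Notation B := (S_integers S').
Local Notation jA := (val : A -> K).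
Local Notation jB := (val : B -> K).

Variables (AB : {rmorphism A -> B}) (E : seq {mpoly A[n.+2]}) (F : {mpoly B[n.+2]}) (G : {mpoly K[n.+2]}).
Variable c : K.
Hypothesis ABE : forall a, val (AB a) = val a.
Hypothesis smE : smooth_hypersurface r E.
Hypothesis gE : generic_form jA r E G.
Hypotheses (c0 : c != 0) (FG : map_mpoly jB F = c *: G).
Hypothesis prim : forall p, finite_place p -> ~ S' p ->
  exists m, val F@_m != 0 /\ integral_at p (val F@_m)^-1.

(** The finite places of B are those of A outside S', so an ideal of B is tested by elements coming
    from A; [prim] makes F itself primitive at each of these places. *)
Lemma cover_local_global (I : set B) : is_ideal I ->
  (forall (O : comNzRingType) (iota : {rmorphism O -> K}) (incl : {rmorphism A -> O})
     (k : fieldType) (phi : {rmorphism O -> k}) (Gp : {mpoly O[n.+2]}),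
     is_place jA iota incl phi -> map_mpoly iota Gp = map_mpoly jB F ->
     map_mpoly phi Gp != 0 -> exists s, I (AB s) /\ phi (incl s) != 0) ->
  I 1.
Proof.
move=> idI h; apply: local_global => // [|p hp nS].
  have pl := generic_place (@residue_field_val K S).
  have id_map : map_mpoly idfun (map_mpoly jB F) = map_mpoly jB F :> {mpoly K[n.+2]}.
    exact: map_mpoly_idfun.
  have [G0 _ _] := gE.
  have [|s [Is s0]] := h _ _ _ _ _ _ pl id_map.
    by rewrite id_map FG scaler_eq0 negb_or c0.
  exists (AB s) => //; apply: contraNneq s0 => ABs.
  by have h1 := ABE s; rewrite ABs in h1; apply/eqP; exact: esym h1.
have [O [iota [incl [k [phi [pl iP phiU]]]]]] := place_is_place hp (fun Sp => nS (SS' Sp)).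
have [m _|Gp [GpE _]] := @mpoly_lift _ _ iota n.+2 (map_mpoly jB F).
  rewrite mcoeff_map_mpoly; apply/iP; have := valP F@_m; move/asboolP; exact.
have Gpm m : iota Gp@_m = val F@_m by rewrite -mcoeff_map_mpoly GpE mcoeff_map_mpoly.
have [|s [Is /phiU s0]] := h _ _ _ _ _ _ pl GpE.
  have [m mP] := prim hp nS; rewrite -Gpm in mP; move/phiU: mP.
  by apply: contraNneq => /mpolyP/(_ m); rewrite mcoeff_map_mpoly mcoeff0 => h1; apply/eqP; exact: h1.
exists (AB s); have [_ inclE _ _] := pl; rewrite ABE -inclE.
by split=> //; case: s0.
Qed.

Lemma cover_place (O : comNzRingType) (iota : {rmorphism O -> K}) (incl : {rmorphism A -> O})
    (k : fieldType) (phi : {rmorphism O -> k}) (Gp : {mpoly O[n.+2]}) :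
  is_place jA iota incl phi -> map_mpoly iota Gp = map_mpoly jB F -> map_mpoly phi Gp != 0 ->
  exists s2 F2, [/\ phi (incl s2) != 0, map_mpoly incl F2 = incl s2 *: Gp,
    map_mpoly AB F2 = AB s2 *: F,
    exists s N, phi (incl s) != 0 /\
      forall i, gen_ideal (fun l : 'I_(size E) => E`_l) (s *: ('X_i ^+ N * F2)) &
    forall l : 'I_(size E), exists s h, phi (incl s) != 0 /\ s *: E`_l = F2 * h].
Proof.
move=> pl GpF Gp0; have GpE : map_mpoly iota Gp = c *: G by rewrite GpF.
have [s2 [F2 [s20 F2E F2s F2l]]] := place_cover pl val_inj smE gE c0 GpE Gp0.
exists s2, F2; split=> //; apply/mpolyP => m; rewrite mcoeff_map_mpoly mcoeffZ; apply: val_inj.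
have [_ inclE _ _] := pl; rewrite [LHS]ABE -inclE -(mcoeff_map_mpoly incl) F2E mcoeffZ.
rewrite [LHS]rmorphM /= inclE; transitivity (val (AB s2) * val F@_m); last by [].
rewrite ABE; congr (_ * _).
by rewrite -(mcoeff_map_mpoly iota) GpF mcoeff_map_mpoly.
Qed.

(** Both directions hold up to multipliers by [cover_place], and the ideals of multipliers glue
    them: over B the single form F defines E. *)
Lemma cover_vanish (R : comNzRingType) (psi : {rmorphism B -> R}) (v : 'rV[R]_n.+2) :
  unimod v -> vanish (psi \o AB) E v <-> ev psi v F = 0.
Proof.
move=> [u uv]; have evF2 s2 F2 : map_mpoly AB F2 = AB s2 *: F ->
    ev (psi \o AB) v F2 = psi (AB s2) * ev psi v F.
  by move=> h; rewrite -mmap_map_mpoly h mmapZ.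
split=> [hE|hF e].
  pose I : set B := [set s | psi s * ev psi v F = 0].
  suff : I 1 by rewrite /I /= rmorph1 mul1r.
  apply: cover_local_global => [|O iota incl k phi Gp pl GpE Gp0].
    split=> [|x y hx hy|x y hy]; rewrite /I /=.
    - by rewrite rmorph0 mul0r.
    - by rewrite rmorphD mulrDl hx hy addr0.
    - by rewrite rmorphM -mulrA hy mulr0.
  have [s2 [F2 [s20 _ F2E [s [N [s0 hN]]] _]]] := cover_place pl GpE Gp0.
  exists (s * s2); split; last by rewrite !rmorphM mulf_neq0.
  pose J : set R := [set y | psi (AB s) * (y * (psi (AB s2) * ev psi v F)) = 0].
  have [|i|N' JN'] := @ideal_radical_sum R J n.+2 (v 0) (fun i => u i 0) N.
  - split=> [|x y hx hy|x y hy]; rewrite /J /= ?mul0r ?mulr0 //.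
      by rewrite mulrDl mulrDr hx hy addr0.
    by rewrite -mulrA mulrCA hy mulr0.
  - have [a aE] := hN i; have := congr1 (fun p => ev (psi \o AB) v p) aE.
    rewrite /= mmapZ rmorphM rmorphXn /= mmapX mmap1U (evF2 _ _ F2E) rmorph_sum big1 // => l _.
    by rewrite rmorphM /= [X in _ * X](hE _ (mem_nth 0 (ltn_ord l))) mulr0.
  have v1 : \sum_i v 0 i * u i 0 = 1.
    by have /matrixP/(_ 0 0) := uv; rewrite mxE => ->; rewrite mxE.
  by move: JN'; rewrite v1 expr1n /J /I /= mul1r !rmorphM mulrA.
move=> /(nthP 0) [l0 l0s <-]; pose l : 'I_(size E) := Ordinal l0s.
pose I : set B := [set s | psi s * ev (psi \o AB) v E`_l = 0].
suff : I 1 by rewrite /I /= rmorph1 mul1r.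
apply: cover_local_global => [|O iota incl k phi Gp pl GpE Gp0].
  split=> [|x y hx hy|x y hy]; rewrite /I /=.
  - by rewrite rmorph0 mul0r.
  - by rewrite rmorphD mulrDl hx hy addr0.
  - by rewrite rmorphM -mulrA hy mulr0.
have [s2 [F2 [s20 _ F2E _ /(_ l) [s [h [s0 hE]]]]]] := cover_place pl GpE Gp0.
exists s; split=> //; rewrite /I /=.
have := congr1 (fun p => ev (psi \o AB) v p) hE.
by rewrite /= mmapZ /= rmorphM /= (evF2 _ _ F2E) hF mulr0 mul0r.
Qed.

Lemma cover_neq0 (k : fieldType) (psi : {rmorphism B -> k}) : map_mpoly psi F != 0.
Proof.
apply/negP => /eqP psiF.
pose I : set B := [set s | psi s = 0].
suff : I 1 by rewrite /I /= rmorph1 => /eqP; rewrite oner_eq0.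
apply: cover_local_global => [|O iota incl k' phi Gp pl GpE Gp0].
  split=> [|x y hx hy|x y hy]; rewrite /I /=.
  - by rewrite rmorph0.
  - by rewrite rmorphD hx hy addr0.
  - by rewrite rmorphM hy mulr0.
have [s2 [F2 [s20 F2i F2E _ _]]] := cover_place pl GpE Gp0.
pose m := mlead (map_mpoly phi Gp); exists F2@_m; split.
  rewrite /I /= -(mcoeff_map_mpoly AB) F2E mcoeffZ rmorphM /=.
  by rewrite -(mcoeff_map_mpoly psi) psiF mcoeff0 mulr0.
rewrite -(mcoeff_map_mpoly incl) F2i mcoeffZ rmorphM mulf_neq0 //.
by rewrite -(mcoeff_map_mpoly phi) mleadc_eq0.
Qed.

Lemma cover_smooth : (1 < r)%N -> (exists b : B, r%:R * b = 1) ->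
  F \is r.-homog /\ smooth_hypersurface r [:: cyclic_cover r F].
Proof.
move=> r1 [b rb]; have [G0 Gr _] := gE.
have Fr : F \is r.-homog.
  apply/dhomogP => m; rewrite mcoeff_msupp => Fm.
  have cG : c *: G \is r.-homog by exact: dhomogZ.
  have /dhomogP := cG; apply; rewrite mcoeff_msupp -FG mcoeff_map_mpoly.
  by rewrite -(inj_eq val_inj) /= in Fm.
have ns (k : fieldType) (psi : {rmorphism B -> k}) : nonsing (map_mpoly psi (cyclic_cover r F)).
  rewrite map_cyclic_cover; apply: cyclic_cover_nonsing => //.
    have : psi r%:R * psi b = 1 by rewrite -rmorphM rb rmorph1.
    rewrite rmorph_nat => h; apply: contra_eq_neq h => ->.
    by rewrite mul0r eq_sym oner_neq0.
  have [_ smo _] := smE.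
  apply: (smooth_over_nonsing (phi := psi \o AB) smo (cover_neq0 psi) (map_homog psi Fr)).
  move=> R chi v uv; rewrite mmap_map_mpoly -(cover_vanish (chi \o psi) uv).
  by [].
have cr := cyclic_cover_homog Fr; split=> //; split.
- by move=> H; rewrite inE => /eqP ->; exists r.
- exact: smooth_over_form cr ns.
move=> k phi _; exists (map_mpoly phi (cyclic_cover r F)); split=> //; last exact: map_homog.
apply/negP => /eqP c00.
(* At (1, 0, ..., 0) the cover takes the value 1, so it is nonzero on every fibre. *)
pose v : 'rV[k]_n.+3 := \row_i (i == ord0)%:R.
have /eqP : ev idfun v (map_mpoly phi (cyclic_cover r F)) = 0 by rewrite c00 mmap0.
rewrite map_cyclic_cover ev_cyclic_cover mxE eqxx expr1n (_ : tl v = 0 *: tl v).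
  have Fr' := map_homog phi Fr.
  by rewrite (ev_homogZ _ _ _ Fr') expr0n eqn0Ngt (ltnW r1) mul0r add0r oner_eq0.
by rewrite scale0r; apply/rowP => i; rewrite !mxE.
Qed.

End Cover.

(** * Recovering the base from the cover *)

Section Splitting.
Variable K : fieldType.
Hypothesis char0 : forall n, (0 < n)%N -> n%:R != 0 :> K.
Local Opaque lin.

Definition dir m (q : 'rV[K]_m) (P : {mpoly K[m]}) : {mpoly K[m]} :=
  \sum_i q 0 i *: mderiv i P.

Lemma dirZ m (q : 'rV[K]_m) c P : dir q (c *: P) = c *: dir q P.
Proof.
rewrite /dir scaler_sumr; apply: eq_bigr => i _.
by rewrite mderivZ !scalerA mulrC.
Qed.

Lemma dir_sub m (q p : 'rV[K]_m) c P : dir (q - c *: p) P = dir q P - c *: dir p P.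
Proof.
rewrite /dir scaler_sumr -sumrB; apply: eq_bigr => i _.
by rewrite !mxE scalerBl scalerA.
Qed.

Lemma mderiv_dir m (q : 'rV[K]_m) j P : mderiv j (dir q P) = dir q (mderiv j P).
Proof.
rewrite /dir raddf_sum; apply: eq_bigr => i _ /=.
by rewrite mderivZ mderiv_comm.
Qed.

Lemma dir_comm m (q p : 'rV[K]_m) P : dir q (dir p P) = dir p (dir q P).
Proof.
have dS (Q : 'I_m -> {mpoly K[m]}) : dir p (\sum_i Q i) = \sum_i dir p (Q i).
  rewrite /dir exchange_big; apply: eq_bigr => i _ /=.
  by rewrite -scaler_sumr (raddf_sum (mderiv i)).
rewrite [dir q P]/dir dS [LHS]/dir; apply: eq_bigr => i _.
by rewrite dirZ mderiv_dir.
Qed.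

Lemma dir_lin m (q : 'rV[K]_m) M P : dir q (lin M P) = lin M (dir (q *m M) P).
Proof.
rewrite /dir lin_sum; under eq_bigr => j _ do rewrite mderiv_lin scaler_sumr.
rewrite exchange_big; apply: eq_bigr => i _ /=; rewrite linZ mxE scaler_suml.
by apply: eq_bigr => j _; rewrite scalerA.
Qed.

Lemma dir_Xn m (q : 'rV[K]_m.+1) e : dir q ('X_ord0 ^+ e) = (q 0 0 * e%:R) *: 'X_ord0 ^+ e.-1.
Proof.
rewrite /dir (bigD1 ord0) //= mderivXn scalerA big1 ?addr0 // => i i0.
rewrite mpolyXn mderivX mulmnE mnm1E eq_sym (negPf i0) mul0n scale0r scaler0.
by [].
Qed.

Lemma dir_cyclic_cover r m (F : {mpoly K[m]}) :
  dir (delta_mx 0 0) (cyclic_cover r F) = r%:R *: 'X_ord0 ^+ r.-1.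
Proof.
rewrite /dir (bigD1 ord0) //= mderiv_cyclic_cover0 mxE !eqxx scale1r big1 ?addr0 // => i i0.
by rewrite mxE (negPf i0) andbF scale0r.
Qed.

Lemma ev_dir_self m d (q : 'rV[K]_m) P : P \is d.-homog ->
  ev idfun q (dir q P) = d%:R * ev idfun q P.
Proof.
move=> Pd; have := congr1 (fun p => ev (idfun : {rmorphism K -> K}) q p) (euler_homog Pd).
rewrite /= rmorphM rmorph_nat => <-; rewrite /dir !rmorph_sum /=; apply: eq_bigr => i _.
by rewrite mmapZ rmorphM /= mmapX mmap1U.
Qed.

(** By Euler's formula for H and for its derivatives, a nonzero direction in which H has derivative
    zero is a singular point of H; r and r - 1 are invertible here. *)
Lemma dir_nonsing m r (q : 'rV[K]_m) H : (1 < r)%N -> H \is r.-homog -> nonsing H ->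
  dir q H = 0 -> q = 0.
Proof.
move=> r1 Hr ns dH; apply/eqP/negPn/negP => q0; apply: (ns K idfun q q0) => [|i].
  have /eqP := ev_dir_self q Hr; rewrite dH mmap0 eq_sym mulf_eq0 (negPf (char0 (ltnW r1))).
  by move/eqP.
have /eqP := ev_dir_self q (mderiv_homog i Hr); rewrite -mderiv_dir dH mderiv0 mmap0 eq_sym.
rewrite mulf_eq0 (negPf (@char0 r.-1 _)); first by move/eqP.
by case: (r) r1 => // -[].
Qed.

Section Directions.
Variables (m r : nat) (H0 : {mpoly K[m.+1]}).
Hypotheses (r2 : (2 < r)%N) (H0r : H0 \is r.-homog) (H0n : nonsing H0).
Variables (I : finType) (M : I -> 'M[K]_m.+1) (u : I -> K) (F : I -> {mpoly K[m]}).
Hypotheses (Mu : forall l, M l \in unitmx) (u0 : forall l, u l != 0).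
Hypothesis MH : forall l, lin (M l) (cyclic_cover r (F l)) = u l *: H0.

(** The direction of the covering variable in the coordinates of H0. There the variable becomes the
    linear form [zeta l], with value [z l y] at y. *)
Definition axis l : 'rV[K]_m.+1 := delta_mx 0 0 *m invmx (M l).
Let z l (y : 'rV[K]_m.+1) := (y *m M l) 0 0.
Let zeta l : {mpoly K[m.+1]} := lin (M l) 'X_ord0.

Let z_axis l : z l (axis l) = 1.
Proof. by rewrite /z /axis mulmxKV // mxE !eqxx. Qed.

Let zetaX l e : zeta l ^+ e = lin (M l) ('X_ord0 ^+ e).
Proof. by elim: e => [|e IH]; rewrite ?exprS ?lin_M ?IH // !expr0 -mpolyC1 linC. Qed.

Let dir_axis l : dir (axis l) H0 = (r%:R / u l) *: zeta l ^+ r.-1.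
Proof.
rewrite -[LHS](scalerK (u0 l)) -dirZ -MH dir_lin /axis mulmxKV // dir_cyclic_cover linZ zetaX.
by rewrite scalerA mulrC.
Qed.

Let dir_dir l y : dir y (dir (axis l) H0) = (r%:R / u l * (z l y * r.-1%:R)) *: zeta l ^+ r.-2.
Proof.
by rewrite dir_axis dirZ zetaX dir_lin dir_Xn linZ -zetaX scalerA.
Qed.

Let ev_zeta l y e : ev idfun y (zeta l ^+ e) = z l y ^+ e.
Proof.
rewrite rmorphXn /= ev_lin mmapX mmap1U; congr (_ ^+ _).
by rewrite /z; congr (fun_of_matrix (_ *m _) _ _); apply/matrixP => i i'; rewrite mxE.
Qed.

(* The mixed derivative of H0 along axis l and axis l' is a multiple of both zeta l ^ (r - 2) and
   zeta l' ^ (r - 2). *)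
Lemma split_directions : (m.+1 < #|I|)%N ->
  exists l l', l != l' /\ exists2 lam, lam != 0 & axis l = lam *: axis l'.
Proof.
move=> Im; have rn : forall e, (e < 2)%N -> (r - e)%:R != 0 :> K.
  by move=> e e2; apply: char0; rewrite subn_gt0 (leq_trans e2) // ltnW.
have [[l [l' [ll' zll']]]|h] := pselect (exists l l', l != l' /\ z l (axis l') != 0); last first.
  (* If all pairs are orthogonal, the axes and the linear forms are dual families in dimension m +
     1. *)
  pose P : 'M[K]_(#|I|, m.+1) := \matrix_(i, b) axis (enum_val i) 0 b.
  pose Z : 'M[K]_(m.+1, #|I|) := \matrix_(b, i) M (enum_val i) b 0.
  have PZ : P *m Z = 1%:M.
    apply/matrixP => i i'; rewrite mxE [RHS]mxE.
    transitivity (z (enum_val i') (axis (enum_val i))).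
      by rewrite /z mxE; apply: eq_bigr => b _; rewrite !mxE.
    have [->|ii'] := eqVneq i i'; first exact: z_axis.
    apply/eqP/negPn/negP => zz; apply: h; exists (enum_val i'), (enum_val i); split=> //.
    by rewrite (inj_eq enum_val_inj) eq_sym.
  have := mxrankM_maxl P Z; rewrite PZ mxrank1 => h1.
  by have := leq_trans h1 (rank_leq_col P); rewrite leqNgt Im.
exists l, l'; split=> //; pose nu := z l (axis l').
have r1r : r.-1%:R != 0 :> K by rewrite -subn1 rn.
have r0r : r%:R != 0 :> K by rewrite -(subn0 r) rn.
(* Both expressions of the mixed derivative have the exponent r - 2 > 0, so zeros of [zeta l'] are
   zeros of [zeta l], and the two linear forms are proportional. *)
have zz y : z l' y = 0 -> z l y = 0.
  move=> zy; have E := dir_comm (axis l) (axis l') H0; rewrite !dir_dir in E.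
  have evzz l1 c e : ev idfun y (c *: zeta l1 ^+ e) = c * z l1 y ^+ e.
    by rewrite -ev_zeta; exact: mmapZ.
  have : r%:R / u l' * (z l' (axis l) * r.-1%:R) * z l' y ^+ r.-2 =
         r%:R / u l * (z l (axis l') * r.-1%:R) * z l y ^+ r.-2.
    by rewrite -!evzz E.
  rewrite zy.
  have r20 : (r.-2 == 0)%N = false by case: (r) r2 => [|[|[]]].
  rewrite expr0n r20 mulr0 => /esym/eqP; rewrite !mulf_eq0 invr_eq0 expf_eq0.
  rewrite (negPf r0r) (negPf (u0 l)) (negPf zll') (negPf r1r) /=.
  by case/andP => _ /eqP.
have zlin l1 y1 y2 a : z l1 (y1 - a *: y2) = z l1 y1 - a * z l1 y2.
  by rewrite /z mulmxBl -scalemxAl !mxE.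
have zE y : z l y = nu * z l' y.
  have := zz (y - z l' y *: axis l'); rewrite !zlin z_axis mulr1 subrr => /(_ erefl)/eqP.
  by rewrite subr_eq0 mulrC => /eqP.
have zetaE : zeta l = nu *: zeta l'.
  rewrite /zeta !linX scaler_sumr; apply: eq_bigr => b _; rewrite scalerA; congr (_ *: _).
  have col l1 : M l1 b ord0 = z l1 (delta_mx 0 b) by rewrite /z -rowE mxE.
  by rewrite !col zE.
(* The scalar is read off from the derivatives of H0 along the two axes, which are multiples of one
   power; equal derivatives mean equal directions by [dir_nonsing]. *)
exists (nu ^+ r.-1 * u l' / u l); first by rewrite !mulf_neq0 ?invr_neq0 ?expf_neq0.
apply/eqP; rewrite -subr_eq0; apply/eqP; apply: (dir_nonsing (ltnW r2) H0r H0n).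
rewrite dir_sub !dir_axis zetaE exprZn !scalerA -scalerBl.
rewrite (_ : _ - _ = 0) ?scale0r //.
by move: (nu ^+ r.-1) (u0 l) (u0 l') => x a0 b0; field; rewrite a0 b0.
Qed.

End Directions.

(** N preserves the covering direction. The derivative along it is r times a power of the covering
    variable for both covers, so N preserves this variable up to a scalar too; hence N is block
    diagonal, and its block relates F' to F. *)
Lemma cyclic_cover_substitution m r (F F' : {mpoly K[m]}) (N : 'M[K]_m.+1) lam u : (1 < r)%N ->
  N \in unitmx -> lam != 0 -> delta_mx 0 0 *m N = lam *: delta_mx 0 0 :> 'rV_m.+1 ->
  lin N (cyclic_cover r F') = u *: cyclic_cover r F ->
  exists2 N' : 'M[K]_m, N' \in unitmx & lin N' F' = u *: F.
Proof.
move=> r1 Nu lam0 eN NF.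
have N0 b : N 0 b = lam * (b == 0)%:R.
  by have /rowP/(_ b) := eN; rewrite -rowE !mxE eqxx.
pose N' := row' ord0 (col' ord0 N).
have N'u : N' \in unitmx.
  move: Nu; rewrite !unitmxE (expand_det_row N 0) (bigD1 0) //= N0 eqxx mulr1.
  rewrite big1 ?addr0 => [|b /negPf b0]; last by rewrite N0 b0 mulr0 mul0r.
  by rewrite /cofactor addn0 expr0 mul1r unitrM => /andP [].
exists N' => //.
have embE p : lin N (emb p) = emb (lin N' p).
  rewrite /emb; elim/mpoly_ring_ind: p => [c|i|p q IHp IHq|p q IHp IHq].
  - by rewrite linC !mmapC linC.
  - rewrite linX mmapX mmap1U linX raddf_sum big_ord_recl N0 mulr0 scale0r add0r.
    by apply: eq_bigr => b _ /=; rewrite mmapZ mmapX mmap1U mul_mpolyC !mxE.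
  - by rewrite linD !mmapD linD IHp IHq.
  - by rewrite lin_M !rmorphM /= lin_M IHp IHq.
have w0 b : N (lift ord0 b) 0 = 0.
  have E := congr1 (mderiv ord0) NF; rewrite mderivZ mderiv_cyclic_cover0 mderiv_lin (bigD1 ord0) //= in E.
  rewrite mderiv_cyclic_cover0 N0 eqxx mulr1 big1 ?addr0 in E; last first.
    by move=> i /negPf i0; rewrite N0 i0 mulr0 scale0r.
  pose y : 'rV[K]_m.+1 := delta_mx 0 (lift ord0 b).
  have ev1 : ev idfun y (lin N ('X_ord0 ^+ r.-1)) = N (lift ord0 b) 0 ^+ r.-1.
    by rewrite ev_lin rmorphXn /= mmapX mmap1U -rowE !mxE.
  have evX : ev idfun y ('X_ord0 ^+ r.-1) = 0 ^+ r.-1.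
    by rewrite rmorphXn /= mmapX mmap1U mxE.
  have evZ c p : c * ev idfun y p = ev idfun y (c *: p) by rewrite mmapZ.
  have : lam * (r%:R * N (lift ord0 b) 0 ^+ r.-1) = u * (r%:R * 0 ^+ r.-1).
    by rewrite -ev1 -evX !evZ -linZ E.
  have r10 : (r.-1 == 0)%N = false by case: (r) r1 => [|[]].
  rewrite expr0n r10 !mulr0 => /eqP; rewrite !mulf_eq0 (negPf lam0) expf_eq0.
  by rewrite (negPf (char0 (ltnW r1))) => /andP [_ /eqP].
(* Setting the covering variable to 0 is a retraction of [emb]. *)
pose rho := mmap (@mpolyC m K) (fun i : 'I_m.+1 => if unlift ord0 i is Some i' then 'X_i' else 0).
have rho_emb p : rho (emb p) = p.
  rewrite /rho /emb; elim/mpoly_ring_ind: p => [c|i|p q IHp IHq|p q IHp IHq].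
  - by rewrite mmapC mmapC.
  - by rewrite !mmapX !mmap1U mmapX mmap1U liftK.
  - by rewrite !mmapD IHp IHq.
  - by rewrite !rmorphM /= IHp IHq.
have rho0 e : (0 < e)%N -> rho ('X_ord0 ^+ e) = 0.
  by move=> e0; rewrite /rho rmorphXn /= mmapX mmap1U unlift_none expr0n eqn0Ngt e0.
have X0 : lin N 'X_ord0 = lam *: 'X_ord0.
  rewrite linX big_ord_recl N0 eqxx mulr1 big1 ?addr0 // => b _.
  by rewrite w0 scale0r.
have r0' : (0 < r)%N by exact: ltnW.
have XrE e : lin N ('X_ord0 ^+ e) = lam ^+ e *: 'X_ord0 ^+ e.
  by elim: e => [|e IH]; rewrite ?expr0 ?scale1r -?mpolyC1 ?linC // !exprS lin_M IH X0 -scalerAl -scalerAr scalerA.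
have rhoZ c p : rho (c *: p) = c *: rho p by rewrite /rho mmapZ mul_mpolyC.
have rhoD p q : rho (p + q) = rho p + rho q by exact: rmorphD.
have := congr1 rho NF; rewrite /cyclic_cover linD embE XrE scalerDr !rhoD !rhoZ !rho_emb (rho0 r r0').
by rewrite !scaler0 !addr0.
Qed.

End Splitting.

(** * Descent in the dimension *)

Section LinearIsoEquivalence.
Variables (A : comNzRingType) (m : nat).
Implicit Types E : seq {mpoly A[m.+1]}.

Lemma linear_iso_refl E : linear_iso E E.
Proof.
exists (fun R L => L); split=> //; split=> // R; split=> // L hL; by exists L.
Qed.

Lemma auto_proj sigma (R : comAlgType A) (L : set 'rV[R]_m.+1) :
  @scheme_iso A m m [::] [::] sigma -> proj_space L -> proj_space (sigma R L).
Proof. by move=> [/(_ R) [h _ _] _] /zero_locus_nil /h /zero_locus_nil. Qed.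

Lemma linear_iso_sym E E' : linear_iso E E' -> linear_iso E' E.
Proof.
move=> [sigma [auto h]]; have [tau [auto' tK]] := auto_inverse auto.
exists tau; split=> // R L' pL'; have [bij _] := auto; have [_ _ surj] := bij R.
have [L /zero_locus_nil pL <-] := surj L' ((zero_locus_nil L').2 pL').
by rewrite tK // -h.
Qed.

Lemma linear_iso_trans E E' E'' : linear_iso E E' -> linear_iso E' E'' -> linear_iso E E''.
Proof.
move=> [s [as_ hs]] [t [at_ ht]]; exists (fun R L => t R (s R L)); split; last first.
  by move=> R L pL; rewrite hs // ht //; exact: auto_proj.
have [bs ns] := as_; have [bt nt] := at_; split=> [R|R R' f L hL].
  exact: (set_bij_comp (bs R) (bt R)).
rewrite ns // nt //; apply/zero_locus_nil/(auto_proj as_); exact/zero_locus_nil.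
Qed.

End LinearIsoEquivalence.

(** Over K the automorphism is a matrix. H1 divides the substituted H2, as points of the first go to
    points of the second, and equal degrees leave only a scalar. *)
Lemma linear_iso_forms (B : comNzRingType) (K : fieldType) (j : {rmorphism B -> K}) n r
    (H1 H2 : {mpoly B[n.+2]}) G1 G2 :
  map_mpoly j H1 = G1 -> map_mpoly j H2 = G2 ->
  H1 \is r.-homog -> H2 \is r.-homog -> G1 != 0 -> G2 != 0 ->
  linear_iso [:: H1] [:: H2] ->
  exists M u, [/\ M \in unitmx, u != 0 & lin M G2 = u *: G1].
Proof.
move=> <- <- h1 h2 j1 j2 [sigma [auto iso]]; have [M Mu ME] := auto_matrix j auto.
have lM0 : lin M (map_mpoly j H2) != 0.
  by apply: contraNneq j2 => h; rewrite -[X in X == 0]lin1 -(mulVmx Mu) lin_mulmx h /lin mmap0.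
have [|u u0 uE] := homog_unit_factor lM0 (map_homog j h1) (lin_homog M (map_homog j h2)); last first.
  by exists M, u.
apply: (subscheme_divides (map_homog j h1) (lin_homog M (map_homog j h2))) => R psi v i vi.
rewrite ev_lin !mmap_map_mpoly => v1.
pose phi : {rmorphism B -> R} := (psi \o j)%FUN.
have uv : unimod v by exact: unimod_coord vi.
have lv : proj_space (line_through v) by apply/line_proj.
have hom1 : homogeneous_eqns [:: H1] by move=> F; rewrite inE => /eqP ->; exists r.
have : zero_locus [:: H1] (alg_of phi) (line_through v).
  apply/(zero_locus_line (R := alg_of phi) v hom1); split=> // F; rewrite inE => /eqP ->.
  exact: etrans (eval_at_alg_of phi H1 v) v1.
move=> /(iso (alg_of phi) _ lv); rewrite (ME R psi v i vi) => -[_ hz].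
have := hz H2 (mem_head _ _) (v *m map_mx psi M); rewrite eval_at_alg_of; apply.
by exists 1; rewrite ?scale1r.
Qed.

Lemma generic_formZ (A : comNzRingType) (K : fieldType) (j : {rmorphism A -> K}) r n
    (E : seq {mpoly A[n.+2]}) G c : c != 0 -> generic_form j r E G -> generic_form j r E (c *: G).
Proof.
move=> c0 [G0 Gr GE]; split; [by rewrite scaler_eq0 negb_or c0 | exact: dhomogZ |].
move=> R psi v uv; rewrite (GE R psi v uv) mmapZ; split=> [->|h]; first by rewrite mulr0.
by rewrite -[LHS]mul1r -(rmorph1 psi) -(mulVf c0) rmorphM -mulrA h mulr0.
Qed.

Lemma numfield_char0 (K : fieldExtType rat) n : (0 < n)%N -> n%:R != 0 :> K.
Proof. by move=> n0; rewrite -[n%:R]/((n%:Z)%:~R) intrK_eq0 -lt0n. Qed.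

Lemma cover_exists (K : fieldExtType rat) (S : set (set K)) r : (1 < r)%N ->
  finite_set S -> S `<=` @finite_place K ->
  exists S', [/\ finite_set S', S' `<=` @finite_place K &
    forall n (E : seq {mpoly (S_integers S)[n.+2]}), smooth_hypersurface r E ->
      exists F : {mpoly (S_integers S')[n.+2]},
        [/\ generic_form (val : S_integers S -> K) r E (map_mpoly (val : S_integers S' -> K) F),
            F \is r.-homog & smooth_hypersurface r [:: cyclic_cover r F]]].
Proof.
move=> r1 fS pS; have [N [N0 hN]] := scale_primitive K.
have r0 : (0 < r)%N by exact: ltnW.
have Nr0 : (0 < N * r)%N by rewrite muln_gt0 N0.
pose T := [set p : set K | finite_place p /\ p (N * r)%:R].
pose S' := S `|` T; have SS' : S `<=` S' by move=> p; left.
exists S'; split; first by rewrite finite_setU; split=> //; exact: places_over_finite.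
  by move=> p [/pS|[]].
move=> n E smE.
have notN p : finite_place p -> ~ S' p -> ~ p N%:R /\ ~ p r%:R.
  move=> hp nS; have [_ _ _ PM _] := hp.
  split=> pN; apply: nS; right; split=> //; rewrite natrM; last by apply: PM => //; exact: (OK_int _ (Posz _)).
  by rewrite mulrC; apply: PM => //; exact: (OK_int _ (Posz _)).
have [G [G0 Gr _ GE]] := hypersurface_fiber smE (@residue_field_val K S).
have gE : generic_form (val : S_integers S -> K) r E G by split.
pose g (i : 'I_(size (msupp G))) := G@_(nth 0%MM (msupp G) i).
have mG : mlead G \in msupp G by exact: mlead_supp.
pose idx m (mG : m \in msupp G) : 'I_(size (msupp G)) := Ordinal (etrans (index_mem m _) mG).
have gidx m (mp : m \in msupp G) : g (idx m mp) = G@_m by rewrite /g /= nth_index.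
have [|b b0 bP] := hN _ g.
  by exists (idx _ mG); rewrite gidx mleadc_eq0.
(* Divided by the scalar b of [scale_primitive], the form is integral outside S' and has a unit
   coefficient at each of these places. *)
have [m|F [FE _]] := @mpoly_lift _ _ (val : S_integers S' -> K) n.+2 (b^-1 *: G).
  rewrite mcoeff_msupp mcoeffZ mulf_eq0 negb_or -mcoeff_msupp => /andP [_ mp].
  suff hx : b^-1 * G@_m \in S_integral S' by exists (SInteger hx).
  apply/asboolP => p hp /(notN p hp) [nN _]; have [h _] := bP p hp nN.
  by rewrite mulrC -(gidx m mp).
have Fm m : val F@_m = G@_m / b.
  by rewrite mulrC -mcoeffZ -FE mcoeff_map_mpoly.
have [AB ABE] := S_integers_incl SS'.
have bV : b^-1 != 0 by rewrite invr_eq0.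
have prim p : finite_place p -> ~ S' p -> exists m, val F@_m != 0 /\ integral_at p (val F@_m)^-1.
  move=> hp /(notN p hp) [nN _]; have [_ [i [i0 iV]]] := bP p hp nN.
  by exists (nth 0%MM (msupp G) i); rewrite Fm.
have [|Fr smF] := cover_smooth SS' ABE smE gE bV FE prim r1.
- have rS : (r%:R^-1 : K) \in S_integral S'.
    apply/asboolP => p hp /(notN p hp) [_ nr]; exists 1, r%:R; split=> //.
    - exact: OK1.
    - exact: (OK_int _ (Posz _)).
    - by rewrite mulVf // numfield_char0.
  exists (SInteger rS); apply: val_inj; rewrite rmorphM rmorph_nat rmorph1 /=.
  by rewrite divff // numfield_char0.
exists F; split=> //; rewrite FE; exact: generic_formZ.
Qed.

Lemma infinite_fiber (T U : Type) (C : set T) (D : set U) (f : T -> U) :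
  finite_set D -> (forall x, C x -> D (f x)) -> ~ finite_set C ->
  exists y, ~ finite_set (C `&` [set x | f x = y]).
Proof.
move=> fD CD nC; apply: contrapT => /forallNP h; apply: nC.
apply: (sub_finite_set (B := \bigcup_(y in D) (C `&` [set x | f x = y]))).
  by move=> x Cx; exists (f x); [exact: CD | split].
by apply: bigcup_finite => // y _; apply: contrapT; exact: h.
Qed.

Lemma infinite_sequence (T : Type) (C : set T) : ~ finite_set C ->
  exists g : nat -> T, (forall i, C (g i)) /\ injective g.
Proof.
move=> /infiniteP /card_leP [f]; exists (fun i => val (f (to_setT i))); split=> [i|i i'].
  by have := valP (f (to_setT i)); rewrite inE.
move=> /val_inj/(@inj _ _ _ f) h; have := h (mem_set Logic.I) (mem_set Logic.I).
by move/(congr1 val).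
Qed.

Local Opaque lin.

Lemma shafarevich_step r n : (2 < r)%N -> shafarevich r n.+1 -> shafarevich r n.
Proof.
move=> r2 sh K S fS pS; have r1 : (1 < r)%N by exact: ltnW.
have [S' [fS' pS' cov]] := cover_exists r1 fS pS.
have fD := sh K S' fS' pS'.
have char0 := @numfield_char0 K; have r0 : r%:R != 0 :> K by apply: char0; exact: ltnW.
apply: contrapT => nC.
pose jA : {rmorphism S_integers S -> K} := (val : S_integers S -> K).
pose jB : {rmorphism S_integers S' -> K} := (val : S_integers S' -> K).
set C := @linear_iso_classes (S_integers S) r n in nC.
set D := @linear_iso_classes (S_integers S') r n.+1 in fD.
have /boolp.choice [E EP] : forall X : set (seq {mpoly (S_integers S)[n.+2]}), exists E,
    C X -> smooth_hypersurface r E /\ X = [set E' | smooth_hypersurface r E' /\ linear_iso E E'].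
  move=> X; have [[E sE XE]|nX] := pselect (C X); last by exists [::].
  by exists E.
have /boolp.choice [F FP] : forall X : set (seq {mpoly (S_integers S)[n.+2]}),
    exists F : {mpoly (S_integers S')[n.+2]}, C X ->
    [/\ generic_form jA r (E X) (map_mpoly jB F), F \is r.-homog & smooth_hypersurface r [:: cyclic_cover r F]].
  move=> X; have [CX|nX] := pselect (C X); last by exists 0.
  by have [sE _] := EP X CX; have [F h] := cov n (E X) sE; exists F.
(* The class of the cover: a map from a supposedly infinite set of classes to a finite one. *)
pose f X : set (seq {mpoly (S_integers S')[n.+3]}) :=
  [set E' | smooth_hypersurface r E' /\ linear_iso [:: cyclic_cover r (F X)] E'].
have [X CX|Y nY] := infinite_fiber (f := f) fD _ nC.
  by have [_ _ sF] := FP X CX; exists [:: cyclic_cover r (F X)].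
have [g [gY g_inj]] := infinite_sequence nY.
have gC i : C (g i) by case: (gY i).
pose FK i := map_mpoly jB (F (g i)).
have smF i : smooth_hypersurface r [:: cyclic_cover r (F (g i))] by case: (FP _ (gC i)).
have Fr i : F (g i) \is r.-homog by case: (FP _ (gC i)).
have gF i : generic_form jA r (E (g i)) (FK i) by case: (FP _ (gC i)).
have smE i : smooth_hypersurface r (E (g i)) by case: (EP _ (gC i)).
have iso0 i : linear_iso [:: cyclic_cover r (F (g 0%N))] [:: cyclic_cover r (F (g i))].
  have [_ /= f0] := gY 0%N; have [_ /= fi] := gY i.
  have : f (g i) [:: cyclic_cover r (F (g i))] by split=> //; exact: linear_iso_refl.
  by rewrite fi -f0 => -[].
have nsF i : nonsing (FK i).
  have [G0 Gr GE] := gF i; have [_ smo _] := smE i.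
  exact: (smooth_over_nonsing smo G0 Gr GE).
have nsC i : nonsing (cyclic_cover r (FK i)) by exact: cyclic_cover_nonsing.
have homC i : cyclic_cover r (FK i) \is r.-homog by apply/cyclic_cover_homog/map_homog.
have neC i : cyclic_cover r (FK i) != 0.
  apply/eqP => c0.
  have e0 : delta_mx 0 0 != 0 :> 'rV[K]_n.+3.
    by apply/eqP => /matrixP/(_ 0 0); rewrite !mxE !eqxx => /eqP; rewrite oner_eq0.
  by apply: (nsC i K idfun _ e0) => [|l]; rewrite c0 ?mderiv0 mmap0.
have /boolp.choice [Mu MuP] : forall i, exists Mu : 'M[K]_n.+3 * K,
    [/\ Mu.1 \in unitmx, Mu.2 != 0 & lin Mu.1 (cyclic_cover r (FK i)) = Mu.2 *: cyclic_cover r (FK 0%N)].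
  move=> i; have [M [u [h1 h2 h3]]] := linear_iso_forms
    (map_cyclic_cover jB r (F (g 0%N))) (map_cyclic_cover jB r (F (g i)))
    (cyclic_cover_homog (Fr 0%N)) (cyclic_cover_homog (Fr i)) (neC 0%N) (neC i) (iso0 i).
  by exists (M, u); split; [exact: h1 | exact: h2 | exact: h3].
have M1 i : (Mu i).1 \in unitmx by case: (MuP i).
have M2 i : (Mu i).2 != 0 by case: (MuP i).
have M3 i : lin (Mu i).1 (cyclic_cover r (FK i)) = (Mu i).2 *: cyclic_cover r (FK 0%N) by case: (MuP i).
(* The covers are forms in n + 3 variables, so among n + 4 of them two have proportional
   directions. *)
have [|l [l' [ll' [lam lam0 axisE]]]] := split_directions char0 r2 (homC 0%N) (nsC 0%N)
    (I := 'I_n.+4) (M := fun i => (Mu i).1) (u := fun i => (Mu i).2) (F := fun i => FK i)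
    (fun i => M1 i) (fun i => M2 i) (fun i => M3 i).
  by rewrite card_ord.
pose N := invmx (Mu l).1 *m (Mu l').1.
have Nu : N \in unitmx by rewrite unitmx_mul unitmx_inv !M1.
have NF : lin N (cyclic_cover r (FK l')) = ((Mu l').2 / (Mu l).2) *: cyclic_cover r (FK l).
  rewrite /N lin_mulmx M3 linZ -(scalerK (M2 l) (cyclic_cover r (FK 0%N))) -M3 linZ -lin_mulmx mulVmx //.
  by rewrite lin1 scalerA.
have eN : delta_mx 0 0 *m N = lam *: delta_mx 0 0 :> 'rV_n.+3.
  by rewrite /N mulmxA -[X in X *m _]/(axis (fun i : 'I_n.+4 => (Mu i).1) l) axisE -scalemxAl mulmxKV.
have [N' N'u N'F] := cyclic_cover_substitution char0 r1 Nu lam0 eN NF.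
have u0 : (Mu l').2 / (Mu l).2 != 0 by rewrite mulf_neq0 ?invr_neq0.
have iso := linear_iso_of_matrix (S_integers_local_global S) r2 r0 (smE l) (smE l') (gF l) (gF l') N'u u0 N'F.
have [_ gl] := EP _ (gC l); have [_ gl'] := EP _ (gC l').
case/eqP: ll'; apply/val_inj/g_inj; rewrite gl gl'; apply/seteqP; split=> E' [smE' isoE']; split=> //.
  exact: linear_iso_trans (linear_iso_sym iso) isoE'.
exact: linear_iso_trans iso isoE'.
Qed.

Local Open Scope nat_scope.

Theorem corollary1p3 :
  (forall r n : nat, 2 <= r -> 1 <= n ->
     fano_hypersurfaces r n -> shafarevich r n) ->
  forall r n : nat, 2 <= r -> 1 <= n -> shafarevich r n.
Proof.
(* Induction on r - (n + 1), which decreases as n grows. Beyond the range r <= n + 1 one has r >= n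
   + 2 >= 3, as [shafarevich_step] requires. *)
move=> fano r n r2 n1; have [d] := ubnP (r - n.+1); elim: d n n1 => // d IHd n n1 rn.
have [rn1|rn1] := leqP r n.+1.
  by apply: fano => //; apply: fano_low_degree => //; exact: ltnW.
apply: shafarevich_step; first by rewrite (leq_trans _ rn1).
apply: IHd => //; rewrite subnS; rewrite ltnS in rn.
by apply: leq_trans rn; rewrite prednK // subn_gt0.
Qed.
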